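(* Let $M$ be a closed nonsimply connected surface, and let $\mathcal{G}$ be an extremal metric on $M$, i.e. a metric with $\mathrm{SR}(M,\mathcal{G})=\mathrm{SR}(M)$. Then for all real numbers $\alpha,\beta>0$ with $4\alpha+\beta<\frac12$, $$h(M,\mathcal{G})\;\le\;-\frac{1}{\beta\,\mathrm{sys}\pi_1(M,\mathcal{G})}\,\log\!\left(2\alpha^2\,\mathrm{SR}(M)\right).$$
   Context: A surface is a connected 2-dimensional manifold; closed means compact without boundary; metrics are Riemannian metrics. Volume entropy: for a closed Riemannian manifold $(M,\mathcal{G})$ with universal Riemannian cover $(\tilde M,\tilde{\mathcal{G}})$ and any point $\tilde x_0\in\tilde M$, $$h(M,\mathcal{G})=\lim_{R\to+\infty}\frac{\log\big(\mathrm{vol}_{\tilde{\mathcal{G}}}B(\tilde x_0,R)\big)}{R},$$ where $B(\tilde x_0,R)$ is the ball of radius $R$ centered at $\tilde x_0$ in $\tilde M$ (the limit exists and is independent of $\tilde x_0$). Systole: for a nonsimply connected closed Riemannian manifold, $\mathrm{sys}\pi_1(M,\mathcal{G})$ is the infimum of the lengths of noncontractible loops of $M$. Systolic ratio of a closed nonsimply connected surface: $\mathrm{SR}(M,\mathcal{G})=\mathrm{sys}\pi_1(M,\mathcal{G})^2/\mathrm{area}(M,\mathcal{G})$. Optimal systolic ratio: $\mathrm{SR}(M)=\sup_{\mathcal{G}}\mathrm{SR}(M,\mathcal{G})$, the supremum being over all metrics $\mathcal{G}$ on $M$. A metric $\mathcal{G}$ on $M$ is called extremal if $\mathrm{SR}(M,\mathcal{G})=\mathrm{SR}(M)$.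 *)

(* Defs.v *)
From HB Require Import structures.
From mathcomp Require Import all_boot all_order all_algebra.
From mathcomp Require Import all_classical all_reals all_analysis.

Set Implicit Arguments.
Unset Strict Implicit.
Unset Printing Implicit Defensive.

Import Order.TTheory GRing.Theory Num.Theory numFieldNormedType.Exports.
Local Open Scope classical_set_scope.
Local Open Scope ring_scope.

(* Only used on open U.  Since all the 'D_v f are required to be C^k on U, this
   is the usual notion: f is C^1 as soon as its directional derivatives exist
   and are continuous. *)
Fixpoint Ck_on (R : realType) (V : normedModType R) (k : nat)
    (U : set (R * R)) (f : R * R -> V) : Prop :=
  if k is k'.+1 then
    forall v, (forall x, U x -> derivable f x v) /\ Ck_on k' U ('D_v f)
  else forall x, U x -> {for x, continuous f}.

Definition smooth_on (R : realType) (V : normedModType R)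
  (U : set (R * R)) (f : R * R -> V) : Prop := forall k, Ck_on k U f.

(* Connected smooth 2-manifolds without boundary.  The smooth structure is
   given by one chart around each point; these form an atlas, and every smooth
   structure is determined by such an atlas.  [chart p] is relevant only on
   [dom p], and [chart_inv p] only on its image [cod p]. *)
Record surface (R : realType) := Surface {
  carrier :> topologicalType ;
  dom : carrier -> set carrier ;
  chart : carrier -> carrier -> R * R ;
  chart_inv : carrier -> R * R -> carrier ;
  surface_hausdorff : hausdorff_space carrier ;
  surface_second_countable : @second_countable carrier ;
  surface_connected : connected [set: carrier] ;
  dom_open : forall p, open (dom p) ;
  dom_center : forall p, dom p p ;
  cod_open : forall p, open (chart p @` dom p) ;
  chartK : forall p x, dom p x -> chart_inv p (chart p x) = x ;
  chart_continuous : forall p, {within dom p, continuous (chart p)} ;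
  chart_inv_continuous :
    forall p, {within chart p @` dom p, continuous (chart_inv p)} ;
  transition_smooth : forall p q,
    smooth_on (chart p @` (dom p `&` dom q)) (chart q \o chart_inv p)
}.

Definition cod (R : realType) (M : surface R) (p : M) : set (R * R) :=
  chart p @` dom p.

Definition closed_surface (R : realType) (M : surface R) : Prop :=
  compact [set: M].

Section Maps.
Variables (R : realType) (N M : surface R).

Definition local_rep (f : N -> M) (p : N) (q : M) : R * R -> R * R :=
  chart q \o f \o chart_inv p.

Definition local_dom (f : N -> M) (p : N) (q : M) : set (R * R) :=
  chart p @` (dom p `&` f @^-1` dom q).

Definition smooth_map (f : N -> M) : Prop :=
  continuous f /\ forall p q, smooth_on (local_dom f p q) (local_rep f p q).

(* f^* gM = gN, where the number [g p x u v] is the inner product, read in the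
   chart [chart p], of the tangent vectors u and v at the point x of [cod p] *)
Definition pullback_eq (gN : N -> R * R -> R * R -> R * R -> R)
    (gM : M -> R * R -> R * R -> R * R -> R) (f : N -> M) : Prop :=
  forall p q x, local_dom f p q x -> forall u v,
    gN p x u v = gM q (local_rep f p q x)
                   ('d (local_rep f p q) x u) ('d (local_rep f p q) x v).

Definition covering_map (f : N -> M) : Prop :=
  [/\ continuous f, set_surj [set: N] [set: M] f &
    forall x : M, exists V : set M, [/\ open V, V x &
      exists sheets : set (set N),
        [/\ f @^-1` V = \bigcup_(W in sheets) W, trivIset sheets id &
          forall W, sheets W -> open W /\
            exists s : M -> N, [/\ {within V, continuous s},
              forall y, V y -> W (s y) /\ f (s y) = y &
              forall z, W z -> s (f z) = z]]]].

End Maps.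

Record riemannian_metric (R : realType) (M : surface R) := RiemannianMetric {
  inner :> M -> R * R -> R * R -> R * R -> R ;
  inner_sym : forall p x, cod p x -> forall u v,
    inner p x u v = inner p x v u ;
  inner_linear : forall p x, cod p x -> forall a u u' v,
    inner p x (a *: u + u') v = a * inner p x u v + inner p x u' v ;
  inner_pos : forall p x, cod p x -> forall u, u != 0 -> 0 < inner p x u u ;
  inner_smooth : forall p u v,
    smooth_on (cod p) (fun x => inner p x u v : R) ;
  inner_compat : pullback_eq inner inner id
}.

Section Loops.
Variables (R : realType) (M : surface R).
Implicit Types (c : R -> M).

(* Paths are maps R -> M considered on [0, 1] only. *)
Definition is_loop c : Prop :=
  {within `[0, 1], continuous c} /\ c 0 = c 1.

(* free null-homotopy; for a loop this is equivalent to being null-homotopic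
   relative to its base point *)
Definition contractible_loop c : Prop :=
  exists H : R * R -> M,
    [/\ {within `[0, 1] `*` `[0, 1], continuous H},
        forall t, t \in `[0, 1] -> H (0, t) = c t,
        exists x, forall t, t \in `[0, 1] -> H (1, t) = x &
        forall s, s \in `[0, 1] -> H (s, 0) = H (s, 1)].

(* path-connectedness is automatic, surfaces being connected *)
Definition simply_connected : Prop :=
  forall c, is_loop c -> contractible_loop c.

Definition C1_curve c : Prop :=
  continuous c /\ forall t,
    (\forall u \near t, derivable (chart (c t) \o c) u 1) /\
    {for t, continuous (derive1 (chart (c t) \o c))}.

(* 0 = t_0 < ... < t_n = 1 with c of class C^1 on each [t_k, t_(k+1)] up to the
   end points, i.e., equal there to a C^1 curve defined on the whole line *)
Definition piecewise_C1 c : Prop :=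
  exists s : seq R, [/\ path <%R 0 s, last 0 s = 1 &
    forall k, (k < size s)%N ->
      exists2 c', C1_curve c' &
        {in `[nth 0 (0 :: s) k, nth 0 s k], c =1 c'}].

End Loops.

Section MetricGeometry.
Variables (R : realType) (M : surface R) (G : riemannian_metric M).

Definition speed (c : R -> M) (t : R) : R :=
  let p := c t in
  let v := derive1 (chart p \o c) t in
  Num.sqrt (G p (chart p p) v v).

Definition curve_length (c : R -> M) : \bar R :=
  (\int[@lebesgue_measure R]_(t in `[0%R, 1%R]) (speed c t)%:E)%E.

Definition riem_dist (x y : M) : \bar R :=
  ereal_inf [set curve_length c | c in
    [set c | [/\ piecewise_C1 c, c 0 = x & c 1 = y]]].

Definition riem_ball (x : M) (r : R) : set M :=
  [set y | (riem_dist x y < r%:E)%E].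

Definition area_density (p : M) (x : R * R) : R :=
  let e1 : R * R := (1, 0) in
  let e2 : R * R := (0, 1) in
  Num.sqrt (G p x e1 e1 * G p x e2 e2 - G p x e1 e2 ^+ 2).

Definition chart_area (p : M) (B : set M) : \bar R :=
  (\int[(@lebesgue_measure R \x @lebesgue_measure R)%E]_(x in chart p @` B)
     (area_density p x)%:E)%E.

(* The Riemannian area of a Borel set A: cut A into countably many disjoint
   Borel pieces, each in the domain of a chart, and add up their areas; by
   countable additivity this is the supremum over finite families of disjoint
   Borel pieces of A. *)
Definition area (A : set M) : \bar R :=
  ereal_sup [set a | exists (n : nat) (p : 'I_n -> M) (B : 'I_n -> set M),
    [/\ forall k, <<s @open M >> (B k) /\ B k `<=` A `&` dom (p k),
        trivIset [set: 'I_n] B &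
        a = (\sum_(k < n) chart_area (p k) (B k))%E]].

Definition systole : \bar R :=
  ereal_inf [set curve_length c | c in
    [set c | [/\ piecewise_C1 c, is_loop c & ~ contractible_loop c]]].

(* meant for closed nonsimply connected surfaces, whose systole and area are
   both finite and positive *)
Definition systolic_ratio : R :=
  fine systole ^+ 2 / fine (area [set: M]).

End MetricGeometry.

Definition optimal_systolic_ratio (R : realType) (M : surface R) : \bar R :=
  ereal_sup [set (systolic_ratio G)%:E | G in [set: riemannian_metric M]].

Definition extremal (R : realType) (M : surface R) (G : riemannian_metric M) :
  Prop := (systolic_ratio G)%:E = optimal_systolic_ratio M.

Record universal_cover (R : realType) (M : surface R)
    (G : riemannian_metric M) := UniversalCover {
  cover_space :> surface R ;
  cover_metric : riemannian_metric cover_space ;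
  cover_proj : cover_space -> M ;
  cover_proj_covering : covering_map cover_proj ;
  cover_proj_smooth : smooth_map cover_proj ;
  cover_proj_isometric : pullback_eq cover_metric G cover_proj ;
  cover_simply_connected : simply_connected cover_space
}.

(* h(M, G), computed on a universal Riemannian cover from a base point; balls
   there have finite area when M is closed *)
Definition volume_entropy (R : realType) (M : surface R)
    (G : riemannian_metric M) (U : universal_cover G) (x0 : U) : \bar R :=
  lim ((lne (area (cover_metric U) (riem_ball (cover_metric U) x0 r)) *
        r^-1%:E)%E @[r --> +oo]).

(* Main.v *)
Require Import Defs.
From HB Require Import structures.
From mathcomp Require Import all_boot all_order all_algebra.
From mathcomp Require Import all_classical all_reals all_analysis.
From mathcomp Require Import ring lra zify measurable_realfun.
Import Order.TTheory GRing.Theory Num.Theory numFieldNormedType.Exports.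
(** In an extremal metric nearly systolic loops pass through every point x, for
otherwise the metric could be shrunk near x without changing the systole. Let u
be a distance function running along such a loop. Stretching the metric in the
direction of grad u on small boxes strung along the loop, with weight
r - d(x, .), while shrinking it on the ball B(x, r) does not decrease the
systole to first order; extremality then yields area B(x, r) >= r^2 / 2 for
4 r <= sys.

Distribute the area of M over a fine net, and let r = 2 alpha sys, so that balls
of radius about r carry at least the mass c = r^2 / 2. Each lifted net point in
the ball of radius R + beta sys of the universal cover is near a point of the
ball of radius R - r, to which at most the mass area M lies close, the points of
a fibre being sys apart. So the mass in the ball of radius R grows at most by the
factor (area M) / c when R grows by beta sys. *)

Set Implicit Arguments.
Unset Strict Implicit.
Unset Printing Implicit Defensive.
Local Open Scope classical_set_scope.
Local Open Scope ring_scope.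

(** The test metrics ([varied]) are enlarged conformally by [psi] on the ball and shrunk by [chi] on
    the boxes, transversally to grad u only: curves along grad u lose no length to first order. A
    loop whose deepest visit to the boxes has depth kap loses at most kap times twice the half-width
    of the boxes, and [psi] repays this on the way in and out ([strip_length]). Squares of
    half-width w at spacing about 2 w with weights b0 - |lambda|, b0 near r, have weighted area
    about 2 w b0^2; half of it is lost, one of two directions being shrunk. The gain is about 2 w
    area B. Hence the bound r^2 / 2. The obstacle is regularity. Metrics must be smooth while
    distance functions are only Lipschitz, so [u] and the radius function [F] are soft minima of
    cones. Neither geodesics nor the exponential map are used: small pieces are handled in charts
    where the metric is nearly constant ([isometric_chart]), and lengths are bounded below by
    calibration, that is, by differentiating a function along the curve ([arc_compare]). Lengths
    have to be controlled only up to O(t^2), as the area varies at first order in t. *)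

(** * Differential calculus of C^k functions on the plane *)

Section PlaneCalculus.
Variable R : realType.
Implicit Types (x y z v : R * R) (U : set (R * R)).

Lemma scaleRE (a b : R) : a *: b = a * b. Proof. by []. Qed.

Lemma is_derive_line (V W : normedModType R) (f : V -> W) (z v : V) (s : R) :
  derivable f (z + s *: v) v -> is_derive s (1 : R) (fun t : R => f (z + t *: v)) ('D_v f (z + s *: v)).
Proof.
have E (t : R) : z + (t *: (1 : R) + s) *: v = t *: v + (z + s *: v).
  have -> : t *: (1 : R) = t by exact: mulr1. by rewrite scalerDl addrCA.
have F : (fun h : R => f (h *: v + (z + s *: v))) =
         (fun h : R => (fun t : R => f (z + t *: v)) (h *: (1 : R) + s)).
  by apply/funext => h /=; rewrite E.
move=> df; split; first by apply/derivable1P; rewrite -F; exact: (iffLR (derivable1P f (z + s *: v) v) df).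
rewrite /derive; set A := (X in lim (X @ _)); set B := (X in _ = lim (X @ _)).
suff -> : A = B by [].
by apply/funext => h; rewrite /A /B /= E.
Qed.

Lemma is_derive_mulr (s c : R) : is_derive s (1 : R) (fun t : R => t * c) c.
Proof.
have E : \forall h \near (0 : R)^', h^-1 *: (((fun t : R => t * c) \o shift s) (h *: (1 : R)) - s * c) = c.
  near=> h; have h0 : h != 0 by near: h; exact: nbhs_dnbhs_neq. have -> : h *: (1 : R) = h by exact: mulr1. rewrite /= mulrDl addrK; rewrite -[LHS]/(h^-1 * (h * c)).
  by rewrite mulKf.
split; first exact: (is_cvg_near_cst c).
exact: (lim_near_cst _ E).
Unshelve. all: by end_near. Qed.

(** The mean value theorem for [f (z + s *: v) - s * c]. The conditions [0 <= s * h] and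
    [|s| <= |h|] say that s lies between 0 and h whatever the sign of h. *)
Lemma segment_increment (f : R * R -> R) z v (c k h : R) :
  (forall s : R, 0 <= s * h -> `|s| <= `|h| ->
     derivable f (z + s *: v) v /\ `|'D_v f (z + s *: v) - c| <= k) ->
  `|f (z + h *: v) - f z - h * c| <= k * `|h|.
Proof.
move=> H.
pose g (s : R) := f (z + s *: v) - s * c.
have dg (s : R) : 0 <= s * h -> `|s| <= `|h| ->
    is_derive s (1 : R) g ('D_v f (z + s *: v) - c).
  move=> sh /(H _ sh) [df _]; have df1 := is_derive_line df. have d2 := is_derive_mulr s c. exact: is_deriveB.
have cg (s : R) : 0 <= s * h -> `|s| <= `|h| -> {for s, continuous g}.
  move=> sh /(dg _ sh) [d _]; apply: differentiable_continuous. exact/derivable1_diffP.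
have [h0|h0] := leP 0 h.
  have P (s : R) : 0 <= s <= h -> 0 <= s * h /\ `|s| <= `|h|.
    by move=> /andP[s0 s1]; rewrite mulr_ge0// !ger0_norm.
  have [||s sh] := @MVT_segment R g (fun s => 'D_v f (z + s *: v) - c) 0 h h0.
  - move=> s; rewrite in_itv/= => /andP[s0 s1]. by have [] := P s; [rewrite !ltW|move=> *; exact: dg].
  - apply: continuous_in_subspaceT => s; rewrite inE/= in_itv/= => /P[]; exact: cg.
  rewrite /g scale0r addr0 mul0r !subr0 => E. move: sh; rewrite in_itv/= => /P[? ?]. by rewrite addrAC E normrM ler_wpM2r //; apply: (H _ _ _).2.
have P (s : R) : h <= s <= 0 -> 0 <= s * h /\ `|s| <= `|h|.
  move=> /andP[s0 s1]; rewrite nmulr_lge0//; split=> //. by rewrite (ler0_norm s1) (ltr0_norm h0) lerN2.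
have [||s sh] := @MVT_segment R g (fun s => 'D_v f (z + s *: v) - c) h 0 (ltW h0).
- move=> s; rewrite in_itv/= => /andP[s0 s1]. by have [] := P s; [rewrite !ltW|move=> *; exact: dg].
- apply: continuous_in_subspaceT => s; rewrite inE/= in_itv/= => /P[]; exact: cg.
rewrite /g scale0r addr0 mul0r !subr0 sub0r => E.
move: sh; rewrite in_itv/= => /P[? ?].
have -> : f (z + h *: v) - f z - h * c = - (f z - (f (z + h *: v) - h * c)).
  by ring.
by rewrite normrN E mulrN normrN normrM ler_wpM2r //; apply: (H _ _ _).2.
Qed.

Local Notation e1 := ((1, 0) : R * R).
Local Notation e2 := ((0, 1) : R * R).

Lemma normB_coord (y z : R * R) (r : R) :
  (`|y - z| < r) = (`|y.1 - z.1| < r) && (`|y.2 - z.2| < r).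
Proof. by rewrite prod_normE /= gt_max. Qed.

Lemma between_near (a b c d s : R) : `|a - c| < d -> `|b - c| < d ->
  0 <= s * (a - b) -> `|s| <= `|a - b| -> `|b + s - c| < d.
Proof.
rewrite !ltr_norml => /andP[a1 a2] /andP[b1 b2].
have [ab|ab] := ltP 0 (a - b).
  rewrite pmulr_lge0// (gtr0_norm ab) ler_norml => s0 /andP[s1 s2]. by apply/andP; split; lra.
have [->|ab0] := eqVneq (a - b) 0.
  by rewrite normr0 normr_le0 => _ /eqP->; rewrite addr0 b1 b2.
have {}ab : a - b < 0 by rewrite lt_neqAle ab0.
rewrite nmulr_lge0// (ltr0_norm ab) ler_norml => s0 /andP[s1 s2].
by apply/andP; split; lra.
Qed.

(** The points z and y are joined through the corner [(z.1, y.2)], so only the two partial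
    derivatives enter. The two-point form is what differentiating an inverse map and bounding
    preimages of small squares require. *)
Lemma strict_diff (f : R * R -> R) U x :
  open U -> U x -> (forall v y, U y -> derivable f y v) -> (forall v, {for x, continuous ('D_v f)}) -> forall e : R, 0 < e -> exists2 d : R, 0 < d &
    forall y z, `|y - x| < d -> `|z - x| < d -> U y /\ `|f y - f z - ((y.1 - z.1) * 'D_e1 f x + (y.2 - z.2) * 'D_e2 f x)|
      <= e * `|y - z|.
Proof.
move=> oU Ux df cf e e0.
have e20 : 0 < e / 2 by rewrite divr_gt0.
have H : \forall y \near x, [/\ U y, `|'D_e1 f y - 'D_e1 f x| <= e / 2 &
    `|'D_e2 f y - 'D_e2 f x| <= e / 2].
  have H1 v : \forall y \near x, `|'D_v f y - 'D_v f x| <= e / 2.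
    have /cvgrPdist_le /(_ _ e20) := cf v. by apply: filterS => y; rewrite distrC.
  by apply: filterS3 (open_nbhs_nbhs (conj oU Ux)) (H1 e1) (H1 e2) => y; split.
have [d /= d0 Hd0] := (nbhs_ballP _ _).1 H.
have Hd w : `|w - x| < d -> [/\ U w, `|'D_e1 f w - 'D_e1 f x| <= e / 2 &
    `|'D_e2 f w - 'D_e2 f x| <= e / 2].
  by move=> wd; apply: Hd0; rewrite ball_prod_normE /ball_/= distrC.
exists d => // y z yd zd; split; first by have [] := Hd _ yd.
pose w : R * R := (z.1, y.2).
have Ey : y = w + (y.1 - z.1) *: e1.
  by apply: injective_projections; rewrite /= scaleRE; ring.
have Ew : w = z + (y.2 - z.2) *: e2.
  by apply: injective_projections; rewrite /= scaleRE; ring.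
move: (yd) (zd); rewrite !normB_coord => /andP[y1 y2] /andP[z1 z2].
have A : `|f y - f w - (y.1 - z.1) * 'D_e1 f x| <= e / 2 * `|y.1 - z.1|.
  rewrite {1}Ey; apply: segment_increment => s s0 s1. have /Hd[Us D _] : `|w + s *: e1 - x| < d.
    rewrite normB_coord /w /= !scaleRE mulr1 mulr0 addr0 y2 andbT. exact: (between_near y1 z1).
  by split=> //; exact: df.
have B : `|f w - f z - (y.2 - z.2) * 'D_e2 f x| <= e / 2 * `|y.2 - z.2|.
  rewrite {1}Ew; apply: segment_increment => s s0 s1. have /Hd[Us _ D] : `|z + s *: e2 - x| < d.
    rewrite normB_coord /= !scaleRE mulr1 mulr0 addr0 z1 /=. exact: (between_near y2 z2).
  by split=> //; exact: df.
have -> : f y - f z - ((y.1 - z.1) * 'D_e1 f x + (y.2 - z.2) * 'D_e2 f x) =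
  (f y - f w - (y.1 - z.1) * 'D_e1 f x) + (f w - f z - (y.2 - z.2) * 'D_e2 f x). by ring.
apply: le_trans (ler_normD _ _) _; apply: le_trans (lerD A B) _.
have N1 : `|y.1 - z.1| <= `|y - z| by rewrite prod_normE /= le_max lexx.
have N2 : `|y.2 - z.2| <= `|y - z| by rewrite prod_normE /= le_max lexx orbT.
by rewrite [in leRHS](splitr e) mulrDl; apply: lerD; rewrite ler_wpM2l// ltW.
Qed.

Definition linform (a b : R) (v : R * R) : R := v.1 * a + v.2 * b.

Lemma linform_is_linear a b : linear (linform a b).
Proof. by move=> k u v; rewrite /linform /= !scaleRE; ring. Qed.

HB.instance Definition _ a b :=
  GRing.isLinear.Build R (R * R)%type R _ (linform a b) (linform_is_linear a b).

Lemma strict_diff_diff (f : R * R -> R) x (a b : R) :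
  (forall e : R, 0 < e -> exists2 d : R, 0 < d &
    forall y z, `|y - x| < d -> `|z - x| < d -> `|f y - f z - ((y.1 - z.1) * a + (y.2 - z.2) * b)| <= e * `|y - z|) ->
  differentiable f x /\ forall v, 'd f x v = v.1 * a + v.2 * b.
Proof.
move=> H.
pose L' : {linear (R * R)%type -> R} := linform a b.
have cL : continuous L'.
  move=> v; apply: cvgD; apply: cvgM; try exact: cvg_cst.
    exact: cvg_fst.
  exact: cvg_snd.
have E : forall e : R, 0 < e -> \forall h \near nbhs (0 : R * R),
    `|(f \o shift x - (cst (f x) + L')) h| <= e * `|h|.
  move=> e e0; have [d d0 Hd] := H _ e0. near=> h. have -> : (f \o shift x - (cst (f x) + L')) h =
      f (h + x) - f x - (h.1 * a + h.2 * b).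
    by rewrite -[LHS]/(f (h + x) - (f x + (h.1 * a + h.2 * b))) opprD addrA.
  have := Hd (h + x) x; rewrite subrr normr0 addrK => /(_ _ d0). have -> : (h + x).1 - x.1 = h.1 by rewrite /= addrK. have -> : (h + x).2 - x.2 = h.2 by rewrite /= addrK.
  apply; near: h. by apply/nbhs_ballP; exists d => //= h; rewrite ball_prod_normE /ball_ /= sub0r normrN.
have {}E := iffRL (@eqaddoP R (R * R)%type R (R * R)%type (nbhs (0 : R * R)) (f \o shift x) (cst (f x) + L') id) E.
have D := diff_unique cL E.
split; last by move=> v; rewrite D.
by apply/diff_locallyP; rewrite D.
Unshelve. all: by end_near. Qed.

Lemma differentiable_C1 (f : R * R -> R) U x : open U -> U x -> Ck_on 1 U f ->
  differentiable f x.
Proof.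
move=> oU Ux cf.
suff H : forall e : R, 0 < e -> exists2 d : R, 0 < d &
    forall y z, `|y - x| < d -> `|z - x| < d -> `|f y - f z - ((y.1 - z.1) * 'D_e1 f x + (y.2 - z.2) * 'D_e2 f x)|
      <= e * `|y - z| by case: (strict_diff_diff H).
move=> e e0; have [||d d0 H] := strict_diff oU Ux _ _ e0 (f := f).
- by move=> v y Uy; have [+ _] := cf v; exact.
- by move=> v; have [_ +] := cf v; exact.
by exists d => // y z yd zd; have [] := H y z yd zd.
Qed.

Section Ck.
Implicit Types (V W : normedModType R) (k : nat).

Lemma Ck_ext V k U (f g : R * R -> V) : open U -> (forall x, U x -> f x = g x) ->
  Ck_on k U f -> Ck_on k U g.
Proof.
move=> oU; elim: k f g => [|k IH] f g fg.
  move=> cf x Ux; have := cf _ Ux. rewrite /prop_for /continuous_at (fg _ Ux) => fx. apply: cvg_trans fx; apply: near_eq_cvg.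
  by apply: filterS (open_nbhs_nbhs (conj oU Ux)) => y /fg.
have E x : U x -> \forall y \near x, f y = g y.
  by move=> Ux; apply: filterS (open_nbhs_nbhs (conj oU Ux)).
move=> cf v; have [df cDf] := cf v; split=> [x Ux|].
  have := df _ Ux; exact: near_eq_derivable (E _ Ux).
apply: IH cDf => x Ux; exact: near_eq_derive (E _ Ux).
Qed.

Lemma Ck_sub V k U U' (f : R * R -> V) : U' `<=` U -> Ck_on k U f -> Ck_on k U' f.
Proof.
move=> UU'; elim: k f => [|k IH] f cf; first by move=> x /UU'; exact: cf.
by move=> v; have [df cDf] := cf v; split=> [x /UU'|]; [exact: df|exact: IH].
Qed.

Lemma Ck_local V k U (f : R * R -> V) :
  (forall x, U x -> exists2 A, open_nbhs x A & Ck_on k A f) -> Ck_on k U f.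
Proof.
elim: k f => [|k IH] f cf.
  by move=> x /cf[A [oA Ax] cA]; apply: cA.
move=> v; split=> [x /cf[A [oA Ax] cA]|]; first by apply: (cA v).1.
by apply: IH => x /cf[A oA cA]; exists A => //; exact: (cA v).2.
Qed.

Lemma derive_linear_comp V W V' (L : {linear V -> W}) (f : V' -> V) (x v : V') :
  continuous L -> derivable f x v -> derivable (L \o f) x v /\ 'D_v (L \o f) x = L ('D_v f x).
Proof.
move=> cL df.
pose q (h : R) := h^-1 *: ((f \o shift x) (h *: v) - f x).
have qL : (fun h : R => h^-1 *: (((L \o f) \o shift x) (h *: v) - (L \o f) x)) = L \o q.
  by rewrite funeqE => h; rewrite /q /= (linearZZ L) (linearB L).
have H : (L \o q) h @[h --> 0^'] --> L ('D_v f x).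
  by apply: (cvg_comp q L df); exact: cL.
split; first by rewrite /derivable qL; apply/cvg_ex; exists (L ('D_v f x)).
by rewrite /derive qL; exact: cvg_lim H.
Qed.

Lemma cont_fst : continuous (fst : R * R -> R).
Proof. by move=> x; exact: cvg_fst. Qed.

Lemma cont_snd : continuous (snd : R * R -> R).
Proof. by move=> x; exact: cvg_snd. Qed.

Lemma Ck_linear k U (L : {linear (R * R)%type -> R}) (f : R * R -> R * R) :
  open U -> continuous L -> Ck_on k U f -> Ck_on k U (L \o f).
Proof.
move=> oU cL; elim: k f => [|k IH] f cf.
  by move=> x /cf fx; apply: continuous_comp fx _; exact: cL.
move=> v; have [df cDf] := cf v; split=> [x /df|].
  by move=> /(derive_linear_comp cL)[].
apply: Ck_ext (IH _ cDf) => // x Ux.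
by have [_ ->] := derive_linear_comp cL (df _ Ux).
Qed.

Lemma Ck_cst V k U (a : V) : Ck_on k U (fun=> a).
Proof.
elim: k a => [|k IH] a; first by move=> x _; exact: cvg_cst.
move=> v; split=> [x _|]; first exact: (derivable_cst a).
have -> : 'D_v (fun=> a) = (fun=> 0) :> (R * R -> V).
  by apply/funext => x; exact: (derive_cst a).
exact: IH.
Qed.

(** [Ck_on k.+1] mentions continuity only of iterated derivatives, so at the bottom of the induction
    the continuity of f comes from its differentiability, by [differentiable_C1]. *)
Lemma Ck_S k U (f : R * R -> R) : open U -> Ck_on k.+1 U f -> Ck_on k U f.
Proof.
move=> oU; elim: k f => [|k IH] f cf.
  by move=> x Ux; apply: differentiable_continuous; exact: (differentiable_C1 oU).
by move=> v; have [df cDf] := cf v; split => //; exact: IH.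
Qed.

Lemma Ck_le k l U (f : R * R -> R) : (l <= k)%N -> open U ->
  Ck_on k U f -> Ck_on l U f.
Proof.
move=> lk oU; rewrite -(subnK lk); elim: (k - l)%N => // n IH.
by rewrite addSn => /(Ck_S oU).
Qed.

Lemma CkD k U (f g : R * R -> R) : open U -> Ck_on k U f -> Ck_on k U g ->
  Ck_on k U (fun x => f x + g x).
Proof.
move=> oU; elim: k f g => [|k IH] f g cf cg.
  by move=> x Ux; apply: cvgD; [exact: cf|exact: cg].
move=> v; have [df cDf] := cf v; have [dg cDg] := cg v; split=> [x Ux|].
  by apply: derivableD; [exact: df|exact: dg].
apply: Ck_ext (IH _ _ cDf cDg) => // x Ux.
by rewrite -(deriveD (df _ Ux) (dg _ Ux)).
Qed.

Lemma CkM k U (f g : R * R -> R) : open U -> Ck_on k U f -> Ck_on k U g ->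
  Ck_on k U (fun x => f x * g x).
Proof.
move=> oU; elim: k f g => [|k IH] f g cf cg.
  by move=> x Ux; apply: cvgM; [exact: cf|exact: cg].
have cf' := Ck_S oU cf; have cg' := Ck_S oU cg.
move=> v; have [df cDf] := cf v; have [dg cDg] := cg v; split=> [x Ux|].
  by apply: derivableM; [exact: df|exact: dg].
apply: Ck_ext (CkD oU (IH _ _ cf' cDg) (IH _ _ cg' cDf)) => // x Ux.
by rewrite (deriveM (df _ Ux) (dg _ Ux)).
Qed.

(** One-variable mirror of [Ck_on], relative to a set I so that powers and the logarithm are
    covered. *)
Fixpoint Ck1 k (I : set R) (phi : R -> R) : Prop :=
  if k is k'.+1 then (forall t, I t -> derivable phi t 1) /\ Ck1 k' I (derive1 phi) else forall t, I t -> {for t, continuous phi}.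

Lemma Ck1_S k I phi : Ck1 k.+1 I phi -> Ck1 k I phi.
Proof.
elim: k phi => [|k IH] phi [dphi cphi].
  by move=> t /dphi d; apply: differentiable_continuous; exact/derivable1_diffP.
by split=> //; exact: IH.
Qed.

Lemma derive_comp1 (f : R * R -> R) (phi : R -> R) x v : differentiable f x ->
  derivable phi (f x) 1 -> derivable (phi \o f) x v /\ 'D_v (phi \o f) x = derive1 phi (f x) * 'D_v f x.
Proof.
move=> df /derivable1_diffP dphi; have d := differentiable_comp df dphi.
split; first exact: diff_derivable.
rewrite (deriveE _ d) diff_comp//= -(deriveE _ df) (deriv1E (iffRL (derivable1_diffP _ _) dphi)).
by rewrite scaleRE mulrC.
Qed.

Lemma Ck_comp1 k U I (f : R * R -> R) (phi : R -> R) : open U ->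
  (forall x, U x -> I (f x)) -> Ck_on k U f -> Ck1 k I phi -> Ck_on k U (phi \o f).
Proof.
move=> oU fUI; elim: k f phi fUI => [|k IH] f phi fUI cf cphi.
  by move=> x Ux; apply: continuous_comp (cf _ Ux) _; apply: cphi; exact: fUI.
have cf' := Ck_S oU cf; have cphi' := Ck1_S cphi.
have D x v : U x -> derivable (phi \o f) x v /\
    'D_v (phi \o f) x = derive1 phi (f x) * 'D_v f x.
  move=> Ux; apply: derive_comp1; last by apply: cphi.1; exact: fUI. by apply: (differentiable_C1 oU Ux); apply: Ck_le cf.
move=> v; split=> [x /(D x v)[]//|].
apply: Ck_ext (CkM oU (IH _ _ fUI cf' cphi.2) (cf v).2) => // x Ux.
by have [_ ->] := D x v Ux.
Qed.

Lemma diff_C1_plane (g : R * R -> R * R) U x : open U -> U x ->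
  Ck_on 1 U g -> differentiable g x.
Proof.
move=> oU Ux cg.
have d1 := differentiable_C1 oU Ux (Ck_linear oU cont_fst cg).
have d2 := differentiable_C1 oU Ux (Ck_linear oU cont_snd cg).
have := differentiable_pair d1 d2; congr (differentiable _ _).
by apply/funext => y /=; rewrite -surjective_pairing.
Qed.

Lemma diff_coord (f : R * R -> R) x v : differentiable f x ->
  'd f x v = v.1 * 'D_e1 f x + v.2 * 'D_e2 f x.
Proof.
move=> df; rewrite !(deriveE _ df).
have {1}-> : v = v.1 *: e1 + v.2 *: e2.
  by apply: injective_projections; rewrite /= !scaleRE; ring.
by rewrite linearD !linearZZ.
Qed.

Lemma derive_comp2 (g : R * R -> R * R) (f : R * R -> R) x v :
  differentiable g x -> differentiable f (g x) -> derivable (f \o g) x v /\ 'D_v (f \o g) x =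
    ('D_v g x).1 * 'D_e1 f (g x) + ('D_v g x).2 * 'D_e2 f (g x).
Proof.
move=> dg df; have d := differentiable_comp dg df.
split; first exact: diff_derivable.
by rewrite (deriveE _ d) diff_comp//= diff_coord// -(deriveE _ dg).
Qed.

Lemma Ck_S_plane k U (f : R * R -> R * R) : open U -> Ck_on k.+1 U f -> Ck_on k U f.
Proof.
move=> oU; elim: k f => [|k IH] f cf.
  by move=> x Ux; apply: differentiable_continuous; exact: (diff_C1_plane oU).
by move=> v; have [df cDf] := cf v; split => //; exact: IH.
Qed.

Lemma Ck_le_plane k l U (f : R * R -> R * R) : (l <= k)%N -> open U ->
  Ck_on k U f -> Ck_on l U f.
Proof.
move=> lk oU; rewrite -(subnK lk); elim: (k - l)%N => // n IH.
by rewrite addSn => /(Ck_S_plane oU).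
Qed.

Lemma Ck_comp2 k U B (g : R * R -> R * R) (f : R * R -> R) : open U -> open B ->
  (forall x, U x -> B (g x)) -> Ck_on k U g -> Ck_on k B f -> Ck_on k U (f \o g).
Proof.
move=> oU oB gUV; elim: k f => [|k IH] f cg cf.
  by move=> x Ux; apply: continuous_comp (cg _ Ux) _; apply: cf; exact: gUV.
have cg' := Ck_S_plane oU cg; have cf' := Ck_S oB cf.
have D x v : U x -> derivable (f \o g) x v /\ 'D_v (f \o g) x =
    ('D_v g x).1 * 'D_e1 f (g x) + ('D_v g x).2 * 'D_e2 f (g x).
  move=> Ux; apply: derive_comp2.
    by apply: (diff_C1_plane oU Ux); apply: Ck_le_plane cg.
  by apply: (differentiable_C1 oB (gUV _ Ux)); apply: Ck_le cf.
move=> v; split=> [x /(D x v)[]//|].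
have H1 := CkM oU (Ck_linear oU cont_fst (cg v).2) (IH _ cg' (cf e1).2).
have H2 := CkM oU (Ck_linear oU cont_snd (cg v).2) (IH _ cg' (cf e2).2).
apply: Ck_ext (CkD oU H1 H2) => // x Ux.
by have [_ ->] := D x v Ux.
Qed.

End Ck.

End PlaneCalculus.

(** * Smooth functions of one variable and the smooth step *)

Section SmoothReal.
Variable R : realType.
Implicit Types (I : set R) (phi psi : R -> R) (k n : nat).

Lemma Ck1_ext k I phi psi : open I -> (forall t, I t -> phi t = psi t) ->
  Ck1 k I phi -> Ck1 k I psi.
Proof.
move=> oI; elim: k phi psi => [|k IH] phi psi E.
  move=> c t It; have := c _ It. rewrite /prop_for /continuous_at (E _ It) => ct. apply: cvg_trans ct; apply: near_eq_cvg. by apply: filterS (open_nbhs_nbhs (conj oI It)) => u /E.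
have N t : I t -> \forall u \near t, phi u = psi u.
  by move=> It; apply: filterS (open_nbhs_nbhs (conj oI It)) => u /E.
move=> [d c]; split=> [t It|].
  by have := d _ It; exact: near_eq_derivable (N _ It).
apply: IH c => t It; rewrite !derive1E; exact: near_eq_derive (N _ It).
Qed.

Lemma Ck1_of_derive k I phi psi : open I ->
  (forall t, I t -> is_derive t (1 : R) phi (psi t)) -> Ck1 k I psi -> Ck1 k.+1 I phi.
Proof.
move=> oI d c; split=> [t /d[]//|].
by apply: Ck1_ext c => // t /d[_ <-]; rewrite derive1E.
Qed.

Lemma Ck1_lincomb k I (a b : R) phi psi : open I -> Ck1 k I phi -> Ck1 k I psi ->
  Ck1 k I (fun t => a * phi t + b * psi t).
Proof.
move=> oI; elim: k phi psi => [|k IH] phi psi.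
  move=> c1 c2 t It; apply: cvgD; (apply: cvgM; first exact: cvg_cst).
    exact: c1.
  exact: c2.
move=> [d1 c1] [d2 c2]; apply: Ck1_of_derive (IH _ _ c1 c2) => // t It.
have D1 : is_derive t (1 : R) (a \*: phi) (a *: 'D_1 phi t).
  by split; [exact: derivableZ (d1 _ It)|exact: deriveZ (d1 _ It)].
have D2 : is_derive t (1 : R) (b \*: psi) (b *: 'D_1 psi t).
  by split; [exact: derivableZ (d2 _ It)|exact: deriveZ (d2 _ It)].
by have := is_deriveD D1 D2; rewrite !derive1E.
Qed.

Lemma Ck1_expR k : Ck1 k [set: R] expR.
Proof.
elim: k => [|k IH]; first by move=> t _; exact: continuous_expR.
apply: (Ck1_of_derive (@openT R)) IH => t _; exact: is_derive_expR.
Qed.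

Lemma open_pos : open [set t : R | 0 < t].
Proof. exact: open_gt. Qed.

Lemma Ck1_powR k (a : R) : Ck1 k [set t : R | 0 < t] (fun t => t `^ a).
Proof.
elim: k a => [|k IH] a.
  move=> t /= t0; apply: differentiable_continuous; apply/derivable1_diffP. by have [] := is_derive1_powR a t0.
have D (t : R) : 0 < t -> is_derive t (1 : R) (fun t => t `^ a) (a * t `^ (a - 1)).
  exact: is_derive1_powR.
apply: (Ck1_of_derive open_pos D).
have := @Ck1_lincomb k _ a 0 _ _ open_pos (IH (a - 1)) (IH 0).
by apply: Ck1_ext => [|t _]; [exact: open_pos|rewrite mul0r addr0].
Qed.

Lemma Ck1_ln k : Ck1 k [set t : R | 0 < t] (@ln R).
Proof.
case: k => [|k].
  by move=> t /= t0; exact: continuous_ln.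
have D (t : R) : 0 < t -> is_derive t (1 : R) (@ln R) (t `^ (-1)).
  by move=> t0; rewrite powR_inv1 ?ltW//; exact: is_derive1_ln.
exact: (Ck1_of_derive open_pos D (@Ck1_powR k (-1))).
Qed.

(* the derivatives of [exp (- 1 / t)] extended by 0 are linear combinations of
   the functions of this family *)
Definition flat n (t : R) : R :=
  if 0 < t then t `^ (- n%:R) * expR (- t `^ (-1)) else 0.

(** From exp (1/t) >= t^-(n+1) / (n+1)!, one term of the exponential series. The linear bound yields
    continuity at 0. *)
Lemma flat_bound n (t : R) : 0 <= flat n t <= (n.+1)`!%:R * `|t|.
Proof.
rewrite /flat; case: ltP => [t0|_]; last by rewrite lexx mulr_ge0.
rewrite mulr_ge0 ?powR_ge0 ?expR_ge0//=.
rewrite (powR_inv1 (ltW t0)) powRN (powR_mulrn _ (ltW t0)) expRN.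
have y0 : 0 <= t^-1 by rewrite invr_ge0 ltW.
have := expR_ge1Dxn n y0; set E := expR _ => HE.
have E0 : 0 < E by exact: expR_gt0.
rewrite ler_pdivrMr// gtr0_norm//.
have f0 : 0 < (n.+1)`!%:R :> R by rewrite ltr0n fact_gt0.
have : t^-1 ^+ n.+1 / (n.+1)`!%:R <= E by apply: le_trans HE; rewrite lerDr.
rewrite ler_pdivrMr// exprS exprVn => H.
have tn0 : 0 < t by [].
have := ler_wpM2l (ltW t0) H; rewrite mulrA divff ?gt_eqF// mul1r.
by rewrite [t * (E * _)]mulrC -mulrA [_ * t]mulrC [E * _]mulrC.
Qed.

Lemma flat_cont n (t : R) : {for t, continuous (flat n)}.
Proof.
have [t0|t0|->] := ltgtP t 0.
- have : (fun=> 0 : R) x @[x --> t] --> flat n t.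
    by rewrite /flat ltNge ltW//=; exact: cvg_cst.
  apply: cvg_trans; apply: near_eq_cvg; near=> u. rewrite /flat ifF//; apply/negbTE; rewrite -leNgt ltW//; near: u. exact: lt_nbhsl.
- have : (t `^ (- n%:R) * expR (- t `^ (-1))) @[t --> t] --> flat n t.
    rewrite /flat t0; apply: cvgM; first exact: (Ck1_powR 0). apply: (@continuous_comp _ _ _ (fun t : R => - t `^ (-1)) expR).
      by apply: cvgN; exact: (Ck1_powR 0).
    exact: continuous_expR.
  apply: cvg_trans; apply: near_eq_cvg; near=> u. by rewrite /flat ifT//; near: u; exact: lt_nbhsr.
- apply/cvgrPdist_le => e e0; rewrite [flat n 0]/flat ltxx. pose c : R := (n.+1)`!%:R; have c0 : 0 < c by rewrite ltr0n fact_gt0. near=> u; rewrite sub0r normrN.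
  have /andP[f0 f1] := flat_bound n u; rewrite ger0_norm//. apply: le_trans f1 _; rewrite -ler_pdivlMl//. near: u; apply/nbhs_ballP; exists (c^-1 * e) => /=.
    by rewrite mulr_gt0// invr_gt0.
  by move=> u; rewrite /ball/= sub0r normrN => /ltW.
Unshelve. all: by end_near. Qed.

(** Away from 0 this is the product rule; at 0 the difference quotient of [flat n] is [flat n.+1],
    which tends to 0. The family is thus closed under differentiation up to linear combinations. *)
Lemma is_derive_flat n (t : R) :
  is_derive t (1 : R) (flat n) (flat n.+2 t - n%:R * flat n.+1 t).
Proof.
have [t0|t0|->] := ltgtP t 0.
- have -> : flat n.+2 t - n%:R * flat n.+1 t = 0.
    by rewrite /flat ltNge ltW//= mulr0 subr0.
  apply: near_eq_is_derive (is_derive_cst (0 : R) t 1). near=> u; rewrite /flat ifF//; apply/negbTE; rewrite -leNgt ltW//; near: u. exact: lt_nbhsl.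
- have D1 := is_derive1_powR (- n%:R) t0. have D2 := is_derive1_comp (is_derive_expR _) (is_deriveN (is_derive1_powR (-1) t0)). have D := is_deriveM D1 D2.
  apply: (@near_eq_is_derive _ _ _ ((fun t => t `^ (- n%:R)) * (expR \o (- (fun t : R => t `^ (-1)))))).
    by near=> u; rewrite /flat ifT//; near: u; exact: lt_nbhsr.
  apply: is_derive_eq D _; rewrite /flat t0 /= !scaleRE. have P (a b : R) : t `^ (a + b) = t `^ a * t `^ b.
    by apply: powRD; apply/implyP => _; rewrite gt_eqF.
  set E := expR _. have -> : - n.+2%:R = - n%:R + -1 + -1 :> R by rewrite -!natr1; ring. have -> : - n.+1%:R = - n%:R + -1 :> R by rewrite -!natr1; ring. by rewrite !P; ring.
- have -> : flat n.+2 0 - n%:R * flat n.+1 0 = 0.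
    by rewrite /flat ltxx mulr0 subr0.
  have H : (h^-1 *: ((flat n \o shift 0) (h *: (1 : R)) - flat n 0)) @[h --> (0 : R)^'] --> (0 : R).
    have : flat n.+1 h @[h --> (0 : R)^'] --> (0 : R).
      have := @flat_cont n.+1 0; rewrite /prop_for /continuous_at. have -> : flat n.+1 0 = 0 by rewrite /flat ltxx. exact: cvg_within_filter.
    apply: cvg_trans; apply: near_eq_cvg; near=> h. have -> : h *: (1 : R) = h by exact: mulr1. rewrite /= addr0 scaleRE [flat n 0]/flat ltxx subr0.
    have h0 : h != 0 by near: h; exact: nbhs_dnbhs_neq. rewrite /flat; case: ltP => [hp|_]; last by rewrite mulr0. rewrite mulrA; congr (_ * _).
    rewrite -[n.+1%:R]natr1 opprD powRD; last by apply/implyP => _; rewrite gt_eqF. by rewrite mulrC powR_inv1// ltW.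
  by split; [apply/cvg_ex; exists 0|exact: cvg_lim H].
Unshelve. all: by end_near. Qed.

Lemma Ck1_flat k n : Ck1 k [set: R] (flat n).
Proof.
elim: k n => [|k IH] n; first by move=> t _; exact: flat_cont.
have D (t : R) : [set: R] t -> is_derive t (1 : R) (flat n) (1 * flat n.+2 t + (- n%:R) * flat n.+1 t).
  by move=> _; rewrite mul1r mulNr; exact: is_derive_flat.
apply: (Ck1_of_derive (@openT R) D).
exact: (Ck1_lincomb _ _ (@openT R) (IH _) (IH _)).
Qed.

Lemma flat0_ge0 (t : R) : 0 <= flat 0 t.
Proof. by have /andP[] := flat_bound 0 t. Qed.

Lemma flat0_gt0 (t : R) : 0 < t -> 0 < flat 0 t.
Proof. by move=> t0; rewrite /flat t0 mulr_gt0 ?powR_gt0 ?expR_gt0. Qed.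

Lemma flat0_eq0 (t : R) : t <= 0 -> flat 0 t = 0.
Proof. by rewrite leNgt /flat => /negbTE ->. Qed.

(** The denominator never vanishes because t and 1 - t are not both nonpositive. The quotient is 0
    for t <= 0 and 1 for t >= 1. *)
Definition step (t : R) : R := flat 0 t / (flat 0 t + flat 0 (1 - t)).

Lemma step_den_gt0 (t : R) : 0 < flat 0 t + flat 0 (1 - t).
Proof.
have [t0|t0] := ltP 0 t.
  by rewrite ltr_wpDr ?flat0_ge0 ?flat0_gt0.
by rewrite ltr_wpDl ?flat0_ge0// flat0_gt0//; lra.
Qed.

Lemma step_itv (t : R) : 0 <= step t <= 1.
Proof.
rewrite divr_ge0 ?flat0_ge0 ?(ltW (step_den_gt0 _))//=.
by rewrite ler_pdivrMr ?step_den_gt0// mul1r lerDl flat0_ge0.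
Qed.

Lemma step_eq0 (t : R) : t <= 0 -> step t = 0.
Proof. by move=> t0; rewrite /step flat0_eq0// mul0r. Qed.

Lemma step_eq1 (t : R) : 1 <= t -> step t = 1.
Proof.
move=> t1; have := step_den_gt0 t; rewrite /step (@flat0_eq0 (1 - t)) ?subr_le0//.
by rewrite addr0 => /lt0r_neq0/divff.
Qed.

Lemma Ck_step k (U : set (R * R)) (f : R * R -> R) : open U -> Ck_on k U f ->
  Ck_on k U (step \o f).
Proof.
move=> oU cf.
have c1 : Ck_on k U (flat 0 \o f) by apply: (Ck_comp1 oU _ cf (Ck1_flat k 0)).
have c2 : Ck_on k U (flat 0 \o (fun x => 1 + (-1) * f x)).
  apply: (Ck_comp1 oU _ _ (Ck1_flat k 0)) => //. by apply: CkD => //; [exact: Ck_cst|apply: CkM => //; exact: Ck_cst].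
have c3 : Ck_on k U ((fun t => t `^ (-1)) \o
    (fun x => (flat 0 \o f) x + (flat 0 \o (fun x => 1 + (-1) * f x)) x)).
  apply: (Ck_comp1 oU _ _ (Ck1_powR k (-1))); last exact: CkD. by move=> x _ /=; rewrite mulN1r step_den_gt0.
apply: Ck_ext (CkM oU c1 c3) => // x _ /=.
by rewrite mulN1r powR_inv1 ?(ltW (step_den_gt0 _)).
Qed.

End SmoothReal.

(** * Smooth functions on a surface and deformations of a metric *)

Section SmoothFunctions.
Variables (R : realType) (M : surface R).
Implicit Types (p q y : M) (x u v : R * R) (F : M -> R).

Lemma cod_chart p y : dom p y -> cod p (chart p y).
Proof. by move=> py; exists y. Qed.

Lemma dom_chart_inv p x : cod p x -> dom p (chart_inv p x).
Proof. by move=> [y py <-]; rewrite chartK. Qed.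

Lemma chart_invK p x : cod p x -> chart p (chart_inv p x) = x.
Proof. by move=> [y py <-]; rewrite chartK. Qed.

Lemma codE p (A : set M) : A `<=` dom p ->
  chart p @` A = cod p `&` chart_inv p @^-1` A.
Proof.
move=> Ap; apply/seteqP; split=> [_ [y Ay <-]|x [cx Ax]].
  by split=> /=; [exact/cod_chart/Ap|rewrite chartK//; exact: Ap].
by exists (chart_inv p x) => //; exact: chart_invK.
Qed.

Lemma open_cod p : open (cod p). Proof. exact: cod_open. Qed.

Lemma continuous_chart_inv p x : cod p x -> {for x, continuous (chart_inv p)}.
Proof.
move=> cx; have := @chart_inv_continuous R M p.
by rewrite (continuous_open_subspace _ (@open_cod p)); apply; rewrite inE.
Qed.

Lemma continuous_chart p y : dom p y -> {for y, continuous (chart p)}.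
Proof.
move=> py; have := @chart_continuous R M p.
by rewrite (continuous_open_subspace _ (@dom_open _ _ p)); apply; rewrite inE.
Qed.

Lemma open_chart_inv p (A : set M) : open A -> open (cod p `&` chart_inv p @^-1` A).
Proof.
move=> oA; rewrite openE => x [cx Ax].
apply: filterI; first exact: open_nbhs_nbhs (conj (@open_cod p) cx).
apply: continuous_chart_inv => //; exact: open_nbhs_nbhs.
Qed.

Lemma open_chart p (B : set (R * R)) : open B -> open (dom p `&` chart p @^-1` B).
Proof.
move=> oB; rewrite openE => y [py By].
apply: filterI; first exact: open_nbhs_nbhs (conj (@dom_open _ _ p) py).
apply: continuous_chart => //; exact: open_nbhs_nbhs.
Qed.

Definition trans p q : R * R -> R * R := chart q \o chart_inv p.

Lemma local_domE p q : local_dom (@id M) p q = cod p `&` chart_inv p @^-1` dom q.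
Proof.
rewrite /local_dom codE; last by move=> y [].
by apply/seteqP; split=> x [cx]; [case|]; split=> //; split=> //; exact: dom_chart_inv.
Qed.

Lemma open_local_dom p q : open (local_dom (@id M) p q).
Proof. rewrite local_domE; exact/open_chart_inv/dom_open. Qed.

Lemma trans_smooth p q : smooth_on (local_dom (@id M) p q) (trans p q).
Proof. exact: transition_smooth. Qed.

Lemma trans_cod p q x : local_dom (@id M) p q x -> cod q (trans p q x).
Proof. by rewrite local_domE => -[cx dx]; exact: cod_chart. Qed.

Lemma trans_diff p q x : local_dom (@id M) p q x -> differentiable (trans p q) x.
Proof.
by move=> dx; exact: diff_C1_plane (@open_local_dom p q) dx (@trans_smooth p q 1).
Qed.

Definition msmooth F := forall p, smooth_on (cod p) (F \o chart_inv p).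

Lemma msmooth_cst a : msmooth (fun=> a).
Proof. by move=> p k; exact: Ck_cst. Qed.

Lemma msmoothD F F' : msmooth F -> msmooth F' -> msmooth (fun y => F y + F' y).
Proof. by move=> s s' p k; exact: CkD (@open_cod p) (s p k) (s' p k). Qed.

Lemma msmoothM F F' : msmooth F -> msmooth F' -> msmooth (fun y => F y * F' y).
Proof. by move=> s s' p k; exact: CkM (@open_cod p) (s p k) (s' p k). Qed.

Lemma msmooth_comp F (I : set R) phi : (forall y, I (F y)) -> msmooth F ->
  (forall k, Ck1 k I phi) -> msmooth (phi \o F).
Proof.
move=> FI s c p k; apply: (@Ck_comp1 _ k _ I (F \o chart_inv p) phi (@open_cod p) _ (s p k) (c k)).
by move=> x _; exact: FI.
Qed.

Lemma msmooth_step F : msmooth F -> msmooth (fun y => step (F y)).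
Proof. by move=> s p k; exact: (Ck_step (@open_cod p) (s p k)). Qed.

Lemma msmooth_sum (I : eqType) (r : seq I) (F : I -> M -> R) :
  (forall i, i \in r -> msmooth (F i)) -> msmooth (fun y => \sum_(i <- r) F i y).
Proof.
elim: r => [|i r IH] s.
  have -> : (fun y => \sum_(i <- [::]) F i y) = (fun=> 0).
    by apply/funext => y; rewrite big_nil.
  exact: msmooth_cst.
have -> : (fun y => \sum_(j <- i :: r) F j y) = (fun y => F i y + \sum_(j <- r) F j y).
  by apply/funext => y; rewrite big_cons.
by apply: msmoothD; [apply: s; rewrite mem_head|apply: IH => j jr; apply: s; rewrite inE jr orbT].
Qed.

Definition chart_ext q (g : R * R -> R) y : R :=
  if `[< dom q y >] then g (chart q y) else 0.

Lemma chart_extE q g y : dom q y -> chart_ext q g y = g (chart q y).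
Proof. by move=> qy; rewrite /chart_ext; case: asboolP. Qed.

Lemma chart_ext_notin q g y : ~ dom q y -> chart_ext q g y = 0.
Proof. by move=> qy; rewrite /chart_ext; case: asboolP. Qed.

(** The set is the compact image of K under [chart_inv q], and surfaces are Hausdorff. This is what
    makes extension by zero smooth. *)
Lemma compact_chart_closed q (K : set (R * R)) : compact K -> K `<=` cod q ->
  closed (dom q `&` chart q @^-1` K).
Proof.
move=> cK Kq.
have -> : dom q `&` chart q @^-1` K = chart_inv q @` K.
  apply/seteqP; split=> [y [qy Ky]|_ [x Kx <-]].
    by exists (chart q y) => //; exact: chartK.
  by split; [exact/dom_chart_inv/Kq|rewrite /= chart_invK//; exact: Kq].
apply: compact_closed; first exact: surface_hausdorff.
apply: continuous_compact cK.
apply: continuous_subspaceW (@chart_inv_continuous R M q); exact: Kq.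
Qed.

(** Around a point outside [dom q] the function vanishes on the complement of the compact image of
    K, which is an open neighbourhood. *)
Lemma msmooth_chart_ext q g (K : set (R * R)) : compact K -> K `<=` cod q ->
  smooth_on (cod q) g -> (forall x, cod q x -> ~ K x -> g x = 0) -> msmooth (chart_ext q g).
Proof.
move=> cK Kq sg g0 p k; apply: Ck_local => x cx.
have [qx|nqx] := pselect (dom q (chart_inv p x)).
  exists (local_dom (@id M) p q).
    by split; [exact: open_local_dom|rewrite local_domE].
  apply: Ck_ext (Ck_comp2 (@open_local_dom p q) (@open_cod q) (@trans_cod p q)
    (@trans_smooth p q k) (sg k)); first exact: open_local_dom.
  by move=> z; rewrite local_domE => -[cz dz] /=; rewrite chart_extE.
pose A := cod p `&` chart_inv p @^-1` (~` (dom q `&` chart q @^-1` K)).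
have oA : open A by apply: open_chart_inv; rewrite openC; exact: compact_chart_closed.
exists A; first by split=> //; split=> //= -[].
apply: Ck_ext (Ck_cst k A 0) => // z [cz /= nz].
have [qz|nqz] := pselect (dom q (chart_inv p z)); last by rewrite chart_ext_notin.
rewrite chart_extE// g0//; first exact: cod_chart.
by move=> Kz; apply: nz.
Qed.

Definition dM F p x v : R := 'D_v (F \o chart_inv p) x.

Lemma msmooth_diff F p x : msmooth F -> cod p x -> differentiable (F \o chart_inv p) x.
Proof. by move=> s cx; exact: differentiable_C1 (@open_cod p) cx (s p 1). Qed.

Lemma dM_trans F p q x v : msmooth F -> local_dom (@id M) p q x ->
  dM F p x v = dM F q (trans p q x) ('d (trans p q) x v).
Proof.
move=> s dx; have cq := trans_cod dx; have := dx; rewrite local_domE => -[cx qx].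
have dT := trans_diff dx; have dF := msmooth_diff s cq.
have -> : dM F p x v = 'D_v ((F \o chart_inv q) \o trans p q) x.
  apply: near_eq_derive. apply: filterS (open_nbhs_nbhs (conj (@open_local_dom p q) dx)) => z. by rewrite local_domE => -[cz qz] /=; rewrite /trans /= chartK.
rewrite /dM (deriveE _ (differentiable_comp dT dF)) diff_comp//=.
by rewrite -(deriveE _ dF).
Qed.

Lemma dM_linear F p x a u u' : msmooth F -> cod p x ->
  dM F p x (a *: u + u') = a * dM F p x u + dM F p x u'.
Proof.
move=> s cx; have dF := msmooth_diff s cx.
by rewrite /dM !(deriveE _ dF) linearD linearZZ.
Qed.

Lemma dM_smooth F p v : msmooth F -> smooth_on (cod p) (fun x => dM F p x v).
Proof. by move=> s k; have [_] := s p k.+1 v. Qed.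

Section Deform.
Variables (G : riemannian_metric M) (al be F : M -> R).
Hypotheses (sal : msmooth al) (sbe : msmooth be) (sF : msmooth F).
Hypotheses (al0 : forall y, 0 < al y) (be0 : forall y, 0 <= be y).

(** A conformal change plus the rank-one form dF (x) dF; a nonnegative multiple of the latter keeps
    the form positive. All comparison metrics have this shape. *)
Definition deform_inner p x u v : R :=
  al (chart_inv p x) * G p x u v + be (chart_inv p x) * (dM F p x u * dM F p x v).

Lemma deform_sym p x : cod p x -> forall u v, deform_inner p x u v = deform_inner p x v u.
Proof. by move=> cx u v; rewrite /deform_inner (inner_sym _ cx); ring. Qed.

Lemma deform_linear p x : cod p x -> forall a u u' v,
  deform_inner p x (a *: u + u') v = a * deform_inner p x u v + deform_inner p x u' v.
Proof.
by move=> cx a u u' v; rewrite /deform_inner (inner_linear _ cx) dM_linear//; ring.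
Qed.

Lemma deform_pos p x : cod p x -> forall u, u != 0 -> 0 < deform_inner p x u u.
Proof.
move=> cx u u0; apply: ltr_wpDr; first by rewrite mulr_ge0// -expr2 sqr_ge0.
by rewrite mulr_gt0// inner_pos.
Qed.

Lemma deform_smooth p u v : smooth_on (cod p) (fun x => deform_inner p x u v : R).
Proof.
move=> k; have o := @open_cod p; apply: CkD => //; apply: CkM => //.
- exact: sal.
- exact: inner_smooth.
- exact: sbe.
- by apply: CkM => //; exact: dM_smooth.
Qed.

Lemma deform_compat : pullback_eq deform_inner deform_inner (@id M).
Proof.
move=> p q x dx u v; rewrite /deform_inner (inner_compat G dx) (dM_trans u sF dx) (dM_trans v sF dx).
have := dx; rewrite local_domE => -[cx qx].
by rewrite /local_rep /= chartK.
Qed.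

Definition deform : riemannian_metric M :=
  RiemannianMetric deform_sym deform_linear deform_pos deform_smooth deform_compat.

End Deform.
End SmoothFunctions.

(** * Velocity and speed of curves in charts *)

Section Curves.
Variables (R : realType) (N : surface R).
Implicit Types (p q y : N) (c : R -> N) (t u : R).
Local Notation e1 := ((1, 0) : R * R).
Local Notation e2 := ((0, 1) : R * R).

Lemma vec_expand (v : R * R) : v = v.1 *: e1 + v.2 *: e2.
Proof. by apply: injective_projections; rewrite /= !scaleRE; ring. Qed.

Lemma diff_expand (W : normedModType R) (f : R * R -> W) x (v : R * R) :
  differentiable f x -> 'd f x v = v.1 *: 'D_e1 f x + v.2 *: 'D_e2 f x.
Proof.
move=> df; rewrite !(deriveE _ df) [in LHS](vec_expand v) linearD.
by rewrite !(linearZZ ('d f x)).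
Qed.

(** Local counterpart of [C1_curve]: chart segments and lifts are C^1 only near a given interval, so
    continuity near t has to be part of the condition. *)
Definition C1_at c t := [/\ \forall u \near t, {for u, continuous c},
  \forall u \near t, derivable (chart (c t) \o c) u 1 & {for t, continuous (derive1 (chart (c t) \o c))}].

Definition vel c t : R * R := derive1 (chart (c t) \o c) t.

Lemma derive1_chart_trans p q c t : dom p (c t) -> dom q (c t) ->
  {for t, continuous c} -> derivable (chart p \o c) t 1 -> derivable (chart q \o c) t 1 /\ derive1 (chart q \o c) t = 'd (trans p q) (chart p (c t)) (derive1 (chart p \o c) t).
Proof.
move=> pt qt cc dp.
have dx : local_dom (@id N) p q (chart p (c t)) by exists (c t).
have dT := trans_diff dx.
have E : \forall u \near t, (trans p q \o (chart p \o c)) u = (chart q \o c) u.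
  have : \forall u \near t, dom p (c u).
    by apply: cc; apply: open_nbhs_nbhs; split=> //; exact: dom_open.
  by apply: filterS => u pu; rewrite /trans /= chartK.
have dc : differentiable (chart p \o c) t by exact/derivable1_diffP.
have d : differentiable (trans p q \o (chart p \o c)) t by exact: differentiable_comp.
split.
  by apply: near_eq_derivable E _; exact: diff_derivable.
rewrite !derive1E -(near_eq_derive _ E) (deriveE _ d) diff_comp//= -(deriveE _ dc).
by [].
Qed.

(** Expanding the new velocity in the partial derivatives of the transition map makes its continuity
    in u a matter of sums and products. *)
Lemma C1_at_chart p c t : dom p (c t) ->
  (\forall u \near t, {for u, continuous c}) -> (\forall u \near t, derivable (chart p \o c) u 1) -> {for t, continuous (derive1 (chart p \o c))} -> forall q, dom q (c t) ->
    (\forall u \near t, derivable (chart q \o c) u 1) /\ {for t, continuous (derive1 (chart q \o c))}.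
Proof.
move=> pt cc dp cdp q qt.
have ct : {for t, continuous c} := nbhs_singleton cc.
have nd r : dom r (c t) -> \forall u \near t, dom r (c u).
  by move=> rt; apply: ct; apply: open_nbhs_nbhs; split=> //; exact: dom_open.
have np := nd _ pt; have nq := nd _ qt.
have H : \forall u \near t, derivable (chart q \o c) u 1 /\
   derive1 (chart q \o c) u = (derive1 (chart p \o c) u).1 *: 'D_e1 (trans p q) (chart p (c u))
     + (derive1 (chart p \o c) u).2 *: 'D_e2 (trans p q) (chart p (c u)).
  near=> u. have [||||d ->] := @derive1_chart_trans p q c u.
  - by near: u.
  - by near: u.
  - by near: u.
  - by near: u.
  split=> //; rewrite diff_expand//; apply: trans_diff; exists (c u) => //. by split; near: u.
split; first by apply: filterS H => u [].
have Et := (nbhs_singleton H).2.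
rewrite /prop_for /continuous_at Et.
have E : \forall u \near t, (derive1 (chart p \o c) u).1 *: 'D_e1 (trans p q) (chart p (c u))
     + (derive1 (chart p \o c) u).2 *: 'D_e2 (trans p q) (chart p (c u)) = derive1 (chart q \o c) u.
  by apply: filterS H => u [].
apply: cvg_trans (near_eq_cvg E) _.
have dx : local_dom (@id N) p q (chart p (c t)) by exists (c t).
have cT (v : R * R) : 'D_v (trans p q) (chart p (c u)) @[u --> t] --> 'D_v (trans p q) (chart p (c t)).
  apply: (@continuous_comp _ _ _ (chart p \o c) ('D_v (trans p q))).
    by apply: continuous_comp ct _; exact: continuous_chart.
  by have [_] := @trans_smooth _ _ p q 1 v; apply.
apply: cvgD; apply: cvgZ; [| exact: cT| |exact: cT].
  by apply: continuous_comp cdp _; exact: cont_fst.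
by apply: continuous_comp cdp _; exact: cont_snd.
Unshelve. all: by end_near. Qed.

Lemma C1_curveP c : C1_curve c <-> forall t, C1_at c t.
Proof.
split=> [[cc H] t|H].
  by have [d cd] := H t; split=> //; near=> u; exact: cc.
by split=> t; have [c0 d cd] := H t => //; exact: (nbhs_singleton c0).
Unshelve. all: by end_near. Qed.

Variable G : riemannian_metric N.

Definition nrm p x (v : R * R) : R := Num.sqrt (G p x v v).

Lemma inner_expand p x (v : R * R) : cod p x ->
  G p x v v = v.1 ^+ 2 * G p x e1 e1 + 2 * (v.1 * v.2) * G p x e1 e2 + v.2 ^+ 2 * G p x e2 e2.
Proof.
move=> cx.
have L (a : R) (u u' w : R * R) : G p x (a *: u + u') w = a * G p x u w + G p x u' w := inner_linear G cx a u u' w.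
have S (u w : R * R) : G p x u w = G p x w u := inner_sym G cx u w.
have G0 (w : R * R) : G p x 0 w = 0.
  by have := L 1 0 0 w; rewrite scaler0 addr0 mul1r => /eqP; rewrite -subr_eq0 opprD addrA subrr sub0r oppr_eq0 => /eqP.
have LL (u w : R * R) : G p x u w = u.1 * G p x e1 w + u.2 * G p x e2 w.
  rewrite [in LHS](vec_expand u) L; congr (_ + _). by rewrite -[X in G p x X](addr0) L G0 addr0.
rewrite (LL v v) (S e1 v) (S e2 v) (LL v e1) (LL v e2) (S e2 e1); ring.
Qed.

Lemma inner_ge0 p x v : cod p x -> 0 <= G p x v v.
Proof.
move=> cx; have [->|v0] := eqVneq v 0; last by rewrite ltW// inner_pos.
by rewrite inner_expand//= expr0n/= !mul0r mulr0 mul0r !addr0.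
Qed.

Lemma nrm_ge0 p x v : 0 <= nrm p x v. Proof. exact: sqrtr_ge0. Qed.

Lemma nrm_trans p q y v : dom p y -> dom q y ->
  nrm q (chart q y) ('d (trans p q) (chart p y) v) = nrm p (chart p y) v.
Proof.
move=> py qy; have dx : local_dom (@id N) p q (chart p y) by exists y.
rewrite /nrm (inner_compat G dx) /local_rep /= chartK//.
Qed.

Lemma nrmZ p x a v : cod p x -> nrm p x (a *: v) = `|a| * nrm p x v.
Proof.
move=> cx; rewrite /nrm -sqrtr_sqr -sqrtrM ?sqr_ge0//; congr Num.sqrt.
by rewrite (inner_expand (a *: v) cx) (inner_expand v cx) /= !scaleRE; ring.
Qed.

Lemma speedE p c t : dom p (c t) -> {for t, continuous c} ->
  derivable (chart p \o c) t 1 -> speed G c t = nrm p (chart p (c t)) (derive1 (chart p \o c) t).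
Proof.
move=> pt cc dp; have [d E] := derive1_chart_trans pt (dom_center (c t)) cc dp.
by rewrite /speed -/(nrm _ _ _) E nrm_trans//; exact: dom_center.
Qed.

Lemma continuous_inner p x (u v : R * R) : cod p x -> {for x, continuous (fun x => G p x u v)}.
Proof. by move=> cx; have := @inner_smooth _ _ G p u v 0; apply. Qed.

(** [speed] uses the chart centred at the moving point; near t it is rewritten in the fixed chart at
    [c t], where continuity is visible. *)
Lemma continuous_speed c t : C1_at c t -> {for t, continuous (speed G c)}.
Proof.
move=> [cc d cd]; set p := c t in d cd *.
have ct : {for t, continuous c} := nbhs_singleton cc.
have pt : dom p (c t) by exact: dom_center.
have np : \forall u \near t, dom p (c u).
  by apply: ct; apply: open_nbhs_nbhs; split=> //; exact: dom_open.
pose w u := derive1 (chart p \o c) u.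
pose g u := ((w u).1 ^+ 2 * G p (chart p (c u)) e1 e1 +
  2 * ((w u).1 * (w u).2) * G p (chart p (c u)) e1 e2 + (w u).2 ^+ 2 * G p (chart p (c u)) e2 e2).
have E : \forall u \near t, Num.sqrt (g u) = speed G c u.
  near=> u; rewrite (@speedE p); [|by near: u..]. by rewrite /nrm inner_expand//; apply: cod_chart; near: u.
rewrite /prop_for /continuous_at -(nbhs_singleton E).
apply: cvg_trans (near_eq_cvg E) _.
suff H : g s @[s --> t] --> g t by exact: (cvg_comp _ _ H (@sqrt_continuous _ (g t))).
have cG (u v : R * R) : G p (chart p (c s)) u v @[s --> t] --> G p (chart p (c t)) u v.
  apply: (@continuous_comp _ _ _ (chart p \o c) (fun x => G p x u v)).
    by apply: continuous_comp ct _; exact: continuous_chart.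
  by apply: continuous_inner; exact: cod_chart.
have c1 : (w s).1 @[s --> t] --> (w t).1.
  by apply: continuous_comp cd _; exact: cont_fst.
have c2 : (w s).2 @[s --> t] --> (w t).2.
  by apply: continuous_comp cd _; exact: cont_snd.
apply: cvgD; [apply: cvgD|].
- by apply: cvgM; [exact: cvgM|exact: cG].
- by apply: cvgM; [apply: cvgM; [exact: cvg_cst|exact: cvgM]|exact: cG].
- by apply: cvgM; [exact: cvgM|exact: cG].
Unshelve. all: by end_near. Qed.

End Curves.

(** * Lengths of piecewise C^1 arcs *)

Section Arcs.
Variables (R : realType).

Lemma derive1_comp_scale (W : normedModType R) (f : R -> W) (th : R -> R) (t : R) :
  derivable th t 1 -> derivable f (th t) 1 -> derivable (f \o th) t 1 /\ derive1 (f \o th) t = derive1 th t *: derive1 f (th t).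
Proof.
move=> /derivable1_diffP dth /derivable1_diffP df.
have d := differentiable_comp dth df.
split; first exact: diff_derivable.
rewrite derive1E (deriveE _ d) diff_comp//=.
rewrite (deriv1E (iffRL (derivable1_diffP _ _) dth)) (deriv1E (iffRL (derivable1_diffP _ _) df)).
by rewrite scaleRE mul1r.
Qed.

Lemma primitive (f : R -> R) (a b : R) : a < b -> continuous f ->
  exists L : R -> R, forall t, a < t < b -> is_derive t (1 : R) L (f t).
Proof.
move=> ab cf.
have fi : lebesgue_measure.-integrable `[a, b] (EFin \o f).
  apply: continuous_compact_integrable; first exact: segment_compact. exact: continuous_subspaceT.
exists (fun x => (\int[lebesgue_measure]_(t in `[a, x]) f t)%R) => t /andP[at' tb].
have [d E] := continuous_FTC1_closed tb fi at' (cf t).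
by rewrite -E; split; [exact: d|rewrite derive1E].
Qed.

Lemma integral_derive (f L : R -> R) (a b : R) : a < b ->
  (forall t, a <= t <= b -> {for t, continuous f}) -> (forall t, a <= t <= b -> is_derive t (1 : R) L (f t)) -> (\int[lebesgue_measure]_(t in `[a, b]) (f t)%:E)%E = (L b - L a)%:E.
Proof.
move=> ab cf dL.
have cL t : a <= t <= b -> {for t, continuous L}.
  by move=> /dL[d _]; apply: differentiable_continuous; exact/derivable1_diffP.
rewrite EFinB; apply: continuous_FTC2 => //.
- by apply: continuous_in_subspaceT => t; rewrite inE/= in_itv/=; exact: cf.
- split.
  + by move=> t; rewrite in_itv/= => /andP[t1 t2]; have [] := dL t; rewrite ?(ltW t1) ?(ltW t2).
  + by apply: cvg_at_right_filter; apply: cL; rewrite lexx ltW.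
  + by apply: cvg_at_left_filter; apply: cL; rewrite lexx ltW.
- move=> t; rewrite in_itv/= => /andP[t1 t2]; rewrite derive1E. have tab : a <= t <= b by rewrite (ltW t1) (ltW t2). by have [_ ->] := dL _ tab.
Qed.

Variables (N : surface R).
Implicit Type c : R -> N.

Lemma near_comp (T U : topologicalType) (f : T -> U) (t : T) (P : U -> Prop) :
  {for t, continuous f} -> (\forall u \near f t, P u) -> \forall u \near t, P (f u).
Proof. by move=> ct Pt; exact: ct. Qed.

Lemma cont_comp (T U V : topologicalType) (f : T -> U) (g : U -> V) (t : T) :
  {for t, continuous f} -> {for f t, continuous g} -> {for t, continuous (g \o f)}.
Proof. exact: continuous_comp. Qed.

Lemma C1_at_comp c (th : R -> R) (t : R) : C1_at c (th t) ->
  (\forall u \near t, derivable th u 1) -> {for t, continuous (derive1 th)} -> C1_at (c \o th) t.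
Proof.
move=> [cc d cd] dth cdth.
have cth : \forall u \near t, {for u, continuous th}.
  by apply: filterS dth => u du; apply: differentiable_continuous; exact/derivable1_diffP.
have ct := nbhs_singleton cth.
pose f := chart (c (th t)) \o c.
have ef : chart ((c \o th) t) \o (c \o th) = f \o th by [].
have H : \forall u \near t, derivable (f \o th) u 1 /\
    derive1 (f \o th) u = derive1 th u *: derive1 f (th u).
  apply: filterS2 dth (near_comp ct d) => u d1 d2. exact: derive1_comp_scale d1 d2.
rewrite /C1_at ef; split.
- apply: filterS2 cth (near_comp ct cc) => u h1 h2; exact: cont_comp h1 h2.
- by apply: filterS H => u [].
- have E : \forall u \near t, derive1 th u *: derive1 f (th u) = derive1 (f \o th) u.
    by apply: filterS H => u [_ ->].
  have K := cont_comp ct cd. have Z : derive1 th u *: derive1 f (th u) @[u --> t] --> derive1 (f \o th) t.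
    by rewrite -(nbhs_singleton E); apply: cvgZ; [exact: cdth|exact: K].
  exact: cvg_trans (near_eq_cvg E) Z.
Qed.

Variable G : riemannian_metric N.

Lemma speed_comp c (th : R -> R) (t : R) : C1_at c (th t) -> derivable th t 1 ->
  speed G (c \o th) t = `|derive1 th t| * speed G c (th t).
Proof.
move=> [_ d0 _] dth; have d : derivable (chart (c (th t)) \o c) (th t) 1 := nbhs_singleton d0.
have [_ E] := derive1_comp_scale dth d.
have -> : speed G (c \o th) t = nrm G (c (th t)) (chart (c (th t)) (c (th t)))
  (derive1 ((chart (c (th t)) \o c) \o th) t) by [].
rewrite E nrmZ//.
exact/cod_chart/dom_center.
Qed.

(** Each C^1 piece carries a primitive of its speed, so lengths are differences of values and can be
    compared by differentiating. Integrals occur only in [arc_integral], which ties this notion to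
    [curve_length]. *)
Inductive arc c : R -> R -> R -> Prop :=
| arc_C1 a b c' L : a < b -> C1_curve c' ->
    (forall t, a <= t <= b -> c t = c' t) -> (forall t, a <= t <= b -> is_derive t (1 : R) L (speed G c' t)) -> arc c a b (L b - L a)
| arc_cat a m b l1 l2 : arc c a m l1 -> arc c m b l2 -> arc c a b (l1 + l2).

Lemma arc_C1_ex c a b c' : a < b -> C1_curve c' ->
    (forall t, a <= t <= b -> c t = c' t) -> exists l, arc c a b l.
Proof.
move=> ab cc' E; have cs : continuous (speed G c').
  by move=> t; apply: continuous_speed; exact: (iffLR (C1_curveP c') cc').
have ab' : a - 1 < b + 1 by lra.
have [L dL] := primitive ab' cs.
exists (L b - L a); apply: (arc_C1 ab cc' E) => t tab; apply: dL.
by move: tab => /andP[? ?]; apply/andP; split; lra.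
Qed.

Lemma arc_lt c a b l : arc c a b l -> a < b.
Proof. by elim=> // a' m b' l1 l2 _ am _ mb; exact: lt_trans am mb. Qed.

Lemma speed_ge0 c t : 0 <= speed G c t. Proof. exact: sqrtr_ge0. Qed.

Lemma derive_ge0_le (L f : R -> R) (a b : R) : a <= b ->
  (forall t, a <= t <= b -> is_derive t (1 : R) L (f t)) -> (forall t, a <= t <= b -> 0 <= f t) -> L a <= L b.
Proof.
move=> ab dL f0.
have cL t : a <= t <= b -> {for t, continuous L}.
  by move=> /dL[d _]; apply: differentiable_continuous; exact/derivable1_diffP.
apply: (@ger0_derive1_le_cc R L a b); rewrite ?in_itv/= ?lexx ?ab//.
- by move=> t; rewrite in_itv/= => /andP[t1 t2]; have [] := dL t; rewrite ?(ltW t1) ?(ltW t2).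
- move=> t; rewrite in_itv/= => /andP[t1 t2]. have tab : a <= t <= b by rewrite (ltW t1) (ltW t2). by rewrite derive1E; have [_ ->] := dL _ tab; exact: f0.
- by apply: continuous_in_subspaceT => t; rewrite inE/= in_itv/=; exact: cL.
Qed.

Lemma arc_ge0 c a b l : arc c a b l -> 0 <= l.
Proof.
elim=> [a' b' c' L ab _ _ dL|a' m b' l1 l2 _ ? _ ?]; last exact: addr_ge0.
by rewrite subr_ge0; apply: (derive_ge0_le (ltW ab) dL) => t _; exact: speed_ge0.
Qed.

Lemma arc_eq c c2 a b l : arc c a b l -> (forall t, a <= t <= b -> c2 t = c t) ->
  arc c2 a b l.
Proof.
move=> h; elim: h => {a b l} [a b c' L ab cc' E dL|a m b l1 l2 h1 IH1 h2 IH2] E2.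
  by apply: arc_C1 => // t tab; rewrite E2// E.
have am := arc_lt h1; have mb := arc_lt h2.
apply: arc_cat; [apply: IH1|apply: IH2] => t /andP[t1 t2]; apply: E2; apply/andP; split; lra.
Qed.

Lemma arc_split c a b l m : arc c a b l -> a < m < b ->
  exists l1 l2, [/\ arc c a m l1, arc c m b l2 & l = l1 + l2].
Proof.
move=> h; elim: h m => {a b l} [a b c' L ab cc' E dL|a m b l1 l2 h1 IH1 h2 IH2] n /andP[an nb].
  exists (L n - L a), (L b - L n); split; last by ring.
  - by apply: (arc_C1 an cc') => t /andP[t1 t2]; [apply: E|apply: dL]; apply/andP; split; lra.
  - by apply: (arc_C1 nb cc') => t /andP[t1 t2]; [apply: E|apply: dL]; apply/andP; split; lra.
have [nm|mn|->] := ltgtP n m; last by exists l1, l2.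
- have [|k1 [k2 [g1 g2 ->]]] := IH1 n; first by rewrite an nm. by exists k1, (k2 + l2); split=> //; [exact: arc_cat g2 h2|rewrite addrA].
- have [|k1 [k2 [g1 g2 ->]]] := IH2 n; first by rewrite mn nb. by exists (l1 + k1), k2; split=> //; [exact: arc_cat h1 g1|rewrite addrA].
Qed.

(** The open interval is used because at an end point [derive1] sees both sides of the curve, so the
    speeds of c and of its C^1 piece need not agree there; single points are null sets. *)
Lemma arc_integral c a b l : arc c a b l ->
  measurable_fun `]a, b[ (speed G c) /\ (\int[lebesgue_measure]_(t in `]a, b[) (speed G c t)%:E)%E = l%:E.
Proof.
have near_speed a' b' (c' : R -> N) t : (forall t, a' <= t <= b' -> c t = c' t) ->
    a' < t < b' -> speed G c' t = speed G c t.
  move=> E /andP[t1 t2]. have n : \forall u \near t, chart (c t) (c' u) = chart (c t) (c u).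
    have : \forall u \near t, a' < u < b'.
      near=> u; apply/andP; split; near: u; [exact: lt_nbhsr|exact: lt_nbhsl].
    by apply: filterS => u /andP[u1 u2]; rewrite (E u)// (ltW u1) (ltW u2).
  have Et : c t = c' t by apply: E; rewrite (ltW t1) (ltW t2). rewrite /speed -Et. suff -> : derive1 (chart (c t) \o c') t = derive1 (chart (c t) \o c) t by [].
  by rewrite !derive1E; exact: near_eq_derive.
elim=> {a b l} [a b c' L ab cc' E dL|a m b l1 l2 h1 [m1 I1] h2 [m2 I2]].
- have cs t : {for t, continuous (speed G c')}.
    by apply: continuous_speed; exact: (iffLR (C1_curveP c') cc').
  have Es : {in `]a, b[, speed G c' =1 speed G c}.
    by move=> t; rewrite in_itv/= => tab; exact: near_speed E tab.
  have mc' : measurable_fun [set: R] (speed G c') by apply: continuous_measurable_fun. have ms : measurable_fun `]a, b[ (speed G c).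
    apply: eq_measurable_fun (measurable_funTS mc') => t. by rewrite inE; exact: Es.
  split=> //. transitivity (\int[lebesgue_measure]_(t in `]a, b[) (speed G c' t)%:E)%E.
    by apply: eq_integral => t; rewrite inE/= => /Es ->.
  have mE : measurable_fun `]a, b[ (fun t => (speed G c' t)%:E).
    by apply/measurable_EFinP; exact: (measurable_funTS mc').
  apply: etrans (esym (integral_itv_bndoo true false mE)) _. by apply: integral_derive => // t _; exact: cs.
- have am := arc_lt h1; have mb := arc_lt h2. have U : `]a, b[%classic = `]a, m[ `|` `[m, b[ :> set R.
    apply/seteqP; split=> t /=; rewrite !in_itv/=.
      by move=> /andP[-> ->]; rewrite andbT; have [] := ltP t m; [left|right].
    by move=> [/andP[t1 t2]|/andP[t1 t2]]; apply/andP; split; lra.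
  have m2' : measurable_fun `[m, b[ (speed G c).
    exact: (measurable_fun_itv_obnd_cbndP _ _ _).1 m2.
  have mU : measurable_fun `]a, b[ (speed G c).
    by rewrite U; apply/measurable_funU.
  split=> //. rewrite U ge0_integral_setU//=; first last.
  - apply/disj_setPS => t [] /=; rewrite !in_itv/= => /andP[_ t1] /andP[t2 _]. by move: t1; rewrite ltNge t2.
  - by move=> t _; rewrite lee_fin speed_ge0.
  - by rewrite -U; exact/measurable_EFinP.
  rewrite I1 -integral_itv_obnd_cbnd; last exact/measurable_EFinP. by rewrite I2.
Unshelve. all: by end_near. Qed.

Lemma arc_curve_length c l : arc c 0 1 l -> curve_length G c = l%:E.
Proof.
move=> /arc_integral[m <-].
have mE : measurable_fun `]0 : R, 1[ (fun t => (speed G c t)%:E) by exact/measurable_EFinP.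
exact: (integral_itv_bndoo true false mE).
Qed.

End Arcs.

(** * A C^1 retraction of the line to a neighbourhood of an interval *)

Section Clamp.
Variable R : realType.

(** One-variable smoothness is read off from the plane calculus by regarding g as a function of the
    first coordinate. *)
Lemma Ck_line_derive (g : R -> R) : Ck_on 1 [set: R * R] (g \o fst) ->
  (forall t, derivable g t 1) /\ continuous (derive1 g).
Proof.
move=> cg; pose e : R * R := (1, 0).
have [dg cDg] := cg e.
have H (t : R) : is_derive t (1 : R) g ('D_e (g \o fst) (0 + t *: e)).
  have := is_derive_line (dg (0 + t *: e) I). rewrite (_ : (fun t : R => (g \o fst) (0 + t *: e)) = g)//. by apply/funext => s /=; rewrite add0r scaleRE mulr1.
split=> [t|t]; first by have [] := H t.
have E : derive1 g = (fun t : R => 'D_e (g \o fst) (0 + t *: e)).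
  by apply/funext => s; have [_ <-] := H s; rewrite derive1E.
rewrite E; apply: (@cont_comp _ _ _ (fun s : R => 0 + s *: e) ('D_e (g \o fst))).
  by apply: cvgD; [exact: cvg_cst|apply: cvgZ; [exact: cvg_id|exact: cvg_cst]].
exact: cDg.
Qed.

Lemma open_plane : open [set: R * R]. Proof. exact: openT. Qed.

Lemma Ck_fst k : Ck_on k [set: R * R] fst.
Proof.
case: k => [|k]; first by move=> x _; exact: cont_fst.
move=> v; split.
  by move=> x _; have [] := @derive_linear_comp R _ _ _ (@fst R R) id x v (@cont_fst R) (@derivable_id R (R * R)%type x v).
have -> : 'D_v (fst : R * R -> R) = fun=> v.1.
  apply/funext => x; have [_] := @derive_linear_comp R _ _ _ (@fst R R) id x v (@cont_fst R) (@derivable_id R (R * R)%type x v). by rewrite derive_id.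
exact: Ck_cst.
Qed.

(** Composition with [th] turns a curve that is C^1 near [a, b] into one that is C^1 on the whole
    line, as [C1_curve] demands. [A] bends the part below a, and [th] the part above b. *)
Lemma C1_clamp (a b e : R) : a <= b -> 0 < e -> exists th : R -> R,
  [/\ forall t, derivable th t 1, continuous (derive1 th),
      forall t, a <= t <= b -> th t = t & forall t, a - e < th t < b + e].
Proof.
move=> ab e0.
pose A (t : R) := a + (t - a) * step ((t - a + e) / e).
pose th (t : R) := b - (b - A t) * step ((b - A t + e) / e).
have step1 (u : R) : 0 <= u -> step ((u + e) / e) = 1.
  by move=> u0; apply: step_eq1; rewrite ler_pdivlMr// mul1r; lra.
have step0 (u : R) : u <= - e -> step ((u + e) / e) = 0.
  by move=> u0; apply: step_eq0; rewrite ler_pdivrMr// mul0r; lra.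
have neg (u : R) : u < 0 -> - e < u * step ((u + e) / e) <= 0.
  move=> u0; have /andP[s0 s1] := step_itv ((u + e) / e). have [ue|ue] := leP u (- e); first by rewrite step0// mulr0 lexx; lra. by apply/andP; split; nra.
have At t : a <= t -> A t = t by move=> at'; rewrite /A step1 ?subr_ge0// mulr1; lra.
have Al t : t < a -> a - e < A t <= a.
  move=> ta; have tn : t - a < 0 by lra. by have /andP[n1 n2] := neg _ tn; rewrite /A; apply/andP; split; lra.
have thA t : A t <= b -> th t = A t.
  by move=> tb; rewrite /th step1 ?subr_ge0// mulr1; lra.
have C : Ck_on 1 [set: R * R] (th \o fst).
  have o := open_plane; have cf := Ck_fst 1; have cc := fun x : R => Ck_cst 1 [set: R * R] x. have cA : Ck_on 1 [set: R * R] (A \o fst).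
    have F1 := CkD o cf (cc (- a)). exact: (CkD o (cc a) (CkM o F1 (Ck_step o (CkM o (CkD o F1 (cc e)) (cc e^-1))))).
  have cB : Ck_on 1 [set: R * R] (fun x => b + (-1) * (A \o fst) x).
    exact: (CkD o (cc b) (CkM o (cc (-1)) cA)).
  have := CkD o (cc b) (CkM o (cc (-1)) (CkM o cB (Ck_step o (CkM o (CkD o cB (cc e)) (cc e^-1))))). by apply: Ck_ext => // x _ /=; rewrite /th !mulN1r.
have [d cd] := Ck_line_derive C.
exists th; split=> // t.
  by move=> /andP[t1 t2]; rewrite thA At.
have [ta|at'] := ltP t a.
  by have /andP[A1 A2] := Al _ ta; rewrite thA ?(le_trans A2)//; apply/andP; split; lra.
have [tb|bt] := leP t b; first by rewrite thA At//; apply/andP; split; lra.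
rewrite /th At//; have /andP[n1 n2] : - e < (b - t) * step ((b - t + e) / e) <= 0.
  by apply: neg; lra.
by apply/andP; split; lra.
Qed.

End Clamp.

(** * Construction, comparison and reparametrization of arcs *)

Section ArcConstruction.
Variables (R : realType) (N : surface R) (G : riemannian_metric N).
Implicit Type c : R -> N.

Lemma C1_at_near c c' t : (\forall u \near t, c u = c' u) -> C1_at c t -> C1_at c' t.
Proof.
move=> E [cc d cd]; have Et : c t = c' t := nbhs_singleton E.
have nE : \forall u \near t, \forall w \near u, c w = c' w by exact: near_join E.
have nE' : \forall u \near t, \forall w \near u, (chart (c t) \o c) w = (chart (c t) \o c') w.
  by apply: filterS nE => u; apply: filterS => w /= ->.
split; rewrite -?Et.
- apply: filterS2 cc nE => u cu Eu; rewrite /prop_for /continuous_at -(nbhs_singleton Eu). exact: cvg_trans (near_eq_cvg Eu) cu.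
- apply: filterS2 d nE' => u du Eu; exact: near_eq_derivable Eu du.
- have E1 : \forall u \near t, derive1 (chart (c t) \o c) u = derive1 (chart (c t) \o c') u.
    by apply: filterS nE' => u Eu; rewrite !derive1E; exact: near_eq_derive.
  rewrite /prop_for /continuous_at -(nbhs_singleton E1). exact: cvg_trans (near_eq_cvg E1) cd.
Qed.

Lemma speed_near c c' t : (\forall u \near t, c u = c' u) -> speed G c t = speed G c' t.
Proof.
move=> E; have Et : c t = c' t := nbhs_singleton E.
have E1 : \forall w \near t, (chart (c t) \o c) w = (chart (c t) \o c') w.
  by apply: filterS E => w /= ->.
rewrite /speed -Et.
suff -> : derive1 (chart (c t) \o c) t = derive1 (chart (c t) \o c') t by [].
by rewrite !derive1E; exact: near_eq_derive.
Qed.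

(** The curve is precomposed with a clamp, which changes nothing near [a, b], neither points nor
    speeds. *)
Lemma arc_local c a b e : a < b -> 0 < e -> (forall t, a - e < t < b + e -> C1_at c t) ->
  exists L : R -> R, (forall t, a <= t <= b -> is_derive t (1 : R) L (speed G c t)) /\
    arc G c a b (L b - L a).
Proof.
move=> ab e0 Hc; have e20 : 0 < e / 2 by rewrite divr_gt0.
have [||th [dth cth th1 th2]] := @C1_clamp R (a - e / 2) (b + e / 2) (e / 2); [lra|by []|].
have Cc : C1_curve (c \o th).
  apply/C1_curveP => t; apply: C1_at_comp; last exact: cth.
    by apply: Hc; have /andP[? ?] := th2 t; apply/andP; split; lra.
  by apply: filterE => u; exact: dth.
have nth t : a <= t <= b -> \forall u \near t, (c \o th) u = c u.
  move=> /andP[t1 t2]. have : \forall u \near t, a - e / 2 < u < b + e / 2.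
    near=> u; apply/andP; split; near: u; [apply: lt_nbhsr|apply: lt_nbhsl]; lra.
  by apply: filterS => u /andP[u1 u2] /=; rewrite th1// (ltW u1) (ltW u2).
have cs : continuous (speed G (c \o th)).
  by move=> t; apply: continuous_speed; exact: (iffLR (C1_curveP _) Cc).
have ab' : a - 1 < b + 1 by lra.
have [L dL] := primitive ab' cs.
have dL' t : a <= t <= b -> is_derive t (1 : R) L (speed G (c \o th) t).
  by move=> /andP[t1 t2]; apply: dL; apply/andP; split; lra.
exists L; split=> [t tab|].
  by rewrite -(speed_near (nth _ tab)); exact: dL'.
by apply: (arc_C1 ab Cc) => // t /nth/nbhs_singleton.
Unshelve. all: by end_near. Qed.

Lemma arc_length_unique c a b l l' : arc G c a b l -> arc G c a b l' -> l = l'.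
Proof. by move=> /arc_integral[_ E] /arc_integral[_]; rewrite E => -[]. Qed.

(** The calibration principle: by hypothesis the derivative of [L' - (A L + B f)] along each piece
    is nonnegative. The condition is imposed on every C^1 curve through a point of c, as the pieces
    of c are known only inside the induction. *)
Lemma arc_compare (G' : riemannian_metric N) (f : N -> R) (A B : R) c a b l :
  arc G c a b l -> (forall c' t, C1_at c' t -> (exists2 u, a <= u <= b & c' t = c u) ->
    exists D, is_derive t (1 : R) (f \o c') D /\
      A * speed G c' t + B * D <= speed G' c' t) ->
  exists l', arc G' c a b l' /\ A * l + B * (f (c b) - f (c a)) <= l'.
Proof.
elim=> {a b l} [a b c' L ab cc' E dL|a m b l1 l2 h1 IH1 h2 IH2] H.
  have C1 := iffLR (C1_curveP c') cc'. have cs : continuous (speed G' c') by move=> t; exact: continuous_speed. have ab' : a - 1 < b + 1 by lra. have [L' dL'] := primitive ab' cs.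
  have {}dL' t : a <= t <= b -> is_derive t (1 : R) L' (speed G' c' t).
    by move=> /andP[t1 t2]; apply: dL'; apply/andP; split; lra.
  exists (L' b - L' a); split; first exact: (arc_C1 ab cc' E dL'). have [a1 b1] : a <= a <= b /\ a <= b <= b by rewrite !lexx (ltW ab). rewrite (E _ a1) (E _ b1).
  pose P t := L' t - (A * L t + B * (f \o c') t). pose D t := 'D_1 (f \o c') t. have HD t : a <= t <= b -> is_derive t (1 : R) (f \o c') (D t) /\
      A * speed G c' t + B * D t <= speed G' c' t.
    move=> tab; have [|d [Hd le]] := H c' t (C1 t); first by exists t => //; rewrite E. have -> : D t = d by case: Hd. by [].
  have dP t : a <= t <= b -> is_derive t (1 : R) P (speed G' c' t - (A * speed G c' t + B * D t)).
    move=> tab; have [h3 _] := HD _ tab. have d2 : is_derive t (1 : R) (A \*: L) (A *: speed G c' t) by apply: is_deriveZ; exact: dL.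
    have d3 : is_derive t (1 : R) (B \*: (f \o c')) (B *: D t) by exact: is_deriveZ. exact: (is_deriveB (dL' _ tab) (is_deriveD d2 d3)).
  have := derive_ge0_le (ltW ab) dP; rewrite /P => /(_ _)/=. have : forall t, a <= t <= b -> 0 <= speed G' c' t - (A * speed G c' t + B * D t).
    by move=> t /HD[_]; rewrite subr_ge0.
  by move=> ge0 /(_ ge0); lra.
have am := arc_lt h1; have mb := arc_lt h2.
have [|k1 [g1 e1]] := IH1.
  move=> c' t C1 [u /andP[u1 u2] Eu]; apply: H => //; exists u => //; apply/andP; split; lra.
have [|k2 [g2 e2]] := IH2.
  move=> c' t C1 [u /andP[u1 u2] Eu]; apply: H => //; exists u => //; apply/andP; split; lra.
exists (k1 + k2); split; first exact: arc_cat g1 g2.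
by lra.
Qed.

Lemma arc_affine c a b l (k h : R) : 0 < k -> arc G c (k * a + h) (k * b + h) l ->
  arc G (fun t => c (k * t + h)) a b l.
Proof.
move=> k0; set a' := k * a + h; set b' := k * b + h => H.
have aff t : derivable (fun t : R => k * t + h) t 1 /\ derive1 (fun t : R => k * t + h) t = k.
  have dk : is_derive t (1 : R) (fun t : R => k * t) k.
    have -> : (fun t : R => k * t) = (fun t => t * k) by apply/funext => s; rewrite mulrC. exact: is_derive_mulr.
  have d : is_derive t (1 : R) ((fun t : R => k * t) + (fun=> h)) (k + 0).
    by apply: is_deriveD; exact: is_derive_cst.
  by split; [case: d|rewrite derive1E; case: d => _ ->; rewrite addr0].
have inv (x : R) : k * ((x - h) / k) + h = x.
  by rewrite mulrCA divff ?gt_eqF// mulr1 subrK.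
have cont : continuous (derive1 (fun t : R => k * t + h)).
  have -> : derive1 (fun t : R => k * t + h) = fun=> k by apply/funext => t; have [] := aff t. by move=> t; exact: cvg_cst.
have ea : a = (a' - h) / k by rewrite /a' addrK mulrAC divff ?gt_eqF// mul1r.
have eb : b = (b' - h) / k by rewrite /b' addrK mulrAC divff ?gt_eqF// mul1r.
rewrite ea eb.
elim: H => {ea eb}  [a1 b1 c' L ab cc' E dL|a1 m b1 l1 l2 h1 IH1 h2 IH2]; last exact: arc_cat IH1 IH2.
have C1 := iffLR (C1_curveP c') cc'.
pose L' t := L (k * t + h).
have {2}-> : a1 = k * ((a1 - h) / k) + h by rewrite inv.
have {2}-> : b1 = k * ((b1 - h) / k) + h by rewrite inv.
have lek t : (a1 - h) / k <= t <= (b1 - h) / k -> a1 <= k * t + h <= b1.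
  by rewrite ler_pdivrMr// ler_pdivlMr// mulrC => /andP[? ?]; apply/andP; split; lra.
apply: (@arc_C1 _ _ _ _ _ _ (c' \o (fun t : R => k * t + h)) L').
- by rewrite ltr_pM2r ?invr_gt0// ltrD2r.
- apply/C1_curveP => t; apply: C1_at_comp; [exact: C1| |exact: cont]. by apply: filterE => u; have [] := aff u.
- by move=> t /lek; exact: E.
- move=> t tab; rewrite speed_comp; [|exact: C1|by have [] := aff t]. have [d e] := aff t; rewrite e gtr0_norm//. have [d2 e2] := dL _ (lek _ tab).
  have [d3 e3] := derive1_comp_scale d d2. split; first exact: d3. by rewrite -derive1E e3 e derive1E e2.
Qed.

Lemma arc_rev c a b l : arc G c a b l -> arc G (fun t => c (- t)) (- b) (- a) l.
Proof.
have aff t : derivable (-%R : R -> R) t 1 /\ derive1 (-%R : R -> R) t = -1.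
  have [d e] := @is_deriveNid R R t 1. by split; [exact: d|rewrite derive1E e].
have cont : continuous (derive1 (-%R : R -> R)).
  have -> : derive1 (-%R : R -> R) = fun=> -1 by apply/funext => t; have [] := aff t. by move=> t; exact: cvg_cst.
elim=> {a b l} [a b c' L ab cc' E dL|a m b l1 l2 h1 IH1 h2 IH2]; last first.
  by rewrite addrC; exact: arc_cat IH2 IH1.
have C1 := iffLR (C1_curveP c') cc'.
have -> : L b - L a = - L (- - a) - (- L (- - b)) by rewrite !opprK addrC.
apply: (@arc_C1 _ _ _ _ _ _ (c' \o -%R) (fun t => - L (- t))).
- by rewrite ltrN2.
- apply/C1_curveP => t; apply: C1_at_comp; [exact: C1| |exact: cont]. by apply: filterE => u; have [] := aff u.
- by move=> t /andP[? ?]; apply: E; apply/andP; split; lra.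
- move=> t /andP[t1 t2]; rewrite speed_comp; [|exact: C1|by have [] := aff t]. have [d e] := aff t; rewrite e normrN1 mul1r.
  have [|d2 e2] := dL (- t); first by apply/andP; split; lra. have [d3 e3] := derive1_comp_scale d d2. have dN := derivableN d3. split; first exact: dN.
  by rewrite (deriveN d3) -derive1E e3 e derive1E e2 scaleRE mulN1r opprK.
Qed.

End ArcConstruction.

(** * Arcs between two points and the Riemannian distance *)

Section Distance.
Variables (R : realType) (N : surface R) (G : riemannian_metric N).
Implicit Types (p q x y z : N) (c : R -> N) (l e : R).

Lemma pieces_arc c (s : seq R) (x : R) : s != [::] -> path <%R x s ->
  (forall k, (k < size s)%N -> exists2 c', C1_curve c' &
     {in `[nth 0 (x :: s) k, nth 0 s k], c =1 c'}) ->
  exists l, arc G c x (last x s) l.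
Proof.
elim: s x => // y s IH x _ /= /andP[xy ps] H.
have [c' cc' E] := H 0%N isT.
have [l1 h1] : exists l, arc G c x y l.
  by apply: (arc_C1_ex G xy cc') => t txy; apply: E; rewrite in_itv.
have [->|s0] := eqVneq s [::]; first by exists l1.
have [l2 h2] := IH y s0 ps (fun k => H k.+1).
by exists (l1 + l2); exact: arc_cat h1 h2.
Qed.

Lemma piecewise_arc c : piecewise_C1 c -> exists l, arc G c 0 1 l.
Proof.
move=> [s [ps ls H]]; have s0 : s != [::].
  by apply/eqP => s0; move: ls; rewrite s0 /= => /eqP; rewrite eq_sym oner_eq0.
by have := pieces_arc s0 ps H; rewrite ls.
Qed.

Lemma arc_pieces c a b l : arc G c a b l -> exists s : seq R,
  [/\ path <%R a s, last a s = b & forall k, (k < size s)%N ->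
      exists2 c', C1_curve c' & {in `[nth 0 (a :: s) k, nth 0 s k], c =1 c'}].
Proof.
elim=> {a b l} [a b c' L ab cc' E dL|a m b l1 l2 _ [s1 [p1 e1 H1]] _ [s2 [p2 e2 H2]]].
  exists [:: b]; split; rewrite /= ?andbT//. by case=> // _; exists c' => // t /=; rewrite in_itv/=; exact: E.
exists (s1 ++ s2); split.
- by rewrite cat_path p1 e1.
- by rewrite last_cat e1.
- move=> k; rewrite size_cat => ks. have [k1|k1] := ltnP k (size s1).
    have [c' cc' E] := H1 k k1; exists c' => //. have -> : nth 0 (a :: s1 ++ s2) k = nth 0 (a :: s1) k.
      by rewrite -cat_cons nth_cat /= ltnS ltnW.
    by rewrite nth_cat k1.
  have k2 : (k - size s1 < size s2)%N by rewrite ltn_subLR. have [c' cc' E] := H2 _ k2; exists c' => //. have -> : nth 0 (a :: s1 ++ s2) k = nth 0 (m :: s2) (k - size s1).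
    case: k ks k1 k2 E => [|k] ks k1 k2 E.
      by move: k1; rewrite leqn0 => /nilP; move: e1 => /[swap] -> /= <-.
    rewrite /= nth_cat; move: k1; rewrite leq_eqVlt => /orP[/eqP k1|k1].
      by rewrite k1 ltnSn subnn /= -e1 (last_nth 0) k1.
    by rewrite ltnNge -ltnS k1 /= subSn.
  by rewrite nth_cat ltnNge k1.
Qed.

Lemma arc_piecewise c l : arc G c 0 1 l -> piecewise_C1 c.
Proof. by move=> /arc_pieces[s [? ? ?]]; exists s. Qed.

Definition joins x y l := exists c, [/\ arc G c 0 1 l, c 0 = x & c 1 = y].

Lemma arc_joins c a b l : arc G c a b l -> joins (c a) (c b) l.
Proof.
move=> h; have ab := arc_lt h; have ba : 0 < b - a by rewrite subr_gt0.
exists (fun t => c ((b - a) * t + a)); rewrite mulr0 add0r mulr1 subrK; split=> //.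
by apply: arc_affine => //; rewrite mulr0 add0r mulr1 subrK.
Qed.

Lemma joins_sym x y l : joins x y l -> joins y x l.
Proof.
move=> [c [h <- <-]]; have := arc_joins (arc_rev h).
by rewrite /= !opprK.
Qed.

Lemma joins_trans x y z l1 l2 : joins x y l1 -> joins y z l2 -> joins x z (l1 + l2).
Proof.
move=> [c [h1 <- c1]] [c' [h2 c0 <-]].
pose c2 t := if t <= 1 then c t else c' (t - 1).
have g1 : arc G c2 0 1 l1.
  by apply: arc_eq h1 _ => t /andP[_ t1]; rewrite /c2 t1.
have g2 : arc G c2 1 2 l2.
  have : arc G (fun t => c' (1 * t + (-1))) 1 2 l2.
    apply: arc_affine => //. have -> : 1 * 1 + -1 = 0 :> R by ring. by have -> : 1 * 2 + -1 = 1 :> R by ring.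
  move=> /arc_eq; apply => t /andP[t1 t2]; rewrite /c2 mul1r. have [t1'|//] := leP t 1; have -> : t = 1 by apply/eqP; rewrite eq_le t1 t1'. by rewrite subrr c1 c0.
have := arc_joins (arc_cat g1 g2).
have -> : c2 0 = c 0 by rewrite /c2 ler01.
have -> // : c2 2 = c' 1.
rewrite /c2 ifF; first by congr c'; ring.
by apply/negbTE; rewrite -ltNge; lra.
Qed.

Lemma joins_ge0 x y l : joins x y l -> 0 <= l.
Proof. by move=> [c [/arc_ge0]]. Qed.

Lemma riem_dist_lt x y e : (riem_dist G x y < e%:E)%E <-> exists2 l, joins x y l & l < e.
Proof.
split=> [H|[l [c [h c0 c1]] le]].
  have [_ [c [pc c0 c1] <-] le] := ereal_inf_lt H. have [k h] := piecewise_arc pc; exists k; first by exists c. by move: le; rewrite (arc_curve_length h) lte_fin.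
rewrite (le_lt_trans (y := l%:E)) ?lte_fin//.
apply: ereal_inf_lbound; exists c; last exact: arc_curve_length.
by split=> //; exact: arc_piecewise h.
Qed.

End Distance.

(** * Induction along a real interval *)

Section RealInduction.
Variable R : realType.

(** The supremum of the t such that Q holds on [a, t] satisfies Q by the first hypothesis and is b
    by the second. The start needs no separate assumption: at t = a the premise of the first
    hypothesis is empty. *)
Lemma real_induction (a b : R) (Q : R -> Prop) : a <= b ->
  (forall t, a <= t <= b -> (forall u, a <= u < t -> Q u) -> Q t) -> (forall t, a <= t < b -> (forall u, a <= u <= t -> Q u) ->
     exists2 e, 0 < e & forall u, t < u < t + e -> u <= b -> Q u) ->
  forall t, a <= t <= b -> Q t.
Proof.
move=> ab Hl Hr.
pose S := [set t : R | a <= t <= b /\ forall u, a <= u <= t -> Q u].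
have Qa : Q a by apply: Hl => [|v /andP[v1 v2]]; [rewrite lexx ab|lra].
have Sa : S a.
  split; first by rewrite lexx ab. by move=> u; rewrite -eq_le => /eqP <-.
have ubS : ubound S b by move=> t [/andP[_ ->]].
have hS : has_sup S by split; [exists a|exists b].
have aS : a <= sup S by exact: (sup_upper_bound hS).
have Sb : sup S <= b by apply: ge_sup => //; exists a.
have Qlt u : a <= u < sup S -> Q u.
  move=> /andP[au us]; have [t [tab Qt] ut] := sup_gt (ex_intro _ a Sa) us. by apply: Qt; rewrite au ltW.
have Qs : Q (sup S) by apply: Hl => //; rewrite aS Sb.
have Qle u : a <= u <= sup S -> Q u.
  move=> /andP[au]; rewrite le_eqVlt => /orP[/eqP->//|us]; by apply: Qlt; rewrite au us.
suff E : sup S = b by move=> t tab; apply: Qle; rewrite E.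
apply/eqP; rewrite eq_le Sb /= leNgt; apply/negP => sb.
have [|e e0 He] := Hr (sup S) _ Qle; first by rewrite aS sb.
pose t := Num.min b (sup S + e / 2).
have st : sup S < t by rewrite /t lt_min sb/= ltrDl divr_gt0.
suff : S t by move=> /(sup_upper_bound hS); rewrite leNgt st.
have tb : t <= b by rewrite /t ge_min lexx.
have te : t <= sup S + e / 2 by rewrite /t ge_min lexx orbT.
split; first by rewrite tb (le_trans aS (ltW st)).
move=> u /andP[au ut]; have [us|us] := leP u (sup S); first by apply: Qle; rewrite au us.
by apply: He; rewrite ?us/=; lra.
Qed.

End RealInduction.

(** * Smooth functions with bounded gradient *)

Section Lipschitz.
Variables (R : realType) (N : surface R) (G : riemannian_metric N).
Implicit Types (p q y z : N) (c : R -> N) (l e : R) (F : N -> R).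

Lemma derive_msmooth F c t : msmooth F -> C1_at c t ->
  is_derive t (1 : R) (F \o c) (dM F (c t) (chart (c t) (c t)) (vel c t)).
Proof.
move=> sF [cc d cd]; set p := c t in d cd *.
have ct : {for t, continuous c} := nbhs_singleton cc.
have pt : dom p (c t) by exact: dom_center.
have d1 : derivable (chart p \o c) t 1 := nbhs_singleton d.
have dF : differentiable (F \o chart_inv p) (chart p (c t)) := msmooth_diff sF (cod_chart pt).
have d2 : differentiable (chart p \o c) t by exact/derivable1_diffP.
have E : \forall u \near t, F (c u) = ((F \o chart_inv p) \o (chart p \o c)) u.
  have : \forall u \near t, dom p (c u).
    by apply: ct; apply: open_nbhs_nbhs; split=> //; exact: dom_open.
  by apply: filterS => u pu /=; rewrite chartK.
have D := differentiable_comp d2 dF.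
have H : is_derive t (1 : R) ((F \o chart_inv p) \o (chart p \o c)) (dM F p (chart p (c t)) (vel c t)).
  apply: DeriveDef; first exact: diff_derivable. rewrite (deriveE _ D) (diff_comp d2 dF)/=. by rewrite /dM (deriveE _ dF) -/p -(deriveE _ d2) /vel derive1E.
apply: near_eq_is_derive H.
by apply: filterS E => u /= ->.
Qed.

Definition lip F (C : R) := forall p (x v : R * R), cod p x -> `|dM F p x v| <= C * nrm G p x v.

(** Calibration of G against itself: [(1 - C) * speed + s * dF <= speed] for both signs s. *)
Lemma lip_arc F (C : R) c a b l : msmooth F -> lip F C -> arc G c a b l ->
  `|F (c b) - F (c a)| <= C * l.
Proof.
move=> sF lF h.
have H (s : R) : `|s| = 1 -> s * (F (c b) - F (c a)) <= C * l.
  move=> s1. have [c' t Cc _|l' [h' le]] := @arc_compare R N G G F (1 - C) s c a b l h.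
    exists (dM F (c' t) (chart (c' t) (c' t)) (vel c' t)); split; first exact: derive_msmooth. have := lF (c' t) _ (vel c' t) (cod_chart (dom_center (c' t))).
    rewrite -/(speed G c' t) => D. have : s * dM F (c' t) (chart (c' t) (c' t)) (vel c' t) <= C * speed G c' t.
      by apply: le_trans (ler_norm _) _; rewrite normrM s1 mul1r.
    lra.
  have E := arc_length_unique h h'; rewrite -E in le; lra.
rewrite ler_norml; have := H 1 (normr1 _); have := H (-1) (normrN1 _); lra.
Qed.

Lemma lip_joins F (C : R) y z l : msmooth F -> lip F C -> joins G y z l ->
  `|F z - F y| <= C * l.
Proof. by move=> sF lF [c [h <- <-]]; exact: lip_arc h. Qed.

(** The bound may vary with the point: gradients of the terms of a soft minimum are controlled by
    the terms themselves. *)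
Definition lipf F (C : N -> R) := forall p (x v : R * R), cod p x ->
  `|dM F p x v| <= C (chart_inv p x) * nrm G p x v.

Lemma lipf_chart_ext p g (K : set (R * R)) (C : N -> R) : compact K -> K `<=` cod p ->
  smooth_on (cod p) g -> (forall x, cod p x -> ~ K x -> g x = 0) -> (forall y, 0 <= C y) ->
  (forall x v, cod p x -> `|'D_v g x| <= C (chart_inv p x) * nrm G p x v) -> lipf (chart_ext p g) C.
Proof.
move=> cK Kp sg g0 C0 H q x v cq.
have sF : msmooth (chart_ext p g) := msmooth_chart_ext cK Kp sg g0.
have [px|npx] := pselect (dom p (chart_inv q x)).
  have dx : local_dom (@id N) q p x by rewrite local_domE. rewrite (dM_trans v sF dx). have cp := trans_cod dx. have -> : nrm G q x v = nrm G p (trans q p x) ('d (trans q p) x v).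
    by rewrite -{1}(chart_invK cq) -(nrm_trans G v (dom_chart_inv cq) px) /trans /= chart_invK.
  set w := 'd _ _ _; set z := trans q p x in cp *. have Ez : chart_inv q x = chart_inv p z by rewrite /z /trans /= chartK.
  suff -> : dM (chart_ext p g) p z w = 'D_w g z by rewrite Ez; exact: H. have E : \forall u \near z, (chart_ext p g \o chart_inv p) u = g u.
    have : \forall u \near z, cod p u by apply: open_nbhs_nbhs; split=> //; exact: open_cod. by apply: filterS => u cu /=; rewrite chart_extE ?chart_invK//; exact: dom_chart_inv.
  exact: near_eq_derive.
suff -> : dM (chart_ext p g) q x v = 0 by rewrite normr0 mulr_ge0// nrm_ge0.
have oA : open (~` (dom p `&` chart p @^-1` K)) by rewrite openC; exact: compact_chart_closed.
have E : \forall u \near x, (chart_ext p g \o chart_inv q) u = 0.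
  have : \forall u \near x, (cod q `&` chart_inv q @^-1` (~` (dom p `&` chart p @^-1` K))) u.
    apply: open_nbhs_nbhs; split; first exact: open_chart_inv. by split=> // -[].
  apply: filterS => u [cu nK] /=; have [pu|npu] := pselect (dom p (chart_inv q u)).
    rewrite chart_extE// g0//; first exact: cod_chart. by move=> Ku; apply: nK.
  by rewrite chart_ext_notin.
rewrite /dM -(derive_cst (0 : R) x v).
exact: near_eq_derive.
Qed.

Lemma lip_chart_ext p g (K : set (R * R)) (C : R) : compact K -> K `<=` cod p ->
  smooth_on (cod p) g -> (forall x, cod p x -> ~ K x -> g x = 0) -> 0 <= C -> (forall x v, cod p x -> `|'D_v g x| <= C * nrm G p x v) -> lip (chart_ext p g) C.
Proof. by move=> cK Kp sg g0 C0 H; exact: (lipf_chart_ext cK Kp sg g0 (C := fun=> C)). Qed.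

End Lipschitz.

(** * A smooth truncation of the identity *)

Section Truncation.
Variable R : realType.
Implicit Types (s K : R).

(** Bounded by K, with slope close to 1 near 0. A linear function truncated in this way and
    multiplied by a cutoff has gradient at most that of the linear function plus K times that of the
    cutoff, and K can be taken small. *)
Definition trunc K s : R := s * (1 + s ^+ 2 / K ^+ 2) `^ (- 2^-1).

Lemma trunc_den_gt0 K s : 0 < 1 + s ^+ 2 / K ^+ 2.
Proof. by rewrite ltr_pwDl// divr_ge0 ?sqr_ge0. Qed.

Lemma truncE K s : trunc K s = s / Num.sqrt (1 + s ^+ 2 / K ^+ 2).
Proof. by rewrite /trunc powRN powR12_sqrt// ltW// trunc_den_gt0. Qed.

Lemma Ck_trunc K k (U : set (R * R)) f : open U -> Ck_on k U f -> Ck_on k U (trunc K \o f).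
Proof.
move=> oU cf; apply: CkM => //.
apply: (@Ck_comp1 R k U _ (fun x => 1 + f x ^+ 2 / K ^+ 2) (fun t : R => t `^ (- 2^-1)) oU _ _ (Ck1_powR k _)).
  by move=> x _ /=; exact: trunc_den_gt0.
apply: CkD => //; first exact: Ck_cst.
by apply: CkM => //; [apply: CkM|exact: Ck_cst].
Qed.

Lemma trunc_le K s : 0 < K -> `|trunc K s| <= K.
Proof.
move=> K0; rewrite truncE normrM normfV (ger0_norm (sqrtr_ge0 _)).
rewrite ler_pdivrMr ?sqrtr_gt0 ?trunc_den_gt0//.
rewrite -(@ler_pXn2r _ 2) ?nnegrE ?mulr_ge0 ?sqrtr_ge0 ?(ltW K0)//.
rewrite exprMn sqr_sqrtr ?(ltW (trunc_den_gt0 _ _))// mulrDr mulr1 real_normK ?num_real// mulrCA divff ?mulr1 ?lerDr ?sqr_ge0//.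
by rewrite expf_neq0// gt_eqF.
Qed.

Lemma is_derive_trunc K s : is_derive s (1 : R) (trunc K) ((1 + s ^+ 2 / K ^+ 2) `^ (- 2^-1) * (1 + s ^+ 2 / K ^+ 2)^-1).
Proof.
set D := 1 + _; have D0 : 0 < D := trunc_den_gt0 K s.
have dq : is_derive s (1 : R) (fun s : R => 1 + s ^+ 2 / K ^+ 2) (2 * s / K ^+ 2).
  have d1 : is_derive s (1 : R) (id ^+ 2 : R -> R) ((2%:R * s ^+ 1) *: (1 : R)).
    exact: (@is_deriveX R R id 2%N s 1 1 (is_derive_id s (1 : R))).
  have d2 := is_derive_cst (1 : R) s (1 : R). have d3 := is_derive_cst ((K ^+ 2)^-1 : R) s (1 : R). have d4 := is_deriveM d1 d3.
  apply: (is_derive_eq (is_deriveD d2 d4)); rewrite !scaleRE /=. by rewrite mulr0 !add0r expr1; ring.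
have dp := is_derive1_powR (- 2^-1) D0.
have dc : is_derive s (1 : R) (fun s : R => (1 + s ^+ 2 / K ^+ 2) `^ (- 2^-1)) _ := @is_derive1_comp R (fun t => t `^ (- 2^-1)) (fun s : R => 1 + s ^+ 2 / K ^+ 2) s _ _ dp dq.
apply: (is_derive_eq (is_deriveM (is_derive_id s (1 : R)) dc)); rewrite !scaleRE /= mulr1 -/D.
have -> : D `^ (- 2^-1 - 1) = D `^ (- 2^-1) * D^-1.
  by rewrite powRD ?(gt_eqF D0) ?implybT// powR_inv1// ltW.
have [K0|K0] := eqVneq K 0.
  have D1 : D = 1 by rewrite /D K0 expr0n/= invr0 mulr0 addr0. by rewrite D1 K0 expr0n/= invr0 !mulr0 add0r invr1 mulr1.
have Dn : D != 0 by rewrite gt_eqF.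
have q : s ^+ 2 / K ^+ 2 = D - 1 by rewrite /D; ring.
move: (D `^ _) => y.
have -> : s * (- 2^-1 * (y / D) * (2 * s / K ^+ 2)) + y = y - y / D * (s ^+ 2 / K ^+ 2).
  by field; rewrite K0 Dn.
by rewrite q; field.
Qed.

(** With q = (s/K)^2 and m = (1 + q)^(-1/2) the slope is m^3, which lies between m^4 >= 1 - 2 q and
    1. *)
Lemma trunc_slope K s (d := (1 + s ^+ 2 / K ^+ 2) `^ (- 2^-1) * (1 + s ^+ 2 / K ^+ 2)^-1) :
  1 - 2 * (s / K) ^+ 2 <= d <= 1.
Proof.
rewrite /d expr_div_n; set q := s ^+ 2 / K ^+ 2.
have q0 : 0 <= q by rewrite divr_ge0 ?sqr_ge0.
have D1 : 1 <= 1 + q by rewrite lerDl.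
have D0 : 0 < 1 + q := trunc_den_gt0 K s.
set m := (1 + q) `^ _; have m0 : 0 < m by rewrite powR_gt0.
have m2 : m ^+ 2 = (1 + q)^-1 by rewrite -powR_mulrn ?ltW// -powRrM mulNr mulVf// powR_inv1// ltW.
have Dm : m ^+ 2 * (1 + q) = 1 by rewrite m2 mulVf// gt_eqF.
have m1 : m <= 1.
  by rewrite -(@ler_pXn2r _ 2) ?nnegrE ?(ltW m0)// m2 expr1n invf_le1.
have n1 : m ^+ 2 <= 1 by rewrite m2 invf_le1.
have n2 : 1 - 2 * q <= m ^+ 2 * m ^+ 2.
  have nq : m ^+ 2 * q <= q by rewrite ler_piMl. have nnq : m ^+ 2 * (m ^+ 2 * q) <= q by rewrite (le_trans _ nq)// ler_piMl// mulr_ge0// sqr_ge0.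
  have : m ^+ 2 * (m ^+ 2 * (1 + q)) = m ^+ 2 by rewrite Dm mulr1. lra.
have n3 : m ^+ 2 * m ^+ 2 <= m * m ^+ 2.
  by rewrite ler_wpM2r ?sqr_ge0// expr2 ler_piMl// ltW.
rewrite -m2 (le_trans n2 n3)/= mulr_ile1 ?sqr_ge0 ?(ltW m0)//.
Qed.

Lemma trunc_increment K r s t : 0 <= r -> `|s| <= r -> `|t| <= r -> s <= t ->
  (1 - 2 * (r / K) ^+ 2) * (t - s) <= trunc K t - trunc K s.
Proof.
move=> r0 sr tr st; set k := 1 - _.
have H u : s <= u <= t -> is_derive u (1 : R) (fun u => trunc K u - u * k) ((1 + u ^+ 2 / K ^+ 2) `^ (- 2^-1) * (1 + u ^+ 2 / K ^+ 2)^-1 - k).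
  by move=> _; exact: is_deriveB (is_derive_trunc K u) (is_derive_mulr u k).
have h := derive_ge0_le st H.
suff /h : forall u, s <= u <= t -> 0 <= (1 + u ^+ 2 / K ^+ 2) `^ (- 2^-1) * (1 + u ^+ 2 / K ^+ 2)^-1 - k by lra.
move=> u /andP[su ut]; rewrite subr_ge0; have /andP[+ _] := trunc_slope K u; apply: le_trans.
rewrite /k lerD2l lerN2 ler_pM2l//.
rewrite !expr_div_n ler_wpM2r ?invr_ge0 ?sqr_ge0//.
rewrite -(real_normK (num_real u)) ler_pXn2r ?nnegrE// ler_norml.
by move: sr tr; rewrite !ler_norml; lra.
Qed.

End Truncation.

(** * Euclidean norms on the plane *)

Section EuclideanCoordinates.
Variable R : realType.
Implicit Types (x v u : R * R) (a b : R).

Lemma Ck_snd k : Ck_on k [set: R * R] snd.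
Proof.
case: k => [|k]; first by move=> x _; exact: cont_snd.
move=> v; split.
  by move=> x _; have [] := @derive_linear_comp R _ _ _ (@snd R R) id x v (@cont_snd R) (@derivable_id R (R * R)%type x v).
have -> : 'D_v (snd : R * R -> R) = fun=> v.2.
  apply/funext => x; have [_] := @derive_linear_comp R _ _ _ (@snd R R) id x v (@cont_snd R) (@derivable_id R (R * R)%type x v). by rewrite derive_id.
exact: Ck_cst.
Qed.

Lemma Ck_affine k (U : set (R * R)) a b d : open U -> Ck_on k U (fun x => x.1 * a + x.2 * b + d).
Proof.
move=> oU; have T := @subsetT _ U.
apply: (CkD oU); last exact: Ck_cst.
by apply: (CkD oU); apply: (CkM oU); try exact: Ck_cst; apply: (Ck_sub T); [exact: Ck_fst|exact: Ck_snd].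
Qed.

Lemma derive_affine a b d x v : derivable (fun x => x.1 * a + x.2 * b + d) x v /\
  'D_v (fun x => x.1 * a + x.2 * b + d) x = v.1 * a + v.2 * b.
Proof.
have [d1 E1] := @derive_linear_comp R _ _ _ (@fst R R) id x v (@cont_fst R) (@derivable_id R (R * R)%type x v).
have [d2 E2] := @derive_linear_comp R _ _ _ (@snd R R) id x v (@cont_snd R) (@derivable_id R (R * R)%type x v).
have i1 : is_derive x v (fst : R * R -> R) v.1 by apply: DeriveDef => //; rewrite E1 derive_id.
have i2 : is_derive x v (snd : R * R -> R) v.2 by apply: DeriveDef => //; rewrite E2 derive_id.
have ca := is_derive_cst (a : R) x v; have cb := is_derive_cst (b : R) x v; have cd := is_derive_cst (d : R) x v.
have [D E] := is_deriveD (is_deriveD (is_deriveM i1 ca) (is_deriveM i2 cb)) cd.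
split; first exact: D.
by rewrite -[LHS]/('D_v (fst * cst a + snd * cst b + cst d) x) E !scaleRE /= /cst; ring.
Qed.

(* an inner product with coefficients (g11, g12, g22) becomes the standard one
   in the coordinates (a1 v1 + a2 v2, b2 v2) *)
Definition en2 (a1 a2 b2 : R) v := (v.1 * a1 + v.2 * a2) ^+ 2 + (v.2 * b2) ^+ 2.
Definition en (a1 a2 b2 : R) v := Num.sqrt (en2 a1 a2 b2 v).

Variables (a1 a2 b2 : R).
Hypotheses (a10 : 0 < a1) (b20 : 0 < b2).
Local Notation E2 := (en2 a1 a2 b2).
Local Notation E := (en a1 a2 b2).

Lemma en2_ge0 v : 0 <= E2 v.
Proof. by rewrite addr_ge0 ?sqr_ge0. Qed.

Lemma sqr_en v : E v ^+ 2 = E2 v.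
Proof. by rewrite sqr_sqrtr ?en2_ge0. Qed.

Lemma en_ge0 v : 0 <= E v.
Proof. exact: sqrtr_ge0. Qed.

Lemma en_subrr v : E (v - v) = 0.
Proof. by rewrite subrr /en /en2 /= !mul0r addr0 expr0n addr0 sqrtr0. Qed.

Lemma en_lt v r : 0 < r -> (E v < r) = (E2 v < r ^+ 2).
Proof. by move=> r0; rewrite -sqr_en ltr_pXn2r ?nnegrE ?en_ge0 ?(ltW r0). Qed.

Lemma en_le v r : 0 <= r -> (E v <= r) = (E2 v <= r ^+ 2).
Proof. by move=> r0; rewrite -sqr_en ler_pXn2r ?nnegrE ?en_ge0. Qed.

Lemma enZ (t : R) v : E (t *: v) = `|t| * E v.
Proof.
rewrite /en -sqrtr_sqr -sqrtrM ?sqr_ge0//; congr Num.sqrt.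
by rewrite /en2 /= !scaleRE; ring.
Qed.

Lemma enN v : E (- v) = E v.
Proof. by rewrite -scaleN1r enZ normrN1 mul1r. Qed.

Lemma en_unit (c s : R) v : c ^+ 2 + s ^+ 2 = 1 ->
  `|c * (v.1 * a1 + v.2 * a2) + s * (v.2 * b2)| <= E v.
Proof.
move=> cs; rewrite -sqrtr_sqr ler_wsqrtr// /en2.
set p := v.1 * a1 + _; set q := v.2 * b2.
have : (c * p + s * q) ^+ 2 + (c * q - s * p) ^+ 2 = (c ^+ 2 + s ^+ 2) * (p ^+ 2 + q ^+ 2) by ring.
by rewrite cs mul1r => <-; rewrite lerDl sqr_ge0.
Qed.

(** A unit covector that norms v. It replaces the norm of a difference by a linear function, both in
    the triangle inequality and in calibrations. *)
Lemma en_direction v : exists c s : R, c ^+ 2 + s ^+ 2 = 1 /\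
  c * (v.1 * a1 + v.2 * a2) + s * (v.2 * b2) = E v.
Proof.
have [E0|E0] := eqVneq (E v) 0.
  exists 1, 0; rewrite expr1n expr0n addr0 mul0r addr0 mul1r E0; split=> //. apply/eqP; rewrite -sqrf_eq0; apply/eqP/le_anti; rewrite sqr_ge0 andbT.
  have := sqr_en v; rewrite E0 expr0n /= /en2 => e; by rewrite [leRHS]e lerDl sqr_ge0.
exists ((v.1 * a1 + v.2 * a2) / E v), ((v.2 * b2) / E v).
have : (v.1 * a1 + v.2 * a2) ^+ 2 + (v.2 * b2) ^+ 2 = E v ^+ 2 by rewrite sqr_en.
move: (v.1 * a1 + _) (v.2 * b2) => p q h; split.
  by rewrite !expr_div_n -mulrDl h divff// sqrf_eq0.
have -> : p / E v * p + q / E v * q = (p ^+ 2 + q ^+ 2) / E v by rewrite !expr2; ring.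
by rewrite h expr2 mulfK.
Qed.

Lemma enD u v : E (u + v) <= E u + E v.
Proof.
have [c [s [cs <-]]] := en_direction (u + v).
have := en_unit u cs; have := en_unit v cs; rewrite /= !ler_norml; lra.
Qed.

Lemma en_coord : exists2 C : R, 0 < C & forall v, `|v.1| <= C * E v /\ `|v.2| <= C * E v.
Proof.
have B v : `|v.2| <= b2^-1 * E v.
  rewrite ler_pdivlMl// mulrC -{1}(gtr0_norm b20) -normrM. have := @en_unit 0 1 v; rewrite mul0r add0r mul1r; apply; by rewrite expr0n expr1n add0r.
have A v : `|v.1| <= a1^-1 * (1 + `|a2| / b2) * E v.
  rewrite -mulrA ler_pdivlMl// mulrC -{1}(gtr0_norm a10) -normrM. have -> : v.1 * a1 = (v.1 * a1 + v.2 * a2) - v.2 * a2 by ring.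
  rewrite (le_trans (ler_normB _ _))// mulrDl mul1r lerD//.
    have := @en_unit 1 0 v; rewrite mul0r addr0 mul1r; apply; by rewrite expr0n expr1n addr0.
  by rewrite normrM mulrC -mulrA ler_wpM2l//; exact: B.
exists (b2^-1 + a1^-1 * (1 + `|a2| / b2)).
  by rewrite ltr_wpDr ?invr_gt0// mulr_ge0 ?invr_ge0 ?(ltW a10)// addr_ge0// divr_ge0// ltW.
move=> v; split.
  by rewrite (le_trans (A v))// mulrDl lerDr mulr_ge0 ?en_ge0// invr_ge0 ltW.
rewrite (le_trans (B v))// mulrDl lerDl mulr_ge0 ?en_ge0//.
by rewrite mulr_ge0 ?invr_ge0 ?(ltW a10)// addr_ge0// divr_ge0// ltW.
Qed.

Lemma nbhs_en x0 (P : set (R * R)) : nbhs x0 P ->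
  exists2 r : R, 0 < r & forall x, E (x - x0) < r -> P x.
Proof.
move=> /nbhs_ballP[r /= r0 B]; have [C C0 HC] := en_coord.
exists (r / C); first exact: divr_gt0.
move=> x; rewrite ltr_pdivlMr// mulrC => h; apply: B; rewrite /ball_ /=.
have [h1 h2] := HC (x - x0).
rewrite -ball_normE /= -normrN opprB normB_coord.
by rewrite (le_lt_trans h1)//= (le_lt_trans h2).
Qed.

Lemma en2_shift_smooth (U : set (R * R)) x0 k : open U -> Ck_on k U (fun x => E2 (x - x0)).
Proof.
move=> oU.
have -> : (fun x => E2 (x - x0)) = (fun x => (x.1 * a1 + x.2 * a2 + (- x0.1 * a1 - x0.2 * a2)) * (x.1 * a1 + x.2 * a2 + (- x0.1 * a1 - x0.2 * a2)) + (x.1 * 0 + x.2 * b2 + (- x0.2 * b2)) * (x.1 * 0 + x.2 * b2 + (- x0.2 * b2))).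
  by apply/funext => x; rewrite /en2 /=; ring.
by apply: (CkD oU); apply: (CkM oU); exact: Ck_affine.
Qed.

Lemma compact_en x0 (r : R) : 0 <= r -> compact [set x | E (x - x0) <= r].
Proof.
move=> r0; have [C C0 HC] := en_coord.
pose B := `[x0.1 - C * r, x0.1 + C * r]%classic `*` `[x0.2 - C * r, x0.2 + C * r]%classic.
have cB : compact B by apply: compact_setX; exact: segment_compact.
apply: subclosed_compact cB _.
  have -> : [set x | E (x - x0) <= r] = (fun x => E2 (x - x0)) @^-1` [set t | t <= r ^+ 2].
    by apply/seteqP; split=> x /=; rewrite en_le.
  apply: closed_comp; last exact: closed_le. by move=> x _; exact: (@en2_shift_smooth setT x0 0%N openT x I).
move=> x /= hx; have [] := HC (x - x0); have := ler_wpM2l (ltW C0) hx.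
rewrite /= !ler_norml /B /= !in_itv /= => h /andP[h1 h2] /andP[h3 h4].
by split; apply/andP; split; lra.
Qed.

End EuclideanCoordinates.

(** * The metric near a point compared with a constant one *)

Section LocalFrame.
Variables (R : realType) (N : surface R) (G : riemannian_metric N).
Implicit Types (p q y z : N) (x u v : R * R).
Local Notation e1 := ((1, 0) : R * R).
Local Notation e2 := ((0, 1) : R * R).

Lemma inner_det_gt0 p x : cod p x -> 0 < G p x e1 e1 /\
  0 < G p x e1 e1 * G p x e2 e2 - G p x e1 e2 ^+ 2.
Proof.
move=> cx.
have g1 : 0 < G p x e1 e1 by apply: inner_pos => //; rewrite xpair_eqE oner_eq0.
split=> //; set g11 := G p x e1 e1 in g1 *; set g12 := G p x e1 e2; set g22 := G p x e2 e2.
have v0 : (- g12, g11) != (0 : R * R) by rewrite xpair_eqE (gt_eqF g1) andbF.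
have := inner_pos G cx v0; rewrite (inner_expand G _ cx) /= -/g11 -/g12 -/g22.
have -> : (- g12) ^+ 2 * g11 + 2 * (- g12 * g11) * g12 + g11 ^+ 2 * g22 = g11 * (g11 * g22 - g12 ^+ 2) by ring.
by rewrite pmulr_rgt0.
Qed.

Lemma continuous_density p x : cod p x -> {for x, continuous (area_density G p)}.
Proof.
move=> cx; apply: (@cont_comp _ _ _ (fun x => G p x e1 e1 * G p x e2 e2 - G p x e1 e2 ^+ 2) Num.sqrt).
  apply: cvgB; [apply: cvgM|apply: cvgM]; exact: continuous_inner.
exact: sqrt_continuous.
Qed.

Lemma density_gt0 p x : cod p x -> 0 < area_density G p x.
Proof. by move=> cx; have [_ h] := inner_det_gt0 cx; rewrite /area_density sqrtr_gt0. Qed.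

(** The numbers a1, a2, b2 are the Cholesky factor of the Gram matrix at z, so [a1 * b2] is the area
    density there; nearby everything follows by continuity of the coefficients. *)
Lemma local_frame z : exists a1 a2 b2 : R, [/\ 0 < a1, 0 < b2 & forall eta : R, 0 < eta ->
  exists2 r : R, 0 < r & forall x, en a1 a2 b2 (x - chart z z) < r ->
    [/\ cod z x, forall v, en a1 a2 b2 v <= (1 + eta) * nrm G z x v,
        forall v, nrm G z x v <= (1 + eta) * en a1 a2 b2 v & (1 - eta) * (a1 * b2) <= area_density G z x <= (1 + eta) * (a1 * b2)]].
Proof.
set x0 := chart z z; have c0 : cod z x0 by apply: cod_chart; exact: dom_center.
have [g1 D0] := inner_det_gt0 c0.
set g11 := G z x0 e1 e1 in g1 D0; set g12 := G z x0 e1 e2 in D0; set g22 := G z x0 e2 e2 in D0.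
set a1 := Num.sqrt g11; have a10 : 0 < a1 by rewrite sqrtr_gt0.
have a1a1 : a1 ^+ 2 = g11 by rewrite sqr_sqrtr// ltW.
set a2 := g12 / a1; set b2 := Num.sqrt ((g11 * g22 - g12 ^+ 2) / g11).
have b20 : 0 < b2 by rewrite sqrtr_gt0 divr_gt0.
have b2b2 : b2 ^+ 2 = (g11 * g22 - g12 ^+ 2) / g11 by rewrite sqr_sqrtr// ltW// divr_gt0.
have E v : en2 a1 a2 b2 v = v.1 ^+ 2 * g11 + 2 * (v.1 * v.2) * g12 + v.2 ^+ 2 * g22.
  rewrite /en2 sqrrD !exprMn b2b2 a1a1 /a2 ?exprMn ?exprVn ?a1a1. by field; rewrite !gt_eqF.
have Ed : a1 * b2 = area_density G z x0.
  rewrite /area_density /a1 /b2 -sqrtrM ?(ltW g1)// -/g11 -/g12 -/g22; congr Num.sqrt. by field; rewrite gt_eqF.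
exists a1, a2, b2; split=> // eta' eta'0.
(* Comparing squares costs a factor: for eta <= 1/2 one has (1 + 2 eta)^2 (1 - eta) >= 1, and 2 eta
   <= eta'. *)
pose eta := Num.min (eta' / 2) 2^-1.
have eta0 : 0 < eta by rewrite lt_min divr_gt0//= invr_gt0.
have eta2 : eta <= 2^-1 by rewrite /eta ge_min lexx orbT.
have etae : 2 * eta <= eta' by rewrite -ler_pdivlMl// mulrC /eta ge_min lexx.
have [C C0 HC] := en_coord a2 a10 b20.
(* Both coordinates of v are at most C E(v), so an error d in the coefficients changes the quadratic
   form by at most (2 C E(v))^2 d = eta E(v)^2. *)
pose d := eta / (4 * C ^+ 2); have d0 : 0 < d by rewrite divr_gt0// mulr_gt0// exprn_gt0.
have near_g u v : \forall x \near x0, `|G z x u v - G z x0 u v| < d.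
  have /cvgr_dist_lt/(_ _ d0) := @continuous_inner _ _ G z x0 u v c0. by apply: filterS => x; rewrite distrC.
have near_c : \forall x \near x0, cod z x by apply: open_nbhs_nbhs; split=> //; exact: open_cod.
have dd0 : 0 < eta' * (a1 * b2) by rewrite !mulr_gt0.
have near_d : \forall x \near x0, `|area_density G z x0 - area_density G z x| < eta' * (a1 * b2).
  have /cvgr_dist_lt/(_ _ dd0) := @continuous_density z x0 c0. by apply: filterS => x.
have [r r0 Hr] := nbhs_en a2 a10 b20 (filterI (filterI near_c near_d) (filterI (near_g e1 e1) (filterI (near_g e1 e2) (near_g e2 e2)))).
exists r => // x /Hr[[cx dx] [h11 [h12 h22]]].
have Q v : `|G z x v v - en2 a1 a2 b2 v| <= eta * en2 a1 a2 b2 v.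
  rewrite (inner_expand G _ cx) E.
  have -> : v.1 ^+ 2 * G z x e1 e1 + 2 * (v.1 * v.2) * G z x e1 e2 + v.2 ^+ 2 * G z x e2 e2 - (v.1 ^+ 2 * g11 + 2 * (v.1 * v.2) * g12 + v.2 ^+ 2 * g22) =
    v.1 ^+ 2 * (G z x e1 e1 - g11) + 2 * (v.1 * v.2) * (G z x e1 e2 - g12) + v.2 ^+ 2 * (G z x e2 e2 - g22) by ring.
  rewrite -E -sqr_en; have [k1 k2] := HC v; set e := en _ _ _ v in k1 k2 *. have e0 : 0 <= e := en_ge0 _ _ _ _. apply: (@le_trans _ _ ((`|v.1| + `|v.2|) ^+ 2 * d)).
    rewrite (le_trans (ler_normD _ _))//. apply: (@le_trans _ _ (`|v.1| ^+ 2 * d + 2 * (`|v.1| * `|v.2|) * d + `|v.2| ^+ 2 * d)); last first.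
      by rewrite le_eqVlt; apply/orP; left; apply/eqP; ring.
    apply: lerD; last by rewrite normrM normrX ler_wpM2l ?sqr_ge0// ltW. rewrite (le_trans (ler_normD _ _))//; apply: lerD; rewrite !normrM.
      by rewrite -expr2 ler_wpM2l ?sqr_ge0// ltW.
    by rewrite (ger0_norm (ler0n _ 2)) ler_wpM2l ?mulr_ge0// ltW.
  have -> : eta * e ^+ 2 = (C * e + C * e) ^+ 2 * d.
    by rewrite /d; field; rewrite gt_eqF.
  rewrite ler_wpM2r ?(ltW d0)// ler_pXn2r ?nnegrE ?addr_ge0 ?mulr_ge0 ?(ltW C0)//. exact: lerD.
have e0 v := en_ge0 a1 a2 b2 v; have n0 v := nrm_ge0 G z x v.
have nn v : nrm G z x v ^+ 2 = G z x v v by rewrite sqr_sqrtr// inner_ge0.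
have ee v := sqr_en a1 a2 b2 v.
split=> //.
- move=> v; rewrite -(@ler_pXn2r _ 2) ?nnegrE ?mulr_ge0 ?addr_ge0 ?e0 ?n0 ?(ltW eta'0)//. rewrite exprMn nn ee; have := Q v; rewrite ler_norml => /andP[h _].
  have : (1 - eta) * en2 a1 a2 b2 v <= G z x v v by lra. have : 1 <= (1 + 2 * eta) ^+ 2 * (1 - eta) by nra. have : (1 + 2 * eta) ^+ 2 <= (1 + eta') ^+ 2.
    by rewrite ler_pXn2r ?nnegrE ?addr_ge0 ?mulr_ge0 ?(ltW eta0) ?(ltW eta'0)// lerD2l.
  have := en2_ge0 a1 a2 b2 v; have : 0 <= (1 + 2 * eta) ^+ 2 by exact: sqr_ge0. move: (en2 _ _ _ _) (G z x v v) ((1 + 2 * eta) ^+ 2) ((1 + eta') ^+ 2) => X Y S T S0 X0 ST S1 XY.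
  have Y0 : 0 <= Y by rewrite (le_trans _ XY)// mulr_ge0//; lra. have h1 : 1 * X <= S * (1 - eta) * X by rewrite ler_wpM2r.
  have h2 : S * ((1 - eta) * X) <= S * Y by rewrite ler_wpM2l. have h3 : S * Y <= T * Y by rewrite ler_wpM2r. lra.
- move=> v; rewrite -(@ler_pXn2r _ 2) ?nnegrE ?mulr_ge0 ?addr_ge0 ?e0 ?n0 ?(ltW eta'0)//. rewrite exprMn nn ee; have := Q v; rewrite ler_norml => /andP[_ h].
  have : G z x v v <= (1 + eta) * en2 a1 a2 b2 v by lra. have : 1 + eta <= (1 + eta') ^+ 2 by nra. have := en2_ge0 a1 a2 b2 v.
  move: (en2 _ _ _ _) (G z x v v) ((1 + eta') ^+ 2) => X Y T X0 ST XY. by rewrite (le_trans XY)// ler_wpM2r.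
- by move: dx; rewrite ltr_norml -Ed; lra.
Qed.

End LocalFrame.

(** * Upper and lower bounds for lengths in a chart *)

Section NearIsometry.
Variables (R : realType) (N : surface R) (G : riemannian_metric N) (z : N).
Variables (a1 a2 b2 : R).
Hypotheses (a10 : 0 < a1) (b20 : 0 < b2).
Implicit Types (p q y : N) (x u v : R * R).
Local Notation e1 := ((1, 0) : R * R).
Local Notation e2 := ((0, 1) : R * R).
Local Notation E := (en a1 a2 b2).
Local Notation x0 := (chart z z).

Lemma open_en (r : R) : 0 < r -> open [set x | E (x - x0) < r].
Proof.
move=> r0; have -> : [set x | E (x - x0) < r] = (fun x => en2 a1 a2 b2 (x - x0)) @^-1` [set t | t < r ^+ 2].
  by apply/seteqP; split=> x /=; rewrite en_lt.
apply: open_comp; last exact: open_lt.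
by move=> x _; exact: (@en2_shift_smooth R a1 a2 b2 setT x0 0%N openT x I).
Qed.

(** The straight segment stays in the convex ball and is taken as the joining curve. *)
Lemma segment_joins (r k : R) x x' : 0 < r ->
  (forall w, E (w - x0) < r -> cod z w /\ forall v, nrm G z w v <= k * E v) -> E (x - x0) < r -> E (x' - x0) < r ->
  exists2 l, joins G (chart_inv z x) (chart_inv z x') l & l <= k * E (x' - x).
Proof.
move=> r0 H xr x'r; set D := x' - x; pose A (t : R) := x + t *: D; pose c := chart_inv z \o A.
have Ar (t : R) : 0 <= t <= 1 -> E (A t - x0) < r.
  move=> /andP[t0 t1]; have -> : A t - x0 = (1 - t) *: (x - x0) + t *: (x' - x0).
    by rewrite /A /D; congr pair; rewrite /= !scaleRE; ring.
  rewrite (le_lt_trans (enD _ _ _ _ _))// !enZ !ger0_norm// ?subr_ge0//. have [->|tn] := eqVneq t 1; first by rewrite subrr mul0r add0r mul1r.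
  have t1' : 0 < 1 - t by rewrite subr_gt0 lt_neqAle tn. have h1 : (1 - t) * E (x - x0) < (1 - t) * r by rewrite ltr_pM2l.
  have h2 : t * E (x' - x0) <= t * r by rewrite ler_wpM2l// ltW. lra.
have dA (t : R) : is_derive t (1 : R) A D.
  have := is_derive_line (@derivable_id R (R * R)%type (x + t *: D) D). by rewrite derive_id.
have cA (t : R) : {for t, continuous A}.
  by apply: differentiable_continuous; apply/derivable1_diffP; have [] := dA t.
have nA (t : R) : 0 <= t <= 1 -> \forall u \near t, E (A u - x0) < r.
  move=> t01; apply: (cA t [set w | E (w - x0) < r]). exact: open_nbhs_nbhs (conj (open_en r0) (Ar t t01)).
have C1c (t : R) : E (A t - x0) < r -> C1_at c t.
  move=> At; have [ct _] := H _ At. have nt : \forall u \near t, E (A u - x0) < r.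
    by apply: (cA t [set w | E (w - x0) < r]); exact: open_nbhs_nbhs (conj (open_en r0) At).
  have cc : \forall u \near t, {for u, continuous c}.
    apply: filterS nt => u Au; apply: cont_comp (cA u) _. by apply: continuous_chart_inv; have [] := H _ Au.
  have nE : \forall u \near t, (chart z \o c) u = A u.
    by apply: filterS nt => u Au; rewrite /= chart_invK//; have [] := H _ Au.
  have nE2 : \forall u \near t, \forall w \near u, A w = (chart z \o c) w.
    by apply: filterS (near_join nE) => u; apply: filterS => w.
  have nd : \forall u \near t, is_derive u (1 : R) (chart z \o c) D.
    by apply: filterS nE2 => u nu; apply: near_eq_is_derive nu (dA u).
  have dt : dom z (c t) by exact: dom_chart_inv. have [d cd] : (\forall u \near t, derivable (chart (c t) \o c) u 1) /\ {for t, continuous (derive1 (chart (c t) \o c))}.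
    apply: (@C1_at_chart R N z c t dt cc _ _ (c t) (dom_center (c t))).
      by apply: filterS nd => u [].
    have nD : \forall u \near t, cst D u = derive1 (chart z \o c) u.
      by apply: filterS nd => u [_ <-]; rewrite derive1E.
    have e0 : D = derive1 (chart z \o c) t := nbhs_singleton nD. rewrite /prop_for /continuous_at -e0; apply: cvg_trans (near_eq_cvg nD) _; exact: cvg_cst.
  by split.
(* The ball being open, the line through the segment stays in it slightly beyond both ends, which
   [arc_local] needs. *)
have [e e0 He] : exists2 e : R, 0 < e & forall t, 0 - e < t < 1 + e -> C1_at c t.
  have [ea ea0 Ha] : exists2 e : R, 0 < e & forall t, `|t| < e -> E (A t - x0) < r.
    have h0 : 0 <= (0 : R) <= 1 by rewrite lexx ler01. have /nbhs_ballP[e /= e0 He] := nA 0 h0. by exists e => // t te; apply: He; rewrite /ball /= sub0r normrN.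
  have [eb eb0 Hb] : exists2 e : R, 0 < e & forall t, `|1 - t| < e -> E (A t - x0) < r.
    have h0 : 0 <= (1 : R) <= 1 by rewrite lexx ler01. have /nbhs_ballP[e /= e0 He] := nA 1 h0. by exists e => // t te; apply: He; rewrite /ball /=.
  exists (Num.min ea eb); first by rewrite lt_min ea0. have ma : Num.min ea eb <= ea by rewrite ge_min lexx. have mb : Num.min ea eb <= eb by rewrite ge_min lexx orbT.
  move=> t /andP[t1 t2]; apply: C1c. have [t0|t0] := ltP t 0; first by apply: Ha; rewrite ltr_norml; lra. have [t3|t3] := leP t 1; first by apply: Ar; rewrite t0.
  by apply: Hb; rewrite ltr_norml; lra.
have [L [dL aL]] := arc_local G ltr01 e0 He.
have c0 : c 0 = chart_inv z x by rewrite /c /= /A scale0r addr0.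
have c1 : c 1 = chart_inv z x' by rewrite /c /= /A scale1r /D addrC subrK.
exists (L 1 - L 0); first by exists c.
have Hd (t : R) : 0 <= t <= 1 -> is_derive t (1 : R) (fun t => t * (k * E D) - L t) (k * E D - speed G c t).
  by move=> t01; exact: is_deriveB (is_derive_mulr t _) (dL t t01).
have := derive_ge0_le ler01 Hd; rewrite mul0r mul1r sub0r => h.
suff /h : forall t, 0 <= t <= 1 -> 0 <= k * E D - speed G c t by lra.
move=> t t01; rewrite subr_ge0.
have At := Ar _ t01; have [ct Hn] := H _ At.
have [cc _ _] := C1c _ At.
have nE : \forall u \near t, A u = (chart z \o c) u.
  by apply: filterS (nA t t01) => u Au; rewrite /= chart_invK//; have [] := H _ Au.
have [dd eD] := near_eq_is_derive nE (dA t).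
rewrite (@speedE R N G z c t (dom_chart_inv ct) (nbhs_singleton cc) dd).
by rewrite derive1E eD /c /= chart_invK.
Qed.

(** It is 1 for E <= r/2 and 0 as soon as E^2 >= 3 r^2 / 4. Working with E^2 avoids the singularity
    of the norm at the centre. *)
Definition cutoff (r : R) x := 1 - step ((en2 a1 a2 b2 (x - x0) - r ^+ 2 / 4) / (r ^+ 2 / 2)).

Lemma cutoff_itv r x : 0 <= cutoff r x <= 1.
Proof. by have := step_itv ((en2 a1 a2 b2 (x - x0) - r ^+ 2 / 4) / (r ^+ 2 / 2)); rewrite /cutoff; lra. Qed.

Lemma cutoff_eq1 r x : 0 < r -> E (x - x0) <= r / 2 -> cutoff r x = 1.
Proof.
move=> r0 xr; rewrite /cutoff step_eq0 ?subr0//.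
rewrite pmulr_lle0 ?invr_gt0 ?divr_gt0 ?exprn_gt0// subr_le0.
by move: xr; rewrite en_le ?divr_ge0 ?(ltW r0)// exprMn expr2; lra.
Qed.

Lemma cutoff_eq0 r x : 0 < r -> r <= E (x - x0) -> cutoff r x = 0.
Proof.
move=> r0 xr; rewrite /cutoff step_eq1 ?subrr//.
have r2 : 0 < r ^+ 2 by rewrite exprn_gt0.
rewrite ler_pdivlMr ?divr_gt0// mul1r.
have : r ^+ 2 <= en2 a1 a2 b2 (x - x0) by rewrite leNgt -en_lt// -leNgt.
lra.
Qed.

Lemma cutoff_smooth r (U : set (R * R)) : open U -> smooth_on U (cutoff r).
Proof.
move=> oU k.
have -> : cutoff r = (fun x => 1 + (-1) * step ((en2 a1 a2 b2 (x - x0) + (- (r ^+ 2 / 4))) * (r ^+ 2 / 2)^-1)).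
  by apply/funext => x; rewrite /cutoff mulN1r.
apply: (CkD oU); first exact: Ck_cst.
apply: (CkM oU); first exact: Ck_cst.
apply: (Ck_step oU); apply: (CkM oU); last exact: Ck_cst.
by apply: (CkD oU); [exact: en2_shift_smooth|exact: Ck_cst].
Qed.

(** Compactness bounds the two partial derivatives on the closed ball, and beyond it the cutoff is
    locally constant. *)
Lemma cutoff_lip (r k : R) : 0 < r -> 0 < k ->
  (forall w, E (w - x0) <= r -> forall v, E v <= k * nrm G z w v) -> exists2 C, 0 < C & forall x v, cod z x -> `|'D_v (cutoff r) x| <= C * nrm G z x v.
Proof.
move=> r0 k0 H; have [C C0 HC] := en_coord a2 a10 b20.
have sm := cutoff_smooth r openT.
have bnd (w : R * R) : exists2 B : R, 0 < B & forall x, E (x - x0) <= r -> `|'D_w (cutoff r) x| <= B.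
  have K0 : [set x | E (x - x0) <= r] !=set0.
    by exists x0; rewrite /= subrr en_le ?(ltW r0)// /en2 /= !mul0r addr0 expr0n addr0 sqr_ge0.
  have cf : {within [set x | E (x - x0) <= r], continuous (fun x => `|'D_w (cutoff r) x|)}.
    apply: continuous_subspaceT => x. have [_ c] := sm 1%N w; apply: (@cont_comp _ _ _ ('D_w (cutoff r)) Num.norm); first exact: c. exact: norm_continuous.
  have [c _ Hc] := compact_EVT_max K0 (@compact_en R a1 a2 b2 a10 b20 x0 r (ltW r0)) cf. exists (`|'D_w (cutoff r) c| + 1); first by rewrite ltr_wpDl.
  by move=> x xr; rewrite (le_trans (Hc x _)) ?lerDl// inE.
have [B1 B10 HB1] := bnd e1; have [B2 B20 HB2] := bnd e2.
exists ((B1 + B2) * C * k); first by rewrite !mulr_gt0 ?addr_gt0.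
move=> x v cx.
have [xr|xr] := leP (E (x - x0)) r.
  have dx : differentiable (cutoff r) x := differentiable_C1 openT I (sm 1%N). rewrite (deriveE _ dx) (diff_coord _ dx). have [h1 h2] := HC v; have Ev := H x xr v.
  have Cv : C * E v <= C * (k * nrm G z x v) by rewrite ler_pM2l. have k1 := ler_pM (normr_ge0 _) (normr_ge0 _) (le_trans h1 Cv) (HB1 x xr).
  have k2 := ler_pM (normr_ge0 _) (normr_ge0 _) (le_trans h2 Cv) (HB2 x xr). rewrite -!normrM in k1 k2. move: (v.1 * _) (v.2 * _) (nrm G z x v) k1 k2 => X Y n k1 k2.
  have := ler_normD X Y; have := lerD k1 k2. have -> : C * (k * n) * B1 + C * (k * n) * B2 = (B1 + B2) * C * k * n by ring. by move=> s1 s2; exact: le_trans s2 s1.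
have -> : 'D_v (cutoff r) x = 0.
  rewrite -(derive_cst (0 : R) x v); apply: near_eq_derive. have nx : \forall w \near x, r < E (w - x0).
    have xr2 : r ^+ 2 < en2 a1 a2 b2 (x - x0) by rewrite ltNge -en_le ?(ltW r0)// -ltNge. have nx : nbhs x [set w : R * R | r ^+ 2 < en2 a1 a2 b2 (w - x0)].
      exact: (@en2_shift_smooth R a1 a2 b2 setT x0 0%N openT x I [set t | r ^+ 2 < t] (lt_nbhsr xr2)).
    apply: filterS nx => w /=; rewrite !ltNge en_le ?(ltW r0)//.
  by apply: filterS nx => w /ltW; exact: cutoff_eq0.
by rewrite normr0 !mulr_ge0 ?nrm_ge0 ?addr_ge0// ltW.
Qed.

Section Calibration.
Variables (r k K C c s : R).
Hypotheses (r0 : 0 < r) (k0 : 0 < k) (K0 : 0 < K) (cs : c ^+ 2 + s ^+ 2 = 1).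
Hypothesis Hk : forall w, E (w - x0) <= r -> cod z w /\ forall v, E v <= k * nrm G z w v.
Hypothesis HC : forall x v, cod z x -> `|'D_v (cutoff r) x| <= C * nrm G z x v.

Definition proj_cs v := c * (v.1 * a1 + v.2 * a2) + s * (v.2 * b2).

(** A truncated unit covector cut off outside the ball: it extends by zero to the whole surface,
    with gradient at most k + K C. *)
Definition calib x := trunc K (proj_cs (x - x0)) * cutoff r x.

Let A := c * a1.
Let B := c * a2 + s * b2.
Let d := - x0.1 * A - x0.2 * B.

Let projE x : proj_cs (x - x0) = x.1 * A + x.2 * B + d.
Proof. by rewrite /proj_cs /d /A /B /=; ring. Qed.

Lemma calib_smooth (U : set (R * R)) : open U -> smooth_on U calib.
Proof.
move=> oU n; apply: (CkM oU); last exact: cutoff_smooth.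
have -> : (fun x => trunc K (proj_cs (x - x0))) = trunc K \o (fun x => x.1 * A + x.2 * B + d).
  by apply/funext => x /=; rewrite projE.
by apply: (Ck_trunc K oU); exact: Ck_affine.
Qed.

Lemma calib_lip x v : cod z x -> `|'D_v calib x| <= (k + K * C) * nrm G z x v.
Proof.
move=> cx; have oT := @openT (R * R)%type.
pose f x : R := x.1 * A + x.2 * B + d.
have df : differentiable f x := differentiable_C1 oT I (@Ck_affine R 1 setT A B d oT).
have [Df Ef] := derive_affine A B d x v.
have dt := is_derive_trunc K (f x); set t' := _ * _ in dt.
have [Dt Et] := derive_comp1 v df (@ex_derive _ _ _ _ _ _ _ dt).
have dphi : differentiable (cutoff r) x := differentiable_C1 oT I (cutoff_smooth r oT 1%N).
have Dphi : derivable (cutoff r) x v := @diff_derivable _ _ _ _ _ v dphi.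
have calE : calib = (trunc K \o f) * cutoff r.
  by apply/funext => w; rewrite /calib projE.
rewrite calE deriveM// !scaleRE Et Ef derive1E (@derive_val _ _ _ _ _ _ _ dt).
have /andP[t0 t1] : 0 <= t' <= 1.
  have /andP[_ ->] := trunc_slope K (f x). by rewrite /t' mulr_ge0 ?powR_ge0 ?invr_ge0 ?(ltW (trunc_den_gt0 _ _)).
clearbody t'; have Pv : v.1 * A + v.2 * B = proj_cs v by rewrite /A /B /proj_cs; ring.
have /andP[p0 p1] := cutoff_itv r x.
have n0 := nrm_ge0 G z x v.
have h1 : `|cutoff r x * (t' * (v.1 * A + v.2 * B))| <= k * nrm G z x v.
  have [xr|xr] := leP (E (x - x0)) r; last first.
    by rewrite cutoff_eq0 ?(ltW xr)// mul0r normr0 mulr_ge0// ltW.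
  have [_ /(_ v)] := Hk xr; apply: le_trans. rewrite !normrM (ger0_norm p0) (ger0_norm t0) Pv. apply: le_trans (en_unit a1 a2 b2 v cs); rewrite -/(proj_cs v).
  by rewrite mulrA ler_piMl// mulr_ile1.
have h2 : `|trunc K (f x) * 'D_v (cutoff r) x| <= K * C * nrm G z x v.
  by rewrite normrM -mulrA ler_pM// ?trunc_le// HC.
move: (cutoff r x * _) (trunc K (f x) * _) h1 h2 => X Y h1 h2.
have := ler_normD Y X; rewrite mulrDl; move: (k * _) (K * C * _) h1 h2 => p q h1 h2 h3.
by apply: (le_trans h3); rewrite addrC lerD.
Qed.

End Calibration.

(** Curves may leave the chart, so the lower bound uses globally defined functions. The first part
    applies [calib] in the direction norming x' - x; with K = eta / C its Lipschitz constant is 1 +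
    2 eta, and truncation costs the factor 1 - eta. The second part uses the cutoff alone: it is 1
    at z and 0 outside the ball, a drop which takes length at least 1 / C'. *)
Lemma frame_lower (eta r : R) : 0 < eta -> 0 < r ->
  (forall w, E (w - x0) <= r -> cod z w /\ forall v, E v <= (1 + eta) * nrm G z w v) -> exists2 r' : R, 0 < r' <= r &
   [/\ forall x x' l, E (x - x0) < r' -> E (x' - x0) < r' ->
       joins G (chart_inv z x) (chart_inv z x') l -> (1 - eta) * E (x' - x) <= (1 + 2 * eta) * l & exists2 d : R, 0 < d & forall y l, joins G z y l -> l < d ->
         dom z y /\ E (chart z y - x0) < r'].
Proof.
move=> eta0 r0 H.
have H1 w : E (w - x0) <= r -> forall v, E v <= (1 + eta) * nrm G z w v by case/H.
have k0 : 0 < 1 + eta by rewrite addr_gt0.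
have [C C0 HC] := cutoff_lip r0 k0 H1.
pose K := eta / C; have K0 : 0 < K by rewrite divr_gt0.
have cK : compact [set x | E (x - x0) <= r] := @compact_en R a1 a2 b2 a10 b20 x0 r (ltW r0).
have Kc : [set x | E (x - x0) <= r] `<=` cod z by move=> w /H[].
have oz := @open_cod R N z.
(* r' <= r/2 puts both points where the cutoff is 1; r' / K <= eta/8 and <= 1 give 2 (r' / K)^2 <=
   eta, the loss in slope of [trunc]. *)
pose r' := Num.min (r / 2) (K * Num.min 1 (eta / 8)).
have m0 : 0 < Num.min 1 (eta / 8) by rewrite lt_min ltr01 divr_gt0.
have r'0 : 0 < r' by rewrite lt_min divr_gt0//= mulr_gt0.
have r'r : r' <= r / 2 by rewrite ge_min lexx.
have r'K : r' / K <= Num.min 1 (eta / 8) by rewrite ler_pdivrMr// mulrC /r' ge_min lexx orbT.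
have r'K1 : r' / K <= 1 by rewrite (le_trans r'K)// ge_min lexx.
have r'K2 : r' / K <= eta / 8 by rewrite (le_trans r'K)// ge_min lexx orbT.
have r'rr : r' <= r by lra.
exists r'; first by rewrite r'0.
split.
  move=> x x' l xr x'r j. have [c [s [cs Ecs]]] := en_direction a1 a2 b2 (x' - x). have cx w : E (w - x0) < r' -> cod z w by move=> h; have [] := H w (ltW (lt_le_trans h r'rr)).
  have sm := calib_smooth r K c s oz. have g0 w : cod z w -> ~ (E (w - x0) <= r) -> calib r K c s w = 0.
    by move=> _ /negP; rewrite -ltNge => h; rewrite /calib cutoff_eq0 ?mulr0// ltW.
  have KC0 : 0 <= (1 + eta) + K * C := addr_ge0 (ltW k0) (mulr_ge0 (ltW K0) (ltW C0)). have HL w v : cod z w -> `|'D_v (calib r K c s) w| <= (1 + eta + K * C) * nrm G z w v.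
    by move=> cw; apply: calib_lip.
  have L := lip_chart_ext cK Kc sm g0 KC0 HL. have := lip_joins (msmooth_chart_ext cK Kc sm g0) L j. rewrite !chart_extE; try exact: dom_chart_inv (cx _ _).
  rewrite !chart_invK; try exact: cx. rewrite /calib !cutoff_eq1 ?mulr1//; try lra. have -> : 1 + eta + K * C = 1 + 2 * eta by rewrite /K divfK ?gt_eqF//; ring.
  move=> h; have h' := le_trans (ler_norm _) h; apply: le_trans h'. have px w : E (w - x0) < r' -> `|proj_cs c s (w - x0)| <= r'.
    by move=> h'; rewrite ltW// (le_lt_trans (en_unit a1 a2 b2 (w - x0) cs)).
  have dp : proj_cs c s (x' - x0) - proj_cs c s (x - x0) = E (x' - x).
    by rewrite -Ecs /proj_cs /=; ring.
  have le : proj_cs c s (x - x0) <= proj_cs c s (x' - x0) by rewrite -subr_ge0 dp en_ge0. apply: le_trans (trunc_increment K (ltW r'0) (px _ xr) (px _ x'r) le).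
  rewrite dp ler_wpM2r ?en_ge0// lerD2l lerN2. have q0 : 0 <= r' / K by rewrite divr_ge0 ?ltW. have : (r' / K) ^+ 2 <= r' / K by rewrite expr2 ler_piMl. lra.
have sm := cutoff_smooth r' oz.
have H1' w : E (w - x0) <= r' -> forall v, E v <= (1 + eta) * nrm G z w v by move=> h; apply: H1; lra.
have [C' C'0 HC'] := cutoff_lip r'0 k0 H1'.
have g0 w : cod z w -> ~ (E (w - x0) <= r) -> cutoff r' w = 0.
  by move=> _ /negP; rewrite -ltNge => h; rewrite cutoff_eq0//; lra.
have L := lip_chart_ext cK Kc sm g0 (ltW C'0) HC'.
exists C'^-1; first by rewrite invr_gt0.
move=> y l j; rewrite -[C'^-1]mulr1 ltr_pdivlMl// => lC.
have Fz : chart_ext z (cutoff r') z = 1.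
  rewrite chart_extE ?cutoff_eq1//; last exact: dom_center. by rewrite subrr en_le ?divr_ge0 ?(ltW r'0)// /en2 /= !mul0r addr0 expr0n addr0 sqr_ge0.
have := lip_joins (msmooth_chart_ext cK Kc sm g0) L j; rewrite Fz => h.
have Fy : 0 < chart_ext z (cutoff r') y.
  rewrite distrC in h; have := le_lt_trans (le_trans (ler_norm _) h) lC. by rewrite ltrBlDr ltrDl.
have [dy|ndy] := pselect (dom z y); last by move: Fy; rewrite chart_ext_notin// ltxx.
split=> //; move: Fy; rewrite chart_extE// !ltNge; apply: contra => /(cutoff_eq0 r'0) ->.
by rewrite lexx.
Qed.

End NearIsometry.

(** * Nearly isometric charts and the distance function *)

Section LengthDistance.
Variables (R : realType) (N : surface R) (G : riemannian_metric N).
Implicit Types (p q y z : N) (x u v : R * R).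

(* (a1, a2, b2) are Euclidean coordinates of the tangent plane at z; up to the
   factor 1 + eta they compute distances near z *)
Record isometric_chart z (eta a1 a2 b2 r d : R) : Prop := IsometricChart {
  ich_a1 : 0 < a1 ; ich_b2 : 0 < b2 ; ich_r : 0 < r ; ich_d : 0 < d ; ich_cod : forall x, en a1 a2 b2 (x - chart z z) < r -> cod z x ;
  ich_density : forall x, en a1 a2 b2 (x - chart z z) < r ->
    (1 - eta) * (a1 * b2) <= area_density G z x <= (1 + eta) * (a1 * b2) ;
  ich_upper : forall x x', en a1 a2 b2 (x - chart z z) < r ->
    en a1 a2 b2 (x' - chart z z) < r -> exists2 l, joins G (chart_inv z x) (chart_inv z x') l &
      l <= (1 + eta) * en a1 a2 b2 (x' - x) ;
  ich_lower : forall x x' l, en a1 a2 b2 (x - chart z z) < r ->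
    en a1 a2 b2 (x' - chart z z) < r -> joins G (chart_inv z x) (chart_inv z x') l -> en a1 a2 b2 (x' - x) <= (1 + eta) * l ;
  ich_dom : forall y l, joins G z y l -> l < d ->
    dom z y /\ en a1 a2 b2 (chart z y - chart z z) < r ;
  ich_nrm : forall x v, en a1 a2 b2 (x - chart z z) < r ->
    en a1 a2 b2 v <= (1 + eta) * nrm G z x v }.

Lemma isometric_chart_ex z (eta : R) : 0 < eta ->
  exists a1 a2 b2 r d, isometric_chart z eta a1 a2 b2 r d.
Proof.
move=> eta0; have [a1 [a2 [b2 [a10 b20 F]]]] := local_frame G z.
(* The lower bound comes as (1 - e') E <= (1 + 2 e') l; the factor 8 leaves room to turn it into E
   <= (1 + eta) l. *)
pose e' := Num.min (eta / 8) (8%:R^-1).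
have e'0 : 0 < e' by rewrite lt_min divr_gt0//= invr_gt0.
have e'1 : e' <= 8%:R^-1 by rewrite ge_min lexx orbT.
have e'2 : e' <= eta / 8 by rewrite ge_min lexx.
have [r r0 H] := F _ e'0.
have r20 : 0 < r / 2 by rewrite divr_gt0.
have r2r : r / 2 < r by lra.
have HF w : en a1 a2 b2 (w - chart z z) <= r / 2 -> cod z w /\ forall v, en a1 a2 b2 v <= (1 + e') * nrm G z w v.
  by move=> h; have [] := H w (le_lt_trans h r2r).
have [r' /andP[r'0 r'r] [L [d d0 D]]] := frame_lower a10 b20 e'0 r20 HF.
have Hr x : en a1 a2 b2 (x - chart z z) < r' -> en a1 a2 b2 (x - chart z z) < r.
  by move=> h; lra.
exists a1, a2, b2, r', d; split=> //.
- by move=> x /Hr/H[].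
- move=> x /Hr/H[_ _ _ /andP[h1 h2]]; have ab0 : 0 < a1 * b2 by rewrite mulr_gt0. have ee : e' <= eta by lra. apply/andP; split; [apply: le_trans h1|apply: (le_trans h2)].
    by rewrite ler_pM2r//; lra.
  by rewrite ler_pM2r//; lra.
- move=> x x' /Hr hx /Hr hx'. have Hn w : en a1 a2 b2 (w - chart z z) < r -> cod z w /\ forall v, nrm G z w v <= (1 + e') * en a1 a2 b2 v.
    by move=> h; have [c _ n _] := H w h.
  have [l j le] := segment_joins r0 Hn hx hx'. by exists l => //; apply: le_trans le _; rewrite ler_wpM2r ?en_ge0//; lra.
- move=> x x' l hx hx' j; have := L x x' l hx hx' j; have l0 := joins_ge0 j. have := en_ge0 a1 a2 b2 (x' - x); move: (en _ _ _ _) => E E0 h.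
  have h2 : (7/8) * E <= (1 - e') * E by rewrite ler_wpM2r//; lra. have k1 : (1 + 2 * e') * l <= (1 - e') * ((1 + eta) * l).
    by rewrite mulrA ler_wpM2r//; nra.
  have k2 := le_trans h k1; rewrite ler_pM2l// in k2; lra.
- move=> x v /Hr/H[_ h _ _]; apply: le_trans (h v) _; rewrite ler_wpM2r ?nrm_ge0//; lra.
Qed.

Lemma joins_refl y : joins G y y 0.
Proof.
have [a1 [a2 [b2 [r [d H]]]]] := @isometric_chart_ex y 1 ltr01.
have c0 : en a1 a2 b2 (chart y y - chart y y) = 0 by exact: en_subrr.
have [||l j le] := ich_upper H (x := chart y y) (x' := chart y y).
- by rewrite c0 (ich_r H).
- by rewrite c0 (ich_r H).
rewrite chartK in j; last exact: dom_center.
have l0 := joins_ge0 j; move: le; rewrite c0 mulr0 => le.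
by have -> : 0 = l by apply/eqP; rewrite eq_le l0 le.
Qed.

Lemma near_joins y (e : R) : 0 < e -> \forall y' \near y, exists2 l, joins G y y' l & l < e.
Proof.
move=> e0; have [a1 [a2 [b2 [r [d H]]]]] := @isometric_chart_ex y 1 ltr01.
pose r' := Num.min r (e / 2).
have r'0 : 0 < r' by rewrite lt_min (ich_r H) divr_gt0.
have c0 : en a1 a2 b2 (chart y y - chart y y) = 0 by exact: en_subrr.
have n1 : \forall y' \near y, dom y y'.
  by apply: open_nbhs_nbhs; split; [exact: dom_open|exact: dom_center].
have n2 : \forall y' \near y, en a1 a2 b2 (chart y y' - chart y y) < r'.
  have := @continuous_chart _ N y y (dom_center y) [set x | en a1 a2 b2 (x - chart y y) < r']. apply; apply: open_nbhs_nbhs; split; first exact: open_en. by rewrite /= c0.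
apply: filterS2 n1 n2 => y' d1 h.
have hr : en a1 a2 b2 (chart y y' - chart y y) < r by rewrite (lt_le_trans h)// ge_min lexx.
have he : en a1 a2 b2 (chart y y' - chart y y) < e / 2 by rewrite (lt_le_trans h)// ge_min lexx orbT.
have [||l j le] := ich_upper H (x := chart y y) (x' := chart y y'); [by rewrite c0 (ich_r H)|by []|].
by rewrite !chartK// in j; [exists l => //; lra|exact: dom_center].
Qed.

Lemma joins_nbhs y (P : set N) : nbhs y P -> exists2 e : R, 0 < e & forall y' l, joins G y y' l -> l < e -> P y'.
Proof.
move=> nP; have [a1 [a2 [b2 [r [d H]]]]] := @isometric_chart_ex y 1 ltr01.
have cy : cod y (chart y y) by apply: cod_chart; exact: dom_center.
have nP' : \forall x \near chart y y, P (chart_inv y x).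
  by apply: (continuous_chart_inv cy); rewrite chartK//; exact: dom_center.
have [r' r'0 Hr'] := nbhs_en a2 (ich_a1 H) (ich_b2 H) nP'.
have c0 : en a1 a2 b2 (chart y y - chart y y) = 0 by exact: en_subrr.
exists (Num.min d (r' / 2)); first by rewrite lt_min (ich_d H) divr_gt0.
move=> y' l j; rewrite lt_min => /andP[ld lr].
have [dy hy] := ich_dom H j ld; rewrite -(chartK dy); apply: Hr'.
have := ich_lower H (x := chart y y) (x' := chart y y') (l := l).
rewrite !chartK ?c0 ?(ich_r H)//; last exact: dom_center.
by move=> /(_ isT hy j); lra.
Qed.

Lemma joins_ex y y' : exists l, joins G y y' l.
Proof.
pose B := [set y' | exists l, joins G y y' l].
suff BT : B = [set: N] by have : B y' by rewrite BT.
apply: (@surface_connected R N).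
- by exists y, 0; exact: joins_refl.
- exists B; last by rewrite setTI. rewrite openE => w [l j]; have := near_joins w ltr01. by apply: filterS => w' [l' j' _]; exists (l + l'); exact: joins_trans j j'.
exists B; last by rewrite setTI.
rewrite -[B]setCK closedC openE => w nB; have := near_joins w ltr01.
apply: filterS => w' [l' j' _] [l j]; apply: nB; exists (l + l').
by apply: joins_trans j _; exact: joins_sym.
Qed.

(** Real-valued version of [riem_dist]; the infimum is over a nonempty set because surfaces are
    connected. *)
Definition dist y y' : R := inf [set l | joins G y y' l].

Let has_inf_joins y y' : has_inf [set l | joins G y y' l].
Proof. by split; [have [l] := joins_ex y y'; exists l|exists 0 => l /joins_ge0]. Qed.

Lemma dist_le y y' l : joins G y y' l -> dist y y' <= l.
Proof. by move=> j; apply: ge_inf => //; have [] := has_inf_joins y y'. Qed.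

Lemma dist_lt y y' (e : R) : dist y y' < e -> exists2 l, joins G y y' l & l < e.
Proof. by move=> /inf_lt[//|l j le]; [exact: (has_inf_joins y y').1|exists l]. Qed.

Lemma le_dist y y' (e : R) : (forall l, joins G y y' l -> e <= l) -> e <= dist y y'.
Proof. by move=> H; apply: lb_le_inf => //; exact: (has_inf_joins y y').1. Qed.

Lemma dist_ge0 y y' : 0 <= dist y y'.
Proof. by apply: le_dist => l /joins_ge0. Qed.

Lemma en_le_dist z eta a1 a2 b2 r d y y' : isometric_chart z eta a1 a2 b2 r d -> 0 < eta ->
  dom z y -> en a1 a2 b2 (chart z y - chart z z) < r -> dom z y' -> en a1 a2 b2 (chart z y' - chart z z) < r -> en a1 a2 b2 (chart z y' - chart z y) <= (1 + eta) * dist y y'.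
Proof.
move=> I eta0 dy Ey dy' Ey'; have k : 0 < 1 + eta by lra.
rewrite mulrC -ler_pdivrMr//; apply: le_dist => l J; rewrite ler_pdivrMr// mulrC.
by apply: (ich_lower I Ey Ey'); rewrite !chartK.
Qed.

Lemma en_center z eta a1 a2 b2 r d y : isometric_chart z eta a1 a2 b2 r d -> 0 < eta -> dist z y < d ->
  [/\ dom z y, en a1 a2 b2 (chart z y - chart z z) < r &
    en a1 a2 b2 (chart z y - chart z z) <= (1 + eta) * dist z y].
Proof.
move=> I eta0 yd; have [l J ld] := dist_lt yd; have [dy Ey] := ich_dom I J ld; split=> //.
by apply: (en_le_dist I) => //; [exact: dom_center|rewrite en_subrr (ich_r I)].
Qed.

Lemma distyy y : dist y y = 0.
Proof. by apply/eqP; rewrite eq_le dist_ge0 dist_le//; exact: joins_refl. Qed.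

Lemma dist_sym y y' : dist y y' = dist y' y.
Proof. by apply/eqP; rewrite eq_le; apply/andP; split; apply: le_dist => l j; apply: dist_le; exact: joins_sym. Qed.

Lemma dist_triangle y y' y'' : dist y y'' <= dist y y' + dist y' y''.
Proof.
rewrite -lerBlDr; apply: le_dist => l j; rewrite lerBlDr -lerBlDl; apply: le_dist => l' j'.
by rewrite lerBlDl; apply: dist_le; exact: joins_trans j j'.
Qed.

Lemma riem_ballE y (e : R) : riem_ball G y e = [set y' | dist y y' < e].
Proof.
apply/seteqP; split=> y' /=; rewrite /riem_ball /= riem_dist_lt.
  by move=> [l j le]; rewrite (le_lt_trans (dist_le j)).
by move=> /dist_lt[l j le]; exists l.
Qed.

Lemma near_dist y (e : R) : 0 < e -> \forall y' \near y, dist y y' < e.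
Proof. by move=> /(near_joins y); apply: filterS => y' [l j]; apply: le_lt_trans; exact: dist_le. Qed.

Lemma dist_nbhs y (P : set N) : nbhs y P -> exists2 e : R, 0 < e & forall y', dist y y' < e -> P y'.
Proof.
by move=> /joins_nbhs[e e0 H]; exists e => // y' /dist_lt[l j le]; exact: H j le.
Qed.

Lemma dist_lip y y' y'' : `|dist y y'' - dist y y'| <= dist y' y''.
Proof.
rewrite ler_norml; have := dist_triangle y y' y''; have := dist_triangle y y'' y'.
rewrite (dist_sym y'' y'); lra.
Qed.

Lemma open_ball y (e : R) : open [set y' | dist y y' < e].
Proof.
rewrite openE => y' /= h; have e0 : 0 < e - dist y y' by rewrite subr_gt0.
apply: filterS (near_dist y' e0) => y'' h' /=.
by have := dist_triangle y y' y''; lra.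
Qed.

Lemma continuous_lip (F : N -> R) (C : R) : (forall y y', `|F y' - F y| <= C * dist y y') -> continuous F.
Proof.
move=> H y; apply/cvgrPdist_lt => e e0.
have C0 : 0 < `|C| + 1 by rewrite ltr_wpDl.
have ec : 0 < e / (`|C| + 1) by rewrite divr_gt0.
apply: filterS (near_dist y ec) => y' h; rewrite distrC (le_lt_trans (H y y'))//.
rewrite ltr_pdivlMr// in h; apply: le_lt_trans h; rewrite mulrC ler_wpM2l ?dist_ge0//.
by rewrite (le_trans (ler_norm _))// lerDl.
Qed.

Section Compact.
Hypothesis cN : compact [set: N].

(** A property Q takes the place of an open cover, so that the chart and constants attached to a
    centre are recovered together with it. The e-ball around y lies inside the r-ball around z. *)
Lemma lebesgue_number (Q : N -> R -> Prop) : (forall z, exists2 r, 0 < r & Q z r) ->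
  exists2 e : R, 0 < e & forall y, exists z r, Q z r /\ dist z y + e < r.
Proof.
move=> H.
have cov : \forall e \near (0 : R)^'+, [set: N] `<=` (fun y => exists z r, Q z r /\ dist z y + e < r).
  apply: ((@compact_near_coveringP N [set: N]).1 cN R _ (fun e y => exists z r, Q z r /\ dist z y + e < r)) => y _. have [r r0 Qr] := H y; have r2 : 0 < r / 2 by rewrite divr_gt0.
  exists ([set y' | dist y y' < r / 2], [set e | e < r / 2]).
    by split; [exact: near_dist|exact: nbhs_right_lt].
  by move=> [y' e] [/= h1 h2]; exists y, r; split=> //; lra.
have [e [e0 He]] := filter_ex (filterI (nbhs_right_gt (0 : R)) cov).
by exists e => // y; exact: He.
Qed.

Lemma finite_net (e : R) : 0 < e -> exists s : seq N, forall y, exists2 z, z \in s & dist z y < e.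
Proof.
move=> e0.
(* The filter of properties that hold for all sufficiently large finite lists; the near-covering
   form of compactness then produces one list good for every point. *)
pose F := [set A : set (seq N) | exists s0 : seq N, forall s, {subset s0 <= s} -> A s].
have fF : Filter F.
  split; first by exists [::].
    move=> A B [sA HA] [sB HB]; exists (sA ++ sB) => s h; split.
      by apply: HA => y ys; apply: h; rewrite mem_cat ys.
    by apply: HB => y ys; apply: h; rewrite mem_cat ys orbT.
  by move=> A B AB [sA HA]; exists sA => s /HA/AB.
have [s Hs] : F (fun s => [set: N] `<=` (fun y => exists2 z, z \in s & dist z y < e)).
  apply: ((@compact_near_coveringP N [set: N]).1 cN (seq N) F (fun s y => exists2 z, z \in s & dist z y < e) fF) => y _.
  exists ([set y' | dist y y' < e], [set s : seq N | y \in s]).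
    by split; [exact: near_dist|exists [:: y] => s; apply; rewrite mem_head].
  by move=> [y' s] [/= h1 h2]; exists y.
by exists s => y; exact: Hs.
Qed.

End Compact.
End LengthDistance.

(** * Lebesgue measure of parallelograms *)

Section PlaneMeasure.
Variable R : realType.
Local Notation mu := (@lebesgue_measure R).
Local Notation RR := (measurableTypeR R).
Local Notation T2 := (RR * RR)%type.
Local Notation mu2 := (@lebesgue_measure R \x @lebesgue_measure R)%E.
Implicit Types (a b c d : R).

Definition affine a b : RR -> RR := fun t => a * t + b.

Lemma measurable_affine a b : measurable_fun setT (affine a b).
Proof. by apply: continuous_measurable_fun => t; apply: cvgD; [apply: cvgM; [exact: cvg_cst|exact: cvg_id]|exact: cvg_cst]. Qed.

Lemma lebesgue_affine a b (A : set RR) : a != 0 -> measurable A ->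
  mu A = (`|a|%:E * mu (affine a b @^-1` A))%E.
Proof.
move=> a0 mA.
pose m : {measure set RR -> \bar R} := mscale (NngNum (normr_ge0 a)) (pushforward mu (affine a b)).
have E : mu A = m (measurable_affine a b) A; last by exact: E.
apply: (@lebesgue_measure_unique R (m (measurable_affine a b))) mA => X -[[x y]] /= _ <-.
rewrite /m /mscale /= /pushforward lebesgue_measure_itv /= lte_fin.
have pos : 0 < a -> affine a b @^-1` `]x, y] = `](x - b) / a, (y - b) / a]%classic.
  move=> ap; apply/seteqP; split=> t; rewrite /affine /= !in_itv /= ltr_pdivrMr// ler_pdivlMr// ltrBlDr lerBrDr (mulrC t); by [].
have neg : a < 0 -> affine a b @^-1` `]x, y] = `[(y - b) / a, (x - b) / a[%classic.
  move=> ap; apply/seteqP; split=> t; rewrite /affine /= !in_itv /= ltr_ndivlMr// ler_ndivrMr// ltrBlDr lerBrDr (mulrC t) andbC; by [].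
have [a1|a1|/eqP] := ltgtP a 0; last by rewrite (negbTE a0).
  rewrite neg// lebesgue_measure_itv /= lte_fin ltr_nM2r ?invr_lt0// ltrD2r. case: ifP => xy; last by rewrite mule0.
  rewrite -!EFinB -EFinM ltr0_norm//; congr EFin; field; exact: a0.
rewrite pos// lebesgue_measure_itv /= lte_fin ltr_pM2r ?invr_gt0// ltrD2r.
case: ifP => xy; last by rewrite mule0.
rewrite -!EFinB -EFinM gtr0_norm//; congr EFin; field; exact: a0.
Qed.

Definition swap (v : T2) : T2 := (v.2, v.1).

Lemma measurable_swap : measurable_fun setT swap.
Proof. by apply: measurable_fun_pair; [exact: measurable_snd|exact: measurable_fst]. Qed.

Lemma mu2_swap (S : set T2) : measurable S -> mu2 S = mu2 (swap @^-1` S).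
Proof.
move=> mS; pose m : {measure set T2 -> \bar R} := pushforward mu2 swap.
apply: (@product_measure_unique _ _ _ _ _ _ _ (m measurable_swap)) => // A B mA mB.
rewrite /m /= /pushforward.
have -> : swap @^-1` (A `*` B) = B `*` A by apply/seteqP; split=> -[x y] [].
by rewrite product_measure1E// muleC.
Qed.

Definition shear c d (v : T2) : T2 := (v.1, c * v.1 + d * v.2).

Lemma measurable_shear c d : measurable_fun setT (shear c d).
Proof.
apply: measurable_fun_pair; first exact: measurable_fst.
have m1 := @measurable_fst _ _ RR RR; have m2 := @measurable_snd _ _ RR RR.
by apply: measurable_funD; apply: measurable_funM => //; exact: measurable_cst.
Qed.

Lemma mu2_shear c d (S : set T2) : d != 0 -> measurable S ->
  mu2 S = (`|d|%:E * mu2 (shear c d @^-1` S))%E.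
Proof.
move=> d0 mS; rewrite /product_measure1.
have mS' : measurable (shear c d @^-1` S) by rewrite -[X in measurable X]setTI; exact: measurable_shear.
rewrite -ge0_integralZl//; last exact: measurable_fun_xsection.
apply: eq_integral => x _ /=.
rewrite (@lebesgue_affine d (c * x) _ d0); last exact: measurable_xsection.
congr (_ * mu _)%E; apply/seteqP; split=> y; rewrite /xsection /affine /shear /= !inE /= (addrC (d * y)); by [].
Qed.

Definition parallelogram a b c d e f (h : R) : set T2 :=
  [set v | `|a * v.1 + b * v.2 - e| < h /\ `|c * v.1 + d * v.2 - f| < h].

Lemma measurable_lin a b : measurable_fun setT (fun v : T2 => a * v.1 + b * v.2 : RR).
Proof.
have m1 := @measurable_fst _ _ RR RR; have m2 := @measurable_snd _ _ RR RR.
by apply: measurable_funD; apply: measurable_funM => //; exact: measurable_cst.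
Qed.

Lemma measurable_parallelogram a b c d e f h : measurable (parallelogram a b c d e f h).
Proof.
have E a' b' e' : measurable [set v : T2 | `|a' * v.1 + b' * v.2 - e'| < h].
  have -> : [set v : T2 | `|a' * v.1 + b' * v.2 - e'| < h] = (fun v : T2 => a' * v.1 + b' * v.2 : RR) @^-1` `]e' - h, e' + h[.
    by apply/seteqP; split=> v /=; rewrite in_itv /= ltr_norml => /andP[? ?]; apply/andP; split; lra.
  by rewrite -[X in measurable X]setTI; apply: measurable_lin => //; exact: measurable_itv.
exact: measurableI (E a b e) (E c d f).
Qed.

(** Two shears with a swap of coordinates in between carry the square to the parallelogram. The
    shears divide by a, which may be assumed nonzero after exchanging the two inequalities. *)
Lemma mu2_parallelogram a b c d e f h : a * d - b * c != 0 -> 0 < h ->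
  mu2 (parallelogram a b c d e f h) = (4 * h ^+ 2 / `|a * d - b * c|)%:E.
Proof.
move=> D0 h0.
wlog a0 : a b c d e f D0 / a != 0.
  have [a0|a0] := eqVneq a 0; last by apply. have c0 : c != 0 by apply: contra_neq D0 => ->; rewrite a0 mul0r mulr0 subrr.
  have D0' : c * b - d * a != 0 by rewrite -oppr_eq0 opprB (mulrC d) (mulrC c). move=> /(_ _ _ _ _ f e D0' c0); rewrite -normrN opprB (mulrC d) (mulrC c) => <-.
  by congr (mu2 _); apply/seteqP; split=> v [].
pose D := a * d - b * c.
have box : mu2 (parallelogram 1 0 0 1 e f h) = (4 * h ^+ 2)%:E.
  have -> : parallelogram 1 0 0 1 e f h = `]e - h, e + h[%classic `*` `]f - h, f + h[%classic.
    apply/seteqP; split=> v; rewrite /parallelogram /= !in_itv /= !ltr_norml !mul1r !mul0r addr0 add0r;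
      by move=> [/andP[? ?] /andP[? ?]]; split; apply/andP; split; lra.
  have L x : mu `]x - h, x + h[%classic = (2 * h)%:E.
    by rewrite lebesgue_measure_itv /= lte_fin ifT -?EFinB; [congr EFin; ring|lra].
  transitivity ((2 * h)%:E * (2 * h)%:E)%E.
    by rewrite -{1}(L e) -(L f); apply: product_measure1E; exact: measurable_itv.
  by rewrite -EFinM; congr EFin; ring.
have Da : D / a != 0 by rewrite mulf_neq0// invr_eq0.
have s1 := @mu2_shear (c / a) (D / a) _ Da (measurable_parallelogram 1 0 0 1 e f h).
pose S2 := shear (c / a) (D / a) @^-1` parallelogram 1 0 0 1 e f h.
have mS2 : measurable S2 by rewrite -[X in measurable X]setTI; apply: measurable_shear => //; exact: measurable_parallelogram.
have mS2' : measurable (swap @^-1` S2) by rewrite -[X in measurable X]setTI; exact: measurable_swap.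
have s2 := @mu2_shear b a _ a0 mS2'.
have mS3 : measurable (shear b a @^-1` (swap @^-1` S2)) by rewrite -[X in measurable X]setTI; exact: measurable_shear.
rewrite box (mu2_swap mS2) s2 (mu2_swap mS3) in s1.
have E : swap @^-1` (shear b a @^-1` (swap @^-1` S2)) = parallelogram a b c d e f h.
  have K v1 v2 : c / a * (a * v1 + b * v2) + D / a * v2 = c * v1 + d * v2 by rewrite /D; field.
  by apply/seteqP; split=> v; rewrite /S2 /swap /shear /parallelogram /= !mul1r !mul0r addr0 add0r (addrC (b * _)) K.
rewrite E in s1; rewrite muleA -EFinM -normrM divfK// in s1.
have D1 : `|D| != 0 by rewrite normr_eq0.
have -> : mu2 (parallelogram a b c d e f h) = (`|D|^-1%:E * (`|D|%:E * mu2 (parallelogram a b c d e f h)))%E.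
  by rewrite muleA -EFinM mulVf// mul1e.
by rewrite -s1 -EFinM mulrC.
Qed.

End PlaneMeasure.

(** * Dyadic squares and comparison of measures on open sets *)

Section DyadicCells.
Variable R : realType.
Local Notation RR := (measurableTypeR R).
Local Notation T2 := (RR * RR)%type.
Implicit Types (n k : nat) (v u : T2).

Definition coord n (t : R) : int := Num.floor (2 ^+ n * t).

Definition cell n (ij : int * int) : set T2 := [set v | coord n v.1 = ij.1 /\ coord n v.2 = ij.2].

Let p2 n : 0 < (2 : R) ^+ n. Proof. by rewrite exprn_gt0. Qed.

Lemma coordP n (t : R) i : coord n t = i <-> i%:~R / 2 ^+ n <= t < (i + 1)%:~R / 2 ^+ n.
Proof.
rewrite ler_pdivrMr// ltr_pdivlMr// (mulrC t); split=> [<-|]; last exact: floor_def.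
exact: floor_itv.
Qed.

Lemma measurable_cell n ij : measurable (cell n ij).
Proof.
have -> : cell n ij = `[ij.1%:~R / 2 ^+ n, (ij.1 + 1)%:~R / 2 ^+ n[%classic `*` `[ij.2%:~R / 2 ^+ n, (ij.2 + 1)%:~R / 2 ^+ n[%classic.
  by apply/seteqP; split=> v; rewrite /cell /= !in_itv /= !coordP.
by apply: measurableX; exact: measurable_itv.
Qed.

Lemma cell_near n ij v u : cell n ij v -> cell n ij u -> `|u - v| < (2 ^+ n)^-1.
Proof.
move=> [/coordP a1 /coordP a2] [/coordP b1 /coordP b2].
rewrite normB_coord !ltr_norml; move: a1 a2 b1 b2; rewrite !intrD !mulrDl.
have -> : 1%:~R / 2 ^+ n = (2 ^+ n)^-1 :> R by rewrite mul1r.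
lra.
Qed.

Lemma cell_succ n ij v : cell n.+1 ij v -> cell n.+1 ij `<=` cell n (coord n v.1, coord n v.2).
Proof.
have E (s t : R) (i : int) : coord n.+1 s = i -> coord n.+1 t = i -> coord n t = coord n s.
  move=> /coordP; rewrite exprS => /andP[h1 h2] /coordP; rewrite exprS => /andP[h3 h4]. apply/coordP.
  have /andP[c1 c2] : (coord n s)%:~R / 2 ^+ n <= s < (coord n s + 1)%:~R / 2 ^+ n by apply/coordP. set j := coord n s in c1 c2 *. rewrite ler_pdivrMr// ltr_pdivlMr//.
  move: h1 h2 h3 h4 c1 c2; rewrite !ler_pdivrMr ?ltr_pdivlMr ?mulr_gt0//. set q := 2 ^+ n; rewrite !(mulrCA _ 2) => h1 h2 h3 h4 c1 c2.
  have k1 : 2 * j%:~R < (i + 1)%:~R :> R by lra. have k2 : i%:~R < 2 * (j + 1)%:~R :> R by lra. have k1' : (2 * j < i + 1)%R by rewrite -(ltr_int R) intrM.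
  have k2' : (i < 2 * (j + 1))%R by rewrite -(ltr_int R) intrM. have k3 : (2 * j <= i)%R by lia. have k4 : (i + 1 <= 2 * (j + 1))%R by lia.
  have k3' : (2 * j)%:~R <= i%:~R :> R by rewrite ler_int. have k4' : (i + 1)%:~R <= (2 * (j + 1))%:~R :> R by rewrite ler_int. by move: k3' k4'; rewrite !intrM; lra.
by move=> [v1 v2] u [u1 u2]; split; [exact: E v1 u1|exact: E v2 u2].
Qed.

Section Decomposition.
Variable Q : set T2 -> Prop.
Hypothesis QS : forall A B, Q A -> B `<=` A -> Q B.

(** The level-n dyadic squares satisfying Q, enumerated by [pickle_inv]. As Q passes to subsets, the
    unions increase with n and no maximal squares have to be selected. *)
Definition cells n k : set T2 :=
  if pickle_inv k is Some ij then if `[< Q (cell n ij) >] then cell n ij else set0 else set0.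

Lemma measurable_cells n k : measurable (cells n k).
Proof. by rewrite /cells; case: (pickle_inv k) => [ij|//]; case: ifP => // _; exact: measurable_cell. Qed.

Lemma trivIset_cells n : trivIset setT (cells n).
Proof.
apply/trivIsetP => k k' _ _ kk'; apply/seteqP; split=> [v []|//]; rewrite /cells.
case E : (pickle_inv k) => [ij|//]; case E' : (pickle_inv k') => [ij'|//].
case: ifP => // _ [a1 a2]; case: ifP => // _ [b1 b2].
have eij : ij = ij' by rewrite (surjective_pairing ij) (surjective_pairing ij') -a1 -a2 b1 b2.
have := @pickle_invK (int * int)%type k; have := @pickle_invK (int * int)%type k'.
by rewrite E E' /= eij => e1 e2; move: kk'; rewrite -e1 -e2 eqxx.
Qed.

Lemma bigcup_cellsP n v : (\bigcup_k cells n k) v <-> Q (cell n (coord n v.1, coord n v.2)).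
Proof.
split=> [[k _]|h].
  rewrite /cells; case: (pickle_inv k) => [[i j]|//]; case: asboolP => // h [/= v1 v2]. apply: (QS h) => u [/= u1 u2]; split; [exact: etrans u1 v1|exact: etrans u2 v2].
exists (pickle (coord n v.1, coord n v.2)); first exact: I.
rewrite /cells pickleK_inv; case: asboolP => [_|nh]; [by split|case: (nh h)].
Qed.

Lemma bigcup_cells_ndecr : nondecreasing_seq (fun n => \bigcup_k cells n k).
Proof.
apply/nondecreasing_seqP => n; apply/subsetPset => v; rewrite !bigcup_cellsP => h.
by apply: QS h _; apply: cell_succ.
Qed.

Lemma cells_cover (U : set T2) :
  (forall v, U v -> exists2 r : R, 0 < r & Q [set u | `|u - v| < r]) -> (forall A, Q A -> A `<=` U) -> U = \bigcup_n \bigcup_k cells n k.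
Proof.
move=> HU QU; apply/seteqP; split=> [v /HU[r r0 h]|v [n _ /bigcup_cellsP/QU]]; last by apply; split.
pose n := Num.bound r^-1.
exists n => //; rewrite bigcup_cellsP; apply: QS h _ => u /= hu.
have hv : cell n (coord n v.1, coord n v.2) v by split.
apply: (lt_trans (cell_near hv hu)); rewrite invf_plt ?posrE//.
apply: (@lt_trans _ _ n%:R); first by rewrite archi_boundP// invr_ge0 ltW.
by rewrite -natrX ltr_nat ltn_expl.
Qed.

End Decomposition.

Lemma open_ballP (U : set T2) : open (U : set (R * R)) -> forall v, U v -> exists2 r : R, 0 < r & [set u | `|u - v| < r] `<=` U.
Proof.
move=> + v Uv; rewrite openE => /(_ v Uv) /nbhs_ballP[r /= r0 H]; exists r => // u h.
by apply: H; rewrite -ball_normE /= distrC.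
Qed.

Lemma measurable_open (U : set T2) : open (U : set (R * R)) -> measurable U.
Proof.
move=> oU; rewrite (@cells_cover (fun A => A `<=` U) _ U).
- apply: bigcupT_measurable => n; apply: bigcupT_measurable => k; exact: measurable_cells.
- by move=> A B AU BA; exact: subset_trans AU.
- exact: open_ballP.
- by [].
Qed.

(** U is the increasing union, over the levels, of disjoint unions of cells on which the inequality
    is assumed. *)
Lemma measure_le_open (nu m : {measure set T2 -> \bar R}) (O U : set T2) :
  open (U : set (R * R)) -> U `<=` O -> (forall v, O v -> exists2 r : R, 0 < r &
    forall n ij, cell n ij `<=` [set u | `|u - v| < r] -> (nu (cell n ij) <= m (cell n ij))%E) ->
  (nu U <= m U)%E.
Proof.
move=> oU UO H.
pose Q (A : set T2) := A `<=` U /\ exists v r, [/\ O v, 0 < r, A `<=` [set u | `|u - v| < r] &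
  forall n ij, cell n ij `<=` [set u | `|u - v| < r] -> (nu (cell n ij) <= m (cell n ij))%E].
have QS A B : Q A -> B `<=` A -> Q B.
  move=> [AU [v [r [Ov r0 Ar h]]]] BA; split; first exact: subset_trans AU. by exists v, r; split=> //; exact: subset_trans Ar.
have UE : U = \bigcup_n \bigcup_k cells Q n k.
  apply: cells_cover => // [v Uv|A []//]. have [r r0 h] := open_ballP oU Uv; have [r' r'0 h'] := H v (UO v Uv). exists (Num.min r r'); first by rewrite lt_min r0.
  have hm : [set u : T2 | `|u - v| < Num.min r r'] `<=` [set u | `|u - v| < r'].
    by move=> u /=; rewrite lt_min => /andP[].
  split; first by move=> u /=; rewrite lt_min => /andP[+ _]; exact: h. by exists v, r'; split=> //; exact: UO.
have le_n n : (nu (\bigcup_k cells Q n k) <= m U)%E.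
  apply: (@le_trans _ _ (m (\bigcup_k cells Q n k))).
    rewrite !measure_bigcup//; try (by move=> k _; exact: measurable_cells); try exact: trivIset_cells. apply: lee_nneseries => // k _; rewrite /cells.
    case: (pickle_inv k) => [ij|]; last by rewrite !measure0. case: asboolP => [[_ [v [r [_ _ Ar h]]]]|_]; last by rewrite !measure0. exact: h.
  apply: le_measure; rewrite ?inE.
  - by apply: bigcupT_measurable => k; exact: measurable_cells.
  - exact: measurable_open.
  - by rewrite [X in _ `<=` X]UE => v [k _ h]; exists n => //; exists k.
have cv : (nu \o (fun n => \bigcup_k cells Q n k)) n @[n --> \oo] --> nu U.
  rewrite [X in _ --> nu X]UE; apply: nondecreasing_cvg_mu.
  - by move=> n; apply: bigcupT_measurable => k; exact: measurable_cells.
  - by rewrite -UE; exact: measurable_open.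
  - exact: bigcup_cells_ndecr.
rewrite -(cvg_lim _ cv)//; apply: lime_le; first by apply/cvg_ex; exists (nu U).
by apply: nearW => n; exact: le_n.
Qed.

End DyadicCells.

(** * Regularity of finite Borel measures on the plane *)

Section Regularity.
Variable R : realType.
Local Notation RR := (measurableTypeR R).
Local Notation T2 := (RR * RR)%type.
Variable m : {measure set T2 -> \bar R}.
Hypothesis mfin : (m setT < +oo)%E.

Definition approx (B : set T2) := forall e : R, 0 < e -> exists U F : set T2,
  [/\ open (U : set (R * R)), closed (F : set (R * R)), F `<=` B, B `<=` U & (m (U `\` F) < e%:E)%E].

Lemma approx_sub B (e : R) : 0 < e -> approx B -> exists U F : set T2,
  [/\ open (U : set (R * R)), closed (F : set (R * R)), F `<=` B, B `<=` U & (m (U `\` F) <= e%:E)%E].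
Proof. by move=> e0 /(_ e e0)[U [F [? ? ? ? /ltW ?]]]; exists U, F. Qed.

Lemma measurable_closed (F : set T2) : closed (F : set (R * R)) -> measurable F.
Proof. by move=> cF; rewrite -[F]setCK; apply: measurableC; apply: measurable_open; rewrite openC. Qed.

Let mlt B : measurable B -> (m B < +oo)%E.
Proof. by move=> mB; apply: le_lt_trans mfin; apply: le_measure; rewrite ?inE. Qed.

Lemma approxC B : approx B -> approx (~` B).
Proof.
move=> H e e0; have [U [F [oU cF FB BU h]]] := H e e0.
exists (~` F), (~` U); split; rewrite ?openC ?closedC//; try exact: subsetC.
by rewrite setDE setCK setIC -setDE.
Qed.

(** An infinite union of closed sets need not be closed, so it is cut at a finite stage; finiteness
    of the measure makes the remainder small. Half of e pays for the approximations, weighted by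
    powers of 1/2. *)
Lemma approx_bigcup (B : (set T2)^nat) : (forall k, approx (B k)) -> approx (\bigcup_k B k).
Proof.
move=> H e e0.
pose d k : R := e / 2 / (2 ^ k.+1)%:R; have d0 k : 0 < d k by rewrite !divr_gt0// ltr0n expn_gt0.
have /choice[f Hf] k : exists UF : set T2 * set T2, [/\ open (UF.1 : set (R * R)), closed (UF.2 : set (R * R)), UF.2 `<=` B k, B k `<=` UF.1 & (m (UF.1 `\` UF.2) <= (d k)%:E)%E].
  by have [U [F h]] := approx_sub (d0 k) (H k); exists (U, F).
pose U := \bigcup_k (f k).1; pose F n := \bigcup_(k in `I_n) (f k).2.
have oU : open (U : set (R * R)) by apply: bigcup_open => k _; have [] := Hf k.
have cF n : closed (F n : set (R * R)).
  by apply: closed_bigcup; [exact: finite_II|move=> k _; have [] := Hf k].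
have mU := measurable_open oU; have mF n := measurable_closed (cF n).
pose Finf := \bigcup_k (f k).2.
have mf1 k : measurable (f k).1 by apply: measurable_open; have [] := Hf k.
have mf2 k : measurable (f k).2 by apply: measurable_closed; have [] := Hf k.
have mFinf : measurable Finf by apply: bigcupT_measurable.
have le1 : (m (U `\` Finf) <= (e / 2)%:E)%E.
  apply: (@le_trans _ _ (\sum_(k <oo) m ((f k).1 `\` (f k).2))%E).
    apply: measure_sigma_subadditive => //.
    - by move=> k; exact: measurableD.
    - exact: measurableD.
    - move=> v [[k _ h] nv]; exists k => //; split=> // h'; apply: nv; by exists k.
  apply: (@le_trans _ _ (\sum_(k <oo) (d k)%:E)%E).
    by apply: lee_nneseries => // k _; have [] := Hf k.
  by apply: (@epsilon_trick0 R (e / 2) xpredT); rewrite divr_ge0// ltW.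
have cv : m (U `\` F n) @[n --> \oo] --> m (U `\` Finf).
  have -> : U `\` Finf = \bigcap_n (U `\` F n).
    apply/seteqP; split=> v.
      move=> [Uv nF] n _; split=> // -[k _ h]; apply: nF; by exists k.
    move=> h; split; first by have [] := h 0%N I. by move=> [k _ hk]; have [_] := h k.+1 I; apply; exists k => //=.
  apply: nonincreasing_cvg_mu.
  - by apply: mlt; exact: measurableD.
  - by move=> n; exact: measurableD.
  - by apply: bigcapT_measurable => n; exact: measurableD.
  - move=> n n' nn; apply/subsetPset; apply: setDS => v [k /= kn h]; exists k => //=; exact: leq_trans nn.
have lt1 : (m (U `\` Finf) < e%:E)%E by apply: le_lt_trans le1 _; rewrite lte_fin; lra.
have [n hn] : exists n, (m (U `\` F n) < e%:E)%E.
  apply: contrapT => /forallNP h; suff : (e%:E <= m (U `\` Finf))%E by rewrite leNgt lt1. rewrite -(cvg_lim _ cv)//; apply: lime_ge; first by apply/cvg_ex; exists (m (U `\` Finf)).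
  by apply: nearW => n; rewrite leNgt; apply/negP/h.
exists U, (F n); split=> //.
  by move=> v [k _ h]; exists k => //; have [_ _ s _ _] := Hf k; exact: s.
by move=> v [k _ h]; exists k => //; have [_ _ _ s _] := Hf k; exact: s.
Qed.

Lemma approx_half (f : T2 -> R) : continuous (f : R * R -> R) -> forall a, approx [set v | a < f v].
Proof.
move=> cf a e e0; pose U := [set v : T2 | a < f v]; pose F n := [set v : T2 | a + n.+1%:R^-1 <= f v].
have oU : open (U : set (R * R)) by apply: (@open_comp _ _ f [set t | a < t]) => [v _|]; [exact: cf|exact: open_gt].
have cF n : closed (F n : set (R * R)).
  by apply: (@closed_comp _ _ f [set t | a + n.+1%:R^-1 <= t]) => [v _|]; [exact: cf|exact: closed_ge].
have mU := measurable_open oU; have mF n := measurable_closed (cF n).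
have cv : m (U `\` F n) @[n --> \oo] --> m set0.
  have <- : \bigcap_n (U `\` F n) = set0.
    apply/seteqP; split=> // v h; have [Uv _] := h 0%N I. have d0 : 0 < f v - a by rewrite subr_gt0. pose n := Num.bound (f v - a)^-1; have [_] := h n I; apply.
    rewrite /F /= -lerBrDl -[leRHS]invrK lef_pV2 ?posrE ?invr_gt0// ltW//. apply: lt_trans (archi_boundP _) _; first by rewrite invr_ge0 ltW. by rewrite ltr_nat.
  apply: nonincreasing_cvg_mu.
  - by apply: mlt; exact: measurableD.
  - by move=> n; exact: measurableD.
  - by apply: bigcapT_measurable => n; exact: measurableD.
  - move=> n n' nn; apply/subsetPset; apply: setDS => v; apply: le_trans. by rewrite lerD2l lef_pV2 ?posrE// ler_nat.
have [n hn] : exists n, (m (U `\` F n) < e%:E)%E.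
  apply: contrapT => /forallNP h; suff : (e%:E <= m set0)%E by rewrite measure0 lee_fin leNgt e0. rewrite -(cvg_lim _ cv)//; apply: lime_ge; first by apply/cvg_ex; exists (m set0).
  by apply: nearW => n; rewrite leNgt; apply/negP/h.
exists U, (F n); split=> // v /=; apply: lt_le_trans; by rewrite ltrDl invr_gt0.
Qed.

(** Well approximated sets form a sigma-algebra, and it contains the preimages of half-lines under
    both coordinates. *)
Lemma approx_measurable B : measurable B -> approx B.
Proof.
have a0 : approx set0.
  move=> e e0; exists set0, set0; split; [exact: open0|exact: closed0|by []|by []|]. by rewrite setD0 measure0 lte_fin.
have H (f : T2 -> RR) : continuous (f : R * R -> R) -> forall A : set RR, measurable A -> approx (f @^-1` A).
  move=> cf A mA. rewrite RGenOInfty.measurableE in mA. have := mA; apply: (@smallest_sub _ _ _ (fun A => approx (f @^-1` A))).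
    split; first by rewrite preimage_set0.
      by move=> A' h; rewrite setTD preimage_setC; exact: approxC.
    by move=> A' h; rewrite preimage_bigcup; exact: approx_bigcup.
  move=> _ [x ->]; have -> : f @^-1` `]x, +oo[ = [set v | x < f v].
    by apply/seteqP; split=> v /=; rewrite in_itv/= andbT.
  exact: approx_half.
rewrite measurable_prod_measurableType; apply: (@smallest_sub _ _ _ approx).
  split=> //; first by move=> A h; rewrite setTD; exact: approxC. exact: approx_bigcup.
move=> _ [A1 mA1 [A2 mA2 <-]].
have I2 A A' : approx A -> approx A' -> approx (A `&` A').
  move=> hA hA'; rewrite -[A `&` A']setCK setCI; apply: approxC; rewrite -bigcup2E. apply: approx_bigcup => k; rewrite /bigcup2; case: ifP => _; first exact: approxC.
  by case: ifP => _ //; exact: approxC.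
have -> : A1 `*` A2 = (fst : T2 -> RR) @^-1` A1 `&` (snd : T2 -> RR) @^-1` A2 by [].
by apply: I2; apply: H => //; [exact: cont_fst|exact: cont_snd].
Qed.

Lemma measure_le_approx (nu : {measure set T2 -> \bar R}) (O B : set T2) :
  open (O : set (R * R)) -> measurable B -> B `<=` O -> (forall U, open (U : set (R * R)) -> U `<=` O -> (nu U <= m U)%E) -> (nu B <= m B)%E.
Proof.
move=> oO mB BO H; apply/lee_addgt0Pr => e e0.
have [U [F [oU cF FB BU h]]] := approx_measurable mB e0.
pose V := U `&` O; have oV : open (V : set (R * R)) by exact: openI.
have BV : B `<=` V by move=> v Bv; split; [exact: BU|exact: BO].
have mV := measurable_open oV; have mF := measurable_closed cF; have mU := measurable_open oU.
apply: (@le_trans _ _ (nu V)); first by apply: le_measure; rewrite ?inE.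
apply: (le_trans (H V oV _)); first by move=> v [].
have -> : V = B `|` (V `\` B) by rewrite setDUK.
apply: (le_trans (measureU2 _ _ _)) => //; first exact: measurableD.
rewrite leeD2l//; apply: le_trans (ltW h); apply: le_measure; rewrite ?inE; try exact: measurableD.
by move=> v [[Uv _] nB]; split=> // /FB.
Qed.

End Regularity.

(** * Properties of the Riemannian area *)

Section Area.
Variables (R : realType) (N : surface R).
Implicit Types (G : riemannian_metric N) (p q y : N) (A B C : set N).
Local Notation RR := (measurableTypeR R).
Local Notation T2 := (RR * RR)%type.

Definition borel B := <<s @open N >> B.

Lemma borel_open B : open B -> borel B.
Proof. exact: sub_sigma_algebra. Qed.

Lemma borelC B : borel B -> borel (~` B).
Proof.
have [_ h _] := @smallest_sigma_algebra N setT (@open N).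
by move=> /h; rewrite setTD.
Qed.

Lemma borelU B C : borel B -> borel C -> borel (B `|` C).
Proof.
move=> bB bC; have [h0 _ h] := @smallest_sigma_algebra N setT (@open N).
by rewrite -bigcup2E; apply: h => k; rewrite /bigcup2; case: ifP => // _; case: ifP.
Qed.

Lemma borelI B C : borel B -> borel C -> borel (B `&` C).
Proof. by move=> bB bC; rewrite -[_ `&` _]setCK setCI; apply: borelC; apply: borelU; exact: borelC. Qed.

Lemma borelD B C : borel B -> borel C -> borel (B `\` C).
Proof. by move=> bB bC; rewrite setDE; apply: borelI => //; exact: borelC. Qed.

Lemma borelT : borel setT.
Proof. exact: borel_open openT. Qed.

Lemma measurable_chart_inv p B : borel B -> measurable (cod p `&` chart_inv p @^-1` B : set T2).
Proof.
have mc : measurable (cod p : set T2) := measurable_open (@open_cod R N p).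
apply: (@smallest_sub _ _ _ (fun B => measurable (cod p `&` chart_inv p @^-1` B : set T2))).
  split; first by rewrite preimage_set0 setI0.
    move=> C mC; have -> : cod p `&` chart_inv p @^-1` (setT `\` C) = cod p `\` (cod p `&` chart_inv p @^-1` C).
      by apply/seteqP; split=> x [cx /= h]; split=> //; [move=> [_]; case: h|split=> // Cx; apply: h].
    exact: measurableD.
  move=> C mC; rewrite preimage_bigcup setI_bigcupr; exact: bigcupT_measurable.
by move=> U oU; apply: measurable_open; exact: open_chart_inv.
Qed.

Lemma measurable_chart p B : borel B -> B `<=` dom p -> measurable (chart p @` B : set T2).
Proof. by move=> bB /codE ->; exact: measurable_chart_inv. Qed.

Lemma measurable_density G p : measurable_fun (cod p : set T2) (area_density G p : T2 -> RR).
Proof.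
apply: (measurability _ (RGenOInfty.measurableE R)) => _ [_ [x ->] <-].
apply: measurable_open; rewrite openE => w [cw /=]; rewrite in_itv/= andbT => h.
have n1 : \forall u \near w, cod p u by apply: open_nbhs_nbhs; split=> //; exact: open_cod.
have n2 := @continuous_density _ _ G _ _ cw [set t | x < t] (lt_nbhsr h).
by apply: filterS2 n1 n2 => u cu hu; split=> //=; rewrite in_itv/= andbT.
Qed.

Lemma measurable_edensity G p B : borel B -> B `<=` dom p ->
  measurable_fun (chart p @` B : set T2) (fun x : T2 => (area_density G p x)%:E).
Proof.
move=> bB Bp; apply/measurable_EFinP.
apply: (measurable_funS (E := cod p : set T2)).
- exact: measurable_open (@open_cod R N p).
- by move=> _ [y By <-]; exact/cod_chart/Bp.
- exact: measurable_density.
Qed.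

Lemma density_ge0 G p x : (0 <= (area_density G p x)%:E)%E.
Proof. by rewrite lee_fin sqrtr_ge0. Qed.

Lemma chart_area_ge0 G p B : (0 <= chart_area G p B)%E.
Proof. by apply: integral_ge0 => x _; exact: density_ge0. Qed.

Lemma chart_area_cut G p B C : borel B -> borel C -> B `<=` dom p ->
  chart_area G p B = (chart_area G p (B `&` C) + chart_area G p (B `\` C))%E.
Proof.
move=> bB bC Bp.
have s1 : B `&` C `<=` dom p by move=> y [/Bp].
have s2 : B `\` C `<=` dom p by move=> y [/Bp].
have m1 := measurable_chart (borelI bB bC) s1; have m2 := measurable_chart (borelD bB bC) s2.
rewrite /chart_area -ge0_integral_setU//.
- by rewrite -image_setU setUIDK.
- by rewrite -image_setU setUIDK; exact: measurable_edensity.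
- by move=> x _; exact: density_ge0.
- apply/disj_setPS => x [[y [By Cy] <-] [y' [By' nC] e]]. by apply: nC; rewrite -(chartK (Bp _ By')) e chartK//; exact: Bp.
Qed.

Lemma area_sup G A n (p : 'I_n -> N) (B : 'I_n -> set N) :
  (forall k, borel (B k) /\ B k `<=` A `&` dom (p k)) -> trivIset setT B -> (\sum_(k < n) chart_area G (p k) (B k) <= area G A)%E.
Proof. by move=> h1 h2; apply: ereal_sup_ubound; exists n, p, B. Qed.

Lemma area_le G A (c : \bar R) :
  (forall n (p : 'I_n -> N) (B : 'I_n -> set N),
    (forall k, borel (B k) /\ B k `<=` A `&` dom (p k)) -> trivIset setT B -> (\sum_(k < n) chart_area G (p k) (B k) <= c)%E) -> (area G A <= c)%E.
Proof. by move=> H; apply: ub_ereal_sup => _ [n [p [B [h1 h2 ->]]]]; exact: H. Qed.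

Lemma chart_area_le_area G A p B : borel B -> B `<=` A -> B `<=` dom p -> (chart_area G p B <= area G A)%E.
Proof.
move=> bB BA Bp; have := @area_sup G A 1 (fun=> p) (fun=> B).
rewrite big_ord1; apply; first by move=> _; split=> // y By; split; [exact: BA|exact: Bp].
by move=> i j _ _ _; rewrite [i]ord1 [j]ord1.
Qed.

Lemma area_ge0 G A : (0 <= area G A)%E.
Proof.
have := @area_sup G A 0 (fun i => False_rect _ (notF (ltn_ord i))) (fun=> set0).
by rewrite big_ord0; apply; [case|case].
Qed.

Lemma le_area G A B : A `<=` B -> (area G A <= area G B)%E.
Proof.
move=> AB; apply: area_le => n p C h1 h2; apply: area_sup => // k.
by have [bC CA] := h1 k; split=> // y /CA[/AB].
Qed.

Lemma area_cut_le G A C : borel C -> (area G A <= area G (A `&` C) + area G (A `\` C))%E.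
Proof.
move=> bC; apply: area_le => n p B h1 h2.
rewrite (eq_bigr (fun k => chart_area G (p k) (B k `&` C) + chart_area G (p k) (B k `\` C))%E); last first.
  by move=> k _; have [bB BA] := h1 k; apply: chart_area_cut => // y /BA[].
rewrite big_split /=; apply: leeD; apply: area_sup => [k|i j _ _ [y [[B1 ?] [B2 ?]]]].
- have [bB BA] := h1 k; split; first exact: borelI. by move=> y [/BA[Ay py] Cy].
- by apply: h2 => //; exists y.
- have [bB BA] := h1 k; split; first exact: borelD. by move=> y [/BA[Ay py] Cy].
- by apply: h2 => //; exists y.
Qed.

(** Finite families for A and for B concatenate to one for C. When the area of C is finite, the
    suprema are taken one after the other by subtraction. *)
Lemma area_superadd G A B C : A `&` B = set0 -> A `|` B `<=` C ->
  (area G A + area G B <= area G C)%E.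
Proof.
move=> AB ABC; have [->|Cfin] := eqVneq (area G C) +oo%E; first by rewrite leey.
have Af : area G A \is a fin_num.
  rewrite ge0_fin_numE ?area_ge0//; apply: (@le_lt_trans _ _ (area G C)); last by rewrite ltey. by apply: le_area => y Ay; apply: ABC; left.
have Bf : area G B \is a fin_num.
  rewrite ge0_fin_numE ?area_ge0//; apply: (@le_lt_trans _ _ (area G C)); last by rewrite ltey. by apply: le_area => y Ay; apply: ABC; right.
rewrite -leeBrDr//; apply: area_le => n p D h1 h2.
set a := (\sum_(k < n) _)%E.
have af : a \is a fin_num.
  rewrite ge0_fin_numE; last by apply: sume_ge0 => k _; exact: chart_area_ge0. by apply: le_lt_trans (area_sup G h1 h2) _; rewrite -ge0_fin_numE// area_ge0.
rewrite leeBrDr// addeC -leeBrDr//; apply: area_le => n' p' D' h1' h2'.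
rewrite leeBrDr// addeC.
pose q (k : 'I_(n + n')) := match fintype.split k with inl i => p i | inr j => p' j end.
pose E (k : 'I_(n + n')) := match fintype.split k with inl i => D i | inr j => D' j end.
have := @area_sup G C (n + n') q E.
rewrite big_split_ord /=.
have -> : (\sum_(i < n) chart_area G (q (lshift n' i)) (E (lshift n' i)) = a)%E.
  by apply: eq_bigr => i _; rewrite /q /E (unsplitK (inl i)).
have -> : (\sum_(i < n') chart_area G (q (rshift n i)) (E (rshift n i)) = \sum_(i < n') chart_area G (p' i) (D' i))%E.
  by apply: eq_bigr => i _; rewrite /q /E (unsplitK (inr i)).
apply.
  move=> k; rewrite /q /E; case: (fintype.split k) => i.
    by have [b s] := h1 i; split=> // y /s[Ay dy]; split=> //; apply: ABC; left.
  by have [b s] := h1' i; split=> // y /s[Ay dy]; split=> //; apply: ABC; right.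
have AB0 y : A y -> B y -> False by move=> Ay By; have : (A `&` B) y by []; rewrite AB.
move=> i j _ _ [y]; rewrite /E; case: (splitP i) => i' ei; case: (splitP j) => j' ej [y1 y2].
- apply: ord_inj; rewrite ei ej /=; congr nat_of_ord; apply: h2 => //; by exists y.
- by have [_ /(_ y y1)[Ay _]] := h1 i'; have [_ /(_ y y2)[By _]] := h1' j'; case: (AB0 y Ay By).
- by have [_ /(_ y y1)[Ay _]] := h1' i'; have [_ /(_ y y2)[By _]] := h1 j'; case: (AB0 y By Ay).
- apply: ord_inj; rewrite ei ej /=; congr (n + nat_of_ord _)%N; apply: h2' => //; by exists y.
Qed.

Lemma area_cover G A n (C : nat -> set N) : (forall i, borel (C i)) ->
  (forall y, A y -> exists2 i, (i < n)%N & C i y) -> (area G A <= \sum_(i < n) area G (A `&` C i))%E.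
Proof.
move=> bC; elim: n A => [|n IH] A HA.
  rewrite big_ord0; apply: area_le => n p B h1 h2; rewrite big1// => k _. have -> : B k = set0 by apply/seteqP; split=> // y By; have [_ /(_ y By)[/HA[]]] := h1 k.
  by rewrite /chart_area image_set0 integral_set0.
rewrite big_ord_recr /=; apply: (le_trans (area_cut_le G A (bC n))).
rewrite addeC; apply: leeD => //; apply: le_trans (IH _ _) _.
  move=> y [Ay nC]; have [i] := HA y Ay; rewrite ltnS leq_eqVlt => /orP[/eqP->//|ni Ci]; by exists i.
by apply: lee_sum => i _; apply: le_area => y [[Ay _] Ci].
Qed.

Lemma area_packing G A n (C : nat -> set N) : (forall i, borel (C i)) ->
  trivIset setT C -> (\sum_(i < n) area G (A `&` C i) <= area G A)%E.
Proof.
move=> bC tC; elim: n A => [|n IH] A; first by rewrite big_ord0 area_ge0.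
rewrite big_ord_recr /=.
apply: (@le_trans _ _ (area G (A `\` C n) + area G (A `&` C n))%E).
  apply: leeD => //; apply: le_trans (IH (A `\` C n)). apply: lee_sum => i _; apply: le_area => y [Ay Ci]; split=> //; split=> // Cn.
  have := tC i n I I (ex_intro _ y (conj Ci Cn)) => e; by have := ltn_ord i; rewrite e ltnn.
apply: area_superadd; first by apply/seteqP; split=> // y [[_ nC] [_ /nC]].
by move=> y [[]|[]].
Qed.

Lemma area_scale G G' A (c : R) : 0 <= c ->
  (forall p x, cod p x -> A (chart_inv p x) -> area_density G' p x <= c * area_density G p x) -> (area G' A <= c%:E * area G A)%E.
Proof.
move=> c0 H; apply: area_le => n p B h1 h2.
apply: (@le_trans _ _ (c%:E * \sum_(k < n) chart_area G (p k) (B k))%E); last first.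
  by apply: lee_wpmul2l; [rewrite lee_fin|exact: area_sup].
rewrite ge0_sume_distrr; last by move=> k _; exact: chart_area_ge0.
apply: lee_sum => k _; have [bB BA] := h1 k.
have Bp : B k `<=` dom (p k) by move=> y /BA[].
have mB := measurable_chart bB Bp; have mf := measurable_edensity G bB Bp.
rewrite /chart_area -ge0_integralZl_EFin//.
- apply: ge0_le_integral => //.
  + by move=> x _; exact: density_ge0.
  + exact: measurable_edensity.
  + exact: measurable_funeM.
  + move=> _ [y By <-]; rewrite -EFinM lee_fin; have [Ay dy] := BA y By. by apply: H; [exact: cod_chart|rewrite chartK].
- by move=> x _; exact: density_ge0.
Qed.

End Area.

(** * A crude change of variables inequality *)

Section ChangeOfVariables.
Variable R : realType.
Local Notation RR := (measurableTypeR R).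
Local Notation T2 := (RR * RR)%type.
Local Notation mu2 := (@lebesgue_measure R \x @lebesgue_measure R)%E.
Local Notation e1 := ((1, 0) : R * R).
Local Notation e2 := ((0, 1) : R * R).

Lemma measurable_continuous_on (O : set (R * R)) (g : R * R -> R) (A : set RR) : open O ->
  (forall x, O x -> {for x, continuous g}) -> measurable A -> measurable (O `&` g @^-1` A : set T2).
Proof.
move=> oO cg mA; have mO := measurable_open oO.
suff mf : measurable_fun (O : set T2) (g : T2 -> RR) by exact: mf.
apply: (measurability _ (RGenOInfty.measurableE R)) => _ [_ [x ->] <-].
apply: measurable_open; rewrite openE => w [cw /=]; rewrite in_itv/= andbT => h.
have n1 : \forall u \near w, O u by apply: open_nbhs_nbhs; split.
have n2 := cg w cw [set t | x < t] (lt_nbhsr h).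
by apply: filterS2 n1 n2 => u cu hu; split=> //=; rewrite in_itv/= andbT.
Qed.

Lemma measurable_plane_map (O : set (R * R)) (g : R * R -> R * R) (S : set T2) : open O ->
  (forall x, O x -> {for x, continuous g}) -> measurable S -> measurable (O `&` g @^-1` S : set T2).
Proof.
move=> oO cg; have mO := measurable_open oO.
rewrite [X in X S -> _]measurable_prod_measurableType.
apply: (@smallest_sub _ _ _ (fun S => measurable (O `&` g @^-1` S : set T2))).
  split; first by rewrite preimage_set0 setI0.
    move=> C mC; have -> : O `&` g @^-1` (setT `\` C) = O `\` (O `&` g @^-1` C).
      by apply/seteqP; split=> x [cx /= h]; split=> //; [move=> [_]; case: h|split=> // Cx; apply: h].
    exact: measurableD.
  move=> C mC; rewrite preimage_bigcup setI_bigcupr; exact: bigcupT_measurable.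
move=> _ [A1 mA1 [A2 mA2 <-]].
have -> : O `&` g @^-1` (A1 `*` A2) = (O `&` (fun x => (g x).1) @^-1` A1) `&` (O `&` (fun x => (g x).2) @^-1` A2).
  by apply/seteqP; split=> x; [move=> [Ox [h1 h2]]|move=> [[Ox h1] [_ h2]]].
have c1 x : O x -> {for x, continuous (fun x => (g x).1)}.
  by move=> Ox; exact: (@cont_comp _ _ _ g fst x (cg x Ox) (@cont_fst R _)).
have c2 x : O x -> {for x, continuous (fun x => (g x).2)}.
  by move=> Ox; exact: (@cont_comp _ _ _ g snd x (cg x Ox) (@cont_snd R _)).
exact: measurableI (measurable_continuous_on oO c1 mA1) (measurable_continuous_on oO c2 mA2).
Qed.

Lemma mu2_cell n ij : mu2 (cell n ij : set T2) = (((2 ^+ n)^-1) ^+ 2)%:E.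
Proof.
have p2 : 0 < (2 : R) ^+ n by rewrite exprn_gt0.
have -> : (cell n ij : set T2) = `[ij.1%:~R / 2 ^+ n, (ij.1 + 1)%:~R / 2 ^+ n[%classic `*` `[ij.2%:~R / 2 ^+ n, (ij.2 + 1)%:~R / 2 ^+ n[%classic.
  by apply/seteqP; split=> v; rewrite /cell /= !in_itv /= !coordP.
have L (i : int) : (@lebesgue_measure R) `[i%:~R / 2 ^+ n, (i + 1)%:~R / 2 ^+ n[%classic = ((2 ^+ n)^-1)%:E.
  rewrite lebesgue_measure_itv /= lte_fin ltr_pM2r ?invr_gt0// ltr_int ltrDl ltr01. by rewrite -EFinB intrD mulrDl mul1r addrAC subrr add0r.
rewrite expr2 EFinM -{1}(L ij.1) -(L ij.2); apply: product_measure1E; exact: measurable_itv.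
Qed.

Section Pushed.
Variables (O : set (R * R)) (tau : R * R -> R * R) (dn : R * R -> R).
Hypotheses (oO : open O) (dn0 : forall x, 0 <= dn x).
Hypothesis ctau : forall x, O x -> {for x, continuous tau}.
Hypothesis cdn : forall x, O x -> {for x, continuous dn}.

(** The image under tau of the measure with density dn on O. Once known to be a measure it can be
    compared with Lebesgue measure cell by cell. *)
Definition pushed (S : set T2) : \bar R := (\int[mu2]_(x in (O `&` tau @^-1` S : set T2)) (dn x)%:E)%E.

Let mdn S : measurable S -> measurable_fun (O `&` tau @^-1` S : set T2) (fun x : T2 => (dn x)%:E).
Proof.
move=> mS; apply/measurable_EFinP; apply: (measurable_funS (E := (O : set T2))).
- exact: measurable_open.
- by move=> x [].
- by move=> _ A mA; exact: measurable_continuous_on.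
Qed.

Let pushed0 : pushed set0 = 0%E.
Proof. by rewrite /pushed preimage_set0 setI0 integral_set0. Qed.

Let pushed_ge0 S : (0 <= pushed S)%E.
Proof. by apply: integral_ge0 => x _; rewrite lee_fin. Qed.

Let pushed_add : semi_sigma_additive pushed.
Proof.
move=> F mF tF mUF; rewrite /pushed preimage_bigcup setI_bigcupr.
have mOF n : measurable (O `&` tau @^-1` F n : set T2) by exact: measurable_plane_map.
have tOF : trivIset setT (fun n => O `&` tau @^-1` F n).
  by move=> i j _ _ [x [[_ h1] [_ h2]]]; apply: tF => //; exists (tau x).
rewrite ge0_integral_bigcup//.
- by apply: is_cvg_nneseries => n _ _; apply: integral_ge0 => x _; rewrite lee_fin.
- by rewrite -setI_bigcupr -preimage_bigcup; exact: mdn.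
- by move=> x _; rewrite lee_fin.
Qed.

HB.instance Definition _ := isMeasure.Build _ _ _ pushed pushed0 pushed_ge0 pushed_add.

Definition pushed_measure : {measure set T2 -> \bar R} := pushed.

End Pushed.

(** Cramer's rule, in the maximum norm. *)
Lemma plane_inverse_bound (a b c d : R) (J := a * d - b * c) : J != 0 -> exists2 M : R, 0 <= M &
  forall v1 v2 h : R, `|a * v1 + b * v2| <= h -> `|c * v1 + d * v2| <= h -> `|v1| <= M * h /\ `|v2| <= M * h.
Proof.
move=> J0; have J1 : 0 < `|J| by rewrite normr_gt0.
exists ((`|a| + `|b| + `|c| + `|d|) / `|J|); first by rewrite divr_ge0 ?addr_ge0.
move=> v1 v2 h h1 h2; have h0 : 0 <= h by exact: le_trans (normr_ge0 _) h1.
have E1 : J * v1 = d * (a * v1 + b * v2) - b * (c * v1 + d * v2) by rewrite /J; ring.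
have E2 : J * v2 = a * (c * v1 + d * v2) - c * (a * v1 + b * v2) by rewrite /J; ring.
have T x y X Y : `|X| <= h -> `|Y| <= h -> `|x * X - y * Y| <= (`|x| + `|y|) * h.
  move=> hX hY; apply: (le_trans (ler_normB _ _)); rewrite !normrM mulrDl. by apply: lerD; rewrite ler_wpM2l.
have b1 : 0 <= (`|a| + `|c|) * h by rewrite mulr_ge0 ?addr_ge0.
have b2 : 0 <= (`|b| + `|d|) * h by rewrite mulr_ge0 ?addr_ge0.
have k1 := T d b _ _ h1 h2; have k2 := T a c _ _ h2 h1.
rewrite -E1 normrM in k1; rewrite -E2 normrM in k2.
rewrite !(mulrAC _ (`|J|^-1)) !ler_pdivlMr// !(mulrC _ `|J|).
by move: b1 b2 k1 k2; rewrite !mulrDl; split; lra.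
Qed.

Lemma strict_diff_coef (f : R * R -> R) U x (a b : R) :
  open U -> U x -> Ck_on 1 U f -> 'D_e1 f x = a -> 'D_e2 f x = b -> forall e : R, 0 < e -> exists2 d : R, 0 < d &
    forall y z, `|y - x| < d -> `|z - x| < d -> `|f y - f z - ((y.1 - z.1) * a + (y.2 - z.2) * b)| <= e * `|y - z|.
Proof.
move=> oU Ux cf <- <- e e0.
have [d d0 h] := strict_diff oU Ux (fun v => (cf v).1) (fun v => (cf v).2 x Ux) e0.
by exists d => // y z hy hz; have [] := h y z hy hz.
Qed.

(* Where tau is a C1 local diffeomorphism with Jacobian J, preimages of small
   squares lie in small parallelograms. *)
Lemma pushed_cell (O : set (R * R)) (tau : R * R -> R * R) (dn : R * R -> R) (w : R * R) (D a b c d : R) :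
  open O -> O w -> Ck_on 1 O tau -> (forall x, O x -> {for x, continuous dn}) -> (forall x, 0 <= dn x) -> 0 < D -> ('D_e1 tau w).1 = a -> ('D_e2 tau w).1 = b ->
  ('D_e1 tau w).2 = c -> ('D_e2 tau w).2 = d -> dn w < D * `|a * d - b * c| -> exists2 r : R, 0 < r & forall n ij (S : set T2), S = cell n ij ->
    (forall x, O x -> S (tau x) -> `|x - w| < r) -> (pushed O tau dn S <= (16 * D)%:E * mu2 S)%E.
Proof.
move=> oO Ow ct cdn dn0 D0 ea eb ec ed.
have c1 := Ck_linear oO (@cont_fst R) ct; have c2 := Ck_linear oO (@cont_snd R) ct.
have D1 v : 'D_v (fst \o tau) w = ('D_v tau w).1.
  by have [_] := @derive_linear_comp R _ _ _ (@fst R R) tau w v (@cont_fst R) ((ct v).1 w Ow).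
have D2 v : 'D_v (snd \o tau) w = ('D_v tau w).2.
  by have [_] := @derive_linear_comp R _ _ _ (@snd R R) tau w v (@cont_snd R) ((ct v).1 w Ow).
have S1 := strict_diff_coef oO Ow c1 (etrans (D1 e1) ea) (etrans (D1 e2) eb).
have S2 := strict_diff_coef oO Ow c2 (etrans (D2 e1) ec) (etrans (D2 e2) ed).
have ctau x : O x -> {for x, continuous tau} by move=> Ox; exact: (Ck_S_plane oO ct).
clear ea eb ec ed c1 c2 D1 D2 ct.
set J := a * d - b * c => dJ.
have J0 : J != 0 by apply/negP => /eqP J0; move: dJ; rewrite J0 normr0 mulr0 ltNge dn0.
have J1 : 0 < `|J| by rewrite normr_gt0.
have [M M0 inv] := plane_inverse_bound J0.
(* Makes M e <= 1/2: if m is the larger of the two linearized displacements, the linearization error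
   is at most m/2, so m < h + m/2, that is m < 2 h. *)
pose e := (2 * (M + 1))^-1; have e0 : 0 < e by rewrite invr_gt0 mulr_gt0// ltr_wpDl.
have [r1 r10 s1] := S1 e e0; have [r2 r20 s2] := S2 e e0.
have [r3 r30 s3] : exists2 r : R, 0 < r & forall x : R * R, `|x - w| < r -> dn x <= D * `|J|.
  have /nbhs_ballP[r r0 h] := cdn w Ow [set t | t < D * `|J|] (lt_nbhsl dJ). by exists r => // x xr; rewrite ltW//; apply: (h x); rewrite -ball_normE /= distrC.
exists (Num.min r1 (Num.min r2 r3)); first by rewrite !lt_min r10 r20.
move=> n ij S SE HS.
have mS : measurable S by rewrite SE; exact: measurable_cell.
have mOS : measurable (O `&` tau @^-1` S : set T2) by exact: measurable_plane_map.
have p2 : 0 < (2 : R) ^+ n by rewrite exprn_gt0.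
pose h := (2 ^+ n)^-1 : R; have h0 : 0 < h by rewrite invr_gt0.
have [[w0 [Ow0 Sw0]]|none] := pselect (exists w0, O w0 /\ S (tau w0)); last first.
  rewrite /pushed; have -> : O `&` tau @^-1` S = set0.
    by apply/seteqP; split=> // x [Ox Sx]; apply: none; exists x.
  by rewrite integral_set0 mule_ge0// lee_fin mulr_ge0// ltW.
have sub : O `&` tau @^-1` S `<=` parallelogram a b c d (a * w0.1 + b * w0.2) (c * w0.1 + d * w0.2) (2 * h).
  move=> x [Ox Sx]. have := HS x Ox Sx; rewrite !lt_min => /andP[x1 /andP[x2 _]]. have := HS w0 Ow0 Sw0; rewrite !lt_min => /andP[y1 /andP[y2 _]].
  have k1 := s1 x w0 x1 y1; have k2 := s2 x w0 x2 y2. rewrite /= in k1 k2. have : `|tau x - tau w0| < h by apply: (@cell_near R n ij); rewrite -SE.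
  rewrite normB_coord => /andP[t1 t2]. set X := a * (x.1 - w0.1) + b * (x.2 - w0.2); set Y := c * (x.1 - w0.1) + d * (x.2 - w0.2). pose m := Num.max `|X| `|Y|.
  have mX : `|X| <= m by rewrite /m le_max lexx. have mY : `|Y| <= m by rewrite /m le_max lexx orbT. have m0 : 0 <= m := le_trans (normr_ge0 _) mX. have [i1 i2] := inv _ _ _ mX mY.
  have nx : `|x - w0| <= M * m.
    rewrite leNgt; apply/negP => lt; have := normB_coord x w0 `|x - w0|; rewrite ltxx. by rewrite (le_lt_trans i1 lt) (le_lt_trans i2 lt).
  have en : e * `|x - w0| <= m / 2.
    rewrite /e ler_pdivrMl ?mulr_gt0 ?ltr_wpDl//; nra.
  have X1 : `|X| < h + m / 2.
    have -> : X = ((tau x).1 - (tau w0).1) - ((tau x).1 - (tau w0).1 - ((x.1 - w0.1) * a + (x.2 - w0.2) * b)) by rewrite /X; ring.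
    apply: le_lt_trans (ler_normB _ _) _; apply: ltr_leD => //; exact: le_trans k1 en.
  have Y1 : `|Y| < h + m / 2.
    have -> : Y = ((tau x).2 - (tau w0).2) - ((tau x).2 - (tau w0).2 - ((x.1 - w0.1) * c + (x.2 - w0.2) * d)) by rewrite /Y; ring.
    apply: le_lt_trans (ler_normB _ _) _; apply: ltr_leD => //; exact: le_trans k2 en.
  have m2 : m < 2 * h by have : m < h + m / 2; [rewrite /m gt_max X1 Y1|clear; lra].
  split; [have -> : a * x.1 + b * x.2 - (a * w0.1 + b * w0.2) = X by rewrite /X; ring|have -> : c * x.1 + d * x.2 - (c * w0.1 + d * w0.2) = Y by rewrite /Y; ring].
    exact: le_lt_trans mX m2.
  exact: le_lt_trans mY m2.
have mP := measurable_parallelogram a b c d (a * w0.1 + b * w0.2) (c * w0.1 + d * w0.2) (2 * h).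
apply: (@le_trans _ _ ((D * `|J|)%:E * mu2 (O `&` tau @^-1` S))%E).
  rewrite -integral_cst//; apply: ge0_le_integral => //.
  - by move=> x _; rewrite lee_fin.
  - apply/measurable_EFinP; apply: (measurable_funS (E := (O : set T2))).
    + exact: measurable_open.
    + by move=> x [].
    + by move=> _ A mA; exact: measurable_continuous_on.
  - move=> x [Ox Sx]; rewrite lee_fin; apply: s3. by have := HS x Ox Sx; rewrite !lt_min => /andP[_ /andP[_]].
apply: (@le_trans _ _ ((D * `|J|)%:E * (4 * (2 * h) ^+ 2 / `|J|)%:E)%E).
  apply: lee_wpmul2l; first by rewrite lee_fin mulr_ge0// ltW. have h2 : 0 < 2 * h by rewrite mulr_gt0.
  by rewrite -(mu2_parallelogram (a * w0.1 + b * w0.2) (c * w0.1 + d * w0.2) J0 h2) le_measure ?inE.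
(* The parallelogram has half-width 2 h, and 4 (2 h)^2 = 16 h^2 is the origin of the constant 16. *)
rewrite SE mu2_cell -/h -!EFinM lee_fin le_eqVlt; apply/orP; left; apply/eqP.
by field; rewrite gt_eqF.
Qed.

End ChangeOfVariables.

(** * Area of lifts of a compact piece of a chart *)

Section LiftedArea.
Variable R : realType.
Local Notation RR := (measurableTypeR R).
Local Notation T2 := (RR * RR)%type.
Local Notation mu2 := (@lebesgue_measure R \x @lebesgue_measure R)%E.
Local Notation e1 := ((1, 0) : R * R).
Local Notation e2 := ((0, 1) : R * R).

Lemma mu2_le (A B : set T2) : measurable A -> measurable B -> A `<=` B -> (mu2 A <= mu2 B)%E.
Proof. by move=> mA mB AB; apply: le_measure; rewrite ?inE. Qed.

Lemma borel_preimage (N M : surface R) (V : set M) (s : M -> N) (B : set N) : open V ->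
  (forall y, V y -> {for y, continuous s}) -> borel B -> borel (V `&` s @^-1` B).
Proof.
move=> oV cs; have bV := borel_open oV.
apply: (@smallest_sub _ _ _ (fun B => borel (V `&` s @^-1` B))).
  have [h0 _ h] := @smallest_sigma_algebra M setT (@open M). split; first by rewrite preimage_set0 setI0.
    move=> C mC; have -> : V `&` s @^-1` (setT `\` C) = V `\` (V `&` s @^-1` C).
      by apply/seteqP; split=> x [cx /= h']; split=> //; [move=> [_]; case: h'|split=> // Cx; apply: h'].
    exact: borelD.
  by move=> C mC; rewrite preimage_bigcup setI_bigcupr; exact: h.
move=> U oU; apply: borel_open; rewrite openE => y [Vy Uy]; apply: filterI.
  exact: open_nbhs_nbhs.
by apply: cs => //; exact: open_nbhs_nbhs.
Qed.

Lemma inner_expand2 (N : surface R) (G : riemannian_metric N) p x (u v : R * R) : cod p x ->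
  G p x u v = u.1 * v.1 * G p x e1 e1 + (u.1 * v.2 + u.2 * v.1) * G p x e1 e2 + u.2 * v.2 * G p x e2 e2.
Proof.
move=> cx; have H := inner_expand G (u + v) cx; have Hu := inner_expand G u cx; have Hv := inner_expand G v cx.
have L (a b : R * R) : G p x (u + v) a = G p x u a + G p x v a.
  by have := inner_linear G cx 1 u v a; rewrite scale1r mul1r.
have S (a b : R * R) : G p x a b = G p x b a := inner_sym G cx a b.
rewrite (L _ 0) (S u) (S v) !(L _ 0) (S v u) Hu Hv /= in H; lra.
Qed.

Lemma density_jacobian (N M : surface R) (GN : riemannian_metric N) (GM : riemannian_metric M)
    (p : N) (q : M) w v (a b c d : R) : cod q v ->
  GN p w e1 e1 = GM q v (a, c) (a, c) -> GN p w e1 e2 = GM q v (a, c) (b, d) -> GN p w e2 e2 = GM q v (b, d) (b, d) -> area_density GN p w = `|a * d - b * c| * area_density GM q v.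
Proof.
move=> cv H11 H12 H22; rewrite /area_density H11 H12 H22.
rewrite (inner_expand2 GM (a, c) (a, c) cv) (inner_expand2 GM (a, c) (b, d) cv) (inner_expand2 GM (b, d) (b, d) cv) /=.
rewrite -sqrtr_sqr -sqrtrM ?sqr_ge0//; congr Num.sqrt.
move: (GM q v _ _) (GM q v _ _) (GM q v _ _) => g11 g12 g22; ring.
Qed.

Variables (M : surface R) (G : riemannian_metric M) (q : M) (K : set (R * R)).
Hypotheses (cK : compact K) (Kq : K `<=` cod q).

(** C depends on K alone, not on the sheet. By isometry the density upstairs is the Jacobian of f
    times the one downstairs, which is less than D on K; so its image under f is at most 16 D times
    Lebesgue measure on a fixed box containing K. A crude constant suffices because entropy does not
    see it. *)
Lemma lifted_area_bound : exists C : R, forall (N : surface R) (GN : riemannian_metric N)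
  (f : N -> M) (W : set N) (V : set M) (s : M -> N), smooth_map f -> pullback_eq GN G f -> open W -> open V -> (forall y, V y -> {for y, continuous s}) ->
  (forall y, V y -> W (s y) /\ f (s y) = y) -> (forall z, W z -> s (f z) = z) -> chart_inv q @` K `<=` V -> (area GN (s @` (chart_inv q @` K)) <= C%:E)%E.
Proof.
have [D D0 HD] : exists2 D : R, 0 < D & forall v, K v -> area_density G q v < D.
  have [[k Kk]|nK] := pselect (K !=set0); last by exists 1 => // v Kv; case: nK; exists v. have cd : {within K, continuous (area_density G q)}.
    by apply: continuous_in_subspaceT => v; rewrite inE => /Kq; exact: continuous_density.
  have [c _ Hc] := compact_EVT_max (ex_intro _ k Kk) cK cd. exists (area_density G q c + 1); first by rewrite ltr_wpDl// sqrtr_ge0.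
  by move=> v Kv; rewrite (le_lt_trans (Hc v _)) ?inE// ltrDl.
have [r r0 Hr] : exists2 r : R, 0 < r & forall v, K v -> `|v| < r.
  have [m [_ Hm]] := compact_bounded cK; exists (`|m| + 2); first by rewrite ltr_wpDl. move=> v Kv; apply: le_lt_trans (Hm (`|m| + 1) _ v Kv) _; last by lra.
  by rewrite (le_lt_trans (ler_norm m))// ltrDl.
pose Bx : set (R * R) := [set v | `|v| < r].
have oBx : open Bx.
  rewrite openE => v hv; have [e e0 he] : exists2 e : R, 0 < e & `|v| + e = r by exists (r - `|v|); [rewrite subr_gt0|lra].
  apply/nbhs_ballP; exists e => //= u; rewrite -ball_normE /= => hu; rewrite /Bx /= -he. have := ler_normB v (v - u); rewrite subKr => h; apply: le_lt_trans h _; by rewrite ltrD2l.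
have mBx : measurable (Bx : set T2) := measurable_open oBx.
have BxP : (Bx : set T2) = parallelogram 1 0 0 1 0 0 r.
  apply/seteqP; split=> v; rewrite /Bx /parallelogram /= !mul1r !mul0r addr0 add0r !subr0.
    by have := normB_coord v 0 r; rewrite !subr0 => -> /andP.
  by have := normB_coord v 0 r; rewrite !subr0 => -> [-> ->].
have mu2Bx : mu2 Bx = (4 * r ^+ 2)%:E.
  by rewrite BxP mu2_parallelogram// ?mulr1 ?mulr0 ?subr0 ?normr1 ?divr1// oner_neq0.
have D16 : 0 <= 16 * D by rewrite mulr_ge0// ltW.
pose m : {measure set T2 -> \bar R} := mscale (NngNum D16) (mrestr mu2 mBx).
have mE S : m S = ((16 * D)%:E * mu2 (S `&` Bx))%E by [].
have mfin : (m setT < +oo)%E by rewrite mE setTI mu2Bx -EFinM ltry.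
exists (16 * D * (4 * r ^+ 2)) => N GN f W V s [cf sf] iso oW oV cs sV Ws KV.
apply: area_le => n p B h1 tB.
(* All conditions are open, and they hold at the chart images of the points of [B k]; on this set
   the comparison can therefore be made on small cells. *)
pose Om k : set (R * R) := [set v | [/\ cod q v, V (chart_inv q v), dom (p k) (s (chart_inv q v)), area_density G q v < D & Bx v]].
have csv v : cod q v -> V (chart_inv q v) -> {for v, continuous (s \o chart_inv q)}.
  by move=> cv Vv; apply: cont_comp (continuous_chart_inv cv) (cs _ Vv).
have oOm k : open (Om k).
  rewrite openE => v [cv Vv dv av bv]. have n1 : \forall u \near v, cod q u by apply: open_nbhs_nbhs; split=> //; exact: open_cod. have n2 : \forall u \near v, V (chart_inv q u).
    by apply: (continuous_chart_inv cv); apply: open_nbhs_nbhs.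
  have n3 : \forall u \near v, dom (p k) (s (chart_inv q u)).
    by apply: (csv v cv Vv); apply: open_nbhs_nbhs; split=> //; exact: dom_open.
  have n4 := @continuous_density _ _ G _ _ cv [set t | t < D] (lt_nbhsl av). have n5 : nbhs v Bx by exact: open_nbhs_nbhs.
  by apply: filterS3 (filterI n1 n2) (filterI n3 n4) n5 => u [? ?] [? ?] ?; split.
pose S k : set (R * R) := Om k `&` [set v | B k (s (chart_inv q v))].
have mS k : measurable (S k : set T2).
  have -> : S k = Om k `&` (cod q `&` chart_inv q @^-1` (V `&` s @^-1` B k)).
    by apply/seteqP; split=> v; [move=> [[? ? ? ? ?] ?]|move=> [? [? [? ?]]]].
  apply: measurableI; first exact: measurable_open. by apply: measurable_chart_inv; apply: borel_preimage => //; have [] := h1 k.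
have tS : trivIset setT S.
  by move=> i j _ _ [v [[_ Bi] [_ Bj]]]; apply: tB => //; exists (s (chart_inv q v)).
suff le_m k : (chart_area GN (p k) (B k) <= m (S k))%E.
  apply: (@le_trans _ _ (\sum_(k < n) m (S k))%E); first by apply: lee_sum => k _. have mU : measurable (\big[setU/set0]_(k < n) S k : set T2) by apply: bigsetU_measurable => k _.
  rewrite -(measure_semi_additive_ord m mS tS mU) EFinM -mu2Bx. have mI : measurable ((\big[setU/set0]_(k < n) S k) `&` Bx : set T2) := measurableI _ _ mU mBx.
  have le2 : (mu2 ((\big[setU/set0]_(k < n) S k) `&` Bx : set T2) <= mu2 Bx)%E := mu2_le mI mBx (@subIsetr _ _ _). have D16e : (0 <= (16 * D)%:E)%E by rewrite lee_fin.
  exact: (lee_wpmul2l D16e le2).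
have [bB BA] := h1 k; have Bd : B k `<=` dom (p k) by move=> y /BA[].
pose O : set (R * R) := cod (p k) `&` chart_inv (p k) @^-1` (W `&` f @^-1` dom q).
pose tau := local_rep f (p k) q; pose dn := area_density GN (p k).
have oO : open O.
  apply: open_chart_inv; apply: openI => //; apply: open_comp (@dom_open _ _ q) => y _; exact: cf.
have Old : O `<=` local_dom f (p k) q.
  move=> x [cx [Wx dx]]; exists (chart_inv (p k) x); last exact: chart_invK. by split=> //; exact: dom_chart_inv.
have ct1 : Ck_on 1 O tau := Ck_sub Old (sf (p k) q 1%N).
have ct x : O x -> {for x, continuous tau} by move=> Ox; exact: (Ck_S_plane oO ct1).
have cdn x : O x -> {for x, continuous dn} by move=> [cx _]; exact: continuous_density.
have dn0 x : 0 <= dn x by exact: sqrtr_ge0.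
pose nu := pushed_measure oO dn0 ct cdn.
apply: (@le_trans _ _ (nu (S k))).
  apply: ge0_subset_integral.
  - exact: measurable_chart.
  - exact: measurable_plane_map.
  - apply/measurable_EFinP; apply: (measurable_funS (E := cod (p k) : set T2)).
    + exact: measurable_open (@open_cod R N (p k)).
    + by move=> x [[]].
    + exact: measurable_density.
  - by move=> x _; exact: density_ge0.
  - move=> _ [y By <-]; have [[_ [v Kv <-] e] dy] := BA y By. have cv := Kq Kv; have Vv : V (chart_inv q v) by apply: KV; exists v.
    have [Wy fy] := sV _ Vv; have fyv : f y = chart_inv q v by rewrite -e. have tv : tau (chart (p k) y) = v by rewrite /tau /local_rep /= chartK// fyv chart_invK. split.
      split; first exact: cod_chart. split; rewrite /= chartK//; first by rewrite -e. by rewrite fyv; exact: dom_chart_inv.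
    rewrite /= tv; split; last by rewrite /= e. by split=> //; [rewrite e|exact: HD|exact: Hr].
apply: (measure_le_approx mfin (oOm k) (mS k)) => [v []//|U oU UO].
apply: (measure_le_open oU UO) => v [cv Vv dv av bv].
have [Ws' fs] := sV _ Vv; set y := s (chart_inv q v) in dv Ws' fs *.
pose w := chart (p k) y.
have cw : cod (p k) w by exact: cod_chart.
have Ow : O w by split=> //; split; rewrite /= /w chartK// fs; exact: dom_chart_inv.
have tw : tau w = v by rewrite /tau /local_rep /= /w chartK// fs chart_invK.
have dtau : differentiable tau w := diff_C1_plane oO Ow ct1.
pose a := ('d tau w e1).1; pose b := ('d tau w e2).1; pose c := ('d tau w e1).2; pose d := ('d tau w e2).2.
have iso' u u' : GN (p k) w u u' = G q v ('d tau w u) ('d tau w u').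
  by rewrite (iso (p k) q w (Old _ Ow)) -/tau tw.
have J : dn w = `|a * d - b * c| * area_density G q v.
  by apply: (density_jacobian cv); rewrite iso' /a /b /c /d -!surjective_pairing.
have dJ : dn w < D * `|a * d - b * c|.
  have : 0 < dn w by exact: density_gt0. have d0 := density_gt0 G cv; rewrite J pmulr_lgt0// => J0. by rewrite (mulrC D) ltr_pM2l.
have [r1 r10 h] : exists2 r : R, 0 < r & forall n ij (S : set T2), S = cell n ij ->
    (forall x, O x -> S (tau x) -> `|x - w| < r) -> (pushed O tau dn S <= (16 * D)%:E * mu2 S)%E.
  apply: (@pushed_cell R O tau dn w D a b c d) => //; rewrite /a /b /c /d; exact: (congr1 _ (deriveE _ dtau)).
have n1 : \forall u \near v, `|(chart (p k) \o (s \o chart_inv q)) u - w| < r1.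
  have cc : {for v, continuous (chart (p k) \o (s \o chart_inv q))}.
    by apply: cont_comp (csv v cv Vv) _; exact: continuous_chart.
  have := cc [set x | `|x - w| < r1]; apply; apply/nbhs_ballP; exists r1 => //= x. by rewrite -ball_normE /= distrC.
have n2 : \forall u \near v, Bx u by exact: open_nbhs_nbhs.
have [r2 /= r20 h2] := (nbhs_ballP _ _).1 (filterI n1 n2).
have h2' u : `|u - v| < r2 -> `|chart (p k) (s (chart_inv q u)) - w| < r1 /\ Bx u.
  by move=> hu; apply: h2; rewrite -ball_normE /= distrC.
exists r2 => // i ij sub.
have -> : m (cell i ij) = ((16 * D)%:E * mu2 (cell i ij : set T2))%E.
  by rewrite mE; congr (_ * mu2 _)%E; apply/setIidPl => u /sub/h2'[].
apply: (h i ij _ erefl) => x [cx [Wx fx]] Sx.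
have [+ _] := h2' _ (sub _ Sx); rewrite /tau /local_rep /= chartK// Ws//.
by rewrite chart_invK.
Qed.

End LiftedArea.

(** * Differentiability of a continuous local inverse *)

Section LocalInverse.
Variable R : realType.
Local Notation e1 := ((1, 0) : R * R).
Local Notation e2 := ((0, 1) : R * R).
Implicit Types (O : set (R * R)) (tau sigma : R * R -> R * R).

Lemma derive_coord tau x v : derivable tau x v ->
  'D_v (fun y => (tau y).1) x = ('D_v tau x).1 /\ 'D_v (fun y => (tau y).2) x = ('D_v tau x).2.
Proof.
move=> dt; split.
  by have [_] := @derive_linear_comp R _ _ _ (@fst R R) tau x v (@cont_fst R) dt.
by have [_] := @derive_linear_comp R _ _ _ (@snd R R) tau x v (@cont_snd R) dt.
Qed.

Lemma Ck_coord k O tau : open O -> Ck_on k O tau ->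
  Ck_on k O (fun y => (tau y).1) /\ Ck_on k O (fun y => (tau y).2).
Proof.
move=> oO ct; split.
  exact: (Ck_linear oO (@cont_fst R) ct).
exact: (Ck_linear oO (@cont_snd R) ct).
Qed.

Lemma norm_coord (x y : R * R) : `|x.1 - y.1| <= `|x - y| /\ `|x.2 - y.2| <= `|x - y|.
Proof.
split; rewrite leNgt; apply/negP => lt.
  have := normB_coord x y `|x.1 - y.1|; by rewrite lt ltxx.
have := normB_coord x y `|x.2 - y.2|; by rewrite lt ltxx andbF.
Qed.

Lemma norm_le_coord (x y : R * R) (B : R) : `|x.1 - y.1| <= B -> `|x.2 - y.2| <= B -> `|x - y| <= B.
Proof.
move=> h1 h2; rewrite leNgt; apply/negP => lt; have := normB_coord x y `|x - y|; rewrite ltxx.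
by rewrite (le_lt_trans h1 lt) (le_lt_trans h2 lt).
Qed.

(** D and Y stand for the displacements before and after the map. For small e the former is at most
    a constant times the latter, so the error e N can be measured by n. *)
Lemma inverse_estimate (a b c d : R) (J := a * d - b * c) : J != 0 -> exists2 k : R, 0 < k &
  forall D1 D2 Y1 Y2 N n e : R, 0 <= e -> e * k <= 1 -> 0 <= N ->
    (forall B, `|D1| <= B -> `|D2| <= B -> N <= B) -> `|Y1| <= n -> `|Y2| <= n -> `|Y1 - (D1 * a + D2 * b)| <= e * N -> `|Y2 - (D1 * c + D2 * d)| <= e * N ->
    `|D1 - (Y1 * (d / J) + Y2 * (- b / J))| <= (e * k) * n /\ `|D2 - (Y1 * (- c / J) + Y2 * (a / J))| <= (e * k) * n.
Proof.
move=> J0; have J1 : 0 < `|J| by rewrite normr_gt0.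
have [M M0 HM] := plane_inverse_bound J0.
pose S := (`|a| + `|b| + `|c| + `|d|) / `|J|.
have S0 : 0 <= S by rewrite divr_ge0 ?addr_ge0.
exists (2 * (M + 1) * (S + 1)); first by rewrite !mulr_gt0// ltr_wpDl.
move=> D1 D2 Y1 Y2 N n e e0 ek N0 HN Y1n Y2n r1 r2.
have n0 : 0 <= n := le_trans (normr_ge0 _) Y1n.
have eN0 : 0 <= e * N by rewrite mulr_ge0.
have x1 : `|a * D1 + b * D2| <= n + e * N.
  have -> : a * D1 + b * D2 = Y1 - (Y1 - (D1 * a + D2 * b)) by ring. by apply: le_trans (ler_normB _ _) _; exact: lerD.
have x2 : `|c * D1 + d * D2| <= n + e * N.
  have -> : c * D1 + d * D2 = Y2 - (Y2 - (D1 * c + D2 * d)) by ring. by apply: le_trans (ler_normB _ _) _; exact: lerD.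
have [d1 d2] := HM _ _ _ x1 x2; have NM := HN _ d1 d2.
have eM : e * (2 * (M + 1)) <= 1.
  apply: le_trans ek; rewrite [leRHS]mulrA ler_peMr ?mulr_ge0 ?addr_ge0//; lra.
have NM2 : N <= 2 * (M + 1) * n.
  have : M * (e * N) <= N / 2.
    have : e * (2 * (M + 1)) * N <= 1 * N by rewrite ler_wpM2r. by move: eN0; rewrite mulrDr mulrDl; lra.
  have : 0 <= M * n by rewrite mulr_ge0. by rewrite mulrDr in NM; lra.
have T x y X Y : `|X| <= e * N -> `|Y| <= e * N -> `|x| + `|y| <= `|a| + `|b| + `|c| + `|d| ->
    `|(x * X - y * Y) / J| <= e * (2 * (M + 1) * (S + 1)) * n.
  move=> hX hY xy; rewrite normrM normfV. apply: (@le_trans _ _ ((`|a| + `|b| + `|c| + `|d|) * (e * N) / `|J|)).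
    rewrite ler_wpM2r ?invr_ge0//; apply: (le_trans (ler_normB _ _)); rewrite !normrM. apply: (@le_trans _ _ ((`|x| + `|y|) * (e * N))); last by rewrite ler_wpM2r.
    by rewrite mulrDl; apply: lerD; rewrite ler_wpM2l.
  rewrite mulrAC -/S. have h1 : S * (e * N) <= S * (e * (2 * (M + 1) * n)) by rewrite ler_wpM2l// ler_wpM2l. apply: le_trans h1 _.
  have h0 : 0 <= e * (2 * (M + 1) * n) by rewrite !mulr_ge0 ?addr_ge0. have -> : e * (2 * (M + 1) * (S + 1)) * n = (S + 1) * (e * (2 * (M + 1) * n)) by ring.
  by rewrite ler_wpM2r// lerDl.
have E1 : D1 - (Y1 * (d / J) + Y2 * (- b / J)) = (b * (Y2 - (D1 * c + D2 * d)) - d * (Y1 - (D1 * a + D2 * b))) / J.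
  by rewrite /J in J0 *; field.
have E2 : D2 - (Y1 * (- c / J) + Y2 * (a / J)) = (c * (Y1 - (D1 * a + D2 * b)) - a * (Y2 - (D1 * c + D2 * d))) / J.
  by rewrite /J in J0 *; field.
have [A B C D] : [/\ 0 <= `|a|, 0 <= `|b|, 0 <= `|c| & 0 <= `|d|] by [].
by rewrite E1 E2; split; apply: T => //; lra.
Qed.

Lemma inverse_strict (Om O : set (R * R)) tau sigma v0 (a b c d : R) (J := a * d - b * c) :
  open O -> open Om -> (forall v, Om v -> O (sigma v) /\ tau (sigma v) = v) -> (forall v, Om v -> {for v, continuous sigma}) -> Ck_on 1 O tau -> Om v0 ->
  'D_e1 (fun y => (tau y).1) (sigma v0) = a -> 'D_e2 (fun y => (tau y).1) (sigma v0) = b ->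
  'D_e1 (fun y => (tau y).2) (sigma v0) = c -> 'D_e2 (fun y => (tau y).2) (sigma v0) = d ->
  J != 0 -> forall e : R, 0 < e -> exists2 r : R, 0 < r & forall y z, `|y - v0| < r -> `|z - v0| < r ->
    `|(sigma y).1 - (sigma z).1 - ((y.1 - z.1) * (d / J) + (y.2 - z.2) * (- b / J))| <= e * `|y - z| /\
    `|(sigma y).2 - (sigma z).2 - ((y.1 - z.1) * (- c / J) + (y.2 - z.2) * (a / J))| <= e * `|y - z|.
Proof.
move=> oO oOm inv cs ct Ov ea eb ec ed J0 e e0.
have [Ow _] := inv v0 Ov; have [c1 c2] := Ck_coord oO ct.
have [k k0 Hk] := inverse_estimate J0.
pose e' := Num.min k^-1 (e / k).
have e'0 : 0 < e' by rewrite lt_min invr_gt0 k0 divr_gt0.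
have e'1 : e' * k <= 1 by rewrite -ler_pdivlMr// div1r ge_min lexx.
have e'2 : e' * k <= e by rewrite -ler_pdivlMr// ge_min lexx orbT.
have [r1 r10 s1] := strict_diff_coef oO Ow c1 ea eb e'0.
have [r2 r20 s2] := strict_diff_coef oO Ow c2 ec ed e'0.
have n1 : \forall u \near v0, Om u by exact: open_nbhs_nbhs.
have n2 : \forall u \near v0, `|sigma u - sigma v0| < Num.min r1 r2.
  apply: (cs v0 Ov [set x | `|x - sigma v0| < Num.min r1 r2]). apply/nbhs_ballP; exists (Num.min r1 r2); first by rewrite /= lt_min r10. by move=> x; rewrite -ball_normE /= distrC.
have [r /= r0 h] := (nbhs_ballP _ _).1 (filterI n1 n2).
have h' u : `|u - v0| < r -> Om u /\ `|sigma u - sigma v0| < Num.min r1 r2.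
  by move=> hu; apply: h; rewrite -ball_normE /= distrC.
exists r => // y z /h'[Oy]; rewrite lt_min => /andP[y1 y2] /h'[Oz]; rewrite lt_min => /andP[z1 z2].
have k1 := s1 _ _ y1 z1; have k2 := s2 _ _ y2 z2.
have [_ ty] := inv y Oy; have [_ tz] := inv z Oz; rewrite /= ty tz in k1 k2.
have [n1' n2'] := norm_coord y z.
have [E1 E2] := Hk _ _ _ _ _ _ _ (ltW e'0) e'1 (normr_ge0 _) (@norm_le_coord (sigma y) (sigma z)) n1' n2' k1 k2.
have ny : 0 <= `|y - z| by exact: normr_ge0.
by split; [apply: le_trans E1 _|apply: le_trans E2 _]; rewrite ler_wpM2r.
Qed.

(** The continuous inverse sigma is given, as a section of a covering; only its differentiability is
    at stake. Strict differentiability of tau is inverted by Cramer's rule. *)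
Lemma inverse_diff (Om O : set (R * R)) tau sigma :
  open O -> open Om -> (forall v, Om v -> O (sigma v) /\ tau (sigma v) = v) -> (forall v, Om v -> {for v, continuous sigma}) -> Ck_on 1 O tau ->
  (forall x, O x -> ('D_e1 tau x).1 * ('D_e2 tau x).2 - ('D_e2 tau x).1 * ('D_e1 tau x).2 != 0) -> Ck_on 1 Om sigma /\ forall v u, Om v -> 'd tau (sigma v) ('d sigma v u) = u.
Proof.
move=> oO oOm inv cs ct JN.
pose A x := 'D_e1 (fun y => (tau y).1) x; pose B x := 'D_e2 (fun y => (tau y).1) x.
pose C x := 'D_e1 (fun y => (tau y).2) x; pose D x := 'D_e2 (fun y => (tau y).2) x.
pose J x := A x * D x - B x * C x.
have dt x : O x -> differentiable tau x by move=> Ox; exact: diff_C1_plane oO Ox ct.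
have cE x v : O x -> 'D_v (fun y => (tau y).1) x = ('D_v tau x).1 /\ 'D_v (fun y => (tau y).2) x = ('D_v tau x).2.
  by move=> Ox; apply: derive_coord; have [h _] := ct v; exact: h.
have J0 x : O x -> J x != 0.
  move=> Ox; rewrite /J /A /B /C /D; have [-> ->] := cE x e1 Ox; have [-> ->] := cE x e2 Ox. exact: JN.
have [ct1 ct2] := Ck_coord oO ct.
have cA x : O x -> {for x, continuous A} by move=> Ox; exact: (ct1 e1).2.
have cB x : O x -> {for x, continuous B} by move=> Ox; exact: (ct1 e2).2.
have cC x : O x -> {for x, continuous C} by move=> Ox; exact: (ct2 e1).2.
have cD x : O x -> {for x, continuous D} by move=> Ox; exact: (ct2 e2).2.
have cJ x : O x -> {for x, continuous J}.
  by move=> Ox; apply: cvgB; apply: cvgM; [exact: cA|exact: cD|exact: cB|exact: cC].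
have S v : Om v -> differentiable sigma v /\ forall u, 'd sigma v u =
    (u.1 * (D (sigma v) / J (sigma v)) + u.2 * (- B (sigma v) / J (sigma v)),
     u.1 * (- C (sigma v) / J (sigma v)) + u.2 * (A (sigma v) / J (sigma v))).
  move=> Ov; have [Ow _] := inv v Ov. have H := inverse_strict oO oOm inv cs ct Ov erefl erefl erefl erefl (J0 _ Ow).
  have H1 e (e0 : 0 < e) : exists2 r : R, 0 < r & forall y z, `|y - v| < r -> `|z - v| < r ->
      `|(sigma y).1 - (sigma z).1 - ((y.1 - z.1) * (D (sigma v) / J (sigma v)) + (y.2 - z.2) * (- B (sigma v) / J (sigma v)))| <= e * `|y - z|.
    by have [r r0 h] := H e e0; exists r => // y z hy hz; have [] := h y z hy hz.
  have H2 e (e0 : 0 < e) : exists2 r : R, 0 < r & forall y z, `|y - v| < r -> `|z - v| < r ->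
      `|(sigma y).2 - (sigma z).2 - ((y.1 - z.1) * (- C (sigma v) / J (sigma v)) + (y.2 - z.2) * (A (sigma v) / J (sigma v)))| <= e * `|y - z|.
    by have [r r0 h] := H e e0; exists r => // y z hy hz; have [] := h y z hy hz.
  have [d1 E1] := @strict_diff_diff R (fun y => (sigma y).1) _ _ _ H1. have [d2 E2] := @strict_diff_diff R (fun y => (sigma y).2) _ _ _ H2. have ds : differentiable sigma v.
    have := differentiable_pair d1 d2; congr (differentiable _ _). by apply/funext => y /=; rewrite -surjective_pairing.
  split=> // u; have [F1 F2] := derive_coord (@diff_derivable _ _ _ _ _ u ds). rewrite -(deriveE _ ds) [LHS]surjective_pairing -F1 -F2 (deriveE _ d1) (deriveE _ d2) E1 E2. by [].
have T w x : O w -> 'd tau w x = (x.1 * A w + x.2 * B w, x.1 * C w + x.2 * D w).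
  move=> Ow; rewrite (diff_expand _ (dt w Ow)). have [h1 h2] := cE w e1 Ow; have [h3 h4] := cE w e2 Ow.
  by rewrite /A /B /C /D h1 h2 h3 h4; apply: injective_projections; rewrite /= !scaleRE.
split; last first.
  move=> v u Ov; have [Ow _] := inv v Ov. apply: etrans (congr1 ('d tau (sigma v)) ((S v Ov).2 u)) _. apply: etrans (T _ _ Ow) _; apply: etrans (esym (surjective_pairing u)).
  have K (a b c d u1 u2 : R) (k := a * d - b * c) : k != 0 ->
      (u1 * (d / k) + u2 * (- b / k)) * a + (u1 * (- c / k) + u2 * (a / k)) * b = u1 /\ (u1 * (d / k) + u2 * (- b / k)) * c + (u1 * (- c / k) + u2 * (a / k)) * d = u2.
    by rewrite /k => k0; split; field.
  have [K1 K2] := K _ _ _ _ u.1 u.2 (J0 _ Ow). exact: (f_equal2 pair K1 K2).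
move=> u; split=> [v Ov|v Ov]; first by have [ds _] := S v Ov; exact: diff_derivable.
have [Ow _] := inv v Ov.
have comp (h : R * R -> R) : (forall x, O x -> {for x, continuous h}) -> {for v, continuous (h \o sigma)}.
  by move=> ch; apply: cont_comp (cs v Ov) (ch _ Ow).
have cF (h g : R * R -> R) : (forall x, O x -> {for x, continuous h}) -> (forall x, O x -> {for x, continuous g}) ->
    {for v, continuous (fun x => u.1 * (h (sigma x) / J (sigma x)) + u.2 * (g (sigma x) / J (sigma x)))}.
  move=> ch cg; apply: cvgD; (apply: cvgM; first exact: cvg_cst); (apply: cvgM; last (apply: cvgV; [exact: J0|exact: comp])); exact: comp.
have nE : \forall x \near v, (u.1 * (D (sigma x) / J (sigma x)) + u.2 * (- B (sigma x) / J (sigma x)),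
     u.1 * (- C (sigma x) / J (sigma x)) + u.2 * (A (sigma x) / J (sigma x))) = 'D_u sigma x.
  have n1 : \forall x \near v, Om x by exact: open_nbhs_nbhs. by apply: filterS n1 => x Ox; have [ds E] := S x Ox; rewrite (deriveE _ ds) E.
rewrite /prop_for /continuous_at -(nbhs_singleton nE).
apply: cvg_trans (near_eq_cvg nE) _.
have cN h : (forall x, O x -> {for x, continuous h}) -> forall x, O x -> {for x, continuous (fun x => - h x : R)}.
  by move=> ch x Ox; apply: cvgN; exact: ch.
have l1 := cF D (fun x => - B x) cD (cN B cB).
have l2 := cF (fun x => - C x) A (cN C cC) cA.
exact: (cvg_pair l1 l2).
Qed.

End LocalInverse.

(** * Local isometries preserve speed *)

Section LocalIsometry.
Variables (R : realType) (N M : surface R) (GN : riemannian_metric N) (GM : riemannian_metric M).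
Local Notation e1 := ((1, 0) : R * R).
Local Notation e2 := ((0, 1) : R * R).
Implicit Types (c : R -> N) (t : R).

(** Formulated at one point and in one pair of charts, so that it applies to the covering map and
    also to its sections, which are defined on an open set only. *)
Definition isometric_at (phi : N -> M) (y : N) :=
  exists p q (A : set (R * R)), [/\ dom p y, dom q (phi y), open_nbhs (chart p y) A,
    A `<=` local_dom phi p q & Ck_on 1 A (local_rep phi p q) /\ forall u, nrm GM q (chart q (phi y)) ('d (local_rep phi p q) (chart p y) u) = nrm GN p (chart p y) u].

Lemma isometric_at_smooth phi : smooth_map phi -> pullback_eq GN GM phi -> forall y, isometric_at phi y.
Proof.
move=> [cp sp] iso y; exists y, (phi y), (local_dom phi y (phi y)).
have dy := dom_center y; have dpy := dom_center (phi y).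
have ly : local_dom phi y (phi y) (chart y y) by exists y.
split=> //.
  split=> //; rewrite /local_dom codE; last by move=> z []. apply: open_chart_inv; apply: openI; first exact: dom_open. by apply: open_comp (@dom_open _ _ _) => z _; exact: cp.
split; first exact: (sp y (phi y) 1%N).
by move=> u; rewrite /nrm (iso _ _ _ ly) /local_rep /= chartK.
Qed.

Lemma isometric_C1 phi c t : isometric_at phi (c t) -> (\forall u \near t, {for c u, continuous phi}) ->
  C1_at c t -> C1_at (phi \o c) t /\ speed GM (phi \o c) t = speed GN c t.
Proof.
move=> [p [q [A [pt qt [oA At] Ald [cA iso]]]]] cphi Ct; have [cc d cd] := Ct.
have ct : {for t, continuous c} := nbhs_singleton cc.
have [dp cdp] := C1_at_chart (dom_center (c t)) cc d cd pt.
have cpt : {for t, continuous (chart p \o c)} by apply: cont_comp ct _; exact: continuous_chart.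
set rep := local_rep phi p q in cA iso *.
have n1 : \forall u \near t, A ((chart p \o c) u) by apply: cpt; exact: open_nbhs_nbhs.
have n2 : \forall u \near t, dom p (c u) by apply: ct; apply: open_nbhs_nbhs; split=> //; exact: dom_open.
have nE : \forall u \near t, (rep \o (chart p \o c)) u = (chart q \o (phi \o c)) u.
  by apply: filterS n2 => u pu; rewrite /rep /local_rep /= chartK.
have drep x : A x -> differentiable rep x by move=> Ax; exact: diff_C1_plane oA Ax cA.
have dE : \forall u \near t, is_derive u (1 : R) (chart q \o (phi \o c)) ('d rep ((chart p \o c) u) (derive1 (chart p \o c) u)).
  apply: filterS3 n1 dp (near_join nE) => u Au du Eu. have du' : differentiable (chart p \o c) u by exact/derivable1_diffP. have D := differentiable_comp du' (drep _ Au).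
  apply: near_eq_is_derive Eu _; apply: DeriveDef; first exact: diff_derivable. by rewrite (deriveE _ D) (diff_comp du' (drep _ Au)) /= derive1E (deriveE _ du').
have cc' : \forall u \near t, {for u, continuous (phi \o c)}.
  by apply: filterS2 cc cphi => u h1 h2; exact: cont_comp h1 h2.
have cd' : {for t, continuous (derive1 (chart q \o (phi \o c)))}.
  have nD : \forall u \near t, (derive1 (chart p \o c) u).1 *: 'D_e1 rep ((chart p \o c) u) + (derive1 (chart p \o c) u).2 *: 'D_e2 rep ((chart p \o c) u) = derive1 (chart q \o (phi \o c)) u.
    apply: filterS2 n1 dE => u Au [_ dE']; rewrite [RHS]derive1E dE'. by rewrite (diff_expand _ (drep _ Au)).
  rewrite /prop_for /continuous_at -(nbhs_singleton nD). apply: cvg_trans (near_eq_cvg nD) _.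
  have k1 : {for t, continuous (fun u => (derive1 (chart p \o c) u).1)} by apply: cont_comp cdp (@cont_fst R _).
  have k2 : {for t, continuous (fun u => (derive1 (chart p \o c) u).2)} by apply: cont_comp cdp (@cont_snd R _).
  have k3 v : {for t, continuous (fun u => 'D_v rep ((chart p \o c) u))} by apply: cont_comp cpt ((cA v).2 _ At).
  by apply: cvgD; apply: cvgZ; [exact: k1|exact: k3|exact: k2|exact: k3].
have dd : \forall u \near t, derivable (chart q \o (phi \o c)) u 1 by apply: filterS dE => u [].
have [r1 r2] := C1_at_chart qt cc' dd cd' (dom_center (phi (c t))).
split; first by split.
have [dt Et] := nbhs_singleton dE.
rewrite (speedE GM qt (nbhs_singleton cc') dt) (speedE GN pt ct (nbhs_singleton dp)).
by rewrite derive1E Et /= iso.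
Qed.

End LocalIsometry.

(** * Gluing of curves and clamping of parameters *)

Section Gluing.
Variable R : realType.

Lemma strong_real_induction (a b : R) (Q : R -> Prop) : a <= b ->
  (forall t, a <= t <= b -> (forall u, a <= u < t -> Q u) ->
     exists2 e, 0 < e & forall u, a <= u <= b -> t - e < u < t + e -> Q u) ->
  forall t, a <= t <= b -> Q t.
Proof.
move=> ab H; apply: real_induction => // [t tab h|t /andP[ta tb] h].
  by have [e e0 He] := H t tab h; apply: He => //; lra.
have [|u /andP[u1 u2]|e e0 He] := H t; first by rewrite ta ltW.
  by apply: h; rewrite u1 ltW.
exists e => // u /andP[u1 u2] ub; apply: He; lra.
Qed.

(** Allows a curve on [a, b] to be treated as a continuous map on the line. *)
Definition clamp (a b t : R) := Num.max a (Num.min t b).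

Lemma clamp_itv a b t : a <= b -> a <= clamp a b t <= b.
Proof. by move=> ab; rewrite /clamp le_max lexx /= ge_max ab ge_min lexx orbT. Qed.

Lemma clampE a b t : a <= t <= b -> clamp a b t = t.
Proof. by move=> /andP[t1 t2]; rewrite /clamp (min_idPl t2) (max_idPr t1). Qed.

Lemma continuous_clamp a b : continuous (clamp a b).
Proof.
move=> t; apply: (@continuous_max R _ (fun=> a) (fun t => Num.min t b)); first exact: cvg_cst.
by apply: (@continuous_min R _ id (fun=> b)); [exact: cvg_id|exact: cvg_cst].
Qed.

Lemma glue_continuous (T : topologicalType) (g h : R -> T) (m : R) :
  continuous g -> continuous h -> g m = h m -> continuous (fun t => if t <= m then g t else h t).
Proof.
move=> cg ch e t; have [tm|tm|->] := ltgtP t m.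
- have n : \forall u \near t, g u = (fun t => if t <= m then g t else h t) u.
    by apply: filterS (lt_nbhsl tm) => u um; rewrite (ltW um).
  rewrite /continuous_at ifT ?(ltW tm)//. apply: cvg_trans (near_eq_cvg n) _; exact: cg.
- have n : \forall u \near t, h u = (fun t => if t <= m then g t else h t) u.
    by apply: filterS (lt_nbhsr tm) => u um; rewrite leNgt um.
  rewrite /continuous_at ifF; last by rewrite leNgt tm. apply: cvg_trans (near_eq_cvg n) _; exact: ch.
- rewrite /continuous_at lexx => A nA; have n1 : nbhs m (g @^-1` A) := cg m A nA. rewrite e in nA; have n2 : nbhs m (h @^-1` A) := ch m A nA.
  have n3 : nbhs m [set u | A (if u <= m then g u else h u)].
    by apply: filterS2 n1 n2 => u h1 h2 /=; case: ifP.
  exact: n3.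
Qed.

Lemma arc_continuous (N : surface R) (G : riemannian_metric N) c a b l :
  arc G c a b l -> continuous (c \o clamp a b).
Proof.
elim=> {a b l} [a b c' L ab [cc' _] E _|a m b l1 l2 h1 IH1 h2 IH2].
  have -> : c \o clamp a b = c' \o clamp a b by apply/funext => t /=; rewrite E// clamp_itv// ltW. by move=> t; apply: cont_comp (@continuous_clamp a b t) _; exact: cc'.
have am := arc_lt h1; have mb := arc_lt h2.
have -> : c \o clamp a b = fun t => if t <= m then (c \o clamp a m) t else (c \o clamp m b) t.
  apply/funext => t /=; case: ifP => tm; congr c; rewrite /clamp.
    by rewrite (min_idPl tm) (min_idPl (le_trans tm (ltW mb))).
  have mt : m <= t by rewrite ltW// ltNge tm. have mm : m <= Num.min t b by rewrite le_min mt ltW. by rewrite (max_idPr mm) (max_idPr (le_trans (ltW am) mm)).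
apply: glue_continuous => //=.
by rewrite !clampE ?lexx ?ltW.
Qed.

End Gluing.

(** * Lifting of paths, lengths and homotopies to the universal cover *)

Section Covering.
Variables (R : realType) (M : surface R) (G : riemannian_metric M) (U : universal_cover G).
Local Notation GU := (cover_metric U).
Local Notation f := (@cover_proj R M G U).
Implicit Types (k : R -> U) (c : R -> M).

Let smooth_f : smooth_map f := cover_proj_smooth U.
Let iso_f : pullback_eq GU G f := @cover_proj_isometric R M G U.

Lemma continuous_proj : continuous f. Proof. by have [] := smooth_f. Qed.

Record section_on (V : set M) (W : set U) (s : M -> U) : Prop := SectionOn {
  sec_openV : open V ; sec_openW : open W ; sec_cont : forall y, V y -> {for y, continuous s} ; sec_img : forall y, V y -> W (s y) /\ f (s y) = y ;
  sec_inv : forall z, W z -> V (f z) /\ s (f z) = z }.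

Lemma evenly_covered (x : M) : exists V : set M, [/\ open V, V x &
  forall u, V (f u) -> exists W s, section_on V W s /\ W u].
Proof.
have [_ _ H] := cover_proj_covering U; have [V [oV Vx [sh [E _ Hs]]]] := H x.
exists V; split=> // u Vu.
have [W sW Wu] : (\bigcup_(W in sh) W) u by rewrite -E.
have [oW [s [cs s1 s2]]] := Hs W sW.
exists W, s; split=> //; split=> //.
  by move=> y Vy; rewrite (continuous_open_subspace _ oV) in cs; apply: cs; rewrite inE.
move=> z Wz; split; last exact: s2.
have : (f @^-1` V) z by rewrite E; exists W.
by [].
Qed.

Lemma proj_surj (x : M) : exists u, f u = x.
Proof. by have [_ H _] := cover_proj_covering U; have [u _ <-] := H x I; exists u. Qed.

(** In charts the section is a continuous inverse of the covering map, so [inverse_diff] applies and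
    the isometry property is inverted with it. *)
Lemma section_isometric V W s y : section_on V W s -> V y -> isometric_at G GU s y.
Proof.
move=> [oV oW cs s1 s2] Vy; have [Wsy fsy] := s1 y Vy; pose q := s y.
pose O : set (R * R) := cod q `&` chart_inv q @^-1` (W `&` f @^-1` dom y).
pose Om : set (R * R) := cod y `&` chart_inv y @^-1` (V `&` s @^-1` dom q).
pose tau := local_rep f q y; pose sigma := local_rep s y q.
have oO : open O.
  apply: open_chart_inv; apply: openI => //. by apply: open_comp (@dom_open _ _ _) => z _; exact: continuous_proj.
have oVs : open (V `&` s @^-1` dom q).
  rewrite openE => z [Vz dz]; apply: filterI; first exact: open_nbhs_nbhs. by apply: cs => //; apply: open_nbhs_nbhs; split=> //; exact: dom_open.
have oOm : open Om by exact: open_chart_inv.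
have Old : O `<=` local_dom f q y.
  move=> w [cw [Ww dw]]; exists (chart_inv q w); last exact: chart_invK. by split=> //; exact: dom_chart_inv.
have ct : Ck_on 1 O tau := Ck_sub Old (smooth_f.2 q y 1%N).
have inv v : Om v -> O (sigma v) /\ tau (sigma v) = v.
  move=> [cv [Vv dv]]; have [Wv fv] := s1 _ Vv. rewrite /sigma /tau /local_rep /=; split; last by rewrite chartK// fv chart_invK. split; first exact: cod_chart.
  by rewrite /= chartK//; split=> //=; rewrite fv; exact: dom_chart_inv.
have csig v : Om v -> {for v, continuous sigma}.
  move=> [cv [Vv dv]]; apply: cont_comp (continuous_chart_inv cv) _. by apply: cont_comp (cs _ Vv) _; exact: continuous_chart.
(* The density upstairs is positive and equals the absolute Jacobian times the density
   downstairs. *)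
have JN w : O w -> ('D_((1, 0) : R * R) tau w).1 * ('D_((0, 1) : R * R) tau w).2 - ('D_((0, 1) : R * R) tau w).1 * ('D_((1, 0) : R * R) tau w).2 != 0.
  move=> Ow; have [cw [Ww dw]] := Ow. have dt : differentiable tau w := diff_C1_plane oO Ow ct. rewrite !(deriveE _ dt).
  have cv : cod y (tau w) by rewrite /tau /local_rep /=; exact: cod_chart. have I u u' : GU q w u u' = G y (tau w) ('d tau w u) ('d tau w u') by exact: (iso_f (Old _ Ow)).
  have := density_gt0 GU cw.
  rewrite (@density_jacobian R U M GU G q y w (tau w) ('d tau w (1, 0)).1 ('d tau w (0, 1)).1 ('d tau w (1, 0)).2 ('d tau w (0, 1)).2 cv); try by rewrite I -!surjective_pairing.
  by apply: contraTneq => ->; rewrite normr0 mul0r ltxx.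
have [cS dS] := inverse_diff oO oOm inv csig ct JN.
have Oy : Om (chart y y).
  by split; [apply: cod_chart; exact: dom_center|rewrite /= chartK; [split=> //; exact: dom_center|exact: dom_center]].
exists y, q, Om; split=> //; [exact: dom_center|exact: dom_center| |split=> // u].
  move=> v [cv [Vv dv]]; exists (chart_inv y v); last exact: chart_invK. by split=> //; exact: dom_chart_inv.
have [Osy _] := inv _ Oy.
have E : sigma (chart y y) = chart q (s y) by rewrite /sigma /local_rep /= chartK//; exact: dom_center.
have fq : f q = y by exact: fsy.
have tE : tau (chart q (s y)) = chart y y by rewrite /tau /local_rep /= chartK ?fsy//; exact: dom_center.
rewrite /nrm -E -/sigma (iso_f (Old _ Osy)) -/tau (dS _ u Oy).
by rewrite E tE.
Qed.

(** Agreement passes to limits because the cover is Hausdorff, and beyond a point because both lifts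
    stay in one sheet. *)
Lemma lift_unique k1 k2 (a b : R) : a <= b -> continuous k1 -> continuous k2 ->
  (forall t, a <= t <= b -> f (k1 t) = f (k2 t)) -> k1 a = k2 a -> forall t, a <= t <= b -> k1 t = k2 t.
Proof.
move=> ab c1 c2 E Ea; apply: real_induction => // [t /andP[ta tb] h|t /andP[ta tb] h].
  have [->//|ta'] := eqVneq t a; have {}ta : a < t by rewrite lt_neqAle eq_sym ta'. apply: (@surface_hausdorff R U) => A B nA nB. have n1 : nbhs t (k1 @^-1` A) := c1 t A nA.
  have n2 : nbhs t (k2 @^-1` B) := c2 t B nB. have [e /= e0 He] := (nbhs_ballP _ _).1 (filterI n1 n2). pose u := Num.max a (t - e / 2). have ut : u < t by rewrite gt_max ta; lra.
  have au : a <= u by rewrite le_max lexx. have eu : t - e / 2 <= u by rewrite le_max lexx orbT.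
  have [/= Au Bu] : (k1 @^-1` A `&` k2 @^-1` B) u by apply: He; rewrite -ball_normE /= ltr_norml; lra. by exists (k1 u); split=> //; rewrite h// au.
have Et : k1 t = k2 t by apply: h; rewrite ta lexx.
have [V [oV Vt HV]] := evenly_covered (f (k1 t)).
have [W [s [[_ oW _ _ sv] Wt]]] := HV _ Vt.
have n1 : \forall u \near t, W (k1 u) by apply: (c1 t W); exact: open_nbhs_nbhs.
have n2 : \forall u \near t, W (k2 u) by apply: (c2 t W); rewrite -Et; exact: open_nbhs_nbhs.
have [e /= e0 He] := (nbhs_ballP _ _).1 (filterI n1 n2).
exists e => // u /andP[u1 u2] ub.
have [W1 W2] : W (k1 u) /\ W (k2 u) by apply: He; rewrite -ball_normE /= ltr_norml; lra.
have [_ <-] := sv _ W1; have [_ <-] := sv _ W2; rewrite E//; lra.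
Qed.

Lemma lift_path c (a b : R) u0 : a <= b -> continuous c -> f u0 = c a ->
  exists k, [/\ continuous k, k a = u0 & forall t, a <= t <= b -> f (k t) = c t].
Proof.
move=> ab cc fu.
pose Q (t : R) := exists k, [/\ continuous k, k a = u0 & forall u, a <= u <= t -> f (k u) = c u].
suff : Q b by [].
have := @strong_real_induction R a b Q ab _ b; apply; last by rewrite ab lexx.
move=> t /andP[ta tb] IH.
have [V [oV Vt HV]] := evenly_covered (c t).
have nV : \forall u \near t, V (c u) by apply: (cc t V); exact: open_nbhs_nbhs.
have [e /= e0 He] := (nbhs_ballP _ _).1 nV.
have He' u : `|u - t| < e -> V (c u) by move=> h; apply: He; rewrite -ball_normE /= distrC.
(* A parameter up to which a lift exists already: either u < t, or u = a with the constant lift.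
   From u on, the lift is the section applied to c. *)
pose u := Num.max a (t - e / 2).
have au : a <= u by rewrite le_max lexx.
have eu : t - e / 2 <= u by rewrite le_max lexx orbT.
have ut : u <= t by rewrite ge_max ta; lra.
have [k [ck ka kf]] : Q u.
  have [->|nu] := eqVneq u a.
    exists (fun=> u0); split=> //; first by move=> x; exact: cvg_cst. by move=> x; rewrite -eq_le => /eqP <-.
  apply: IH; rewrite au /= gt_max lt_neqAle ta andbT; apply/andP; split; last by lra. by apply: contra_neq nu => at'; rewrite /u -at' max_l// gerBl divr_ge0// ltW.
have Vu : V (f (k u)) by rewrite kf ?au ?lexx//; apply: He'; rewrite ltr_norml; lra.
have [W [s [[_ oW cs s1 s2] Wu]]] := HV _ Vu.
have Vc x : V (c (clamp u (t + e / 2) x)).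
  have utt : u <= t + e / 2 by lra. by have := @clamp_itv R _ _ x utt => /andP[x1 x2]; apply: He'; rewrite ltr_norml; lra.
pose h x := s (c (clamp u (t + e / 2) x)).
have ch : continuous h.
  have h1 x : {for x, continuous (c \o clamp u (t + e / 2))}.
    exact: (@cont_comp _ _ _ (clamp u (t + e / 2)) c x (@continuous_clamp R _ _ x) (cc _)).
  move=> x; exact: (@cont_comp _ _ _ (c \o clamp u (t + e / 2)) s x (h1 x) (cs _ (Vc x))).
exists (e / 2); first by rewrite divr_gt0.
move=> v /andP[av vb] /andP[v1 v2]; exists (fun x => if x <= u then k x else h x); split.
- apply: glue_continuous => //; rewrite /h clampE; last by lra. by have [_ <-] := s2 _ Wu; rewrite kf// au lexx.
- by rewrite au.
- move=> x /andP[ax xv]; case: ifP => xu; first by apply: kf; rewrite ax. have ux : u < x by rewrite ltNge xu.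
  have := (s1 _ (Vc x)).2; rewrite -/(h x) => ->; rewrite clampE//; lra.
Qed.

Lemma proj_arc k (a b l : R) : arc GU k a b l -> arc G (f \o k) a b l.
Proof.
elim=> {a b l} [a b c' L ab cc' E dL|a m b l1 l2 _ IH1 _ IH2]; last exact: arc_cat IH1 IH2.
have C t : C1_at c' t by exact: (C1_curveP c').1.
have I t : C1_at (f \o c') t /\ speed G (f \o c') t = speed GU c' t.
  apply: isometric_C1 (C t); first exact: isometric_at_smooth. by apply: filterE => u; exact: continuous_proj.
apply: (arc_C1 ab (c' := f \o c')).
- by apply/C1_curveP => t; have [] := I t.
- by move=> t tab /=; rewrite E.
- by move=> t tab; have [_ ->] := I t; exact: dL.
Qed.

Lemma lift_C1 k c (t : R) : (\forall u \near t, {for u, continuous k}) -> (\forall u \near t, f (k u) = c u) ->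
  C1_at c t -> C1_at k t /\ speed GU k t = speed G c t.
Proof.
move=> ck E Ct; have Et : f (k t) = c t := nbhs_singleton E.
have [V [oV Vt HV]] := evenly_covered (c t).
have [W [s [sec Wt]]] : exists W s, section_on V W s /\ W (k t) by apply: HV; rewrite Et.
have nW : \forall u \near t, W (k u).
  by apply: (nbhs_singleton ck W); apply: open_nbhs_nbhs; split=> //; exact: sec_openW sec.
have nE : \forall u \near t, (s \o c) u = k u.
  by apply: filterS2 nW E => u Wu Eu; rewrite /= -Eu; have [_ ->] := sec_inv sec Wu.
have nV : \forall u \near t, {for c u, continuous s}.
  by apply: filterS2 nW E => u Wu Eu; rewrite -Eu; apply: (sec_cont sec); have [] := sec_inv sec Wu.
have [C S] := isometric_C1 (section_isometric sec Vt) nV Ct.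
by split; [exact: C1_at_near nE C|rewrite -(speed_near GU nE)].
Qed.

(** [arc_local] needs a lift that is C^1 slightly beyond [a, b]. So k is prolonged by lifts of the
    C^1 piece c' over [a - 1, a], run backwards, and [b, b + 1]. Equality of speeds then makes the
    two primitives differ by a constant. *)
Lemma lift_arc k c (a b l : R) : continuous k -> (forall t, a <= t <= b -> f (k t) = c t) ->
  arc G c a b l -> arc GU k a b l.
Proof.
move=> ck E h; elim: h E => {a b l} [a b c' L ab cc' Ec dL|a m b l1 l2 h1 IH1 h2 IH2] E; last first.
  have am := arc_lt h1; have mb := arc_lt h2. by apply: arc_cat; [apply: IH1|apply: IH2] => t /andP[t1 t2]; apply: E; lra.
have C t : C1_at c' t by exact: (C1_curveP c').1.
have cont_c' : continuous c' by case: cc'.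
have fa : f (k a) = c' a by rewrite E ?lexx ?ltW// Ec// lexx ltW.
have fb : f (k b) = c' b by rewrite E ?lexx ?ltW// Ec// lexx ltW.
have ab1 : a - 1 <= a by lra.
have bb1 : b <= b + 1 by lra.
have cneg : continuous (fun t => c' (a - t)).
  move=> t; apply: (@cont_comp _ _ _ (fun t => a - t) c'); last exact: cont_c'. by apply: cvgB; [exact: cvg_cst|exact: cvg_id].
have fa0 : f (k a) = c' (a - 0) by rewrite subr0.
have [kl [ckl kl0 kle]] := lift_path ler01 cneg fa0.
have [kr [ckr kr0 kre]] := lift_path bb1 cont_c' fb.
pose h t := if t <= a then kl (a - t) else (if t <= b then k t else kr t).
have ch : continuous h.
  apply: (@glue_continuous R U (fun t => kl (a - t)) (fun t => if t <= b then k t else kr t)).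
  - move=> t; apply: (@cont_comp _ _ _ (fun t => a - t) kl); last exact: ckl. by apply: cvgB; [exact: cvg_cst|exact: cvg_id].
  - by apply: glue_continuous.
  - by rewrite subrr kl0 ifT// ltW.
have fh t : a - 1 <= t <= b + 1 -> f (h t) = c' t.
  move=> /andP[t1 t2]; rewrite /h; case: ifP => ta; first by rewrite kle ?subKr//; lra. have {}ta : a < t by rewrite ltNge ta. case: ifP => tb; first by rewrite E ?Ec//; lra.
  have {}tb : b < t by rewrite ltNge tb. by rewrite kre//; lra.
have HC t : a - 1 < t < b + 1 -> C1_at h t /\ speed GU h t = speed G c' t.
  move=> /andP[t1 t2]; apply: lift_C1 (C t); first by apply: filterE => u; exact: ch. by apply: filterS2 (lt_nbhsr t1) (lt_nbhsl t2) => u u1 u2; apply: fh; rewrite !ltW.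
have [L2 [dL2 aL2]] := arc_local GU ab ltr01 (fun t ht => (HC t ht).1).
have hk t : a <= t <= b -> k t = h t.
  move=> /andP[t1 t2]; rewrite /h; case: ifP => ta; last by rewrite t2. by have -> : t = a by [apply/eqP; rewrite eq_le ta t1]; rewrite subrr kl0.
have -> : L b - L a = L2 b - L2 a; last exact: arc_eq aL2 hk.
have D t : a <= t <= b -> is_derive t (1 : R) (fun t => L2 t - L t) 0.
  move=> /andP[t1 t2]; have ht : a - 1 < t < b + 1 by lra. apply: (is_derive_eq (is_deriveB (dL2 t _) (dL t _))); rewrite ?t1 ?t2//. by rewrite (HC t ht).2 subrr.
have D' t : a <= t <= b -> is_derive t (1 : R) (fun t => L t - L2 t) 0.
  move=> /andP[t1 t2]; have ht : a - 1 < t < b + 1 by lra. apply: (is_derive_eq (is_deriveB (dL t _) (dL2 t _))); rewrite ?t1 ?t2//. by rewrite (HC t ht).2 subrr.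
have := derive_ge0_le (ltW ab) D (fun _ _ => lexx 0); have := derive_ge0_le (ltW ab) D' (fun _ _ => lexx 0).
lra.
Qed.

Lemma within_nbhs (T T' : topologicalType) (S : set T) (g : T -> T') x A :
  {within S, continuous g} -> S x -> nbhs (g x) A -> nbhs x [set u | S u -> A (g u)].
Proof.
move=> cg Sx nA; have [V nV E] := (nbhs_subspace_ex (g @^-1` A) Sx).1 (cg x A nA).
apply: filterS nV => u Vu Su.
by have : (V `&` S) u by []; rewrite -E => -[].
Qed.

Lemma clamp_within (T : topologicalType) (c : R -> T) (a b : R) : a <= b ->
  {within `[a, b], continuous c} -> continuous (c \o clamp a b).
Proof.
move=> ab cc t A nA.
have h : `[a, b]%classic (clamp a b t) by rewrite /= in_itv /= clamp_itv.
have n1 := within_nbhs cc h nA.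
have n2 : nbhs t (clamp a b @^-1` [set u | `[a, b]%classic u -> A (c u)]) := @continuous_clamp R a b t _ n1.
by apply: filterS n2 => u /= hu; apply: hu; rewrite /= in_itv /= clamp_itv.
Qed.

(* If c is freely contractible, the monodromy of the homotopy is constant. *)
Lemma contractible_lift c k : contractible_loop c -> continuous k ->
  (forall t, 0 <= t <= 1 -> f (k t) = c t) -> k 0 = k 1.
Proof.
move=> [H [cH H0 [x Hx] Hp]] ck kc.
pose cl : R -> R := clamp 0 1.
have cl01 t : 0 <= cl t <= 1 by exact: clamp_itv.
pose H' (v : R * R) := H (cl v.1, cl v.2).
have cH' : continuous H'.
  move=> v A nA. have h : (`[0, 1]%classic `*` `[0, 1]%classic) (cl v.1, cl v.2) by split; rewrite /= in_itv /= cl01. have n1 := within_nbhs cH h nA.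
  have cc : {for v, continuous (fun v : R * R => (cl v.1, cl v.2))}.
    have c1 : {for v, continuous (fun v : R * R => cl v.1)} by exact: (@cont_comp _ _ _ fst cl v (@cont_fst R v) (@continuous_clamp R 0 1 _)).
    have c2 : {for v, continuous (fun v : R * R => cl v.2)} by exact: (@cont_comp _ _ _ snd cl v (@cont_snd R v) (@continuous_clamp R 0 1 _)). exact: (cvg_pair c1 c2).
  have n2 : nbhs v [set u : R * R | (`[0, 1]%classic `*` `[0, 1]%classic) (cl u.1, cl u.2) -> A (H' u)] := cc _ n1.
  by apply: filterS n2 => u /= hu; apply: hu; split; rewrite /= in_itv /= cl01.
have pair_cont1 (s : R) : continuous (fun t : R => (s, t)).
  move=> t; have l1 : {for t, continuous (fun _ : R => s)} by exact: cvg_cst. have l2 : {for t, continuous (fun t : R => t)} by exact: cvg_id. exact: (cvg_pair l1 l2).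
have pair_cont2 (t : R) : continuous (fun s : R => (s, t)).
  move=> s; have l1 : {for s, continuous (fun _ : R => t)} by exact: cvg_cst. have l2 : {for s, continuous (fun t : R => t)} by exact: cvg_id. exact: (cvg_pair l2 l1).
have cHs s : continuous (fun t => H' (s, t)) by move=> t; exact: (@cont_comp _ _ _ (fun t : R => (s, t)) H' t (pair_cont1 s t) (cH' _)).
have cHt t : continuous (fun s => H' (s, t)) by move=> s; exact: (@cont_comp _ _ _ (fun s : R => (s, t)) H' s (pair_cont2 t s) (cH' _)).
have e0 : 0 <= (0 : R) <= 1 by rewrite lexx ler01.
have e1 : 0 <= (1 : R) <= 1 by rewrite lexx ler01.
have clE t : 0 <= t <= 1 -> cl t = t by exact: clampE.
have k00 : f (k 0) = H' (0, 0) by rewrite kc// /H' /= !clE// H0// in_itv.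
have [P [cP P0 fP]] := lift_path ler01 (cHt 0) k00.
(* [h s] lifts the loop at stage s, starting on the lift P of the track of the base point. These
   lifts are chosen independently, so continuity in s needs an argument. *)
have /choice[h Hh] s : exists k', [/\ continuous k', k' 0 = P (cl s) & forall t, 0 <= t <= 1 -> f (k' t) = H' (s, t)].
  have E : f (P (cl s)) = H' (s, 0) by rewrite fP// /H' /= (clE (cl s)). exact: lift_path ler01 (cHs s) E.
have ch s : continuous (h s) by have [] := Hh s.
have h0 s : h s 0 = P (cl s) by have [] := Hh s.
have fh s t : 0 <= t <= 1 -> f (h s t) = H' (s, t) by have [_ _] := Hh s; apply.
(* Continuity in s is propagated along t: inside an evenly covered set [h s v] is the section
   applied to the homotopy, by unique lifting from an earlier parameter u at which continuity is
   known. *)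
have cont s0 : forall t, 0 <= t <= 1 -> {for s0, continuous (fun s => h s t)}.
  apply: strong_real_induction => // t /andP[t0 t1] IH. have [V [oV Vt HV]] := evenly_covered (H' (s0, t)).
  have nV : nbhs (s0, t) [set v | V (H' v)] := cH' (s0, t) V (open_nbhs_nbhs (conj oV Vt)). have [e /= e00 He] := (nbhs_ballP _ _).1 nV.
  have He' s u : `|s - s0| < e -> `|u - t| < e -> V (H' (s, u)).
    by move=> hs hu; apply: He; split; rewrite -ball_normE /= distrC.
  pose u := Num.max 0 (t - e / 2). have au : 0 <= u by rewrite le_max lexx. have eu : t - e / 2 <= u by rewrite le_max lexx orbT. have ut : u <= t by rewrite ge_max t0; lra.
  have u01 : 0 <= u <= 1 by lra. have cu : {for s0, continuous (fun s => h s u)}.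
    have [E|nu] := eqVneq u 0.
      have -> : (fun s => h s u) = P \o cl by apply/funext => s; rewrite E h0. exact: (@cont_comp _ _ _ cl P s0 (@continuous_clamp R 0 1 s0) (cP _)).
    apply: IH; rewrite au /= gt_max; apply/andP; split; last by lra. rewrite lt_neqAle t0 andbT; apply: contra_neq nu => t0'.
    by rewrite /u -t0' max_l// sub0r oppr_le0 divr_ge0// ltW.
  have e'0 : `|u - t| < e by rewrite ltr_norml; lra. have Vu : V (f (h s0 u)) by rewrite fh//; apply: He'; rewrite ?subrr ?normr0. have [W [sg [[_ oW cs s1 s2] Wu]]] := HV _ Vu.
  have nW : nbhs s0 [set s | W (h s u)] := cu W (open_nbhs_nbhs (conj oW Wu)). have nE : \forall s \near s0, `|s - s0| < e.
    by apply/nbhs_ballP; exists e => //= s; rewrite -ball_normE /= distrC.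
  exists (e / 2); first by rewrite divr_gt0. move=> v /andP[v0 v1] /andP[v2 v3]. have [vu|uv] := leP v u.
    have [->//|nvu] := eqVneq v u; apply: IH; rewrite v0 /=; apply: lt_le_trans ut. by rewrite lt_neqAle nvu.
  have nF : \forall s \near s0, sg (H' (s, v)) = h s v.
    apply: filterS2 nW nE => s Ws hs. pose q x := sg (H' (s, clamp u v x)). have Vq z : V (H' (s, clamp u v z)).
      have /andP[z1 z2] := clamp_itv z (ltW uv); apply: He' => //; rewrite ltr_norml; lra.
    have cq : continuous q.
      move=> y; have c1 : {for y, continuous (fun y => H' (s, clamp u v y))}.
        exact: (@cont_comp _ _ _ (clamp u v) (fun t => H' (s, t)) y (@continuous_clamp R u v y) (cHs s _)).
      exact: (@cont_comp _ _ _ (fun y => H' (s, clamp u v y)) sg y c1 (cs _ (Vq y))).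
    have uu : u <= u <= v by rewrite lexx (ltW uv). have vv : u <= v <= v by rewrite lexx (ltW uv). have qf y : u <= y <= v -> f (q y) = f (h s y).
      move=> /andP[y1 y2]; rewrite (s1 _ (Vq y)).2 clampE ?y1// fh//. by rewrite (le_trans au y1) (le_trans y2 v1).
    have qu : q u = h s u by rewrite /q clampE// -fh//; exact: (s2 _ Ws).2. by have := lift_unique (ltW uv) cq (ch s) qf qu vv; rewrite /q clampE.
  have Vv : V (H' (s0, v)) by apply: He'; rewrite ?subrr ?normr0// ltr_norml; lra. have cg : {for s0, continuous (fun s => sg (H' (s, v)))}.
    exact: (@cont_comp _ _ _ (fun s => H' (s, v)) sg s0 (cHt v s0) (cs _ Vv)).
  rewrite /prop_for /continuous_at -(nbhs_singleton nF). exact: cvg_trans (near_eq_cvg nF) cg.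
have H01 s : 0 <= s <= 1 -> H' (s, 1) = H' (s, 0).
  by move=> s01; rewrite /H' /= !clE// Hp// in_itv.
have hk : k 1 = h 0 1.
  apply: (lift_unique ler01 ck (ch 0)) => //.
    by move=> t t01; rewrite kc// fh// /H' /= !clE// H0// in_itv.
  by rewrite h0 clE.
have h1 : h 1 1 = P 1.
  have cc : continuous (fun _ : R => P 1) by move=> t; exact: cvg_cst. apply: (lift_unique ler01 (ch 1) cc) => //; last by rewrite h0 clE.
  by move=> t t01; rewrite fh// fP// /H' /= !clE// !Hx// in_itv /= ?ler01 ?lexx.
have cs1 s : {for s, continuous (fun s : R => 1 - s : R)}.
  by apply: cvgB; [exact: cvg_cst|exact: cvg_id].
(* Uniqueness of lifts is run backwards from s = 1, where the loop and hence its lift are constant.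
   It gives h s 1 = P s for all s, in particular k 1 = h 0 1 = P 0 = k 0. *)
have c1 : continuous (fun s : R => h (1 - s) 1).
  by move=> s; apply: (@cont_comp _ _ _ (fun s : R => 1 - s) (fun s : R => h s 1)); [exact: cs1|exact: cont].
have c2 : continuous (fun s : R => P (1 - s)).
  by move=> s; apply: (@cont_comp _ _ _ (fun s : R => 1 - s) P); [exact: cs1|exact: cP].
have : h (1 - 1) 1 = P (1 - 1).
  apply: (lift_unique ler01 c1 c2) => //; last by rewrite subr0. by move=> s /andP[sa sb]; rewrite fh// fP ?H01//; lra.
by rewrite subrr => e; rewrite hk e P0.
Qed.

Lemma lift_joins u y l : joins G (f u) y l -> exists u', f u' = y /\ joins GU u u' l.
Proof.
move=> [c [h c0 c1]]; have cc := arc_continuous h.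
have e0 : 0 <= (0 : R) <= 1 by rewrite lexx ler01.
have e1 : 0 <= (1 : R) <= 1 by rewrite lexx ler01.
have fu : f u = (c \o clamp 0 1) 0 by rewrite /= clampE.
have [k [ck k0 kc]] := lift_path ler01 cc fu.
have kc' t : 0 <= t <= 1 -> f (k t) = c t by move=> t01; rewrite kc//= clampE.
exists (k 1); rewrite kc'//; split=> //.
by exists k; split=> //; exact: lift_arc ck kc' h.
Qed.

Lemma proj_joins u u' l : joins GU u u' l -> joins G (f u) (f u') l.
Proof. by move=> [k [h <- <-]]; exists (f \o k); split=> //; exact: proj_arc. Qed.

(** The projected path is a loop with a nonclosed lift, so by [contractible_lift] it is not
    contractible. *)
Lemma fiber_joins u u' l : f u = f u' -> u != u' -> joins GU u u' l -> (systole G <= l%:E)%E.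
Proof.
move=> fu uu [k [h k0 k1]]; have h' := proj_arc h.
rewrite -(arc_curve_length h'); apply: ereal_inf_lbound; exists (f \o k) => //.
have cc := arc_continuous h.
split; first exact: arc_piecewise h'.
  split; last by rewrite /= k0 k1. have c1 : continuous (f \o (k \o clamp 0 1)).
    by move=> t; exact: (@cont_comp _ _ _ (k \o clamp 0 1) f t (cc t) (@continuous_proj _)).
  apply: (@subspace_eq_continuous _ _ _ (f \o (k \o clamp 0 1))); last exact: continuous_subspaceT. by move=> t; rewrite inE /= in_itv /= => t01; rewrite clampE.
move=> ctr; have := contractible_lift ctr cc.
rewrite /= !clampE ?lexx ?ler01// k0 k1 => E; move/eqP: uu; apply; apply: E.
by move=> t t01; rewrite /= clampE.
Qed.

(** A closed lift would be contractible in the simply connected cover, and the contraction would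
    project. *)
Lemma lift_nonclosed c : is_loop c -> ~ contractible_loop c ->
  exists k, [/\ continuous k, forall t, 0 <= t <= 1 -> f (k t) = c t & k 0 != k 1].
Proof.
move=> [cw c01] nc; have cc := clamp_within ler01 cw.
have e0 : 0 <= (0 : R) <= 1 by rewrite lexx ler01.
have [u fu] := proj_surj (c 0).
have fu' : f u = (c \o clamp 0 1) 0 by rewrite /= clampE.
have [k [ck k0 kc]] := lift_path ler01 cc fu'.
have kc' t : 0 <= t <= 1 -> f (k t) = c t by move=> t01; rewrite kc//= clampE.
exists k; split=> //; apply/eqP => k01; apply: nc.
have lk : is_loop k by split=> //; exact: continuous_subspaceT.
have [H [cH H0 [x Hx] Hp]] := @cover_simply_connected R M G U k lk.
exists (f \o H); split.
- by move=> v A nA; exact: (cH v (f @^-1` A) (@continuous_proj (H v) A nA)).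
- by move=> t t01; rewrite /= H0// kc'//; rewrite in_itv in t01.
- by exists (f x) => t /Hx /= ->.
- by move=> s /Hp /= ->.
Qed.

End Covering.



(** * Area of small rotated squares *)

Section BoxArea.
Variables (R : realType) (N : surface R) (G : riemannian_metric N).
Local Notation RR := (measurableTypeR R).
Local Notation T2 := (RR * RR)%type.
Local Notation mu2 := (@lebesgue_measure R \x @lebesgue_measure R)%E.
Implicit Types (z : N).

Lemma borel_chart_box z (P : set (R * R)) : open P -> P `<=` cod z -> borel (chart_inv z @` P).
Proof.
move=> oP Pz; have -> : chart_inv z @` P = dom z `&` chart z @^-1` P.
  apply/seteqP; split => [_ [x Px <-]|y [dy Py]].
    by split; [exact/dom_chart_inv/Pz|rewrite /= chart_invK//; exact: Pz].
  by exists (chart z y) => //; rewrite chartK.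
by apply: borel_open; exact: open_chart.
Qed.

Lemma open_parallelogram (a b c d e g h : R) : open (parallelogram a b c d e g h : set (R * R)).
Proof.
have cl a' b' e' : continuous (fun v : R * R => `|a' * v.1 + b' * v.2 - e'| : R).
  move=> v; apply: cvg_norm; apply: cvgB; last exact: cvg_cst. by apply: cvgD; apply: cvgM; [exact: cvg_cst|exact: cont_fst|exact: cvg_cst|exact: cont_snd].
have ol a' b' e' : open [set v : R * R | `|a' * v.1 + b' * v.2 - e'| < h].
  apply: (@open_comp _ _ (fun v : R * R => `|a' * v.1 + b' * v.2 - e'| : R) [set t | t < h]); last exact: open_lt. by move=> v _; exact: cl.
exact: (openI (ol a b e) (ol c d g)).
Qed.

(** The parallelogram is a square of half-side h in the Euclidean coordinates rotated by (c, s). Its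
    Lebesgue measure is 4 h^2 / (a1 b2), and the density is at least (1 - eta) a1 b2. *)
Lemma box_area z (eta a1 a2 b2 r d c s e g h : R) : isometric_chart G z eta a1 a2 b2 r d ->
  eta <= 1 -> c ^+ 2 + s ^+ 2 = 1 -> 0 < h -> (parallelogram (c * a1) (c * a2 + s * b2) (- s * a1) (- s * a2 + c * b2) e g h `<=`
    [set x | en a1 a2 b2 (x - chart z z) < r]) ->
  borel (chart_inv z @` parallelogram (c * a1) (c * a2 + s * b2) (- s * a1) (- s * a2 + c * b2) e g h) /\ (((1 - eta) * (4 * h ^+ 2))%:E <= area G
    (chart_inv z @` parallelogram (c * a1) (c * a2 + s * b2) (- s * a1) (- s * a2 + c * b2) e g h))%E.
Proof.
move=> I eta1 cs h0 PB; have a0 := ich_a1 I; have b0 := ich_b2 I.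
have oP := @open_parallelogram (c * a1) (c * a2 + s * b2) (- s * a1) (- s * a2 + c * b2) e g h.
have mP := @measurable_parallelogram R (c * a1) (c * a2 + s * b2) (- s * a1) (- s * a2 + c * b2) e g h.
have J : (c * a1) * (- s * a2 + c * b2) - (c * a2 + s * b2) * (- s * a1) = a1 * b2.
  have -> : a1 * b2 = a1 * b2 * (c ^+ 2 + s ^+ 2) by rewrite cs mulr1. by ring.
have J0 : 0 < a1 * b2 by exact: mulr_gt0.
have muP : mu2 (parallelogram (c * a1) (c * a2 + s * b2) (- s * a1) (- s * a2 + c * b2) e g h) =
    (4 * h ^+ 2 / (a1 * b2))%:E.
  by rewrite mu2_parallelogram// J ?gtr0_norm// gt_eqF.
move: PB oP mP muP; set P := parallelogram _ _ _ _ _ _ _ => PB oP mP muP.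
have Pz : P `<=` cod z by move=> x /PB; exact: (ich_cod I).
have bP := borel_chart_box oP Pz; split=> //.
have Pd : chart_inv z @` P `<=` dom z by move=> _ [x Px <-]; exact/dom_chart_inv/Pz.
have PE : chart z @` (chart_inv z @` P) = P.
  apply/seteqP; split => [_ [_ [x Px <-] <-]|x Px]; first by rewrite chart_invK//; exact: Pz. by exists (chart_inv z x); [exists x|rewrite chart_invK//; exact: Pz].
have mf := measurable_edensity G bP Pd; rewrite PE in mf.
apply: le_trans (chart_area_le_area G bP (@subset_refl _ _) Pd); rewrite /chart_area PE.
have -> : ((1 - eta) * (4 * h ^+ 2))%:E = (((1 - eta) * (a1 * b2))%:E * mu2 P)%E.
  by rewrite muP -EFinM; congr EFin; field; rewrite !gt_eqF.
rewrite -integral_cst//; apply: ge0_le_integral => //.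
- by move=> x _; rewrite lee_fin mulr_ge0 ?(ltW J0)// subr_ge0.
- by move=> x Px; rewrite lee_fin; have /andP[] := ich_density I (PB x Px).
Qed.

Lemma area_gt0 z : (0 < area G [set: N])%E.
Proof.
have [a1 [a2 [b2 [r [d I]]]]] := isometric_chart_ex G z (ltac:(by []) : 0 < (2^-1 : R)).
have h0 : 0 < r / 4 by rewrite divr_gt0// (ich_r I).
have cs : (1 : R) ^+ 2 + 0 ^+ 2 = 1 by rewrite expr1n expr0n addr0.
have h1 : (2^-1 : R) <= 1 by lra.
have a0 := ich_a1 I; have b0 := ich_b2 I; have r0 := ich_r I.
pose x0 := chart z z.
have [|_ H] := box_area (e := a1 * x0.1 + a2 * x0.2) (g := b2 * x0.2) I h1 cs h0.
  move=> x [p1 p2]; rewrite /= en_lt// /en2 /=. have q1 : `|(x - chart z z).1 * a1 + (x - chart z z).2 * a2| < r / 4.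
    by move: p1; congr (`| _ | < _); rewrite /x0 /=; ring.
  have q2 : `|(x - chart z z).2 * b2| < r / 4.
    by move: p2; congr (`| _ | < _); rewrite /x0 /=; ring.
  rewrite -(real_normK (num_real (_ * a1 + _))) -(real_normK (num_real (_ * b2))).
  move: q1 q2 (normr_ge0 ((x - chart z z).1 * a1 + (x - chart z z).2 * a2)) (normr_ge0 ((x - chart z z).2 * b2)). by move: `|_| `|_| => A B; nra.
apply: lt_le_trans (le_trans H _); last exact: le_area.
by have h2 : 0 < (r / 4) ^+ 2 := exprn_gt0 2 h0; rewrite lte_fin; lra.
Qed.

End BoxArea.

(** * Closed surfaces have finite area *)

Section FiniteArea.
Variables (R : realType) (M : surface R) (G : riemannian_metric M).
Hypothesis cM : compact [set: M].
Implicit Types (z : M).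

Lemma smooth_id : smooth_map (@id M).
Proof. by split; [move=> y; exact: cvg_id|move=> p q; exact: trans_smooth]. Qed.

Lemma compact_chart_in (z : M) (V : set M) : nbhs z V -> exists2 r : R, 0 < r & exists K : set (R * R),
  [/\ compact K, K `<=` cod z, [set y | dist G z y < r] `<=` chart_inv z @` K & chart_inv z @` K `<=` V].
Proof.
move=> nV; have [a1 [a2 [b2 [r [d I]]]]] := isometric_chart_ex G z (@ltr01 R).
have cz : cod z (chart z z) by apply: cod_chart; exact: dom_center.
have nV' : \forall x \near chart z z, V (chart_inv z x).
  by apply: (continuous_chart_inv cz); rewrite chartK//; exact: dom_center.
have [r' r'0 Hr'] := nbhs_en a2 (ich_a1 I) (ich_b2 I) nV'.
pose q := Num.min r r'; have q0 : 0 < q by rewrite lt_min (ich_r I).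
have qr : q <= r by rewrite ge_min lexx.
have qr' : q <= r' by rewrite ge_min lexx orbT.
pose K := [set x | en a1 a2 b2 (x - chart z z) <= q / 2].
have cK : compact K by apply: compact_en; [exact: ich_a1 I|exact: ich_b2 I|rewrite divr_ge0// ltW].
exists (Num.min d (q / 4)); first by rewrite lt_min (ich_d I) divr_gt0.
exists K; split=> //.
- by move=> x Kx; apply: (ich_cod I); apply: le_lt_trans Kx _; lra.
- move=> y /= ; rewrite lt_min => /andP[yd yr]. have [dy _ Ey] := en_center I ltr01 yd; exists (chart z y); last exact: chartK. rewrite /K /=; lra.
by move=> _ [x Kx <-]; apply: Hr'; apply: le_lt_trans Kx _; lra.
Qed.

(** [lifted_area_bound] is applied to the identity map of M on finitely many compact chart
    pieces. *)
Lemma area_fin : (area G [set: M] < +oo)%E.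
Proof.
have [e e0 He] := lebesgue_number G cM (Q := fun z r => exists K : set (R * R), [/\ compact K, K `<=` cod z,
  [set y | dist G z y < r] `<=` chart_inv z @` K & chart_inv z @` K `<=` setT]) (fun z => compact_chart_in filterT).
have [s Hs] := finite_net G cM e0.
(* The empty surface is set apart because [nth] below needs a default point. *)
have [->|nM] := eqVneq [set: M] set0.
  have : (area G set0 <= 0)%E.
    apply: (area_le (c := 0%E)) => n p B hB _; rewrite big1// => k _; have [_ Bk] := hB k. have -> : B k = set0 by apply/seteqP; split=> // y /Bk[].
    by rewrite /chart_area image_set0 integral_set0.
  by move=> h; exact: le_lt_trans h (ltry 0).
have /set0P[y0 _] := nM.
pose C i := [set y | dist G (nth y0 s i) y < e].
have bC i : borel (C i) by apply: borel_open; exact: open_ball.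
have cv y : [set: M] y -> exists2 i, (i < size s)%N & C i y.
  move=> _; have [z zs zy] := Hs y; exists (index z s); first by rewrite index_mem. by rewrite /C /= nth_index.
apply: le_lt_trans (area_cover G bC cv) _.
apply: lte_sum_pinfty => i _; have [z [r [[K [cK Kz KB _]] zr]]] := He (nth y0 s i).
have [A HA] := lifted_area_bound G cK Kz.
have bound := HA M G id setT setT id smooth_id (inner_compat G) (@openT _) (@openT _).
have : (area G (id @` (chart_inv z @` K)) <= A%:E)%E.
  apply: bound => //; by move=> y _; exact: cvg_id.
rewrite image_id => h; apply: le_lt_trans (ltry A); apply: le_trans h; apply: le_area => y [_ hy].
by apply: KB => /=; have := dist_triangle G z (nth y0 s i) y; rewrite /C /= in hy; lra.
Qed.

End FiniteArea.

(** * Fibres of the covering and the systole *)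

Section FiberDistance.
Variables (R : realType) (M : surface R) (G : riemannian_metric M) (U : universal_cover G).
Hypothesis cM : compact [set: M].
Local Notation GU := (cover_metric U).
Local Notation f := (@cover_proj R M G U).
Implicit Types (u : U) (c : R -> M).

Lemma dist_proj u u' : dist G (f u) (f u') <= dist GU u u'.
Proof. by apply: le_dist => l /proj_joins; exact: dist_le. Qed.

Lemma lift_dist u y (e : R) : dist G (f u) y < e -> exists2 u', f u' = y & dist GU u u' < e.
Proof.
move=> /dist_lt[l J le]; have [u' [fu' J']] := lift_joins J.
by exists u' => //; apply: le_lt_trans le; exact: dist_le.
Qed.

(* The curve and the lift by [s] of its projection agree, by uniqueness of lifts. *)
Lemma section_end (V : set M) (W : set U) (s : M -> U) u u' l : section_on V W s -> W u -> joins GU u u' l ->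
  (forall y, dist G (f u) y <= l -> V y) -> s (f u') = u'.
Proof.
move=> [_ oW cs s1 s2] Wu [k [h k0 k1]] HV.
have inV t : 0 <= t <= 1 -> V (f (k t)).
  move=> /andP[t0 t1]; apply: HV. have [<-|t0'] := eqVneq 0 t; first by rewrite k0 distyy (arc_ge0 h).
  have [->|t1'] := eqVneq t 1; first by rewrite -k0; apply: dist_le; apply: arc_joins (proj_arc h). have t01 : 0 < t < 1 by rewrite lt_neqAle t0' t0 lt_neqAle t1' t1.
  have [l1 [l2 [h1 h2 ll]]] := arc_split h t01; have l20 := arc_ge0 h2. have := dist_le (arc_joins (proj_arc h1)); rewrite /= k0; lra.
have ck := arc_continuous h.
have e0' : 0 <= (0 : R) <= 1 by rewrite lexx ler01.
have e1' : 0 <= (1 : R) <= 1 by rewrite lexx ler01.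
have Vk t : V (f (k (clamp 0 1 t))) by apply/inV/clamp_itv.
have cq : continuous (fun t => s (f (k (clamp 0 1 t)))).
  move=> t; have c1 : {for t, continuous (fun t => f (k (clamp 0 1 t)))}.
    exact: (@cont_comp _ _ _ (k \o clamp 0 1) f t (ck t) (@continuous_proj R M G U _)).
  exact: (@cont_comp _ _ _ (fun t => f (k (clamp 0 1 t))) s t c1 (cs _ (Vk t))).
have E t : 0 <= t <= 1 -> f (s (f (k (clamp 0 1 t)))) = f ((k \o clamp 0 1) t).
  by move=> t01; exact: (s1 _ (Vk t)).2.
have E0 : s (f (k (clamp 0 1 0))) = (k \o clamp 0 1) 0.
  by rewrite /= clampE// k0; exact: (s2 _ Wu).2.
by have := lift_unique ler01 cq ck E E0 e1'; rewrite /= clampE// k1.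
Qed.

(** A path shorter than the Lebesgue number of a cover by evenly covered sets stays in one sheet,
    which meets each fibre once. *)
Lemma fiber_separated : exists2 e : R, 0 < e &
  forall u u' l, f u = f u' -> u != u' -> joins GU u u' l -> e <= l.
Proof.
pose even (V : set M) := open V /\ forall u, V (f u) -> exists W s, section_on (U := U) V W s /\ W u.
have H z : exists2 r : R, 0 < r & exists2 V, even V & [set y | dist G z y < r] `<=` V.
  have [V [oV Vz HV]] := evenly_covered U z. have [r r0 hr] := dist_nbhs G (open_nbhs_nbhs (conj oV Vz)). by exists r => //; exists V.
have [e e0 He] := lebesgue_number G cM H.
exists e => // u u' l fu uu [k [h k0 k1]]; rewrite leNgt; apply/negP => le.
have [z [r [[V [oV HV] BV] zr]]] := He (f u).
have BV' y : dist G (f u) y <= l -> V y by move=> d; apply: BV => /=; have := dist_triangle G z (f u) y; lra.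
have Vu : V (f u) by apply: BV'; rewrite distyy (arc_ge0 h).
have [W [s [sec Wu]]] := HV u Vu; have [_ _ _ _ s2] := sec.
have J : joins GU u u' l by exists k.
by have := section_end sec Wu J BV'; rewrite -fu (s2 _ Wu).2 => uu'; rewrite uu' eqxx in uu.
Qed.

Hypothesis nsc : ~ simply_connected M.

Lemma nonclosed_lift_ex : exists u u' : U, f u = f u' /\ u != u'.
Proof.
have [c /not_implyP[lc nc]] := (existsNP _).2 nsc.
have [k [ck kc k01]] := lift_nonclosed U lc nc.
exists (k 0), (k 1); split=> //; rewrite !kc ?lexx ?ler01//; exact: lc.2.
Qed.

Definition sys : R := fine (systole G).

Lemma noncontractible_lift c l : arc G c 0 1 l -> is_loop c -> ~ contractible_loop c ->
  exists k, [/\ continuous k, arc GU k 0 1 l, forall t, 0 <= t <= 1 -> f (k t) = c t & k 0 != k 1].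
Proof.
move=> h lc nc; have [k [ck kc k01]] := lift_nonclosed U lc nc.
by exists k; split=> //; exact: lift_arc ck kc h.
Qed.

(** Noncontractible loops have nonclosed lifts, whose length is at least the separation of fibres;
    and a path between two points of one fibre gives a finite upper bound. *)
Lemma systole_fin : systole G = sys%:E /\ 0 < sys.
Proof.
have [e e0 He] := fiber_separated.
have [u [u' [fu uu]]] := nonclosed_lift_ex.
have [l J] := joins_ex GU u u'.
have le := fiber_joins fu uu J.
have ge : (e%:E <= systole G)%E.
  apply: le_ereal_inf_tmp => _ [c [pc lc nc] <-]; have [l' h] := piecewise_arc G pc. rewrite (arc_curve_length h) lee_fin. have [k [_ hk kc k01]] := noncontractible_lift h lc nc.
  apply: (He (k 0) (k 1)) => //; last by exists k. by rewrite !kc ?lexx ?ler01//; exact: lc.2.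
have fin : systole G \is a fin_num.
  by rewrite fin_numE; apply/andP; split; apply/eqP => E; rewrite E in le ge.
rewrite /sys fineK//; split=> //; apply: lt_le_trans e0 _.
by rewrite -lee_fin fineK.
Qed.

Lemma fiber_dist u u' : f u = f u' -> u != u' -> sys <= dist GU u u'.
Proof.
move=> fu uu; apply: le_dist => l J; have := fiber_joins fu uu J.
by rewrite systole_fin.1 lee_fin.
Qed.

(** A shorter path downstairs would lift to a path from u to another point over f u', at distance
    less than 2 d(u, u') <= sys from u'. *)
Lemma dist_proj_eq u u' : 2 * dist GU u u' <= sys -> dist G (f u) (f u') = dist GU u u'.
Proof.
move=> h; apply/eqP; rewrite eq_le dist_proj leNgt; apply/negP => /lift_dist[u2 fu2 h2].
have uu : u' != u2 by apply: contraTneq h2 => <-; rewrite ltxx.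
have := fiber_dist (esym fu2) uu; have := dist_triangle GU u' u u2; rewrite (dist_sym GU u' u); lra.
Qed.

End FiberDistance.

(** * Elementary bounds for derivatives and square roots *)

Section DerivativeBounds.
Variable R : realType.

Lemma derive_bound (g : R * R -> R) (x v : R * R) (c : R) : derivable g x v ->
  (forall h : R, `|g (h *: v + x) - g x| <= c * `|h|) -> `|'D_v g x| <= c.
Proof.
move=> dg H; rewrite leNgt; apply/negP => lt.
have cv : (fun h : R => h^-1 *: (g (h *: v + x) - g x)) @ 0^' --> 'D_v g x by exact: dg.
have n1 : \forall h \near 0^', c < `|h^-1 *: (g (h *: v + x) - g x)|.
  exact: (cvgr_gt _ (cvg_norm cv) _ lt).
have [h [h1 h0]] := filter_ex (filterI n1 (nbhs_dnbhs_neq (0 : R))).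
move: h1; rewrite scaleRE normrM normfV ltNge => /negP; apply.
by rewrite mulrC ler_pdivrMr ?normr_gt0// H.
Qed.

Lemma deriveM_val (g h : R * R -> R) (x v : R * R) : derivable g x v -> derivable h x v ->
  'D_v (fun x => g x * h x) x = g x * 'D_v h x + h x * 'D_v g x.
Proof. by move=> dg dh; rewrite (deriveM dg dh). Qed.

Lemma derive_mull (a : R) (g : R * R -> R) (x v : R * R) : derivable g x v ->
  derivable (fun x => a * g x) x v /\ 'D_v (fun x => a * g x) x = a * 'D_v g x.
Proof.
move=> dg; have dc : derivable (fun _ : R * R => a) x v by exact: derivable_cst.
split; first exact: (derivableM dc dg).
by rewrite (deriveM_val dc dg) derive_cst mulr0 addr0.
Qed.

Lemma sqrt_sqrD_lip (a b d : R) : 0 <= a -> 0 <= b ->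
  `|Num.sqrt (a ^+ 2 + d ^+ 2) - Num.sqrt (b ^+ 2 + d ^+ 2)| <= `|a - b|.
Proof.
wlog ab : a b / b <= a.
  by move=> W a0 b0; have [ab|/ltW ab] := leP b a; [exact: W|rewrite distrC (distrC a); exact: W].
move=> a0 b0; rewrite (ger0_norm (x := a - b)) ?subr_ge0//.
have A0 : 0 <= a ^+ 2 + d ^+ 2 by rewrite addr_ge0 ?sqr_ge0.
have B0 : 0 <= b ^+ 2 + d ^+ 2 by rewrite addr_ge0 ?sqr_ge0.
have SB : b <= Num.sqrt (b ^+ 2 + d ^+ 2).
  by rewrite -(ler_pXn2r (n := 2))// ?nnegrE ?sqrtr_ge0// sqr_sqrtr// lerDl sqr_ge0.
have SS : Num.sqrt (b ^+ 2 + d ^+ 2) <= Num.sqrt (a ^+ 2 + d ^+ 2).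
  by rewrite ler_wsqrtr// lerD2r ler_sqr ?nnegrE.
have h : (a - b) * b <= (a - b) * Num.sqrt (b ^+ 2 + d ^+ 2) by rewrite ler_wpM2l// subr_ge0.
have key : Num.sqrt (a ^+ 2 + d ^+ 2) <= a - b + Num.sqrt (b ^+ 2 + d ^+ 2).
  have S0 := sqrtr_ge0 (b ^+ 2 + d ^+ 2); have ab0 : 0 <= a - b by rewrite subr_ge0. have SA := sqrtr_ge0 (a ^+ 2 + d ^+ 2); have T0 := addr_ge0 ab0 S0.
  rewrite -ler_sqr ?nnegrE// (sqr_sqrtr A0) sqrrD (sqr_sqrtr B0) mulr2n. move: h; move: (Num.sqrt (b ^+ 2 + d ^+ 2)) => S h; nra.
by rewrite ger0_norm ?subr_ge0// lerBlDr.
Qed.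

End DerivativeBounds.

Section Common.

Lemma seq_bound (R : realType) (T : eqType) (s : seq T) (P : T -> R -> Prop) :
  (forall z K K', P z K -> K <= K' -> P z K') -> (forall z, z \in s -> exists K, P z K) -> exists2 K, 0 < K & forall z, z \in s -> P z K.
Proof.
move=> mon; elim: s => [|z s IH] H; first by exists 1.
have [K1 K10 H1] : exists2 K, 0 < K & forall z, z \in s -> P z K.
  by apply: IH => y ys; apply: H; rewrite in_cons ys orbT.
have [K2 H2] := H z (mem_head z s).
exists (Num.max K1 K2); first by rewrite lt_max K10.
move=> y; rewrite in_cons => /orP[/eqP->|ys].
  by apply: mon H2 _; rewrite le_max lexx orbT.
by apply: mon (H1 y ys) _; rewrite le_max lexx.
Qed.

End Common.

(** * Terms of a smooth soft minimum *)

Section Smoothing.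
Variables (R : realType) (N : surface R) (G : riemannian_metric N).
Implicit Types (p q y z : N) (x u v : R * R) (F : N -> R).

Lemma lipfD F F' (C C' : N -> R) : msmooth F -> msmooth F' -> lipf G F C -> lipf G F' C' ->
  lipf G (fun y => F y + F' y) (fun y => C y + C' y).
Proof.
move=> sF sF' H H' p x v cx.
have d1 := @diff_derivable _ _ _ _ _ v (msmooth_diff sF cx).
have d2 := @diff_derivable _ _ _ _ _ v (msmooth_diff sF' cx).
have -> : dM (fun y => F y + F' y) p x v = dM F p x v + dM F' p x v.
  by rewrite /dM -deriveD.
by rewrite mulrDl (le_trans (ler_normD _ _))// lerD ?H ?H'.
Qed.

Lemma lipf_sum (I : eqType) (s : seq I) (F C : I -> N -> R) :
  (forall i, i \in s -> msmooth (F i) /\ lipf G (F i) (C i)) -> lipf G (fun y => \sum_(i <- s) F i y) (fun y => \sum_(i <- s) C i y).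
Proof.
elim: s => [|i s IH] H.
  move=> p x v cx; rewrite big_nil mul0r. have -> : dM (fun y => \sum_(i <- [::]) F i y) p x v = 0.
    have E : (fun y => \sum_(i <- [::]) F i y) \o chart_inv p = cst 0.
      by apply/funext => w /=; rewrite big_nil.
    by rewrite /dM E derive_cst.
  by rewrite normr0.
have H' j : j \in s -> msmooth (F j) /\ lipf G (F j) (C j).
  by move=> js; apply: H; rewrite in_cons js orbT.
have [s1 l1] := H i (mem_head _ _).
have s2 : msmooth (fun y => \sum_(i <- s) F i y).
  by apply: msmooth_sum => j /H'[].
have := lipfD s1 s2 l1 (IH H').
have -> : (fun y => F i y + \sum_(i <- s) F i y) = (fun y => \sum_(i <- (i :: s)) F i y).
  by apply/funext => y; rewrite big_cons.
have -> // : (fun y => C i y + \sum_(i <- s) C i y) = (fun y => \sum_(i <- (i :: s)) C i y).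
by apply/funext => y; rewrite big_cons.
Qed.

(* A term of the soft minimum: near z it is exp (- h / tau), where h is a cone
   over the graph point (y1, f y1), and its cutoff takes place where h > f. *)
Lemma softmin_term (f : N -> R) z (eta : R) : (forall y y', `|f y' - f y| <= dist G y y') ->
  0 < eta -> eta <= 1 -> exists d0 C kap : R, [/\ 0 < d0, 0 <= C, 0 < kap & forall y1 (del tau : R),
    dist G z y1 < d0 -> 0 < del -> 0 < tau -> exists T : N -> R, [/\ msmooth T, forall y, 0 <= T y <= expR (- f y / tau),
      lipf G T (fun y => (1 + eta) ^+ 3 / tau * T y + C * expR (- (f y + kap) / tau)) & forall y, dist G z y < d0 -> dist G y1 y < del ->
        expR (- (f y + (1 + (1 + eta) ^+ 2 * (2 + eta)) * del) / tau) <= T y]].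
Proof.
move=> lf eta0 eta1; have [a1 [a2 [b2 [r [d I]]]]] := isometric_chart_ex G z eta0.
have a0 := ich_a1 I; have b0 := ich_b2 I; have r0 := ich_r I; have d0 := ich_d I.
pose E := en a1 a2 b2; pose x0 := chart z z.
have e0 v : 0 <= E v by exact: en_ge0.
have ED u v : E (u + v) <= E u + E v by exact: enD.
have EN v : E (- v) = E v by exact: enN.
have EZ (t : R) v : E (t *: v) = `|t| * E v by exact: enZ.
have E0 : E 0 = 0 by rewrite /E /en /en2 /= !mul0r addr0 expr0n addr0 sqrtr0.
have r2 : 0 < r / 2 by rewrite divr_gt0.
have ke : 0 < 1 + eta by lra.
have Hk w : E (w - x0) <= r / 2 -> forall v, E v <= (1 + eta) * nrm G z w v.
  by move=> h v; apply: (ich_nrm I); apply: le_lt_trans h _; lra.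
have [C C0 HC] := cutoff_lip a0 b0 r2 ke Hk.
have near_z y : dist G z y < Num.min d (r / (8 * (1 + eta))) -> dom z y /\ E (chart z y - x0) < r / 8.
  rewrite lt_min => /andP[h1]; rewrite -(ltr_pM2l ke); have [dy _ Ey] := en_center I eta0 h1. have -> : (1 + eta) * (r / (8 * (1 + eta))) = r / 8 by field; rewrite gt_eqF.
  by move=> h2; split=> //; exact: le_lt_trans Ey h2.
(* Where the cutoff varies, x is at Euclidean distance at least r/8 from x1. The cone, having slope
   larger than the Lipschitz constant of f, exceeds f by at least kap there. *)
pose kap := eta * (r / (8 * (1 + eta))).
exists (Num.min d (r / (8 * (1 + eta)))), C, kap; split=> //.
- by rewrite lt_min d0 divr_gt0// mulr_gt0.
- exact: ltW.
- by rewrite mulr_gt0// divr_gt0// mulr_gt0.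
move=> y1 del tau /near_z[dy1 Ey1] del0 tau0; pose x1 := chart z y1.
(* A distance to x1 smoothed at its tip; it lies between E and E + del. *)
pose S x := Num.sqrt (E (x - x1) ^+ 2 + del ^+ 2).
pose q x := - (f y1 + (1 + eta) ^+ 2 * S x) / tau.
pose g x := cutoff z a1 a2 b2 (r / 2) x * expR (q x).
pose K := [set x | E (x - x0) <= r / 2].
have cK : compact K by exact: compact_en (ltW r2).
have Kz : K `<=` cod z by move=> x Kx; apply: (ich_cod I); apply: le_lt_trans Kx _; lra.
have oz := @open_cod R N z.
have sS : smooth_on (cod z) S.
  move=> k; have -> : S = (fun t : R => t `^ (2^-1)) \o (fun x => en2 a1 a2 b2 (x - x1) + del ^+ 2).
    by apply/funext => x; rewrite /S sqr_en /= powR12_sqrt// addr_ge0 ?en2_ge0 ?sqr_ge0.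
  apply: (Ck_comp1 oz _ _ (@Ck1_powR R k (2^-1))) => [x _ /=|].
    by rewrite ltr_wpDl ?en2_ge0// exprn_gt0.
  by apply: CkD => //; [exact: en2_shift_smooth|exact: Ck_cst].
have sq : smooth_on (cod z) q.
  move=> k; have -> : q = (fun x => (- f y1 / tau) + (- (1 + eta) ^+ 2 / tau) * S x).
    by apply/funext => x; rewrite /q; field; rewrite gt_eqF.
  apply: CkD => //; first exact: Ck_cst. by apply: CkM => //; exact: Ck_cst.
have sexp : smooth_on (cod z) (expR \o q).
  by move=> k; apply: (Ck_comp1 oz _ (sq k) (@Ck1_expR R k)).
have scut := @cutoff_smooth R N z a1 a2 b2 (r / 2) (cod z) oz.
have sg : smooth_on (cod z) g by move=> k; exact: (CkM oz (scut k) (sexp k)).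
have g0 x : cod z x -> ~ K x -> g x = 0.
  move=> _ nK; rewrite /g cutoff_eq0 ?mul0r//; apply: ltW. by rewrite ltNge; exact/negP.
have S0 x : 0 <= S x by exact: sqrtr_ge0.
have S2 x : S x ^+ 2 = E (x - x1) ^+ 2 + del ^+ 2.
  exact: sqr_sqrtr (addr_ge0 (sqr_ge0 (E (x - x1))) (sqr_ge0 del)).
have SE x : E (x - x1) <= S x.
  by rewrite -ler_sqr ?nnegrE// S2 lerDl sqr_ge0.
have SE' x : S x <= E (x - x1) + del.
  have h : 0 <= E (x - x1) + del by rewrite addr_ge0// ltW. by rewrite -ler_sqr ?nnegrE// S2 sqrrD lerD2r lerDl mulrn_wge0// mulr_ge0// ltW.
have Elip x x' : E (x - x1) <= E (x' - x1) + E (x - x').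
  by have := ED (x' - x1) (x - x'); rewrite addrC addrA addrNK.
have cx1 : E (x1 - x0) < r by apply: lt_trans Ey1 _; lra.
have inK x : K x -> dist G y1 (chart_inv z x) <= (1 + eta) * E (x - x1).
  move=> Kx; have hx : E (x - x0) < r by apply: le_lt_trans Kx _; lra. have [l J ll] := ich_upper I cx1 hx; apply: le_trans ll; apply: dist_le. by rewrite /x1 chartK in J.
have upper x : K x -> q x <= - f (chart_inv z x) / tau /\
    (r / 4 <= E (x - x0) -> q x <= - (f (chart_inv z x) + kap) / tau).
  move=> Kx; have h1 := inK x Kx; have := lf y1 (chart_inv z x); rewrite ler_norml => /andP[_ h2]. have h3 : (1 + eta) * E (x - x1) * (1 + eta) <= (1 + eta) ^+ 2 * S x.
    have := SE x; rewrite expr2 mulrAC -mulrA => h; rewrite -!mulrA ler_pM2l// ler_pM2l//.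
  have ex : 0 <= (1 + eta) * E (x - x1) by rewrite mulr_ge0// ltW. split=> [|far].
    rewrite ler_pM2r ?invr_gt0// lerN2; nra.
  have h4 : r / 8 <= E (x - x1).
    have := ED (x - x1) (x1 - x0); rewrite addrA addrNK -/E; have := ltW Ey1; rewrite -/x1; lra.
  have h5 : kap <= eta * ((1 + eta) * E (x - x1)).
    rewrite /kap ler_pM2l// ler_pdivrMr ?mulr_gt0//; nra.
  rewrite ler_pM2r ?invr_gt0// lerN2; nra.
have cut01 x : 0 <= cutoff z a1 a2 b2 (r / 2) x <= 1 by exact: cutoff_itv.
have gge x : 0 <= g x by rewrite /g mulr_ge0 ?expR_ge0//; have /andP[] := cut01 x.
have tex y : 0 <= chart_ext z g y by rewrite /chart_ext; case: asboolP.
have cf0 : 0 <= (1 + eta) ^+ 3 / tau by rewrite divr_ge0 ?exprn_ge0 ?(ltW tau0) ?(ltW ke).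
exists (chart_ext z g); split.
- exact: msmooth_chart_ext cK Kz sg g0.
- move=> y; have [dy|ndy] := pselect (dom z y); last by rewrite chart_ext_notin// lexx expR_ge0.
  rewrite chart_extE//; have [Ky|nK] := pselect (K (chart z y)); last by rewrite g0 ?expR_ge0 ?lexx//; exact: cod_chart. have [h _] := upper _ Ky; rewrite chartK// in h.
  have /andP[c0 c1] := cut01 (chart z y). rewrite /g mulr_ge0 ?expR_ge0//=; apply: le_trans (_ : expR (q (chart z y)) <= _); last by rewrite ler_expR.
  by rewrite ler_piMl ?expR_ge0.
- apply: (lipf_chart_ext cK Kz sg g0).
    by move=> y; exact: addr_ge0 (mulr_ge0 cf0 (tex y)) (mulr_ge0 (ltW C0) (expR_ge0 _)).
  move=> x v cx; rewrite chart_extE ?chart_invK//; last exact: dom_chart_inv. have dcut : differentiable (cutoff z a1 a2 b2 (r / 2)) x := differentiable_C1 oz cx (scut 1%N).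
  have dexp : differentiable (expR \o q) x := differentiable_C1 oz cx (sexp 1%N). have dq : differentiable q x := differentiable_C1 oz cx (sq 1%N).
  have Dcut := @diff_derivable _ _ _ _ _ v dcut. have Dexp := @diff_derivable _ _ _ _ _ v dexp. have Dq := @diff_derivable _ _ _ _ _ v dq.
  have gE : 'D_v g x = cutoff z a1 a2 b2 (r / 2) x * 'D_v (expR \o q) x + expR (q x) * 'D_v (cutoff z a1 a2 b2 (r / 2)) x.
    exact: deriveM_val Dcut Dexp.
  have de := is_derive_expR (q x). have [_ DE] := derive_comp1 v dq (@ex_derive _ _ _ _ _ _ _ de). rewrite derive1E (@derive_val _ _ _ _ _ _ _ de) in DE.
  have qb : `|'D_v q x| <= (1 + eta) ^+ 2 / tau * E v.
    apply: derive_bound => // h. have -> : q (h *: v + x) - q x = - ((1 + eta) ^+ 2 / tau) * (S (h *: v + x) - S x).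
      by rewrite /q; field; rewrite gt_eqF.
    have c0 : 0 <= (1 + eta) ^+ 2 / tau by rewrite divr_ge0 ?exprn_ge0 ?(ltW tau0) ?(ltW ke). rewrite normrM normrN (ger0_norm c0) -mulrA ler_wpM2l//.
    apply: le_trans (sqrt_sqrD_lip _ (e0 _) (e0 _)) _. have Eh : E (h *: v) = E v * `|h| by rewrite EZ mulrC. rewrite -Eh ler_norml.
    have k1 := Elip (h *: v + x) x; rewrite addrK in k1. have k2 := Elip x (h *: v + x); rewrite opprD addrCA subrr addr0 EN in k2. by apply/andP; split; lra.
  have [Kx|nK] := pselect (K x); last first.
    rewrite gE (_ : 'D_v (cutoff _ _ _ _ _) x = 0).
      rewrite (_ : cutoff _ _ _ _ _ _ = 0) ?mul0r ?mulr0 ?addr0 ?normr0; last first.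
        by rewrite cutoff_eq0//; apply: ltW; rewrite ltNge; exact/negP.
      exact: mulr_ge0 (addr_ge0 (mulr_ge0 cf0 (gge x)) (mulr_ge0 (ltW C0) (expR_ge0 _))) (nrm_ge0 G z x v).
    apply/eqP; rewrite -normr_le0. have cc : continuous (fun w : R * R => E (w - x0)).
      move=> w; have c2 := @en2_shift_smooth R a1 a2 b2 setT x0 0%N openT w Logic.I.
      exact: (@cont_comp _ _ _ (fun x : R * R => en2 a1 a2 b2 (x - x0)) Num.sqrt w c2 (@sqrt_continuous R _)).
    have nx : \forall w \near x, r / 2 < E (w - x0).
      have xr : r / 2 < E (x - x0) by rewrite ltNge; exact/negP. exact: (cc x [set t | r / 2 < t] (lt_nbhsr xr)).
    have -> : 'D_v (cutoff z a1 a2 b2 (r / 2)) x = 0.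
      rewrite -(derive_cst (0 : R) x v); apply: near_eq_derive. by apply: filterS nx => w /ltW; exact: cutoff_eq0.
    by rewrite normr0.
  have [u1 u2] := upper x Kx; have /andP[c0 c1] := cut01 x. have n0 := nrm_ge0 G z x v.
  have b1 : `|cutoff z a1 a2 b2 (r / 2) x * 'D_v (expR \o q) x| <= (1 + eta) ^+ 3 / tau * g x * nrm G z x v.
    rewrite DE /g !normrM (ger0_norm c0) (ger0_norm (expR_ge0 _)) mulrA. have gx0 : 0 <= cutoff z a1 a2 b2 (r / 2) x * expR (q x) by rewrite mulr_ge0 ?expR_ge0.
    rewrite [X in _ <= X]mulrAC [X in _ <= X]mulrC ler_wpM2l//; apply: (le_trans qb). have cf2 : 0 <= (1 + eta) ^+ 2 / tau by rewrite divr_ge0 ?exprn_ge0 ?(ltW tau0) ?(ltW ke).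
    have := ler_wpM2l cf2 (Hk x Kx v); congr (_ <= _). by field; rewrite gt_eqF.
  have b2' : `|expR (q x) * 'D_v (cutoff z a1 a2 b2 (r / 2)) x| <= C * expR (- (f (chart_inv z x) + kap) / tau) * nrm G z x v.
    have [far|close] := leP (r / 4) (E (x - x0)).
      rewrite normrM (ger0_norm (expR_ge0 _)) (mulrC C) -mulrA ler_pM ?expR_ge0// ?ler_expR ?u2//. exact: HC.
    have nx : \forall w \near x, E (w - x0) < r / 4.
      by apply: open_nbhs_nbhs; split=> //; apply: open_en => //; lra.
    have -> : 'D_v (cutoff z a1 a2 b2 (r / 2)) x = 0.
      rewrite -(derive_cst (1 : R) x v); apply: near_eq_derive. apply: filterS nx => w h; apply: cutoff_eq1 => //; apply: ltW; apply: lt_le_trans h _; lra.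
    by rewrite mulr0 normr0 !mulr_ge0 ?expR_ge0 ?(ltW C0).
  by rewrite gE; apply: le_trans (ler_normD _ _) _; rewrite [X in _ <= X]mulrDl; exact: lerD.
- move=> y /near_z[dy Ey] ydel; rewrite chart_extE// /g cutoff_eq1//; last by rewrite -/E -/x0; lra. rewrite mul1r ler_expR /q ler_pM2r ?invr_gt0// lerN2.
  have cy : E (chart z y - x0) < r by apply: lt_trans Ey _; lra. have k1 : E (chart z y - x1) <= (1 + eta) * del.
    by apply: le_trans (en_le_dist I eta0 dy1 cx1 dy cy) _; rewrite ler_pM2l// ltW.
  have k2 := SE' (chart z y). have := lf y1 y; rewrite ler_norml => /andP[k3 _]. have k4 : (1 + eta) ^+ 2 * S (chart z y) <= (1 + eta) ^+ 2 * ((2 + eta) * del).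
    rewrite ler_wpM2l ?exprn_ge0 ?(ltW ke)//; lra.
  move: k4; move: ((1 + eta) ^+ 2) => ee; lra.
Qed.

End Smoothing.

(** * Smooth approximation of 1-Lipschitz functions *)

Section SmoothApproximation.
Variables (R : realType) (N : surface R) (G : riemannian_metric N).
Hypothesis cN : compact [set: N].

Lemma cube_near1 (e : R) : 0 < e -> exists eta : R, [/\ 0 < eta, eta <= 1 & (1 + eta) ^+ 3 <= 1 + e].
Proof.
move=> e0; pose eta := Num.min 1 (e / 7).
have eta0 : 0 < eta by rewrite lt_min ltr01 divr_gt0.
have eta1 : eta <= 1 by rewrite ge_min lexx.
have eta2 : eta <= e / 7 by rewrite ge_min lexx orbT.
exists eta; split=> //.
have -> : (1 + eta) ^+ 3 = 1 + eta * (3 + 3 * eta + eta ^+ 2) by ring.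
have : eta ^+ 2 <= 1 by rewrite expr2; nra.
nra.
Qed.

(* The approximation is the soft minimum - tau ln (sum_i T_i). *)
Lemma smooth_approximation (f : N -> R) (e : R) : (forall y y', `|f y' - f y| <= dist G y y') ->
  0 < e -> exists F, [/\ msmooth F, forall y, `|F y - f y| <= e & lip G F (1 + e)].
Proof.
move=> lf e0; have [eta [eta0 eta1 eta3]] := cube_near1 (divr_gt0 e0 (ltr0n R 2)).
pose c0 := 1 + (1 + eta) ^+ 2 * (2 + eta).
have c00 : 0 < c0 by rewrite /c0; have := mulr_ge0 (sqr_ge0 (1 + eta)) (_ : 0 <= 2 + eta); lra.
pose good z (d : R) := exists C kap : R, [/\ 0 <= C, 0 < kap & forall y1 (del tau : R),
    dist G z y1 < d -> 0 < del -> 0 < tau -> exists T : N -> R, [/\ msmooth T, forall y, 0 <= T y <= expR (- f y / tau),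
      lipf G T (fun y => (1 + eta) ^+ 3 / tau * T y + C * expR (- (f y + kap) / tau)) & forall y, dist G z y < d -> dist G y1 y < del ->
        expR (- (f y + c0 * del) / tau) <= T y]].
have Hgood z : exists2 d, 0 < d & good z d.
  by have [d [C [kap [d0 C0 k0 H]]]] := softmin_term z lf eta0 eta1; exists d => //; exists C, kap.
have [d d0 Hd] := lebesgue_number G cN Hgood.
have /choice[ctr Hctr] y : exists zr : N * R, good zr.1 zr.2 /\ dist G zr.1 y + d < zr.2.
  by have [z [r Hr]] := Hd y; exists (z, r).
have d2 : 0 < d / 2 by rewrite divr_gt0.
have [s1 Hs1] := finite_net G cN d2.
pose P z (K : R) := forall y1 (del tau : R),
    dist G (ctr z).1 y1 < (ctr z).2 -> 0 < del -> 0 < tau -> exists T : N -> R, [/\ msmooth T, forall y, 0 <= T y <= expR (- f y / tau),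
      lipf G T (fun y => (1 + eta) ^+ 3 / tau * T y + K * expR (- (f y + K^-1) / tau)) & forall y, dist G (ctr z).1 y < (ctr z).2 -> dist G y1 y < del ->
        expR (- (f y + c0 * del) / tau) <= T y].
pose P' z K := 0 < K /\ P z K.
have [K K0 HK] : exists2 K, 0 < K & forall z, z \in s1 -> P' z K.
  apply: seq_bound => [z K K' [K0 PK] KK'|z _].
    split; first exact: lt_le_trans KK'. move=> y1 del tau h1 h2 h3; have [T [t1 t2 t3 t4]] := PK y1 del tau h1 h2 h3.
    exists T; split=> // p x v cx; apply: le_trans (t3 p x v cx) _. rewrite ler_wpM2r ?nrm_ge0// lerD2l ler_pM ?expR_ge0 ?(ltW K0)// ler_expR ler_pM2r ?invr_gt0//.
    by rewrite lerN2 lerD2l lef_pV2 ?posrE// (lt_le_trans K0).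
  have [[C [kap [C0 k0 H]]] _] := Hctr z. pose K := Num.max (C + 1) kap^-1. have K1 : C + 1 <= K by rewrite le_max lexx. have K2 : kap^-1 <= K by rewrite le_max lexx orbT.
  have K0 : 0 < K by apply: lt_le_trans K1; lra. exists K; split=> // y1 del tau h1 h2 h3; have [T [t1 t2 t3 t4]] := H y1 del tau h1 h2 h3.
  exists T; split=> // p x v cx; apply: le_trans (t3 p x v cx) _. have CK : C <= K by lra. rewrite ler_wpM2r ?nrm_ge0// lerD2l ler_pM ?expR_ge0// ler_expR ler_pM2r ?invr_gt0//.
  by rewrite lerN2 lerD2l -(invrK kap) lef_pV2 ?posrE// invr_gt0.
(* Some term is at least exp (- (f + c0 del) / tau). The bound 1/K for c0 del makes it dominate the
   errors of the cutoffs, and the bound e gives the estimate F <= f + e. *)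
pose del := Num.min (d / 2) (Num.min (K^-1 / c0) (e / c0)).
have del0 : 0 < del by rewrite !lt_min d2 !divr_gt0 ?invr_gt0.
have del1 : del <= d / 2 by rewrite ge_min lexx.
have del2 : c0 * del <= K^-1.
  by rewrite mulrC -ler_pdivlMr// !ge_min lexx orbT.
have del3 : c0 * del <= e.
  by rewrite mulrC -ler_pdivlMr// !ge_min lexx !orbT.
have [s2 Hs2] := finite_net G cN del0.
pose I := [seq i <- allpairs pair s1 s2 | dist G (ctr i.1).1 i.2 < (ctr i.1).2].
pose n : R := (size I)%:R + 1.
have n1 : 1 <= n by rewrite lerDr ler0n.
(* tau is small against the number of terms: tau n K <= e/2 absorbs the errors of the cutoffs into
   the Lipschitz constant, and tau ln n <= tau n <= e bounds how far F lies below f. *)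
pose tau := e / (2 * n * (K + 1)).
have D0 : 0 < 2 * n * (K + 1) by rewrite !mulr_gt0//; lra.
have tau0 : 0 < tau by rewrite divr_gt0.
have tauE : tau * (2 * n * (K + 1)) = e by rewrite /tau divfK// gt_eqF.
have tn0 : 0 <= tau * n by rewrite mulr_ge0 ?(ltW tau0)//; lra.
have tnK0 : 0 <= tau * n * K by exact: mulr_ge0 tn0 (ltW K0).
have tauK : tau * n * K <= e / 2.
  by rewrite -tauE; lra.
have taun : tau * n <= e.
  by rewrite -tauE; lra.
have /choice[T HT] i : exists T : N -> R, i \in I -> [/\ msmooth T, forall y, 0 <= T y <= expR (- f y / tau),
      lipf G T (fun y => (1 + eta) ^+ 3 / tau * T y + K * expR (- (f y + K^-1) / tau)) & forall y, dist G (ctr i.1).1 y < (ctr i.1).2 -> dist G i.2 y < del ->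
        expR (- (f y + c0 * del) / tau) <= T y].
  have [iI|_] := boolP (i \in I); last by exists (fun=> 0). move: iI; rewrite mem_filter => /andP[h1 /allpairsP[[a b] /= [as1 bs2 E]]].
  have [_ H] : P' i.1 K by apply: HK; rewrite E. have [T HT] := H i.2 del tau h1 del0 tau0. by exists T.
pose S y := \sum_(i <- I) T i y.
have Tge i y : i \in I -> 0 <= T i y by move=> /HT[_ h _ _]; have /andP[] := h y.
have Slow y : expR (- (f y + c0 * del) / tau) <= S y.
  have [z1 z1s z1y] := Hs1 y; have [y1 y1s y1y] := Hs2 y. have [_ h] := Hctr z1; have t := dist_triangle G (ctr z1).1 z1 y. have i1 : dist G (ctr z1).1 y < (ctr z1).2 by lra.
  have iI : (z1, y1) \in I.
    rewrite mem_filter /=; apply/andP; split; last exact: (allpairs_f pair). have := dist_triangle G (ctr z1).1 y y1; rewrite (dist_sym G y y1); lra.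
  have [_ _ _ h4] := HT _ iI. apply: le_trans (h4 y i1 y1y) _; rewrite /S (big_rem _ iI) /= lerDl. rewrite big_seq; apply: sumr_ge0 => j jI; apply: Tge; exact: mem_rem jI.
have S0 y : 0 < S y := lt_le_trans (expR_gt0 _) (Slow y).
have Sup y : S y <= n * expR (- f y / tau).
  apply: (@le_trans _ _ (\sum_(i <- I) expR (- f y / tau))).
    rewrite /S big_seq [X in _ <= X]big_seq; apply: ler_sum => i iI. by have [_ h _ _] := HT i iI; have /andP[] := h y.
  by rewrite big_const_seq count_predT iter_addr_0 -[X in X <= _]mulr_natl ler_wpM2r ?expR_ge0// lerDl.
have sS : msmooth S by apply: msmooth_sum => i iI; have [] := HT i iI.
have sL : msmooth (fun y => ln (S y)) by exact: (msmooth_comp S0 sS (@Ck1_ln R)).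
pose F y := - tau * ln (S y).
have sF : msmooth F by apply: msmoothM sL; exact: msmooth_cst.
have lS : lipf G S (fun y => (1 + e) / tau * S y).
  have l1 := lipf_sum (s := I) (F := T) (C := fun i y => (1 + eta) ^+ 3 / tau * T i y + K * expR (- (f y + K^-1) / tau)) (G := G).
  have {}l1 := l1 (fun i iI => let: And4 h1 _ h3 _ := HT i iI in conj h1 h3). move=> p x v cx; apply: le_trans (l1 p x v cx) _; rewrite ler_wpM2r ?nrm_ge0//.
  move: (chart_inv p x) => y; rewrite big_split /= -mulr_sumr -/(S y). have E1 : \sum_(i <- I) K * expR (- (f y + K^-1) / tau) <= n * (K * S y).
    rewrite big_const_seq count_predT iter_addr_0 -[X in X <= _]mulr_natl. have h : K * expR (- (f y + K^-1) / tau) <= K * S y.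
      rewrite ler_pM2l//; apply: le_trans (Slow y); rewrite ler_expR ler_pM2r ?invr_gt0// lerN2 lerD2l//.
    have k0 : 0 <= K * S y := mulr_ge0 (ltW K0) (ltW (S0 y)). apply: le_trans (ler_wpM2l (ler0n _ _) h) _; apply: ler_wpM2r => //. by rewrite lerDl.
  have E2 : n * (K * S y) <= e / 2 / tau * S y.
    rewrite mulrA ler_pM2r// ler_pdivlMr//; apply: le_trans tauK; rewrite (mulrC _ tau) mulrA//.
  have E3 : (1 + eta) ^+ 3 / tau * S y <= (1 + e / 2) / tau * S y.
    by rewrite ler_pM2r// ler_pM2r ?invr_gt0.
  apply: le_trans (lerD E3 (le_trans E1 E2)) _; rewrite -mulrDl -mulrDl. by rewrite ler_pM2r// ler_pM2r ?invr_gt0//; lra.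
exists F; split=> //.
- move=> y; have lnS1 : ln (S y) <= ln n - f y / tau.
    have n0 : 0 < n by lra. have -> : - (f y / tau) = ln (expR (- f y / tau)) by rewrite expRK mulNr. by rewrite -lnM ?posrE ?expR_gt0// ler_ln ?posrE ?mulr_gt0 ?expR_gt0.
  have lnS2 : - (f y + c0 * del) / tau <= ln (S y).
    by rewrite -(expRK (- (f y + c0 * del) / tau)) ler_ln ?posrE ?expR_gt0.
  have n2 : ln n <= n by apply: ltW; apply: ln_sublinear; lra. have k1 : tau * ln (S y) <= tau * (n - f y / tau) by rewrite ler_pM2l//; lra.
  have k2 : tau * (- (f y + c0 * del) / tau) <= tau * ln (S y) by rewrite ler_pM2l. have e1 : tau * (n - f y / tau) = tau * n - f y by field; rewrite gt_eqF.
  have e2 : tau * (- (f y + c0 * del) / tau) = - (f y + c0 * del) by field; rewrite gt_eqF. rewrite e1 in k1; rewrite e2 in k2; rewrite /F mulNr ler_norml; apply/andP; split; lra.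
- move=> p x v cx; have dS := msmooth_diff sS cx. have dl : is_derive (S (chart_inv p x)) (1 : R) (@ln R) (S (chart_inv p x))^-1 by exact: is_derive1_ln.
  have [D1 E1] := derive_comp1 v dS (@ex_derive _ _ _ _ _ _ _ dl). rewrite derive1E (@derive_val _ _ _ _ _ _ _ dl) in E1.
  have -> : dM F p x v = - tau * ((S (chart_inv p x))^-1 * dM S p x v).
    rewrite /dM -E1; have [_ <-] := derive_mull (- tau) D1. by [].
  have h := lS p x v cx; have Sx := S0 (chart_inv p x). rewrite normrM normrN (gtr0_norm tau0) normrM normfV (gtr0_norm Sx).
  have h2 : tau * ((S (chart_inv p x))^-1 * `|dM S p x v|) <=
      tau * ((S (chart_inv p x))^-1 * ((1 + e) / tau * S (chart_inv p x) * nrm G p x v)).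
    by rewrite ler_pM2l// ler_pM2l ?invr_gt0.
  apply: le_trans h2 _; rewrite le_eqVlt; apply/orP; left; apply/eqP. by field; rewrite !gt_eqF.
Qed.

End SmoothApproximation.

(** * First variation of lengths and areas *)

Section Variation.
Variables (R : realType) (M : surface R) (G : riemannian_metric M).
Implicit Types (p q y z : M) (x v w : R * R) (psi chi u : M -> R) (t : R).
Local Notation e1 := ((1, 0) : R * R).
Local Notation e2 := ((0, 1) : R * R).

(** Where |du| = 1, squared lengths along grad u are multiplied by 1 + t psi and transverse ones by
    1 + t psi - t chi. Thus psi enlarges conformally and chi shrinks only across the gradient. For u
    = 0 the whole change is conformal. *)
Definition varied psi chi u t (G' : riemannian_metric M) := forall p x v w,
  G' p x v w = (1 + t * psi (chart_inv p x) - t * chi (chart_inv p x)) * G p x v w +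
    t * chi (chart_inv p x) * (dM u p x v * dM u p x w).

Lemma varied_ex psi chi u t (X : R) : msmooth psi -> msmooth chi -> msmooth u ->
  0 <= t -> (forall y, 0 <= psi y) -> (forall y, 0 <= chi y <= X) -> t * X < 1 -> exists G', varied psi chi u t G'.
Proof.
move=> sp sc su t0 p0 cX tX.
have sal : msmooth (fun y => 1 + t * psi y + (- t) * chi y).
  apply: msmoothD; last by apply: msmoothM => //; exact: msmooth_cst. by apply: msmoothD; [exact: msmooth_cst|apply: msmoothM => //; exact: msmooth_cst].
have sbe : msmooth (fun y => t * chi y) by apply: msmoothM => //; exact: msmooth_cst.
have al0 y : 0 < 1 + t * psi y + (- t) * chi y.
  have /andP[h1 h2] := cX y; have := ler_wpM2l t0 h2; have := mulr_ge0 t0 (p0 y); lra.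
have be0 y : 0 <= t * chi y by have /andP[h1 h2] := cX y; exact: mulr_ge0.
exists (deform G sal sbe su al0 be0) => p x v w.
by rewrite /= /deform_inner mulNr.
Qed.

Lemma sqrt_lower (x : R) : -1 <= x -> x <= 1 -> 1 + x / 2 - x ^+ 2 / 2 <= Num.sqrt (1 + x).
Proof.
move=> x0 x1; have h : 0 <= 1 + x / 2 - x ^+ 2 / 2 by nra.
rewrite -ler_sqr ?nnegrE ?sqrtr_ge0// sqr_sqrtr; last by lra.
have : 0 <= x ^+ 2 * ((1 + x) * (3 - x)) by rewrite mulr_ge0 ?sqr_ge0 ?mulr_ge0//; lra.
by rewrite !expr2 => k; lra.
Qed.

(** Uses sqrt (1 + z) >= 1 + z/2 - z^2/2. With b = |du(v)| / |v| <= 2 one has |1 - b^2| <= 3, whence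
    |z| <= t (Y + 3 X), and (1 - b^2) / 2 <= 1 - b. The loss vanishes for unit speed along grad u,
    and the remaining error is quadratic in t. *)
Lemma varied_nrm psi chi u t (Y X : R) G' : varied psi chi u t G' -> lip G u 2 -> 0 <= t ->
  (forall y, 0 <= psi y <= Y) -> (forall y, 0 <= chi y <= X) -> t * (Y + 3 * X) <= 1 -> forall p x v, cod p x ->
    (1 - (Y + 3 * X) ^+ 2 / 2 * t ^+ 2) * nrm G p x v + t * psi (chart_inv p x) / 2 * nrm G p x v
      - t * chi (chart_inv p x) * (nrm G p x v - `|dM u p x v|) <= nrm G' p x v.
Proof.
move=> HG lu t0 pY cX tZ p x v cx; set y := chart_inv p x.
have /andP[p0 p1] := pY y; have /andP[c0 c1] := cX y.
have n0 := nrm_ge0 G p x v; have hu := lu p x v cx.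
have nE : G p x v v = nrm G p x v ^+ 2 by rewrite sqr_sqrtr// inner_ge0.
have n'E : nrm G' p x v = Num.sqrt ((1 + t * psi y - t * chi y) * nrm G p x v ^+ 2 + t * chi y * `|dM u p x v| ^+ 2).
  have dE : `|dM u p x v| ^+ 2 = dM u p x v * dM u p x v by rewrite real_normK ?num_real// expr2. by rewrite {1}/nrm HG nE dE.
rewrite n'E; have d0 := normr_ge0 (dM u p x v).
move: (nrm G p x v) (`|dM u p x v|) n0 hu d0 => n d n0 hu d0.
have [n00|nn0] := eqVneq n 0.
  have -> : d = 0 by lra. by rewrite n00 !(mulr0, subr0, addr0) sqrtr_ge0.
have np : 0 < n by rewrite lt_def nn0.
pose b := d / n; have db : d = b * n by rewrite /b divfK.
have b0 : 0 <= b by rewrite divr_ge0.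
have b2 : b <= 2 by rewrite ler_pdivrMr.
pose z := t * psi y - t * chi y * (1 - b ^+ 2).
have tp0 : 0 <= t * psi y by rewrite mulr_ge0.
have tc0 : 0 <= t * chi y by rewrite mulr_ge0.
have tp1 : t * psi y <= t * Y by rewrite ler_wpM2l.
have tc1 : t * chi y <= t * X by rewrite ler_wpM2l.
have bb : b ^+ 2 <= 4 by rewrite expr2; nra.
have bb0 : 0 <= b ^+ 2 by rewrite sqr_ge0.
have z1 : z <= t * (Y + 3 * X).
  have : t * chi y * (b ^+ 2 - 1) <= t * chi y * 3 by rewrite ler_wpM2l//; lra. rewrite /z; lra.
have z2 : - (t * (Y + 3 * X)) <= z.
  have : t * chi y * (1 - b ^+ 2) <= t * chi y * 3 by rewrite ler_wpM2l//; lra. rewrite /z; lra.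
have -> : (1 + t * psi y - t * chi y) * n ^+ 2 + t * chi y * d ^+ 2 = (1 + z) * n ^+ 2.
  by rewrite db /z; ring.
have z10 : 0 <= 1 + z by lra.
rewrite sqrtrM// sqrtr_sqr ger0_norm//.
have s1 : 1 + z / 2 - z ^+ 2 / 2 <= Num.sqrt (1 + z) by apply: sqrt_lower; lra.
have zz : z ^+ 2 <= (Y + 3 * X) ^+ 2 * t ^+ 2.
  rewrite -exprMn (mulrC (Y + 3 * X)) -(real_normK (num_real z)) ler_sqr ?nnegrE ?normr_ge0//.
    by rewrite ler_norml z2.
  by apply: le_trans (normr_ge0 z) _; rewrite ler_norml z2.
have cc : - (t * chi y * (1 - b)) <= - (t * chi y * (1 - b ^+ 2)) / 2.
  have : 0 <= t * chi y * (1 - b) ^+ 2 by rewrite mulr_ge0 ?sqr_ge0. by rewrite sqrrB expr1n mul1r mulr2n; lra.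
have key : (1 - (Y + 3 * X) ^+ 2 / 2 * t ^+ 2) + t * psi y / 2 - t * chi y * (1 - b) <= Num.sqrt (1 + z).
  have zE : z = t * psi y - t * chi y * (1 - b ^+ 2) by []. apply: le_trans s1; clearbody z; lra.
have := ler_wpM2r n0 key; rewrite db; congr (_ <= _).
by ring.
Qed.

(** The left side is the determinant times the squared dual norm of du. The Lipschitz condition is
    tested on the vector v, which is the determinant times grad u. *)
Lemma gradient_bound u (k : R) p x : 0 <= k -> msmooth u -> lip G u k -> cod p x ->
  G p x e2 e2 * dM u p x e1 ^+ 2 - 2 * G p x e1 e2 * (dM u p x e1 * dM u p x e2) + G p x e1 e1 * dM u p x e2 ^+ 2
    <= k ^+ 2 * (G p x e1 e1 * G p x e2 e2 - G p x e1 e2 ^+ 2).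
Proof.
move=> k0 su lu cx; have [_ D0] := inner_det_gt0 G cx.
set g11 := G p x e1 e1 in D0 *; set g12 := G p x e1 e2 in D0 *; set g22 := G p x e2 e2 in D0 *.
set F1 := dM u p x e1; set F2 := dM u p x e2; set D := g11 * g22 - _ in D0 *.
set Q := (X in X <= _).
pose v : R * R := (g22 * F1 - g12 * F2, g11 * F2 - g12 * F1).
have dv : dM u p x v = Q.
  have -> : v = v.1 *: e1 + (v.2 *: e2 + 0) by rewrite addr0 -vec_expand. rewrite !dM_linear// (_ : dM u p x 0 = 0); last first.
    by have := dM_linear 0 0 0 su cx; rewrite scale0r addr0 mul0r add0r => /eqP; rewrite eq_sym -subr_eq0 subrr => _; apply: derive0.
  by rewrite /v /Q /= -/F1 -/F2; ring.
have gv : G p x v v = D * Q.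
  by rewrite (inner_expand G v cx) -/g11 -/g12 -/g22 /v /D /Q /=; ring.
have := lu p x v cx; rewrite dv /nrm gv => h.
have [Q0|Q0] := leP Q 0; first by apply: le_trans Q0 _; rewrite mulr_ge0 ?sqr_ge0// ltW.
have DQ : 0 <= D * Q by rewrite mulr_ge0 ?ltW.
have : Q ^+ 2 <= (k * Num.sqrt (D * Q)) ^+ 2.
  by rewrite ler_sqr ?nnegrE ?mulr_ge0 ?sqrtr_ge0 ?(ltW Q0)//; rewrite (gtr0_norm Q0) in h.
by rewrite exprMn sqr_sqrtr// mulrA expr2 ler_pM2r.
Qed.

(** The determinant of a rank-one update is computed exactly. For k near 1 only about half of t chi
    reaches the area, as one of two directions is shrunk. *)
Lemma varied_density psi chi u t (k : R) G' p x : varied psi chi u t G' -> msmooth u ->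
  0 <= k -> lip G u k -> 0 <= t -> 0 <= chi (chart_inv p x) -> 0 <= psi (chart_inv p x) -> t * chi (chart_inv p x) <= 1 -> cod p x ->
  area_density G' p x <= (1 + t * psi (chart_inv p x) - t * chi (chart_inv p x) * ((2 - k ^+ 2) / 2)) * area_density G p x.
Proof.
move=> HG su k0 lu t0 c0 p0 tc cx; have Q := gradient_bound k0 su lu cx.
have [_ D0] := inner_det_gt0 G cx.
rewrite /area_density !HG; move: (chart_inv p x) p0 c0 tc => y p0 c0 tc.
move: (G p x e1 e1) (G p x e1 e2) (G p x e2 e2) (dM u p x e1) (dM u p x e2) Q D0 => g11 g12 g22 F1 F2 Q D0.
have tp0 : 0 <= t * psi y by rewrite mulr_ge0.
have tc0 : 0 <= t * chi y by rewrite mulr_ge0.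
move: (t * psi y) (t * chi y) tp0 tc0 tc => P C tp0 tc0 tc.
have kk : 0 <= k ^+ 2 by rewrite sqr_ge0.
have m0 : 0 <= 1 + P - C * ((2 - k ^+ 2) / 2).
  have : 0 <= C * k ^+ 2 by rewrite mulr_ge0. lra.
rewrite -{1}(ger0_norm m0) -sqrtr_sqr -sqrtrM ?sqr_ge0// ler_wsqrtr//.
have -> : ((1 + P - C) * g11 + C * (F1 * F1)) * ((1 + P - C) * g22 + C * (F2 * F2)) - ((1 + P - C) * g12 + C * (F1 * F2)) ^+ 2
  = (1 + P - C) ^+ 2 * (g11 * g22 - g12 ^+ 2) + (1 + P - C) * C * (g22 * F1 ^+ 2 - 2 * g12 * (F1 * F2) + g11 * F2 ^+ 2) by ring.
move: (g22 * _ - _ + _) (g11 * g22 - _) Q D0 => Q D QD D0.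
have al0 : 0 <= 1 + P - C by lra.
have h := ler_wpM2l (mulr_ge0 al0 tc0) QD.
have h2 : 0 <= (C * k ^+ 2 / 2) ^+ 2 * D by rewrite mulr_ge0 ?sqr_ge0 ?(ltW D0).
rewrite -subr_ge0; apply: le_trans (_ : (C * k ^+ 2 / 2) ^+ 2 * D + ((1 + P - C) * C * (k ^+ 2 * D) - (1 + P - C) * C * Q) <= _).
  by rewrite addr_ge0 ?subr_ge0.
by rewrite le_eqVlt; apply/orP; left; apply/eqP; field.
Qed.

Hypothesis cM : compact [set: M].
Local Notation a B := (fine (area G B)).

Lemma area_finE B : area G B = (a B)%:E.
Proof.
rewrite fineK// fin_numE; apply/andP; split; apply/eqP => E.
  by have := area_ge0 G B; rewrite E.
by have := le_area G (@subsetT _ B); rewrite E leye_eq => /eqP h; have := area_fin G cM; rewrite h.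
Qed.

Lemma fine_area_ge0 B : 0 <= a B.
Proof. by rewrite -lee_fin -area_finE area_ge0. Qed.

Lemma fine_le_area B C : B `<=` C -> a B <= a C.
Proof. by move=> BC; rewrite -lee_fin -!area_finE; exact: le_area. Qed.

(** M is cut into the sets Q i, the rest of P, and the complement of P; on each piece the density
    changes by a constant factor at most, and outside P it does not grow. *)
Lemma varied_area psi chi u t (k Y X : R) G' (P : set M) (Q : nat -> set M) (kap : nat -> R) n :
  varied psi chi u t G' -> msmooth u -> 0 <= k -> k ^+ 2 <= 2 -> lip G u k -> 0 <= t -> 0 <= Y -> (forall y, 0 <= psi y <= Y) -> (forall y, 0 <= chi y <= X) -> t * X <= 1 ->
  (forall y, ~ P y -> psi y = 0) -> borel P -> (forall i, borel (Q i)) -> trivIset setT Q ->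
  (forall i, Q i `<=` P) -> (forall i y, Q i y -> kap i <= chi y) -> (forall i, 0 <= kap i) ->
  fine (area G' [set: M]) <= a [set: M] + t * (Y * a P - (2 - k ^+ 2) / 2 * \sum_(i < n) kap i * a (Q i)).
Proof.
move=> HG su k0 k2 lu t0 Y0 pY cX tX pP bP bQ tQ QP kQ kap0.
have tc y : t * chi y <= 1.
  by have /andP[_ h] := cX y; apply: le_trans tX; rewrite ler_wpM2l.
pose m := (2 - k ^+ 2) / 2; have m0 : 0 <= m by rewrite divr_ge0 ?subr_ge0.
have m1 : m <= 1 by have := sqr_ge0 k; rewrite /m; lra.
have scale B (c : R) : 0 <= c -> (forall y, B y -> 1 + t * psi y - t * chi y * m <= c) -> (area G' B <= (c * a B)%:E)%E.
  move=> c0 Hc; rewrite EFinM -area_finE; apply: area_scale => // p x cx Bx. have /andP[h1 _] := pY (chart_inv p x); have /andP[h2 _] := cX (chart_inv p x).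
  apply: le_trans (varied_density HG su k0 lu t0 h2 h1 (tc _) cx) _. rewrite ler_wpM2r//; last exact: Hc. by rewrite -lee_fin; exact: density_ge0.
pose V := \big[setU/set0]_(i < n) Q i.
have VE y : V y <-> exists2 i, (i < n)%N & Q i y.
  rewrite /V -bigcup_mkord; split => [[i /= h1 h2]|[i h1 h2]]; by exists i.
have bVj j : borel (\big[setU/set0]_(i < j) Q i).
  elim: j => [|j IH]; first by rewrite big_ord0; apply: borel_open; exact: open0. by rewrite big_ord_recr /=; exact: borelU.
have bV : borel V by exact: bVj.
pose C i := if (i < n)%N then Q i else if i == n then P `\` V else if i == n.+1 then ~` P else set0.
have Cn : C n = P `\` V by rewrite /C ltnn eqxx.
have Cn1 : C n.+1 = ~` P.
  by rewrite /C ltnNge leqnSn /= eqxx (gtn_eqF (ltnSn n)).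
have Ci i : (i < n)%N -> C i = Q i by rewrite /C => ->.
have bC i : borel (C i).
  rewrite /C; case: ifP => // _; case: ifP => _; first exact: borelD. by case: ifP => _; [exact: borelC|apply: borel_open; exact: open0].
have cov y : [set: M] y -> exists2 i, (i < n.+2)%N & C i y.
  move=> _; have [Py|nPy] := pselect (P y); last by exists n.+1 => //; rewrite Cn1. have [/VE[i h1 h2]|nV] := pselect (V y).
    by exists i; [exact: ltn_trans h1 (ltnW (ltnSn _))|rewrite Ci].
  by exists n => //; rewrite Cn.
have tc0 y : 0 <= t * chi y by have /andP[h _] := cX y; exact: mulr_ge0.
have tp1 y : t * psi y <= t * Y by have /andP[_ h] := pY y; exact: ler_wpM2l.
have tcm0 y : 0 <= t * chi y * m by exact: mulr_ge0.
have tY0 : 0 <= t * Y by exact: mulr_ge0.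
have hQ i : (area G' (Q i) <= ((1 + t * Y - t * kap i * m) * a (Q i))%:E)%E.
  have [->|/set0P[y Qy]] := eqVneq (Q i) set0.
    have -> : a set0 = 0.
      apply/eqP; rewrite eq_le fine_area_ge0 andbT -lee_fin -area_finE. apply: (area_le (c := 0%E)) => j p B hB _; rewrite big1// => l _; have [_ Bk] := hB l.
      have -> : B l = set0 by apply/seteqP; split=> // z /Bk[]. by rewrite /chart_area image_set0 integral_set0.
    have := scale set0 0 (lexx _); rewrite mul0r mulr0; apply. by [].
  have kt z : Q i z -> t * kap i * m <= t * chi z * m.
    by move=> /kQ h; rewrite ler_wpM2r// ler_wpM2l.
  apply: scale => [|z Qz].
    have := kt y Qy; have : t * chi y * m <= 1 by rewrite mulr_ile1. lra.
  by have := kt z Qz; have := tp1 z; lra.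
have h1 : (area G' (P `\` V) <= ((1 + t * Y) * a (P `\` V))%:E)%E.
  by apply: scale => [|y _]; [lra|have := tp1 y; have := tcm0 y; lra].
have h2 : (area G' (~` P) <= (a (~` P))%:E)%E.
  rewrite -[X in X%:E]mul1r; apply: scale => // y nP. by rewrite (pP y nP) mulr0; have := tcm0 y; lra.
have up : (area G' [set: M] <= (\sum_(i < n) (1 + t * Y - t * kap i * m) * a (Q i) + (1 + t * Y) * a (P `\` V) + a (~` P))%:E)%E.
  apply: le_trans (area_cover G' bC cov) _. rewrite !big_ord_recr /= !setTI Cn Cn1 !EFinD; apply: leeD => //; apply: leeD => //.
  rewrite -sumEFin; apply: lee_sum => i _; rewrite setTI Ci//.
have pk : \sum_(i < n) a (Q i) + a (P `\` V) <= a P.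
  rewrite -lee_fin -area_finE EFinD -sumEFin. pose D i := if (i < n)%N then Q i else if i == n then P `\` V else set0. have bD i : borel (D i).
    rewrite /D; case: ifP => // _; case: ifP => _; first exact: borelD. by apply: borel_open; exact: open0.
  have Dn : D n = P `\` V by rewrite /D ltnn eqxx. have QV i y : (i < n)%N -> Q i y -> V y by move=> ? ?; apply/VE; exists i. have tD : trivIset setT D.
    have DE j y : D j y -> ((j < n)%N /\ Q j y) \/ (j = n /\ (P `\` V) y).
      by rewrite /D; case: ifP => hj; [left|case: eqVneq => // -> h; right].
    move=> i j _ _ [y [/DE[[hi yi]|[-> [_ yi]]] /DE[[hj yj]|[-> [_ yj]]]]] //.
    - by apply: tQ => //; exists y.
    - by case: yj; exact: QV yi.
    - by case: yi; exact: QV yj.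
  have := @area_packing R M G P n.+1 D bD tD; rewrite big_ord_recr /= Dn. have -> : P `&` (P `\` V) = P `\` V by apply/seteqP; split => [y []//|y []//].
  rewrite -area_finE; congr (_ <= _)%E; congr (_ + _)%E; apply: eq_bigr => i _. by rewrite /D ltn_ord -area_finE (_ : P `&` Q i = Q i)//; apply/setIidPr; exact: QP.
have pk2 : a P + a (~` P) <= a [set: M].
  by rewrite -lee_fin -area_finE EFinD -!area_finE; apply: area_superadd => //; rewrite setICr.
have sE : \sum_(i < n) (1 + t * Y - t * kap i * m) * a (Q i) =
    (1 + t * Y) * \sum_(i < n) a (Q i) - t * m * \sum_(i < n) kap i * a (Q i).
  by rewrite !mulr_sumr -sumrB; apply: eq_bigr => i _; ring.
have fin : fine (area G' [set: M]) <= \sum_(i < n) (1 + t * Y - t * kap i * m) * a (Q i) + (1 + t * Y) * a (P `\` V) + a (~` P).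
  rewrite -lee_fin fineK//; apply: fin_real; apply/andP; split.
    by apply: (@lt_le_trans _ _ 0%E); [exact: ltNy0|exact: area_ge0].
  exact: le_lt_trans up (ltry _).
rewrite sE in fin; have := ler_wpM2l tY0 pk; rewrite -/m.
move: (\sum_(i < n) a (Q i)) (\sum_(i < n) kap i * a (Q i)) (a (P `\` V)) (a (~` P)) (a P) (a setT) fin pk pk2 => S1 S2 A1 A2 A3 A4 fin pk pk2 h; lra.
Qed.

End Variation.

(** * The variational inequality for an extremal metric *)

Section Extremality.
Variables (R : realType) (M : surface R) (G : riemannian_metric M) (U : universal_cover G).
Hypotheses (cM : compact [set: M]) (nsc : ~ simply_connected M) (ext : extremal G).
Local Notation GU := (cover_metric U).
Local Notation f := (@cover_proj R M G U).
Local Notation a B := (fine (area G B)).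

(** A lift of a noncontractible loop, described in the cover: distinct end points in one fibre. *)
Definition essential (k : R -> U) := [/\ continuous k, f (k 0) = f (k 1) & k 0 != k 1].

Lemma area_M_gt0 (G' : riemannian_metric M) : 0 < fine (area G' [set: M]).
Proof.
have [u _] := nonclosed_lift_ex U nsc.
by rewrite -lte_fin -(area_finE G' cM); exact: (area_gt0 G' (f u)).
Qed.

Lemma extremal_compare (G' : riemannian_metric M) (s' : R) : 0 <= s' ->
  (forall k l l', essential k -> arc G (f \o k) 0 1 l -> arc G' (f \o k) 0 1 l' -> s' <= l') -> a [set: M] * s' ^+ 2 <= sys G ^+ 2 * fine (area G' [set: M]).
Proof.
move=> s0 H.
have [c /not_implyP[lc nc]] := (existsNP _).2 nsc.
have ge : (s'%:E <= systole G')%E.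
  apply: le_ereal_inf_tmp => _ [c' [pc lc' nc'] <-]; have [l' h'] := piecewise_arc G' pc. have [l h] := piecewise_arc G pc. rewrite (arc_curve_length h') lee_fin.
  have [k [ck hk kc k01]] := noncontractible_lift U h lc' nc'. have E t : 0 <= t <= 1 -> (f \o k) t = c' t by exact: kc. apply: (H k l l'); [|exact: arc_eq h E|exact: arc_eq h' E].
  by split=> //; rewrite !kc ?lexx ?ler01//; exact: lc'.2.
have fin : systole G' \is a fin_num.
  have [u [u' [fu uu]]] := nonclosed_lift_ex U nsc. have [l [c' [h c0 c1]]] := joins_ex GU u u'. have h1 := arc_piecewise (proj_arc h). have [l' h'] := piecewise_arc G' h1.
  have cc := arc_continuous h. have le : (systole G' <= l'%:E)%E.
    rewrite -(arc_curve_length h'); apply: ereal_inf_lbound; exists (f \o c') => //. split=> //.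
      split; last by rewrite /= c0 c1. have c2 : continuous (f \o (c' \o clamp 0 1)).
        by move=> t; exact: (@cont_comp _ _ _ (c' \o clamp 0 1) f t (cc t) (@continuous_proj R M G U _)).
      apply: (@subspace_eq_continuous _ _ _ (f \o (c' \o clamp 0 1))); last exact: continuous_subspaceT. by move=> t; rewrite inE /= in_itv /= => t01; rewrite clampE.
    move=> ctr; have := contractible_lift ctr cc. rewrite /= !clampE ?lexx ?ler01// c0 c1 => E; move/eqP: uu; apply; apply: E. by move=> t t01; rewrite /= clampE.
  by rewrite fin_numE; apply/andP; split; apply/eqP => E; rewrite E in le ge.
have ss : s' <= sys G' by rewrite -lee_fin /sys fineK.
have le : systolic_ratio G' <= systolic_ratio G.
  rewrite -lee_fin ext /optimal_systolic_ratio; apply: ereal_sup_ubound; by exists G'.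
have A0 := area_M_gt0 G; have A'0 := area_M_gt0 G'.
move: le; rewrite /systolic_ratio -/(sys G) -/(sys G') ler_pdivrMr// mulrAC ler_pdivlMr//.
apply: le_trans; rewrite mulrC ler_pM2r// ler_sqr ?nnegrE// (le_trans s0)//.
Qed.

(** If the first-order change B of the area were negative, a small t would lower the area linearly
    while the systole falls at most quadratically, so the systolic ratio would rise. *)
Lemma first_variation (psi chi u : M -> R) (k Y X C t0 : R) (P : set M) (Q : nat -> set M) (kap : nat -> R) n :
  msmooth psi -> msmooth chi -> msmooth u -> 0 <= k -> k ^+ 2 <= 2 -> lip G u k -> 0 <= Y -> (forall y, 0 <= psi y <= Y) -> (forall y, 0 <= chi y <= X) ->
  (forall y, ~ P y -> psi y = 0) -> borel P -> (forall i, borel (Q i)) -> trivIset setT Q ->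
  (forall i, Q i `<=` P) -> (forall i y, Q i y -> kap i <= chi y) -> (forall i, 0 <= kap i) -> 0 < t0 -> 0 <= C ->
  (forall t G' r l l', 0 < t -> t < t0 -> varied G psi chi u t G' -> essential r ->
     arc G (f \o r) 0 1 l -> arc G' (f \o r) 0 1 l' -> sys G * (1 - C * t ^+ 2) <= l') ->
  (2 - k ^+ 2) / 2 * \sum_(i < n) kap i * a (Q i) <= Y * a P.
Proof.
move=> sp sc su k0 k2 lu Y0 pY cX pP bP bQ tQ QP kQ kap0 t00 C0 H.
have [_ s0] := systole_fin U cM nsc; have A0 := area_M_gt0 G.
rewrite leNgt; apply/negP => lt; set B := Y * a P - (2 - k ^+ 2) / 2 * \sum_(i < n) kap i * a (Q i).
have B0 : B < 0 by rewrite /B; lra.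
have X0 : 0 <= X by have [z _] := nonclosed_lift_ex U nsc; have /andP[h1 h2] := cX (f z); exact: le_trans h1 h2.
pose W := 2 * C * a [set: M] + 1.
have W0 : 0 < W by rewrite /W; have := mulr_ge0 C0 (ltW A0); lra.
(* In turn: the range of H, positivity of the metric, C t^2 <= 1, t <= 1, and t W < - B, by which
   the quadratic loss 2 C area t^2 cannot make up for t B. *)
pose t := Num.min (t0 / 2) (Num.min (1 / (2 * (X + 1))) (Num.min (1 / (C + 1)) (Num.min 1 (- B / W / 2)))).
have t1 : 0 < t.
  by rewrite !lt_min !divr_gt0// ?mulr_gt0 ?oppr_gt0// ?ltr01 /=; lra.
have t2 : t <= t0 / 2 by rewrite ge_min lexx.
have t3 : t <= 1 / (2 * (X + 1)) by rewrite !ge_min lexx !orbT.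
have t4 : t <= 1 / (C + 1) by rewrite !ge_min lexx !orbT.
have t5 : t <= 1 by rewrite !ge_min lexx !orbT.
have t6 : t <= - B / W / 2 by rewrite !ge_min lexx !orbT.
have tX : t * X < 1.
  have : t * (2 * (X + 1)) <= 1 by rewrite -ler_pdivlMr// mulr_gt0//; lra. have := mulr_ge0 (ltW t1) X0; lra.
have tC : C * t ^+ 2 <= 1.
  have : t * (C + 1) <= 1 by rewrite -ler_pdivlMr//; lra. have : C * t ^+ 2 <= C * t by rewrite ler_wpM2l// expr2; rewrite ler_piMl ?(ltW t1). lra.
have tW : t * W < - B.
  have : t * W <= - B / 2 by rewrite -ler_pdivlMr// mulrAC. lra.
have [G' HG] := varied_ex G sp sc su (ltW t1) (fun y => proj1 (andP (pY y))) cX tX.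
have := varied_area cM n HG su k0 k2 lu (ltW t1) Y0 pY cX (ltW tX) pP bP bQ tQ QP kQ kap0.
rewrite -/B => hA.
have s1 : 0 <= sys G * (1 - C * t ^+ 2) by rewrite mulr_ge0 ?(ltW s0)// subr_ge0.
have tt0 : t < t0 by lra.
have := extremal_compare s1 (fun r l l' er h h' => H t G' r l l' t1 tt0 HG er h h').
rewrite exprMn mulrCA ler_pM2l ?exprn_gt0// => h.
have h2 := le_trans h hA.
have h3 : 1 - 2 * (C * t ^+ 2) <= (1 - C * t ^+ 2) ^+ 2 by have := sqr_ge0 (C * t ^+ 2); rewrite sqrrB expr1n mul1r mulr2n; lra.
have h4 := ler_wpM2l (ltW A0) h3.
have h5 : - (2 * C * a [set: M] * t ^+ 2) <= t * B by lra.
have h6 : - (2 * C * a [set: M] * t) <= B.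
  rewrite -(ler_pM2l t1); apply: le_trans h5; rewrite le_eqVlt; apply/orP; left; apply/eqP; ring.
move: tW; rewrite /W; lra.
Qed.

End Extremality.

(** * Possibly degenerate arcs and cutting at a given length *)

Section WeakArcs.
Variables (R : realType) (N : surface R) (G : riemannian_metric N).
Implicit Types (c : R -> N) (a b l m h : R).

(** [arc] requires a < b; cutting an arc at an end point produces the degenerate case. *)
Definition warc c a b l := (a = b /\ l = 0) \/ arc G c a b l.

Lemma warc_le c a b l : warc c a b l -> a <= b.
Proof. by move=> [[-> _]//|/arc_lt/ltW]. Qed.

Lemma warc_ge0 c a b l : warc c a b l -> 0 <= l.
Proof. by move=> [[_ ->]//|/arc_ge0]. Qed.

Lemma warc_cat c a m b l1 l2 : warc c a m l1 -> warc c m b l2 -> warc c a b (l1 + l2).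
Proof.
move=> [[-> ->]|h1]; first by rewrite add0r.
move=> [[<- ->]|h2]; first by rewrite addr0; right.
by right; exact: arc_cat h1 h2.
Qed.

Lemma warc_split c a b l m : warc c a b l -> a <= m <= b ->
  exists l1 l2, [/\ warc c a m l1, warc c m b l2 & l = l1 + l2].
Proof.
move=> h /andP[am mb]; have [E|nam] := eqVneq a m.
  by exists 0, l; rewrite -E add0r; split=> //; left.
have [E|nmb] := eqVneq m b.
  by exists l, 0; rewrite E addr0; split=> //; left.
have ab : a < m < b by rewrite !lt_neqAle nam am nmb mb.
case: h => [[E _]|h]; first by case/andP: ab => h1 h2; move: (lt_trans h1 h2); rewrite E ltxx.
by have [l1 [l2 [h1 h2 ->]]] := arc_split h ab; exists l1, l2; split=> //; right.
Qed.

Lemma warc_dist c a b l : warc c a b l -> dist G (c a) (c b) <= l.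
Proof. by move=> [[-> ->]|/arc_joins/dist_le//]; rewrite distyy. Qed.

Lemma warc_unique c a b l l' : warc c a b l -> warc c a b l' -> l = l'.
Proof.
move=> [[ab ->]|h] [[ab' ->]|h'] //; last exact: arc_length_unique h h'.
- by have := arc_lt h'; rewrite ab ltxx.
- by have := arc_lt h; rewrite ab' ltxx.
Qed.

Lemma warc_eq c c2 a b l : warc c a b l -> (forall t, a <= t <= b -> c2 t = c t) -> warc c2 a b l.
Proof. by move=> [[-> ->]|h] E; [left|right; exact: arc_eq h E]. Qed.

Lemma warc_shift c a b l h : warc c (a + h) (b + h) l -> warc (fun t => c (t + h)) a b l.
Proof.
move=> [[/addIr -> ->]|k]; [by left|right].
have := @arc_affine _ _ G c a b l 1 h ltr01; rewrite !mul1r => /(_ k) k'.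
by apply: arc_eq k' _ => t _; rewrite mul1r.
Qed.

(** On a C^1 piece the cutting parameter comes from the intermediate value theorem for the primitive
    of the speed. *)
Lemma arc_cut c a b l h : arc G c a b l -> 0 <= h <= l ->
  exists m, [/\ a <= m <= b, warc c a m h & warc c m b (l - h)].
Proof.
move=> k; elim: k h => {a b l} [a b c' L ab cc' E dL|a m b l1 l2 h1 IH1 h2 IH2] h /andP[h0 hl].
  have cL : {within `[a, b], continuous L}.
    have c0 t : a <= t <= b -> {for t, continuous L}.
      by move=> tab; apply/differentiable_continuous/derivable1_diffP; have := dL t tab => d; exact: ex_derive.
    apply: continuous_in_subspaceT => t; rewrite inE /= in_itv /=; exact: c0.
  have LL : L a <= L b by rewrite -subr_ge0; exact: le_trans h0 hl. have v : Num.min (L a) (L b) <= L a + h <= Num.max (L a) (L b).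
    by rewrite (min_idPl LL) (max_idPr LL) lerDl h0 -lerBrDl.
  have [m mab Lm] := IVT (ltW ab) cL v; rewrite in_itv /= in mab; case/andP: mab => am mb. exists m; split; first by rewrite am.
    have [Em|nm] := eqVneq a m; first by left; split=> //; move: Lm; rewrite -Em => /eqP; rewrite -subr_eq0 opprD addrA subrr sub0r oppr_eq0 => /eqP.
    right; have -> : h = L m - L a by rewrite Lm addrC addKr. apply: (arc_C1 _ cc'); first by rewrite lt_neqAle nm.
      by move=> t /andP[t1 t2]; apply: E; rewrite t1 (le_trans t2).
    by move=> t /andP[t1 t2]; apply: dL; rewrite t1 (le_trans t2).
  have -> : L b - L a - h = L b - L m by rewrite Lm; ring. have [Em|nm] := eqVneq m b; first by left; rewrite Em subrr. right; apply: (arc_C1 _ cc'); first by rewrite lt_neqAle nm.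
    by move=> t /andP[t1 t2]; apply: E; rewrite t2 (le_trans am).
  by move=> t /andP[t1 t2]; apply: dL; rewrite t2 (le_trans am).
have am := arc_lt h1; have mb := arc_lt h2.
have [hl1|l1h] := leP h l1.
  have [|n [/andP[an nm] k1 k2]] := IH1 h; first by rewrite h0. exists n; split=> //; first by rewrite an (le_trans nm)// ltW. by rewrite addrAC; apply: warc_cat k2 _; right.
have [|n [/andP[mn nb] k1 k2]] := IH2 (h - l1).
  by apply/andP; split; lra.
exists n; split; first by rewrite nb (le_trans (ltW am)).
  by rewrite -(subrK l1 h) addrC; apply: warc_cat k1; right.
by have <- : l2 - (h - l1) = l1 + l2 - h by ring.
Qed.

Lemma warc_compare (G' : riemannian_metric N) (g : N -> R) (A B : R) c a b l l' :
  warc c a b l -> (a = b /\ l' = 0) \/ arc G' c a b l' -> (a < b -> forall c' t, C1_at c' t -> (exists2 u, a <= u <= b & c' t = c u) ->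
    exists D, is_derive t (1 : R) (g \o c') D /\ A * speed G c' t + B * D <= speed G' c' t) ->
  A * l + B * (g (c b) - g (c a)) <= l'.
Proof.
move=> [[ab ->]|h] h' H.
  case: h' => [[_ ->]|h']; last by have := arc_lt h'; rewrite ab ltxx. by rewrite ab subrr !mulr0 addr0.
have ab := arc_lt h; have [l2 [h2 le]] := arc_compare h (H ab).
case: h' => [[E _]|h']; first by rewrite E ltxx in ab.
by rewrite (arc_length_unique h' h2).
Qed.

End WeakArcs.

(** * Change of the starting point of a loop, seen in the cover *)

Section Rotation.
Variables (R : realType) (M : surface R) (G : riemannian_metric M) (U : universal_cover G).
Local Notation GU := (cover_metric U).
Local Notation f := (@cover_proj R M G U).

Lemma lift_warc k c (a b l : R) : continuous k -> (forall t, a <= t <= b -> f (k t) = c t) ->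
  warc G c a b l -> warc GU k a b l.
Proof. by move=> ck kc [[-> ->]|h]; [left|right; exact: lift_arc ck kc h]. Qed.

Lemma proj_warc k (a b l : R) : warc GU k a b l -> warc G (f \o k) a b l.
Proof. by move=> [[-> ->]|h]; [left|right; exact: proj_arc]. Qed.

(** The new lift follows k from m to 1 and then the lift, starting at k 1, of the initial part of
    the loop. It is not closed: otherwise running both lifts of the initial part backwards from
    their common end would give k 0 = k 1. *)
Lemma rotate_loop (k : R -> U) (m l1 l2 : R) : essential k -> 0 <= m <= 1 ->
  warc GU k 0 m l1 -> warc GU k m 1 l2 -> exists k2, [/\ essential k2,
    warc GU k2 0 (1 - m) l2 /\ warc GU k2 (1 - m) 1 l1, f (k2 0) = f (k m) /\ f (k2 (1 - m)) = f (k 0), forall t, 0 <= t <= 1 -> exists2 t', 0 <= t' <= 1 & f (k2 t) = f (k t') &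
    forall (G' : riemannian_metric M) l', arc G' (f \o k) 0 1 l' -> arc G' (f \o k2) 0 1 l'].
Proof.
move=> [ck fk k01] /andP[m0 m1] h1 h2.
have [E|nm0] := eqVneq m 0.
  move: h1 h2; rewrite E subr0 => h1 h2; exists k; split=> //; last by move=> t t01; exists t.
    split=> //; case: h1 => [[_ ->]|/arc_lt]; [by left|by rewrite ltxx].
have [E|nm1] := eqVneq m 1.
  move: h1 h2; rewrite E subrr => h1 h2; exists k; split=> //; last by move=> t t01; exists t.
    split=> //; case: h2 => [[_ ->]|/arc_lt]; [by left|by rewrite ltxx].
have mp : 0 < m by rewrite lt_def nm0.
have mq : m < 1 by rewrite lt_neqAle nm1.
have cs h : continuous (fun t : R => t + h).
  by move=> t; apply: cvgD; [exact: cvg_id|exact: cvg_cst].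
have csh h : continuous (fun t => k (t + h)).
  by move=> t; exact: (@cont_comp _ _ _ (fun t => t + h) k t (cs h t) (ck _)).
have cfs h : continuous (fun t => f (k (t + h))).
  by move=> t; exact: (@cont_comp _ _ _ (fun t => k (t + h)) f t (csh h t) (@continuous_proj R M G U _)).
have E0 : f (k 1) = f (k (1 - m + (m - 1))) by rewrite addrA subrK subrr.
have m1' : 1 - m <= 1 by lra.
have [k3 [ck3 k30 k3f]] := lift_path m1' (cfs (m - 1)) E0.
pose k2 (t : R) := if t <= 1 - m then k (t + m) else k3 t.
have ck2 : continuous k2.
  by apply: glue_continuous; [exact: csh|exact: ck3|rewrite subrK k30].
have k2l t : t <= 1 - m -> k2 t = k (t + m) by rewrite /k2 => ->.
have k2r t : 1 - m <= t -> k2 t = k3 t.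
  rewrite le_eqVlt => /orP[/eqP <-|lt]; first by rewrite k2l// subrK k30. by rewrite /k2 leNgt lt.
have k20 : k2 0 = k m by rewrite k2l ?add0r// subr_ge0.
have k21 : k2 1 = k3 1 by rewrite k2r.
have fk2r t : 1 - m <= t <= 1 -> f (k2 t) = f (k (t + (m - 1))).
  by move=> /andP[t1 t2]; rewrite k2r// k3f// t1.
have f21 : f (k2 1) = f (k m).
  by rewrite fk2r ?lexx ?m1'//; congr (f (k _)); ring.
exists k2; split.
- split=> //; first by rewrite k20 f21. apply/eqP; rewrite k20 k21 => km; move/eqP: k01; apply. have c1 : continuous (fun t : R => k3 (1 - t)).
    move=> t; have c0 : {for t, continuous (fun t : R => 1 - t : R)} by apply: cvgB; [exact: cvg_cst|exact: cvg_id]. exact: (@cont_comp _ _ _ (fun t : R => 1 - t) k3 t c0 (ck3 _)).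
  have c2 : continuous (fun t : R => k (m - t)).
    move=> t; have c0 : {for t, continuous (fun t : R => m - t : R)} by apply: cvgB; [exact: cvg_cst|exact: cvg_id]. exact: (@cont_comp _ _ _ (fun t : R => m - t) k t c0 (ck _)).
  have := @lift_unique _ _ _ _ (fun t : R => k3 (1 - t)) (fun t : R => k (m - t)) 0 m m0 c1 c2. rewrite !subr0 => /(_ _ (esym km) m); rewrite k30 subrr lexx m0 => ->//.
  move=> t /andP[t0 tm]; rewrite k3f; last by apply/andP; split; lra. by congr (f (k _)); ring.
- split.
    apply: (warc_eq (c := fun t => k (t + m))); last by move=> t /andP[_ t1]; rewrite k2l. by apply: warc_shift; rewrite add0r subrK.
  apply: (lift_warc (c := fun t => f (k (t + (m - 1))))) => //. apply: (@warc_shift _ _ G (f \o k)); have -> : 1 - m + (m - 1) = 0 by ring. have -> : 1 + (m - 1) = m by ring.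
  exact: proj_warc.
- by rewrite k20; split=> //; rewrite k2l// subrK.
- move=> t /andP[t0 t1]; have [h|h] := leP t (1 - m).
    by exists (t + m); [apply/andP; split; lra|rewrite k2l].
  by exists (t + (m - 1)); [apply/andP; split; lra|rewrite fk2r// (ltW h)].
- move=> G' l' h'; have m01 : 0 < m < 1 by rewrite mp. have [a1 [a2 [g1 g2 ->]]] := arc_split h' m01; rewrite addrC. apply: (@arc_cat _ _ _ _ _ (1 - m)).
    have := @arc_affine _ _ G' (f \o k) 0 (1 - m) a2 1 m ltr01. rewrite mulr0 add0r mul1r subrK => /(_ g2) g. by apply: arc_eq g _ => t /andP[_ t1]; rewrite /= mul1r k2l.
  have := @arc_affine _ _ G' (f \o k) (1 - m) 1 a1 1 (m - 1) ltr01. have -> : 1 * (1 - m) + (m - 1) = 0 by ring. have -> : 1 * 1 + (m - 1) = m by ring.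
  by move=> /(_ g1) g; apply: arc_eq g _ => t tm; rewrite /= mul1r fk2r.
Qed.

End Rotation.

(** The balance of [strip_length]. The gain is at least t om ((P0 - Py) + (P1 - Py)) >= 2 t om kap;
    the loss is t kap ((1 + e) (lb1 + lb2) - v), and (1 + e) (lb1 + lb2) - v <= 2 wp + eps + 2 e s
    <= 2 om. *)
Lemma strip_arith (R : realType) (s eps wp e om kap D t la lb1 lb2 lc l d l1 l2 m1 m2 m3 m4 l' u1 u2 v uy P0 P1 Py Q1 Q2 sg : R) :
  0 <= la -> 0 <= lc -> 0 <= e -> 0 <= t -> 0 <= om -> 0 <= kap -> l <= s + eps -> eps <= s -> wp + eps / 2 + e * s <= om ->
  kap <= P0 - Py -> kap <= P1 - Py -> lb1 + lb2 <= d + (l - s) -> d <= v + 2 * wp -> sg * (u2 - u1) = v ->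
  l / 2 = la + lb1 -> l / 2 = lb2 + lc -> l' = l1 + l2 -> l1 = m1 + m2 -> l2 = m3 + m4 -> D * la + t * (- om * (Q1 - P0)) <= m1 ->
  (D - t * kap * (1 + e)) * lb1 + t * ((kap * sg * uy - om * Py) - (kap * sg * u1 - om * Q1)) <= m2 ->
  (D - t * kap * (1 + e)) * lb2 + t * ((kap * sg * u2 + om * Q2) - (kap * sg * uy + om * Py)) <= m3 -> D * lc + t * (om * (P1 - Q2)) <= m4 -> D * l <= l'.
Proof.
move=> la0 lc0 e0 t0 om0 kap0 ls epss omE G0 G1 l12 gap sgE lE1 lE2 lE1' mE1 mE2 p1 p2 p3 p4.
have gain : 2 * om * kap <= om * (P0 - Py) + om * (P1 - Py).
  by have := ler_wpM2l om0 G0; have := ler_wpM2l om0 G1; lra.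
have lb0 : lb1 + lb2 <= 2 * s by lra.
have loss : (1 + e) * (lb1 + lb2) - v <= 2 * om by have := ler_wpM2l e0 lb0; lra.
have loss2 := ler_wpM2l kap0 loss.
have tot : 0 <= t * (om * (P0 - Py) + om * (P1 - Py) + kap * (sg * (u2 - u1)) - kap * ((1 + e) * (lb1 + lb2))).
  by rewrite mulr_ge0// sgE; lra.
have lE : l = la + lb1 + lb2 + lc by lra.
rewrite lE1' mE1 mE2 lE; lra.
Qed.

(** * Effect of the variation on loops, and loops near every point *)

Section NearSystolicLoops.
Variables (R : realType) (M : surface R) (G : riemannian_metric M) (U : universal_cover G).
Hypotheses (cM : compact [set: M]) (nsc : ~ simply_connected M).
Local Notation GU := (cover_metric U).
Local Notation f := (@cover_proj R M G U).
Local Notation s := (sys G).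

Lemma lip_dist (F : M -> R) (C : R) : 0 < C -> msmooth F -> lip G F C -> forall y y', `|F y' - F y| <= C * dist G y y'.
Proof.
move=> C0 sF lF y y'; rewrite mulrC -ler_pdivrMr//; apply: le_dist => l J.
by rewrite ler_pdivrMr// mulrC; exact: lip_joins lF J.
Qed.

Lemma msmooth_continuous (F : M -> R) : msmooth F -> continuous F.
Proof.
move=> sF z; have dz := dom_center z.
have c1 : {for chart z z, continuous (F \o chart_inv z)} := sF z 0%N _ (cod_chart dz).
have c2 := @cont_comp _ _ _ (chart z) (F \o chart_inv z) z (continuous_chart dz) c1.
have nE : \forall y \near z, ((F \o chart_inv z) \o chart z) y = F y.
  have : \forall y \near z, dom z y by apply: open_nbhs_nbhs; split=> //; exact: dom_open. by apply: filterS => y dy /=; rewrite chartK.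
rewrite /prop_for /continuous_at -(nbhs_singleton nE).
exact: cvg_trans (near_eq_cvg nE) c2.
Qed.

Lemma continuous_zero_left (g : R -> R) (a b : R) : a < b -> continuous g ->
  (forall t, a <= t < b -> g t = 0) -> g b = 0.
Proof.
move=> ab cg g0; apply/eqP; apply: contraT => nz.
have n1 : \forall t \near b, 0 < `|g t|.
  have cn : {for b, continuous (fun t => `|g t|)} by apply: cvg_norm; exact: cg. have h : 0 < `|g b| by rewrite normr_gt0. exact: (cn [set t | 0 < t] (lt_nbhsr h)).
have [e /= e0 He] := (nbhs_ballP _ _).1 n1.
pose t := Num.max a (b - e / 2).
have t1 : a <= t by rewrite le_max lexx.
have t2 : b - e / 2 <= t by rewrite le_max lexx orbT.
have t3 : t < b by rewrite gt_max ab; lra.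
have : 0 < `|g t| by apply: He; rewrite -ball_normE /= gtr0_norm ?subr_gt0//; lra.
by rewrite g0 ?t1// normr0 ltxx.
Qed.

Lemma essential_length k l : essential (G := G) k -> arc GU k 0 1 l -> s <= l.
Proof.
move=> [_ fk k01] /arc_joins/dist_le; apply: le_trans.
exact: fiber_dist.
Qed.

Lemma same_fiber_eq (u u' : U) : f u = f u' -> dist GU u u' < s -> u = u'.
Proof.
move=> fu d; apply/eqP; apply: contraT => uu.
by have := fiber_dist cM nsc fu uu; rewrite leNgt d.
Qed.

(* A curve of length less than s + eps can lose length only between its first
   and its last visit to K, where it is nearly minimizing; it gains length on
   the way into K and out of it. *)
Lemma strip_length (x : M) (r eps wp e X Y om : R) (psi chi u F : M -> R) (h Phi : R -> R) (K : set M)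
    (G' : riemannian_metric M) (t : R) k l l' :
  0 < eps -> 4 * r + eps < s -> eps <= s -> 0 <= e -> e <= 1 -> msmooth u -> msmooth F -> msmooth chi -> lip G u (1 + e) -> lip G F (1 + e) ->
  closed K -> (forall y, K y -> dist G x y < r /\ chi y <= r - F y) -> (forall y, ~ K y -> chi y = 0) ->
  (forall y, 0 <= chi y <= X) -> (forall y, 0 <= psi y <= Y) -> (forall y, dist G x y <= F y) -> (forall y y', K y -> K y' -> dist G y y' <= `|u y - u y'| + 2 * wp) ->
  (forall y, is_derive (F y) (1 : R) Phi (h (F y))) -> (forall y, 0 <= h (F y)) -> (forall y y', F y <= r -> r <= F y' -> r - F y <= Phi (F y') - Phi (F y)) ->
  wp + eps / 2 + e * s <= om -> (forall y, psi y = 2 * om * (1 + e) * h (F y)) -> 0 <= om -> 0 < t -> t * (Y + 3 * X) <= 1 -> varied G psi chi u t G' ->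
  essential (G := G) k -> arc G (f \o k) 0 1 l -> l < s + eps -> arc G' (f \o k) 0 1 l' -> s * (1 - (Y + 3 * X) ^+ 2 / 2 * t ^+ 2) <= l'.
Proof.
move=> eps0 rs epss e0 e1 su sF schi lu lF clK HK nK cX pY FD HKK dPhi h0 PhiF omE psiE om0 t0 tZ HG ek hl ls hl'.
have [_ s0] := systole_fin U cM nsc.
have b0 : 0 < 1 + e by lra.
have lu2 : lip G u 2 by move=> p z v cz; apply: le_trans (lu p z v cz) _; rewrite ler_wpM2r ?nrm_ge0//; lra.
have vn := varied_nrm HG lu2 (ltW t0) pY cX tZ.
set C := (Y + 3 * X) ^+ 2 / 2 in vn *.
(* The calibrating function is kap sg u + rho Phi(F): where chi <= kap, its u-part accounts for the
   loss through chi, and its Phi-part is paid for by psi, which is 2 om (1 + e) times the derivative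
   of Phi at F. *)
have pw (kap sg rho : R) c' tt : 0 <= kap -> `|sg| <= 1 -> `|rho| <= om -> C1_at c' tt ->
    chi (c' tt) <= kap -> exists D, is_derive tt (1 : R) ((fun y => kap * sg * u y + rho * Phi (F y)) \o c') D /\
      (1 - C * t ^+ 2 - t * kap * (1 + e)) * speed G c' tt + t * D <= speed G' c' tt.
  move=> kap0 sg1 rho1 Cc ck. have du := derive_msmooth su Cc; have dF := derive_msmooth sF Cc. have dPF := is_derive1_comp (dPhi (c' tt)) dF.
  have cp : cod (c' tt) (chart (c' tt) (c' tt)) by apply: cod_chart; exact: dom_center.
  have cK : chart_inv (c' tt) (chart (c' tt) (c' tt)) = c' tt by apply: chartK; exact: dom_center. have := vn _ _ (vel c' tt) cp; rewrite cK.
  have := lu _ _ (vel c' tt) cp; have := lF _ _ (vel c' tt) cp. have n0 := nrm_ge0 G (c' tt) (chart (c' tt) (c' tt)) (vel c' tt).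
  rewrite -[speed G c' tt]/(nrm G (c' tt) (chart (c' tt) (c' tt)) (vel c' tt)). rewrite -[speed G' c' tt]/(nrm G' (c' tt) (chart (c' tt) (c' tt)) (vel c' tt)).
  move: (nrm G _ _ _) (nrm G' _ _ _) (dM u _ _ _) (dM F _ _ _) du dF dPF n0 => n n' Du DF du dF dPF n0 hF hu hn. exists (kap * sg * Du + rho * (h (F (c' tt)) * DF)); split.
    have E : (fun y => kap * sg * u y + rho * Phi (F y)) \o c' = (kap * sg) \*: (u \o c') + rho \*: (Phi \o (F \o c')).
      by apply/funext.
    rewrite E; apply: is_deriveD.
  have hh := h0 (c' tt); have /andP[c0 c1] := cX (c' tt). have p1 : rho * (h (F (c' tt)) * DF) <= psi (c' tt) / 2 * n.
    have -> : psi (c' tt) / 2 * n = om * (h (F (c' tt)) * ((1 + e) * n)) by rewrite psiE; field.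
    apply: le_trans (ler_norm _) _; rewrite !normrM (ger0_norm hh) ler_pM// ?mulr_ge0//. by rewrite ler_wpM2l.
  have p2 : kap * sg * Du - kap * (1 + e) * n <= - chi (c' tt) * (n - `|Du|).
    have k1 : sg * Du <= `|Du|.
      by apply: le_trans (ler_norm _) _; rewrite normrM ler_piMl.
    have k2 := ler_wpM2l kap0 k1. have k3 : (kap - chi (c' tt)) * `|Du| <= (kap - chi (c' tt)) * ((1 + e) * n) by rewrite ler_wpM2l// subr_ge0.
    have k4 : 0 <= chi (c' tt) * (e * n) by rewrite !mulr_ge0. lra.
  apply: le_trans hn. have q1 := ler_wpM2l (ltW t0) p1; have q2 := ler_wpM2l (ltW t0) p2. lra.
have cf (k' : R -> U) : continuous k' -> continuous (f \o k').
  by move=> ck t'; exact: (@cont_comp _ _ _ k' f t' (ck t') (@continuous_proj R M G U _)).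
have T_compact (k' : R -> U) : continuous k' -> compact (`[0, 1]%classic `&` (f \o k') @^-1` K).
  move=> ck; apply: compact_closedI; first exact: segment_compact. by apply: closed_comp clK => t' _; exact: cf.
have hlU : arc GU k 0 1 l by have [ck _ _] := ek; exact: lift_arc ck (fun _ _ => erefl) hl.
have sl := essential_length ek hlU.
have Ct : C * t ^+ 2 <= 1.
  have : (t * (Y + 3 * X)) ^+ 2 <= 1.
    have : 0 <= t * (Y + 3 * X).
      by rewrite mulr_ge0 ?(ltW t0)//; have /andP[p0 p1] := pY x; have /andP[c0 c1] := cX x; lra.
    by move=> ?; rewrite expr_le1.
  rewrite exprMn /C; lra.
(* A loop that misses K meets no shrunk region and loses only the quadratic error. *)
have [T0|/set0P[tv [tv01 Ktv]]] := eqVneq (`[0, 1]%classic `&` (f \o k) @^-1` K) set0.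
  have chi0 tt : 0 <= tt <= 1 -> chi (f (k tt)) = 0.
    move=> tt01; apply: nK => Kt; have : (`[0, 1]%classic `&` (f \o k) @^-1` K) tt by split=> //; rewrite /= in_itv. by rewrite T0.
  have := @warc_compare _ _ G G' (fun y => 0 * 0 * u y + 0 * Phi (F y)) (1 - C * t ^+ 2 - t * 0 * (1 + e)) t (f \o k) 0 1 l l' (or_intror hl) (or_intror hl').
  rewrite (_ : _ + t * _ = (1 - C * t ^+ 2) * l); last by ring. move=> H; have {}H : (1 - C * t ^+ 2) * l <= l'.
    apply: H => _ c' tt Cc [tu tu01 E]; have := pw 0 0 0 c' tt (lexx _). rewrite normr0 => /(_ ler01 om0 Cc); rewrite E /= chi0// => /(_ (lexx _)). by [].
  apply: le_trans H; rewrite mulrC ler_wpM2l// subr_ge0//.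
have cF : continuous F by exact: continuous_lip (lip_dist b0 sF lF).
have cFk (k' : R -> U) : continuous k' -> continuous (F \o (f \o k')).
  by move=> ck t'; exact: (@cont_comp _ _ _ (f \o k') F t' (cf k' ck t') (cF _)).
have [ck _ _] := ek.
(* The deepest visit to K; kap = r - F there bounds chi along the whole loop. *)
have [a0 a0T a0min] := compact_EVT_min (ex_intro _ tv (conj tv01 Ktv)) (T_compact k ck) (continuous_subspaceT (cFk k ck)).
move: a0T; rewrite inE /= in_itv /= => -[a001 Ka0].
have [b1 [b2 [hb1 hb2 lb]]] := warc_split (or_intror hlU : warc GU k 0 1 l) a001.
(* Two rotations, to the deepest point y and then by half the length, make y the midpoint [k2 a]:
   every point of k2 is then within l/2 of it. *)
have [k1 [ek1 [g1 g2] [fk10 _] rng1 arc1]] := rotate_loop ek a001 hb1 hb2.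
have hl1 := arc1 G l hl.
have [ck1 _ _] := ek1.
have hl1U : arc GU k1 0 1 l by exact: lift_arc ck1 (fun _ _ => erefl) hl1.
have l0 := arc_ge0 hl.
have half : 0 <= l / 2 <= l by apply/andP; split; lra.
have [m [m01 d1 d2]] := arc_cut hl1U half.
have [k2 [ek2 [h1 h2] [_ fk2m] rng2 arc2]] := rotate_loop ek1 m01 d1 d2.
have [ck2 fk2 _] := ek2.
have hl2 := arc2 G l hl1; have hl2' := arc2 G' l' (arc1 G' l' hl').
have hl2U : arc GU k2 0 1 l by exact: lift_arc ck2 (fun _ _ => erefl) hl2.
set a := 1 - m in h1 h2 fk2m.
have l2E : l - l / 2 = l / 2 by lra.
rewrite l2E in h1.
have a01 : 0 <= a <= 1 by case/andP: m01 => m0 m1; rewrite /a; apply/andP; split; lra.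
have /andP[a_ge0 a_le1] := a01.
pose y := f (k2 a); have yE : y = f (k a0) by rewrite /y fk2m fk10.
have Ky : K y by rewrite yE.
have ymin tt : 0 <= tt <= 1 -> K (f (k2 tt)) -> F y <= F (f (k2 tt)).
  move=> /rng2[t1 /rng1[t3 t301 E3] E1]; rewrite E1 E3 => Kt; rewrite yE. by apply: (a0min t3); rewrite inE; split=> //; rewrite /= in_itv.
pose kap := r - F y; have [dy cy] := HK y Ky.
have kap0 : 0 <= kap by have /andP[h3 _] := cX y; exact: le_trans h3 cy.
have chik tt : 0 <= tt <= 1 -> chi (f (k2 tt)) <= kap.
  move=> tt01; have [Kt|nKt] := pselect (K (f (k2 tt))); last by rewrite nK. by have [_ h3] := HK _ Kt; have := ymin tt tt01 Kt; rewrite /kap; lra.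
pose T2 := `[0, 1]%classic `&` (f \o k2) @^-1` K.
have T2a : T2 a by split=> //; rewrite /= in_itv /=.
have idc : continuous (fun tt : R => tt) by move=> tt; exact: cvg_id.
(* t1 and t2 are the first and the last visit to K; before t1 and after t2 nothing is lost. *)
have [t1 t1T t1min] := compact_EVT_min (ex_intro _ a T2a) (T_compact k2 ck2) (continuous_subspaceT idc).
have [t2 t2T t2max] := compact_EVT_max (ex_intro _ a T2a) (T_compact k2 ck2) (continuous_subspaceT idc).
move: t1T t2T; rewrite !inE /= !in_itv /= => -[t101 Kt1] [t201 Kt2].
have t1a : t1 <= a by apply: t1min; rewrite inE.
have at2 : a <= t2 by apply: t2max; rewrite inE.
have /andP[t1_0 _] := t101; have /andP[_ t2_1] := t201.
have chi1 tt : 0 <= tt < t1 -> chi (f (k2 tt)) = 0.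
  move=> /andP[u0 u1]; apply: nK => Kt; suff : t1 <= tt by rewrite leNgt u1. by apply: t1min; rewrite inE; split=> //; rewrite /= in_itv /= u0 (le_trans (ltW u1))// (le_trans t1a).
have chi2 tt : t2 < tt <= 1 -> chi (f (k2 tt)) = 0.
  move=> /andP[u0 u1]; apply: nK => Kt; suff : tt <= t2 by rewrite leNgt u0.
  by apply: t2max; rewrite inE; split=> //; rewrite /= in_itv /= u1 andbT; exact: le_trans (le_trans a_ge0 at2) (ltW u0).
have cchi : continuous (chi \o (f \o k2)).
  have cc : continuous chi by move=> z; exact: msmooth_continuous. by move=> t'; exact: (@cont_comp _ _ _ (f \o k2) chi t' (cf k2 ck2 t') (cc _)).
(* At t1 itself the point lies in K, but chi is continuous and vanishes just before. *)
have chi1' tt : 0 < t1 -> 0 <= tt <= t1 -> chi (f (k2 tt)) <= 0.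
  move=> t10 /andP[u0]; rewrite le_eqVlt => /orP[/eqP->|u1]; last by rewrite chi1// u0. by have := continuous_zero_left t10 cchi chi1 => /= ->.
have chi2' tt : t2 < 1 -> t2 <= tt <= 1 -> chi (f (k2 tt)) <= 0.
  move=> t21 /andP[]; rewrite le_eqVlt => /orP[/eqP<- _|u0 u1]; last by rewrite chi2// u0. have oc t' : {for t', continuous (fun tt : R => - tt : R)} by apply: cvgN; exact: cvg_id.
  have cr : continuous (fun tt : R => chi (f (k2 (- tt)))).
    by move=> t'; exact: (@cont_comp _ _ _ (fun tt : R => - tt) (chi \o (f \o k2)) t' (oc t') (cchi _)).
  have t21' : -1 < - t2 by rewrite ltrN2. have := continuous_zero_left t21' cr; rewrite opprK => -> // t' /andP[u1 u2]. by apply: chi2; rewrite ltrNr u2 lerNl u1.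
have [la [lb1 [ha hb lE1]]] := warc_split h1 (introT andP (conj t1_0 t1a)).
have [lb2 [lc [hb' hc lE2]]] := warc_split h2 (introT andP (conj at2 t2_1)).
have near_x tt : 0 <= tt <= 1 -> dist G x (f (k2 tt)) < r -> exists2 xt, f xt = x & dist GU (k2 tt) xt < r.
  by move=> tt01 d; apply: lift_dist; rewrite dist_sym.
have to_a tt : 0 <= tt <= 1 -> dist GU (k2 a) (k2 tt) <= l / 2.
  move=> /andP[u0 u1]; have [ta|at'] := leP tt a.
    have [c1 [c2 [w1 w2 E]]] := warc_split h1 (introT andP (conj u0 ta)). by have := warc_dist w2; have := warc_ge0 w1; rewrite dist_sym; lra.
  have [c1 [c2 [w1 w2 E]]] := warc_split h2 (introT andP (conj (ltW at') u1)). by have := warc_dist w1; have := warc_ge0 w2; lra.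
(* One lift xs of x serves all visits: two lifts near different visits would be less than 2 r + l/2
   < s apart. *)
have [xs fxs dxs] := near_x a a01 dy.
have near_xs tt : 0 <= tt <= 1 -> dist G x (f (k2 tt)) < r -> dist GU (k2 tt) xs < r.
  move=> tt01 d; have [xt fxt dxt] := near_x tt tt01 d. suff -> : xs = xt by []. apply: same_fiber_eq; first by rewrite fxs.
  have d1' := dist_triangle GU xs (k2 a) xt; have d2' := dist_triangle GU (k2 a) (k2 tt) xt. have := to_a tt tt01; rewrite (dist_sym GU xs (k2 a)) in d1'; lra.
have d1s := near_xs t1 t101 (HK _ Kt1).1; have d2s := near_xs t2 t201 (HK _ Kt2).1.
have d12 := dist_triangle GU (k2 t1) xs (k2 t2); rewrite (dist_sym GU xs) in d12.
have dM12 : dist G (f (k2 t1)) (f (k2 t2)) = dist GU (k2 t1) (k2 t2).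
  by apply: dist_proj_eq => //; lra.
have e01 : 0 <= (0 : R) <= 1 by rewrite lexx ler01.
have e11 : 0 <= (1 : R) <= 1 by rewrite lexx ler01.
have sd : s <= dist GU (k2 0) (k2 1) by have [_ _ k01] := ek2; exact: fiber_dist.
(* If the loop started inside the ball, both ends of k2 would be within r of xs, though they are at
   least s apart. *)
have F0 : r <= F (f (k2 0)).
  rewrite leNgt; apply/negP => lt; have dx0 := le_lt_trans (FD _) lt. have g3 := near_xs 0 e01 dx0; have g4 := near_xs 1 e11; rewrite -fk2 in g4; have {}g4 := g4 dx0.
  have := dist_triangle GU (k2 0) xs (k2 1); rewrite (dist_sym GU xs); lra.
have F1 : r <= F (f (k2 1)) by rewrite -fk2.
have l12 : lb1 + lb2 <= dist GU (k2 t1) (k2 t2) + (l - s).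
  have := dist_triangle GU (k2 0) (k2 t1) (k2 1); have := dist_triangle GU (k2 t1) (k2 t2) (k2 1). have := warc_dist ha; have := warc_dist hc; lra.
have gap := HKK _ _ Kt1 Kt2.
have [l1' [l2' [ha1 ha2 lE1']]] := warc_split (or_intror hl2' : warc G' (f \o k2) 0 1 l') a01.
have [m1 [m2 [hm1 hm2 mE1]]] := warc_split ha1 (introT andP (conj t1_0 t1a)).
have [m3 [m4 [hm3 hm4 mE2]]] := warc_split ha2 (introT andP (conj at2 t2_1)).
have [sg sg1 sgE] : exists2 sg : R, `|sg| <= 1 & sg * (u (f (k2 t2)) - u (f (k2 t1))) = `|u (f (k2 t1)) - u (f (k2 t2))|.
  exists (Num.sg (u (f (k2 t2)) - u (f (k2 t1)))); first by rewrite normr_sg; case: (_ != 0). by rewrite distrC normrEsg.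
have oml : `|- om| <= om by rewrite normrN ger0_norm.
have omr : `|om| <= om by rewrite ger0_norm.
have z1 : `|0 : R| <= 1 by rewrite normr0.
have p1 := warc_compare (g := fun y => 0 * 0 * u y + - om * Phi (F y)) (A := 1 - C * t ^+ 2 - t * 0 * (1 + e)) (B := t) (proj_warc ha) hm1.
have {}p1 : (1 - C * t ^+ 2) * la + t * (- om * (Phi (F (f (k2 t1))) - Phi (F (f (k2 0))))) <= m1.
  move: p1; rewrite (_ : _ + t * _ = (1 - C * t ^+ 2) * la + t * (- om * (Phi (F (f (k2 t1))) - Phi (F (f (k2 0)))))); last by rewrite /=; ring. apply => t10 c' tt Cc [tu tu01 E].
  have := pw 0 0 (- om) c' tt (lexx _) z1 oml Cc; rewrite E /= => pw'. have [D [dD hD]] := pw' (chi1' tu t10 tu01). by exists D.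
have p2 : (1 - C * t ^+ 2 - t * kap * (1 + e)) * lb1 + t * ((kap * sg * u y - om * Phi (F y)) - (kap * sg * u (f (k2 t1)) - om * Phi (F (f (k2 t1))))) <= m2.
  have := warc_compare (g := fun y => kap * sg * u y + - om * Phi (F y)) (A := 1 - C * t ^+ 2 - t * kap * (1 + e)) (B := t) (proj_warc hb) hm2.
  rewrite /= (mulNr om (Phi (F y))) (mulNr om (Phi (F (f (k2 t1))))); apply => _ c' tt Cc [tu /andP[tu0 tu1] E].
  have := pw kap sg (- om) c' tt kap0 sg1 oml Cc; rewrite E /= => pw'. have [|D [dD hD]] := pw'; first by apply: chik; rewrite (le_trans t1_0 tu0) (le_trans tu1 a_le1).
  by exists D.
have p3 : (1 - C * t ^+ 2 - t * kap * (1 + e)) * lb2 + t * ((kap * sg * u (f (k2 t2)) + om * Phi (F (f (k2 t2)))) - (kap * sg * u y + om * Phi (F y))) <= m3.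
  have := warc_compare (g := fun y => kap * sg * u y + om * Phi (F y)) (A := 1 - C * t ^+ 2 - t * kap * (1 + e)) (B := t) (proj_warc hb') hm3.
  apply => _ c' tt Cc [tu /andP[tu0 tu1] E]. apply: (pw kap sg om c' tt kap0 sg1 omr Cc); rewrite E. by apply: chik; rewrite (le_trans a_ge0 tu0) (le_trans tu1 t2_1).
have p4 := warc_compare (g := fun y => 0 * 0 * u y + om * Phi (F y)) (A := 1 - C * t ^+ 2 - t * 0 * (1 + e)) (B := t) (proj_warc hc) hm4.
have {}p4 : (1 - C * t ^+ 2) * lc + t * (om * (Phi (F (f (k2 1))) - Phi (F (f (k2 t2))))) <= m4.
  move: p4; rewrite (_ : _ + t * _ = (1 - C * t ^+ 2) * lc + t * (om * (Phi (F (f (k2 1))) - Phi (F (f (k2 t2)))))); last by rewrite /=; ring. apply => t21 c' tt Cc [tu tu01 E].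
  have := pw 0 0 om c' tt (lexx _) z1 omr Cc; rewrite E /= => pw'. have [D [dD hD]] := pw' (chi2' tu t21 tu01). by exists D.
have Fyr : F y <= r by rewrite -subr_ge0.
have G0 := PhiF y _ Fyr F0; have G1 := PhiF y _ Fyr F1.
have fin : (1 - C * t ^+ 2) * l <= l'.
  rewrite dM12 in gap; exact: (strip_arith (warc_ge0 ha) (warc_ge0 hc) e0 (ltW t0) om0 kap0 (ltW ls) epss omE G0 G1 l12 gap sgE lE1 lE2 lE1' mE1 mE2 p1 p2 p3 p4).
apply: le_trans fin; rewrite mulrC ler_wpM2l// subr_ge0//.
Qed.

Local Notation a B := (fine (area G B)).

Lemma box_en (a1 a2 b2 c d : R) (x1 x : R * R) (h : R) : c ^+ 2 + d ^+ 2 = 1 -> 0 < h ->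
  parallelogram (c * a1) (c * a2 + d * b2) (- d * a1) (- d * a2 + c * b2)
    (c * a1 * x1.1 + (c * a2 + d * b2) * x1.2) (- d * a1 * x1.1 + (- d * a2 + c * b2) * x1.2) h x ->
  en a1 a2 b2 (x - x1) < 2 * h.
Proof.
move=> cd h0 [p1 p2]; have h2 : 0 < 2 * h by rewrite mulr_gt0.
rewrite en_lt//.
set X := c * a1 * x.1 + (c * a2 + d * b2) * x.2 - (c * a1 * x1.1 + (c * a2 + d * b2) * x1.2) in p1.
set Y := - d * a1 * x.1 + (- d * a2 + c * b2) * x.2 - (- d * a1 * x1.1 + (- d * a2 + c * b2) * x1.2) in p2.
have -> : en2 a1 a2 b2 (x - x1) = X ^+ 2 + Y ^+ 2.
  have -> : X ^+ 2 + Y ^+ 2 = (c ^+ 2 + d ^+ 2) * en2 a1 a2 b2 (x - x1) by rewrite /X /Y /en2 /=; ring. by rewrite cd mul1r.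
have q (Z : R) : `|Z| < h -> Z ^+ 2 < h ^+ 2.
  by move=> Zh; rewrite -(real_normK (num_real Z)) ltr_sqr ?nnegrE ?normr_ge0// ltW.
have := q _ p1; have := q _ p2; have := sqr_ge0 h; rewrite exprMn; lra.
Qed.

(** A loop of length at least s + eps can afford the crude loss factor 1 - C t^2 - t X when t is
    small. *)
Lemma long_length (eps X Y : R) (psi chi u : M -> R) (G' : riemannian_metric M) (t : R) c l l' :
  0 < s -> 0 < eps -> lip G u 2 -> (forall y, 0 <= chi y <= X) -> (forall y, 0 <= psi y <= Y) ->
  0 < t -> t * (Y + 3 * X) <= 1 -> 2 * (t * X * (s + eps)) <= eps -> varied G psi chi u t G' -> arc G c 0 1 l -> s + eps <= l -> arc G' c 0 1 l' ->
  s * (1 - (Y + 3 * X) ^+ 2 / 2 * t ^+ 2) <= l'.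
Proof.
move=> s0 eps0 lu cX pY t0 tZ tX HG hl sl hl'.
have vn := varied_nrm HG lu (ltW t0) pY cX tZ.
set C := (Y + 3 * X) ^+ 2 / 2 in vn *.
have [X0 Y0] : 0 <= X /\ 0 <= Y.
  have /andP[p0 p1] := pY (c 0); have /andP[c0 c1] := cX (c 0). by split; [exact: le_trans c1|exact: le_trans p1].
have tZ0 : 0 <= t * (Y + 3 * X) by rewrite mulr_ge0 ?(ltW t0)//; lra.
have Ct : C * t ^+ 2 <= 1 / 2.
  have : (t * (Y + 3 * X)) ^+ 2 <= 1 by rewrite expr_le1. rewrite exprMn /C; lra.
have := @warc_compare _ _ G G' (fun=> 0 : R) (1 - C * t ^+ 2 - t * X) 0 c 0 1 l l' (or_intror hl) (or_intror hl').
rewrite mul0r addr0 => H; have {}H : (1 - C * t ^+ 2 - t * X) * l <= l'.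
  apply: H => _ c' tt Cc _; exists 0; split.
    by have -> : (fun=> 0 : R) \o c' = cst 0 by []; exact: is_derive_cst.
  rewrite mul0r addr0. have cp : cod (c' tt) (chart (c' tt) (c' tt)) by apply: cod_chart; exact: dom_center. have := vn _ _ (vel c' tt) cp.
  have n0 := nrm_ge0 G (c' tt) (chart (c' tt) (c' tt)) (vel c' tt). rewrite -[speed G c' tt]/(nrm G (c' tt) (chart (c' tt) (c' tt)) (vel c' tt)).
  rewrite -[speed G' c' tt]/(nrm G' (c' tt) (chart (c' tt) (c' tt)) (vel c' tt)).
  move: (chart_inv _ _) (nrm G _ _ _) (nrm G' _ _ _) (dM u _ _ _) n0 => y n n' Du n0; apply: le_trans. have /andP[c0 c1] := cX y; have /andP[p0 p1] := pY y.
  have k1 : 0 <= t * psi y / 2 * n by rewrite !mulr_ge0 ?(ltW t0)// invr_ge0. have k2 : 0 <= t * chi y * `|Du| by rewrite !mulr_ge0 ?(ltW t0).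
  have k3 : t * chi y * n <= t * X * n by rewrite ler_wpM2r// ler_wpM2l// ltW. lra.
apply: le_trans H.
have tX1 : t * X <= 1 / 2.
  have : t * X * (s + eps) <= 1 / 2 * (s + eps) by lra. by rewrite ler_pM2r//; lra.
have k1 : (1 - C * t ^+ 2 - t * X) * (s + eps) <= (1 - C * t ^+ 2 - t * X) * l.
  by rewrite ler_wpM2l//; lra.
apply: le_trans k1; have : 1 / 2 * eps <= (1 - C * t ^+ 2) * eps by rewrite ler_wpM2r ?(ltW eps0)//; lra.
lra.
Qed.

Lemma bump_at (x : M) (del : R) : 0 < del -> exists chi Q,
  [/\ msmooth chi, forall y, 0 <= chi y <= 1, forall y, del <= dist G x y -> chi y = 0,
      borel Q & (forall y, Q y -> 1 <= chi y) /\ 0 < a Q].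
Proof.
move=> del0; have [a1 [a2 [b2 [r [d I]]]]] := isometric_chart_ex G x (ltac:(lra) : 0 < (2^-1 : R)).
have a0 := ich_a1 I; have b0 := ich_b2 I; have r0 := ich_r I.
pose x1 := chart x x; pose E := en a1 a2 b2.
pose rho := Num.min (r / 2) (del / 2).
have rho0 : 0 < rho by rewrite lt_min !divr_gt0.
have rho1 : rho <= r / 2 by rewrite ge_min lexx.
have rho2 : rho <= del / 2 by rewrite ge_min lexx orbT.
pose K := [set y | E (y - x1) <= rho].
have cK : compact K by exact: compact_en (ltW rho0).
have Kz : K `<=` cod x by move=> y Ky; apply: (ich_cod I); apply: le_lt_trans Ky _; lra.
have oz := @open_cod R M x.
have E0 : E (x1 - x1) < r by rewrite /E en_subrr.
have scut := @cutoff_smooth R M x a1 a2 b2 rho (cod x) oz.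
have g0 y : cod x y -> ~ K y -> cutoff x a1 a2 b2 rho y = 0.
  by move=> _ nK; apply: cutoff_eq0 => //; apply: ltW; rewrite ltNge; exact/negP.
have cs : (1 : R) ^+ 2 + 0 ^+ 2 = 1 by rewrite expr1n expr0n addr0.
have h0 : 0 < rho / 4 by rewrite divr_gt0.
pose Pb := parallelogram (1 * a1) (1 * a2 + 0 * b2) (- 0 * a1) (- 0 * a2 + 1 * b2)
    (1 * a1 * x1.1 + (1 * a2 + 0 * b2) * x1.2) (- 0 * a1 * x1.1 + (- 0 * a2 + 1 * b2) * x1.2) (rho / 4).
have PbE y : Pb y -> E (y - x1) < rho / 2.
  by move=> /(box_en cs h0) h; apply: lt_le_trans h _; lra.
have h1 : (2^-1 : R) <= 1 by lra.
have PB : Pb `<=` [set y | en a1 a2 b2 (y - chart x x) < r].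
  by move=> y /PbE h; apply: lt_trans h _; lra.
have [bQ aQ] := box_area I h1 cs h0 PB.
exists (chart_ext x (cutoff x a1 a2 b2 rho)), (chart_inv x @` Pb); split=> //.
- exact: msmooth_chart_ext cK Kz scut g0.
- move=> y; rewrite /chart_ext; case: asboolP => _; last by rewrite lexx ler01. exact: cutoff_itv.
- move=> y dy; have [dxy|ndxy] := pselect (dom x y); last by rewrite chart_ext_notin. rewrite chart_extE// g0//; first exact: cod_chart.
  move=> Ky; have Ey : E (chart x y - x1) < r by apply: le_lt_trans Ky _; lra. have [l J le] := ich_upper I E0 Ey.
  have dl : dist G x y <= l by apply: dist_le; rewrite !chartK// in J; exact: dom_center. by have e0 := en_ge0 a1 a2 b2 (chart x y - x1); rewrite /K /= /E in Ky; lra.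
- split.
    move=> _ [y Py <-]; have Ey := PbE y Py. have cy : cod x y by apply: (ich_cod I); exact: PB. rewrite chart_extE ?chart_invK//; last exact: dom_chart_inv.
    by rewrite cutoff_eq1// ltW.
  rewrite -lte_fin -(area_finE G cM); apply: lt_le_trans aQ. have := exprn_gt0 2 h0; rewrite lte_fin; lra.
Qed.

Hypothesis ext : extremal G.

(* Otherwise the metric could be shrunk near x without shortening the systole. *)
Lemma near_systolic (x : M) (del eps : R) : 0 < del -> 0 < eps -> exists k l,
  [/\ essential (G := G) k, arc GU k 0 1 l, l < s + eps &
      exists2 t, 0 <= t <= 1 & dist G x (f (k t)) < del].
Proof.
move=> del0 eps0; apply: contrapT => H.
have [_ s0] := systole_fin U cM nsc.
have [chi [Q [schi c01 c0 bQ [Qc aQ]]]] := bump_at x del0.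
(* With Y = 0 and X = 1, the bound 1/3 is the range of [varied_nrm] and the other one that of
   [long_length]. *)
pose t0 : R := Num.min (1 / 3) (eps / (2 * (s + eps))).
have t00 : 0 < t0 by rewrite lt_min !divr_gt0// mulr_gt0// addr_gt0.
have lu k : 0 <= k -> lip G (fun=> 0 : R) k.
  move=> k0 p y v cy; rewrite /dM (_ : (fun=> 0) \o _ = cst 0)// derive_cst normr0. by rewrite mulr_ge0// nrm_ge0.
pose Qn i := if i is 0%N then Q else set0.
pose psi0 (y : M) : R := 0.
have p0 y : 0 <= psi0 y <= 0 by rewrite lexx.
have bn i : borel (Qn i) by case: i => // i; apply: borel_open; exact: open0.
have tn : trivIset setT Qn by move=> [|i] [|j] _ _ [y []].
have kn i y : Qn i y -> (if i is 0%N then 1 else 0 : R) <= chi y by case: i => [/Qc|].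
have k0 i : 0 <= (if i is 0%N then 1 else 0 : R) by case: i.
have smc : msmooth psi0 by exact: msmooth_cst.
have k02 : (0 : R) ^+ 2 <= 2 by rewrite expr0n ler0n.
have CC : 0 <= (0 + 3 * 1 : R) ^+ 2 / 2 by rewrite divr_ge0 ?sqr_ge0.
have := @first_variation _ _ G U cM nsc ext psi0 chi psi0 0 0 1 ((0 + 3 * 1) ^+ 2 / 2) t0 setT Qn
  (fun i => if i is 0%N then 1 else 0) 1%N smc schi smc (lexx _) k02 (lu 0 (lexx _)) (lexx _) p0 c01 (fun _ _ => erefl) (@borelT _ _) bn tn (fun _ _ _ => I) kn k0 t00 CC.
rewrite expr0n /= big_ord1 /= mul1r mul0r subr0 => FV.
have : 2 / 2 * a Q <= 0.
  apply: FV => t G' r l l' t1 t2 HG er h h'. have tt : t * (0 + 3 * 1) <= 1.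
    have : t < 1 / 3 by apply: lt_le_trans t2 _; rewrite ge_min lexx. lra.
  have [ck _ _] := er. have hU : arc GU r 0 1 l := lift_arc ck (fun _ _ => erefl) h. have [sl|ls] := leP (s + eps) l.
    apply: (long_length s0 eps0 (lu 2 _) c01 p0 t1 tt _ HG h sl h') => //. have : t <= eps / (2 * (s + eps)) by apply: ltW; apply: lt_le_trans t2 _; rewrite ge_min lexx orbT.
    by rewrite ler_pdivlMr ?mulr_gt0 ?addr_gt0//; lra.
  have away tt0 : 0 <= tt0 <= 1 -> chi (f (r tt0)) = 0.
    move=> tt01; apply: c0; rewrite leNgt; apply/negP => dd; apply: H. by exists r, l; split=> //; exists tt0.
  have sl := essential_length er hU. have vn := varied_nrm HG (lu 2 (ler0n _ _)) (ltW t1) p0 c01 tt.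
  have := @warc_compare _ _ G G' (fun=> 0 : R) (1 - (0 + 3 * 1) ^+ 2 / 2 * t ^+ 2) 0 (f \o r) 0 1 l l' (or_intror h) (or_intror h').
  rewrite mul0r addr0 => K; have {}K : (1 - (0 + 3 * 1) ^+ 2 / 2 * t ^+ 2) * l <= l'.
    apply: K => _ c' tt0 Cc [tu tu01 E]; exists 0; split.
      by have -> : (fun=> 0 : R) \o c' = cst 0 by []; exact: is_derive_cst.
    have cp : cod (c' tt0) (chart (c' tt0) (c' tt0)) by apply: cod_chart; exact: dom_center.
    have cK : chart_inv (c' tt0) (chart (c' tt0) (c' tt0)) = c' tt0 by apply: chartK; exact: dom_center. have := vn _ _ (vel c' tt0) cp; rewrite cK.
    rewrite -[speed G c' tt0]/(nrm G (c' tt0) (chart (c' tt0) (c' tt0)) (vel c' tt0)). rewrite -[speed G' c' tt0]/(nrm G' (c' tt0) (chart (c' tt0) (c' tt0)) (vel c' tt0)).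
    by rewrite E /= away// /psi0 !(mulr0, mul0r, addr0, subr0).
  apply: le_trans K; rewrite mulrC ler_wpM2l// subr_ge0. have : (t * (0 + 3 * 1)) ^+ 2 <= 1 by rewrite expr_le1// mulr_ge0 ?(ltW t1)//; lra. rewrite exprMn; lra.
lra.
Qed.

(** z is the arc-length parametrization, from its midpoint, of a nearly systolic loop rotated so
    that a point near x is the midpoint. A shortcut longer than eps would bring the loop below the
    systole, and at these scales distances in M and in the cover agree. *)
Lemma geodesic_chain (x : M) (del eps rho : R) : 0 < del -> 0 < eps -> 0 < rho -> 4 * rho <= s ->
  exists z : R -> M, dist G x (z 0) < del /\
    forall p q, - rho <= p -> p <= q -> q <= rho -> q - p - eps <= dist G (z p) (z q) <= q - p.
Proof.
move=> del0 eps0 rho0 rs; have [_ s0] := systole_fin U cM nsc.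
have [k [l [ek hl ls [t0 t001 dx]]]] := near_systolic x del0 eps0.
have [b1 [b2 [hb1 hb2 lb]]] := warc_split (or_intror hl : warc GU k 0 1 l) t001.
have [k1 [ek1 _ [fk10 _] _ arc1]] := rotate_loop ek t001 hb1 hb2.
have hl1 := arc1 G l (proj_arc hl); have [ck1 _ _] := ek1.
have hl1U : arc GU k1 0 1 l := lift_arc ck1 (fun _ _ => erefl) hl1.
have l0 := arc_ge0 hl; have sl := essential_length ek hl.
have half : 0 <= l / 2 <= l by apply/andP; split; lra.
have [m [m01 d1 d2]] := arc_cut hl1U half.
have [k2 [ek2 [h1 h2] [_ fk2m] _ arc2]] := rotate_loop ek1 m01 d1 d2.
have hl2 := arc2 G l hl1; have [ck2 fk2 k201] := ek2.
have hl2U : arc GU k2 0 1 l := lift_arc ck2 (fun _ _ => erefl) hl2.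
have /choice[pos Hpos] h : exists m, 0 <= h <= l -> [/\ 0 <= m <= 1, warc GU k2 0 m h & warc GU k2 m 1 (l - h)].
  have [hh|nh] := boolP (0 <= h <= l); last by exists 0. by have [m' Hm] := arc_cut hl2U hh; exists m'.
pose z p := f (k2 (pos (l / 2 + p))).
have between h h' : 0 <= h -> h <= h' -> h' <= l -> dist GU (k2 (pos h)) (k2 (pos h')) <= h' - h.
  move=> g1 g2 g3. have [|/andP[u0 u1] w1 w2] := Hpos h; first by rewrite g1 (le_trans g2). have [|/andP[v0 v1] w3 w4] := Hpos h'; first by rewrite (le_trans g1 g2) g3.
  have [uv|vu] := leP (pos h) (pos h').
    have [c1 [c2 [e1 e2 E]]] := warc_split w3 (introT andP (conj u0 uv)). by have := warc_unique e1 w1; have := warc_dist e2; lra.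
  have [c1 [c2 [e1 e2 E]]] := warc_split w1 (introT andP (conj v0 (ltW vu))). by have := warc_unique e1 w3; have := warc_dist e2; have := warc_ge0 e2; rewrite dist_sym; lra.
have lower h h' : 0 <= h -> h <= h' -> h' <= l -> h' - h - eps <= dist GU (k2 (pos h)) (k2 (pos h')).
  move=> g1 g2 g3. have [|_ w1 _] := Hpos h; first by rewrite g1 (le_trans g2). have [|_ _ w4] := Hpos h'; first by rewrite (le_trans g1 g2) g3. have := fiber_dist cM nsc fk2 k201.
  have := dist_triangle GU (k2 0) (k2 (pos h)) (k2 1); have := dist_triangle GU (k2 (pos h)) (k2 (pos h')) (k2 1). have := warc_dist w1; have := warc_dist w4; lra.
exists z; split.
  have [|/andP[u0 u1] w1 w2] := Hpos (l / 2); first by rewrite half. have E : dist GU (k2 (1 - m)) (k2 (pos (l / 2))) <= 0.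
    have [uv|vu] := leP (1 - m) (pos (l / 2)).
      have [c1 [c2 [e1 e2 E]]] := warc_split w1 (introT andP (conj (warc_le h1) uv)). by have := warc_unique e1 h1; have := warc_dist e2; lra.
    have [c1 [c2 [e1 e2 E]]] := warc_split h1 (introT andP (conj u0 (ltW vu))). by have := warc_unique e1 w1; have := warc_dist e2; rewrite dist_sym; lra.
  have := dist_proj (k2 (1 - m)) (k2 (pos (l / 2))); rewrite fk2m fk10 /z addr0. have := dist_triangle G x (f (k t0)) (f (k2 (pos (l / 2)))); lra.
move=> p q p1 pq q1; have b := between (l / 2 + p) (l / 2 + q); have lo := lower (l / 2 + p) (l / 2 + q).
have c1 : 0 <= l / 2 + p by lra.
have c2 : l / 2 + p <= l / 2 + q by lra.
have c3 : l / 2 + q <= l by lra.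
have {}b := b c1 c2 c3; have {}lo := lo c1 c2 c3.
rewrite /z dist_proj_eq//; last by lra.
apply/andP; split; lra.
Qed.

End NearSystolicLoops.



(** * Nearly collinear triples in the Euclidean plane *)

Section PlaneEstimates.
Variable R : realType.
Implicit Types (a b c d L w eta kap P mu : R).

Definition n2 a b : R := Num.sqrt (a ^+ 2 + b ^+ 2).

Lemma n2_ge0 a b : 0 <= n2 a b. Proof. exact: sqrtr_ge0. Qed.

Lemma sqr_n2 a b : n2 a b ^+ 2 = a ^+ 2 + b ^+ 2.
Proof. by rewrite sqr_sqrtr// addr_ge0 ?sqr_ge0. Qed.

Lemma n2D a b c d : n2 (a + c) (b + d) <= n2 a b + n2 c d.
Proof.
have := @enD R 1 0 1 (a, b) (c, d).
by rewrite /en /en2 /= !mulr1 !mulr0 !addr0.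
Qed.

Lemma n2_le a b c : 0 <= c -> a ^+ 2 + b ^+ 2 <= c ^+ 2 -> n2 a b <= c.
Proof. by move=> c0 h; rewrite -ler_sqr ?nnegrE ?n2_ge0// sqr_n2. Qed.

Lemma le_n2 a b : `|a| <= n2 a b.
Proof. by rewrite -ler_sqr ?nnegrE ?n2_ge0// sqr_n2 real_normK ?num_real// lerDl sqr_ge0. Qed.

Lemma n2_le_sum a b : n2 a b <= `|a| + `|b|.
Proof.
apply: n2_le; first by rewrite addr_ge0.
have := mulr_ge0 (normr_ge0 a) (normr_ge0 b); rewrite sqrrD !real_normK ?num_real// mulr2n; lra.
Qed.

Lemma n2N a b : n2 (- a) (- b) = n2 a b. Proof. by rewrite /n2 !sqrrN. Qed.

Lemma n2_axis (x y L w : R) : 0 < w -> 4 * w <= L -> `|x| <= w -> `|y| <= w -> n2 (L + x) y <= L + x + w ^+ 2 / L.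
Proof.
move=> w0 wL; rewrite !ler_norml => /andP[x1 x2] /andP[y1 y2].
have L0 : 0 < L by lra.
have v0 : 0 <= w ^+ 2 / L by rewrite divr_ge0 ?sqr_ge0// ltW.
have vL : w ^+ 2 / L * L = w ^+ 2 by rewrite divfK// gt_eqF.
apply: n2_le; first by lra.
have yy : y ^+ 2 <= w ^+ 2 by nra.
have : w ^+ 2 / L * (L * (3 / 4)) <= w ^+ 2 / L * (L + x) by rewrite ler_wpM2l//; lra.
by rewrite mulrA vL; move: (w ^+ 2 / L) v0 {vL} => v v0; nra.
Qed.

(* p = (P, 0) and q are at distance about L from the origin and about 2 L from
   each other, so that q is close to (- L, 0) *)
Section Triple.
Variables (L kap eta P q1 q2 : R).
Hypotheses (L0 : 0 < L) (k0 : 0 < kap) (k1 : kap <= 1 / 100) (etaE : eta = kap ^+ 2).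
Hypotheses (P1 : L * (1 - eta) <= (1 + eta) * P) (P2 : P <= (1 + eta) * L).
Hypotheses (q_le : n2 q1 q2 <= (1 + eta) * L) (pq : L * (2 - eta) <= (1 + eta) * n2 (P - q1) (- q2)).

Lemma eta_bounds : [/\ 0 < eta, eta <= kap / 100 & eta <= 1 / 100].
Proof.
have h : kap * kap <= kap * (1 / 100) by rewrite ler_pM2l.
by have k1' := k1; rewrite etaE expr2; split; [exact: mulr_gt0|lra|lra].
Qed.

Lemma small_products : [/\ 0 <= eta * L, eta * L <= kap * L / 100, kap * L <= L / 100, 0 <= kap * L & 0 <= eta * (eta * L)].
Proof.
have [e0 e1 _] := eta_bounds; have h := ler_wpM2r (ltW L0) e1; have h' := ler_wpM2r (ltW L0) k1.
by split; rewrite ?mulr_ge0 ?(ltW e0) ?(ltW k0) ?(ltW L0)//; lra.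
Qed.

Lemma axis_point : `|P - L| <= 2 * eta * L.
Proof.
have [e0 _ _] := eta_bounds; have [eL0 eL kL kL0 eeL] := small_products.
have P1' := P1; have P2' := P2.
rewrite ler_norml; apply/andP; split; last by lra.
have h : (1 + eta) * (L * (1 - 2 * eta)) <= (1 + eta) * P by lra.
by rewrite ler_pM2l in h; lra.
Qed.

(** The parallelogram identity for (L, 0) and q. It subtracts nearly equal quantities and leaves a
    multiple of eta L^2, whose square root is of order kap L; hence the relation eta = kap^2. *)
Lemma opposite_point : n2 (L + q1) q2 <= 6 * kap * L.
Proof.
have [e0 _ e2] := eta_bounds; have [eL0 eL kL kL0 eeL] := small_products.
have ap := axis_point; have pq' := pq; have L0' := L0.
have h3 : 2 * L * (1 - 2 * eta) <= n2 (P - q1) (- q2).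
  have h : (1 + eta) * (2 * L * (1 - 2 * eta)) <= (1 + eta) * n2 (P - q1) (- q2) by lra. by rewrite ler_pM2l in h; lra.
have h4 : 2 * L * (1 - 3 * eta) <= n2 (L - q1) (- q2).
  have := n2D (L - q1) (- q2) (P - L) 0; rewrite addr0 (_ : L - q1 + (P - L) = P - q1); last by ring. have := n2_le_sum (P - L) 0; rewrite normr0 addr0; lra.
have h40 : 0 <= 2 * L * (1 - 3 * eta) by lra.
have h5 : (2 * L * (1 - 3 * eta)) ^+ 2 <= (L - q1) ^+ 2 + q2 ^+ 2.
  by rewrite -(sqrrN q2) -sqr_n2 ler_sqr ?nnegrE ?n2_ge0.
have h6 : q1 ^+ 2 + q2 ^+ 2 <= ((1 + eta) * L) ^+ 2.
  by rewrite -sqr_n2 ler_sqr ?nnegrE ?n2_ge0// mulr_ge0 ?(ltW L0)//; lra.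
apply: n2_le; first by lra.
have -> : (6 * kap * L) ^+ 2 = 36 * eta * L ^+ 2 by rewrite etaE; ring.
have LL : 0 < L ^+ 2 by exact: exprn_gt0.
have ee : 0 <= eta * L ^+ 2 by rewrite mulr_ge0 ?ltW.
have e3 : eta ^+ 2 * L ^+ 2 <= eta * L ^+ 2 / 100.
  have := ler_wpM2r ee e2; rewrite expr2; lra.
have e4 : 0 <= eta ^+ 2 * L ^+ 2 by rewrite mulr_ge0 ?sqr_ge0.
have E5 : (2 * L * (1 - 3 * eta)) ^+ 2 = 4 * L ^+ 2 - 24 * (eta * L ^+ 2) + 36 * (eta ^+ 2 * L ^+ 2) by ring.
have E6 : ((1 + eta) * L) ^+ 2 = L ^+ 2 + 2 * (eta * L ^+ 2) + eta ^+ 2 * L ^+ 2 by ring.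
have E7 : (L - q1) ^+ 2 = L ^+ 2 - 2 * (L * q1) + q1 ^+ 2 by ring.
have E8 : (L + q1) ^+ 2 = L ^+ 2 + 2 * (L * q1) + q1 ^+ 2 by ring.
rewrite E5 E7 in h5; rewrite E6 in h6; rewrite E8.
move: (eta ^+ 2 * L ^+ 2) (eta * L ^+ 2) (L * q1) (L ^+ 2) (q1 ^+ 2) (q2 ^+ 2) h5 h6 e3 e4 ee => A B C D E' F h5 h6 e3 e4 ee; lra.
Qed.

(** In a box small against L, the distance from the far end q is at most L plus the axial
    coordinate, up to small errors. With [axis_lower] this makes distance functions nearly affine on
    the box. *)
Lemma axis_upper w x y : 0 < w -> 4 * w <= L -> `|x| <= w -> `|y| <= w ->
  (1 + eta) * n2 (x - q1) (y - q2) <= L + x + (w ^+ 2 / L + 8 * kap * L).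
Proof.
move=> w0 wL xw yw; have [e0 e1 e2] := eta_bounds; have [eL0 eL kL kL0 eeL] := small_products.
have h1 := n2_axis w0 wL xw yw; have h2 := opposite_point.
have h3 := n2D (L + x) y (- (L + q1)) (- q2); rewrite n2N in h3.
have E : L + x + - (L + q1) = x - q1 by ring.
rewrite E in h3; move: xw; rewrite ler_norml => /andP[x1 x2].
have w2 : w ^+ 2 / L <= w by rewrite ler_pdivrMr// expr2 ler_pM2l//; lra.
have v0 : 0 <= w ^+ 2 / L by rewrite divr_ge0 ?sqr_ge0// ltW.
have h4 : n2 (x - q1) (y - q2) <= 2 * L by lra.
have h5 : eta * n2 (x - q1) (y - q2) <= kap / 100 * (2 * L).
  by rewrite ler_pM ?n2_ge0// ltW.
have := mulr_ge0 (ltW k0) (ltW L0); lra.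
Qed.

Lemma axis_lower w x y : 0 < w -> 4 * w <= L -> `|x| <= w -> `|y| <= w ->
  (1 + eta) * n2 (P - x) (- y) <= L - x + (w ^+ 2 / L + 8 * kap * L).
Proof.
move=> w0 wL xw yw; have [e0 e1 e2] := eta_bounds; have [eL0 eL kL kL0 eeL] := small_products.
have xw' : `|- x| <= w by rewrite normrN.
have yw' : `|- y| <= w by rewrite normrN.
have h1 := n2_axis w0 wL xw' yw'; have h2 := axis_point.
have h3 := n2D (L - x) (- y) (P - L) 0; rewrite addr0 in h3.
have E : L - x + (P - L) = P - x by ring.
rewrite E in h3; have h4 := n2_le_sum (P - L) 0; rewrite normr0 addr0 in h4.
move: xw; rewrite ler_norml => /andP[x1 x2].
have w2 : w ^+ 2 / L <= w by rewrite ler_pdivrMr// expr2 ler_pM2l//; lra.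
have v0 : 0 <= w ^+ 2 / L by rewrite divr_ge0 ?sqr_ge0// ltW.
have h5 : n2 (P - x) (- y) <= 2 * L by lra.
have h6 : eta * n2 (P - x) (- y) <= kap / 100 * (2 * L).
  by rewrite ler_pM ?n2_ge0// ltW.
have := mulr_ge0 (ltW k0) (ltW L0); lra.
Qed.

(** The distances to p and q pin down the axial coordinate up to kap L. The distance to the origin
    then bounds the transverse one, only to the order of sqrt (kap L w). *)
Lemma axis_near w mu z1 z2 : 0 < w -> 4 * w <= L -> `|mu| <= w ->
  n2 z1 z2 <= (1 + eta) * `|mu| -> n2 (P - z1) (- z2) <= (1 + eta) * (L - mu) -> n2 (z1 - q1) (z2 - q2) <= (1 + eta) * (L + mu) ->
  `|z1 - mu| <= 8 * kap * L /\ z2 ^+ 2 <= 17 * kap * L * w.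
Proof.
move=> w0 wL muw d0 dp dq; have [e0 e1 e2] := eta_bounds; have [eL0 eL kL kL0 eeL] := small_products.
have := axis_point; rewrite ler_norml => /andP[a1 a2]; have oq := opposite_point.
have mw := muw; rewrite ler_norml in mw; case/andP: mw => m1 m2.
have emu : eta * mu <= eta * L by rewrite ler_wpM2l ?(ltW e0)//; lra.
have emu' : - (eta * L) <= eta * mu by rewrite -mulrN ler_wpM2l ?(ltW e0)//; lra.
have low : mu - 8 * kap * L <= z1.
  have := le_trans (ler_norm _) (le_trans (le_n2 (P - z1) (- z2)) dp); lra.
have up : z1 <= mu + 8 * kap * L.
  have := n2D (z1 - q1) (z2 - q2) (L + q1) q2; rewrite addrNK (_ : z1 - q1 + (L + q1) = L + z1); last by ring. have := le_trans (ler_norm _) (le_n2 (L + z1) z2); lra.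
have z1mu : `|z1 - mu| <= 8 * kap * L by rewrite ler_norml; apply/andP; split; lra.
split=> //.
have d0' : z1 ^+ 2 + z2 ^+ 2 <= (1 + eta) ^+ 2 * mu ^+ 2.
  rewrite -sqr_n2 -[X in _ <= _ * X](real_normK (num_real mu)) -exprMn ler_sqr ?nnegrE ?n2_ge0//. by rewrite mulr_ge0//; lra.
have mm : mu ^+ 2 <= w * w.
  rewrite -(real_normK (num_real mu)) expr2; exact: ler_pM.
have zz : mu ^+ 2 - 16 * kap * L * w <= z1 ^+ 2.
  have k2 : `|mu * (z1 - mu)| <= w * (8 * kap * L) by rewrite normrM ler_pM. have := le_trans (ler_norm _) (le_trans (_ : `|- (mu * (z1 - mu))| <= `|mu * (z1 - mu)|) k2).
  rewrite normrN => /(_ (lexx _)); have := sqr_ge0 (z1 - mu); rewrite !expr2; lra.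
have em : eta * mu ^+ 2 <= eta * (w * w) by rewrite ler_wpM2l// ltW.
have ee : eta ^+ 2 * mu ^+ 2 <= eta * (w * w).
  have em0 : 0 <= eta * mu ^+ 2 by rewrite mulr_ge0 ?sqr_ge0// ltW. have := ler_wpM2r em0 e2; rewrite expr2; lra.
have ew : eta * (w * w) <= kap * L * w / 100.
  have : eta * w <= kap * L / 100.
    have wL1 : w <= L by lra. by have := ler_wpM2l (ltW e0) wL1; lra.
  by move=> h; have := ler_wpM2r (ltW w0) h; lra.
have kw : 0 <= kap * L * w by rewrite mulr_ge0 ?(ltW w0).
have E : (1 + eta) ^+ 2 * mu ^+ 2 = mu ^+ 2 + 2 * (eta * mu ^+ 2) + eta ^+ 2 * mu ^+ 2 by ring.
rewrite E in d0'; lra.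
Qed.

End Triple.
End PlaneEstimates.

(** * Boxes around points of a nearly geodesic chain *)

Section GeodesicBox.
Variables (R : realType) (M : surface R) (G : riemannian_metric M).
Implicit Types (y z : M) (x v : R * R).

Lemma mulr_itv01 (p q : R) : 0 <= p <= 1 -> 0 <= q <= 1 -> 0 <= p * q <= 1.
Proof. by move=> /andP[p0 p1] /andP[q0 q1]; rewrite mulr_ge0// mulr_ile1. Qed.

Lemma box_bump (A1 A2 A0 B1 B2 B0 w th : R) : 0 < w -> 0 < th -> th <= 1 ->
  exists g : R * R -> R, [/\ forall U, open U -> smooth_on U g, forall x, 0 <= g x <= 1,
    forall x, w <= `|x.1 * A1 + x.2 * A2 + A0| \/ w <= `|x.1 * B1 + x.2 * B2 + B0| -> g x = 0 &
    forall x, `|x.1 * A1 + x.2 * A2 + A0| <= (1 - th) * w -> `|x.1 * B1 + x.2 * B2 + B0| <= (1 - th) * w -> g x = 1].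
Proof.
move=> w0 th0 th1; pose D := w ^+ 2 - ((1 - th) * w) ^+ 2.
have D0 : 0 < D.
  have -> : D = w ^+ 2 * (th * (2 - th)) by rewrite /D; ring. by rewrite mulr_gt0 ?exprn_gt0 ?mulr_gt0//; lra.
pose b (t : R) := step ((w ^+ 2 - t ^+ 2) / D).
have b01 t : 0 <= b t <= 1 by exact: step_itv.
have b0 t : w <= `|t| -> b t = 0.
  move=> h; apply: step_eq0; rewrite pmulr_lle0 ?invr_gt0// subr_le0 -[X in _ <= X]real_normK ?num_real//. by rewrite ler_sqr ?nnegrE// ltW.
have b1 t : `|t| <= (1 - th) * w -> b t = 1.
  move=> h; apply: step_eq1; rewrite ler_pdivlMr// mul1r lerD2l lerN2 -[X in X <= _]real_normK ?num_real//. by rewrite ler_sqr ?nnegrE// mulr_ge0 ?(ltW w0)// subr_ge0.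
exists (fun x => b (x.1 * A1 + x.2 * A2 + A0) * b (x.1 * B1 + x.2 * B2 + B0)); split.
- move=> U oU k. have sb C1 C2 C0 : Ck_on k U (fun x => b (x.1 * C1 + x.2 * C2 + C0)).
    have -> : (fun x => b (x.1 * C1 + x.2 * C2 + C0)) =
        @step R \o (fun x : R * R => (w ^+ 2 + (-1) * ((x.1 * C1 + x.2 * C2 + C0) * (x.1 * C1 + x.2 * C2 + C0))) * D^-1).
      by apply/funext => x; rewrite /b /= mulN1r expr2.
    apply: Ck_step => //; apply: CkM => //; last exact: Ck_cst. apply: CkD => //; first exact: Ck_cst. apply: CkM => //; first exact: Ck_cst. by apply: CkM => //; exact: Ck_affine.
  exact: CkM.
- by move=> x; exact: mulr_itv01 (b01 _) (b01 _).
- by move=> x [] /b0 ->; rewrite ?mul0r ?mulr0.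
- by move=> x h1 h2; rewrite !b1// mulr1.
Qed.

(** Compactness makes the size of the nearly isometric charts independent of the point. *)
Lemma uniform_chart (eta : R) : compact [set: M] -> 0 < eta -> eta <= 1 -> exists2 rho : R, 0 < rho &
  forall y, exists z a1 a2 b2 r d, [/\ isometric_chart G z eta a1 a2 b2 r d, rho <= r / 4 &
    forall y', dist G y y' < rho -> dom z y' /\ en a1 a2 b2 (chart z y' - chart z z) < r / 2].
Proof.
move=> cM eta0 eta1.
pose Q z (r0 : R) := exists a1 a2 b2 r d, [/\ isometric_chart G z eta a1 a2 b2 r d, r0 <= r / 4 &
    forall y', dist G z y' < r0 -> dom z y' /\ en a1 a2 b2 (chart z y' - chart z z) < r / 2].
have HQ z : exists2 r0, 0 < r0 & Q z r0.
  have [a1 [a2 [b2 [r [d I]]]]] := isometric_chart_ex G z eta0. have r0 := ich_r I; have d0 := ich_d I. exists (Num.min d (r / 4)); first by rewrite lt_min d0 divr_gt0.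
  exists a1, a2, b2, r, d; split=> //; first by rewrite ge_min lexx orbT. move=> y'; rewrite lt_min => /andP[h1 h2]; have [dy _ Ey] := en_center I eta0 h1; split=> //.
  apply: le_lt_trans Ey _; have := dist_ge0 G z y'; move: (dist G z y') h2 => D h2 D0. by have : (1 + eta) * D <= 2 * D; [rewrite ler_wpM2r//; lra|lra].
have [e e0 He] := lebesgue_number G cM HQ.
exists e => // y; have [z [r0 [[a1 [a2 [b2 [r [d [I r0r H]]]]]] zy]]] := He y.
exists z, a1, a2, b2, r, d; split=> //; first by have := dist_ge0 G z y; lra.
by move=> y' yy'; apply: H; have := dist_triangle G z y y'; lra.
Qed.

Lemma near_axis_bound (X w th eta kap : R) : 0 < w -> 0 < th -> th <= 1 / 4 -> kap = th ^+ 3 / 800 ->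
  0 < eta -> eta <= kap / 100 -> 0 <= X -> X <= 8 * (th ^+ 2 / 400 * w) + (th * w / 4 + w) -> (1 + eta) * X <= w * (1 + th).
Proof.
move=> w0 th0 th1 kapE eta0 eta1 X0 h3.
have thh : th ^+ 2 <= th / 4 by rewrite expr2; have := ler_wpM2l (ltW th0) th1; lra.
have thh0 : 0 < th ^+ 2 by exact: exprn_gt0.
have k3 : th ^+ 3 <= th ^+ 2 / 4 by rewrite exprSr; have := ler_wpM2l (ltW thh0) th1; lra.
have ttw : th ^+ 2 * w <= th * w / 4 by have := ler_wpM2r (ltW w0) thh; lra.
have tw : 0 < th * w by exact: mulr_gt0.
have h4 : X <= w * (1 + th / 2) by lra.
have tw1 : th * w <= w / 4 by have := ler_wpM2r (ltW w0) th1; lra.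
have h5 : eta * X <= eta * (2 * w) by rewrite ler_wpM2l ?(ltW eta0)//; lra.
have h6 : eta * w <= kap / 100 * w by rewrite ler_wpM2r// ltW.
have h7 : kap * w <= th * w / 100 by rewrite kapE; have := ler_wpM2r (ltW w0) k3; lra.
lra.
Qed.

Section Chain.
Variables (th L w lam kap eta : R) (zz : R -> M) (u : M -> R).
Hypotheses (th0 : 0 < th) (th1 : th <= 1 / 4) (L0 : 0 < L) (wE : w = th / 2 * L).
Hypotheses (kapE : kap = th ^+ 3 / 800) (etaE : eta = kap ^+ 2).
Hypothesis chain : forall p q, - L <= p -> p <= q -> q <= L -> q - p - eta * L <= dist G (zz p) (zz q) <= q - p.
Hypothesis u_upper : forall y, u y <= lam - L + dist G (zz (- L)) y + eta * L.
Hypothesis u_lower : forall y, lam + L - dist G (zz L) y - eta * L <= u y.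

Lemma chain_dist p : - L <= p -> p <= L -> dist G (zz 0) (zz p) <= `|p|.
Proof.
have L0' := L0; have L1 : - L <= 0 by lra.
move=> p1 p2; have [pp|pn] := leP 0 p.
  by have /andP[_] := chain L1 pp p2; rewrite subr0 ger0_norm.
by have /andP[_] := chain p1 (ltW pn) (ltW L0); rewrite sub0r dist_sym ltr0_norm.
Qed.

Section Coordinates.
Variables (O V : M -> R) (good : M -> Prop).
Hypothesis dE : forall y y', good y -> good y' -> n2 (O y' - O y) (V y' - V y) <= (1 + eta) * dist G y y' /\
   dist G y y' <= (1 + eta) * n2 (O y' - O y) (V y' - V y).
Hypothesis zgood : forall p, - L <= p -> p <= L -> good (zz p).
Hypotheses (O0 : O (zz 0) = 0) (V0 : V (zz 0) = 0) (VL : V (zz L) = 0) (OL : 0 <= O (zz L)).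

(** O and V are coordinates along and across the chord. By [u_upper] and [u_lower], u is squeezed
    between the distances to the two ends of the chain, both affine in O up to errors. With w = th L
    / 2 and kap = th^3 / 800 the errors w^2 / L, kap L and sqrt (kap L w) are all fractions of th
    w. *)
Lemma box_coordinates y : good y -> `|O y| <= w -> `|V y| <= w ->
  `|u y - lam - O y| <= th * w /\ dist G y (zz (O y)) <= w * (1 + th).
Proof.
move=> gy Ow Vw; have th0' := th0; have th1' := th1; have L0' := L0.
have thh : th ^+ 2 <= th / 4 by rewrite expr2; have := ler_wpM2l (ltW th0) th1; lra.
have thh0 : 0 < th ^+ 2 by exact: exprn_gt0.
have p3 := exprn_gt0 3 th0; have kap0 : 0 < kap by rewrite kapE; lra.
have k3 : th ^+ 3 <= th ^+ 2 / 4 by rewrite exprSr; have := ler_wpM2l (ltW thh0) th1; lra.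
have kap1 : kap <= 1 / 100 by rewrite kapE; lra.
have [eta0 eta1 eta2] := eta_bounds kap0 kap1 etaE.
have w0 : 0 < w by rewrite wE mulr_gt0// divr_gt0.
have wL : 4 * w <= L by rewrite wE; have := ler_wpM2r (ltW L0) th1; lra.
have kL : kap * L = th ^+ 2 / 400 * w by rewrite kapE wE; field.
have wwL : w ^+ 2 / L = th / 2 * w by rewrite wE; field; rewrite gt_eqF.
have eL : eta * L <= kap * L / 100 by have := ler_wpM2r (ltW L0) eta1; lra.
have ket : 0 < 1 + eta by lra.
have L1 : - L <= 0 by lra.
have L2 : - L <= L by lra.
have g0 := zgood L1 (ltW L0); have gL := zgood L2 (lexx L); have gm := zgood (lexx (- L)) L2.
have nP : n2 (O (zz L)) 0 = O (zz L) by rewrite /n2 expr0n addr0 sqrtr_sqr ger0_norm.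
have P1 : L * (1 - eta) <= (1 + eta) * O (zz L).
  have [_ h] := dE g0 gL; have /andP[h1 _] := chain L1 (ltW L0) (lexx L). rewrite O0 V0 VL !subr0 nP in h; apply: le_trans h; apply: le_trans h1.
  by rewrite subr0 mulrBr mulr1 mulrC.
have P2 : O (zz L) <= (1 + eta) * L.
  have [h _] := dE g0 gL; rewrite O0 V0 VL !subr0 nP in h; apply: le_trans h _. by rewrite ler_pM2l//; have := chain_dist L2 (lexx L); rewrite gtr0_norm.
have q_le : n2 (O (zz (- L))) (V (zz (- L))) <= (1 + eta) * L.
  have [h _] := dE g0 gm; rewrite O0 V0 !subr0 in h; apply: le_trans h _. by rewrite ler_pM2l//; have := chain_dist (lexx (- L)) L2; rewrite normrN gtr0_norm.
have pq : L * (2 - eta) <= (1 + eta) * n2 (O (zz L) - O (zz (- L))) (- V (zz (- L))).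
  have [_ h] := dE gm gL; have /andP[h1 _] := chain (lexx (- L)) L2 (lexx L). rewrite VL sub0r in h; apply: le_trans h; apply: le_trans h1.
  by have -> : L * (2 - eta) = L - - L - eta * L by ring.
have up := axis_upper L0 kap0 kap1 etaE P1 P2 q_le pq w0 wL Ow Vw.
have lo := axis_lower L0 kap0 kap1 etaE P1 P2 w0 wL Ow Vw.
have mus := Ow; rewrite ler_norml in mus; case/andP: mus => mu1 mu2.
have [_ d1] := dE gm gy; have [_ d2] := dE gy gL; rewrite VL sub0r in d2.
have tw : 0 < th * w by exact: mulr_gt0.
have ttw : th ^+ 2 * w <= th * w / 4 by have := ler_wpM2r (ltW w0) thh; lra.
have ttw0 : 0 < th ^+ 2 * w by exact: mulr_gt0.
have uu := u_upper y; have ul := u_lower y; rewrite (dist_sym G (zz L)) in ul.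
have k8 : 8 * kap * L = 8 * (th ^+ 2 / 400 * w) by rewrite -mulrA kL.
rewrite wwL k8 in up; rewrite wwL k8 in lo; rewrite kL in eL.
have d1' := le_trans d1 up; have d2' := le_trans d2 lo.
split.
  move: (dist G (zz (- L)) y) (dist G y (zz L)) d1' d2' uu ul => D1 D2 d1' d2' uu ul. by rewrite ler_norml; apply/andP; split; lra.
have muL1 : - L <= O y by lra.
have muL2 : O y <= L by lra.
have gmu := zgood muL1 muL2.
have k0 : n2 (O (zz (O y))) (V (zz (O y))) <= (1 + eta) * `|O y|.
  have [hh _] := dE g0 gmu; rewrite O0 V0 !subr0 in hh; apply: le_trans hh _. by rewrite ler_pM2l//; exact: chain_dist.
have kp : n2 (O (zz L) - O (zz (O y))) (- V (zz (O y))) <= (1 + eta) * (L - O y).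
  have [hh _] := dE gmu gL; rewrite VL sub0r in hh; apply: le_trans hh _. by rewrite ler_pM2l//; have /andP[] := chain muL1 muL2 (lexx L).
have kq : n2 (O (zz (O y)) - O (zz (- L))) (V (zz (O y)) - V (zz (- L))) <= (1 + eta) * (L + O y).
  have [hh _] := dE gm gmu; apply: le_trans hh _; rewrite ler_pM2l//. by have /andP[_] := chain (lexx (- L)) muL1 muL2; rewrite opprK addrC.
have [z1 z2] := axis_near L0 kap0 kap1 etaE P1 P2 q_le pq w0 wL Ow k0 kp kq.
have z2' : `|V (zz (O y))| <= th * w / 4.
  rewrite -ler_sqr ?nnegrE ?divr_ge0 ?(ltW tw)// real_normK ?num_real//. apply: le_trans z2 _; have -> : 17 * kap * L * w = 17 * (kap * L) * w by ring.
  have -> : (th * w / 4) ^+ 2 = th ^+ 2 * w * w / 16 by field. rewrite kL; have := mulr_gt0 ttw0 w0; move: (th ^+ 2) => tt; lra.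
have [_ d3] := dE gy gmu; apply: le_trans d3 _.
have h3 : n2 (O (zz (O y)) - O y) (V (zz (O y)) - V y) <= 8 * kap * L + (th * w / 4 + w).
  apply: le_trans (n2_le_sum _ _) _; apply: lerD; first exact: z1. by apply: le_trans (ler_normB _ _) _; exact: lerD.
by rewrite k8 in h3; exact: near_axis_bound w0 th0 th1 kapE eta0 eta1 (n2_ge0 _ _) h3.
Qed.

End Coordinates.

Section Box.
Variables (rho : R) (z : M) (a1 a2 b2 r d : R).
Hypothesis I : isometric_chart G z eta a1 a2 b2 r d.
Hypotheses (rr : rho <= r / 4) (Lrho : L < rho).
Hypothesis near_z : forall y, dist G (zz 0) y < rho -> dom z y /\ en a1 a2 b2 (chart z y - chart z z) < r / 2.

(** [Kb] is the closed square of half-side w centred at [zz 0] and aligned with the chord to [zz L];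
    [Qb] is the open square of half-side (1 - th) w, where the bump is 1. *)
Lemma geodesic_box : exists chi Kb Qb, [/\
  [/\ msmooth chi, forall y, 0 <= chi y <= 1, closed Kb & forall y, ~ Kb y -> chi y = 0], borel Qb, Qb `<=` Kb, (forall y, Qb y -> 1 <= chi y) /\
    ((((1 - eta) * (4 * ((1 - th) * w) ^+ 2))%:E <= area G Qb)%E) &
  forall y, Kb y -> exists mu, [/\ `|mu| <= w, `|u y - lam - mu| <= th * w & dist G y (zz mu) <= w * (1 + th)]].
Proof.
have th0' := th0; have th1' := th1; have L0' := L0; have rr' := rr; have Lrho' := Lrho.
have r0 := ich_r I; have a0 := ich_a1 I; have b0 := ich_b2 I.
have thh : th ^+ 2 <= th / 4 by rewrite expr2; have := ler_wpM2l (ltW th0) th1; lra.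
have thh0 : 0 < th ^+ 2 by exact: exprn_gt0.
have p3 := exprn_gt0 3 th0; have kap0 : 0 < kap by rewrite kapE; lra.
have k3 : th ^+ 3 <= th ^+ 2 / 4 by rewrite exprSr; have := ler_wpM2l (ltW thh0) th1; lra.
have kap1 : kap <= 1 / 100 by rewrite kapE; lra.
have [eta0 eta1 eta2] := eta_bounds kap0 kap1 etaE.
have w0 : 0 < w by rewrite wE mulr_gt0// divr_gt0.
have wL : 4 * w <= L by rewrite wE; have := ler_wpM2r (ltW L0) th1; lra.
have ket : 0 < 1 + eta by lra.
pose E := en a1 a2 b2; pose x0 := chart z z.
have ED v v' : E (v + v') <= E v + E v' by exact: enD.
have EN v : E (- v) = E v by exact: enN.
have L1 : - L <= 0 by lra.
have L2 : - L <= L by lra.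
have zgood p : - L <= p -> p <= L -> dom z (zz p) /\ E (chart z (zz p) - x0) < r.
  move=> p1 p2; have pL : `|p| <= L by rewrite ler_norml p1. have pd := le_lt_trans (le_trans (chain_dist p1 p2) pL) Lrho.
  by have [h1 h2] := near_z pd; split=> //; apply: lt_trans h2 _; lra.
have dE y y' : dom z y -> E (chart z y - x0) < r -> dom z y' -> E (chart z y' - x0) < r ->
    E (chart z y' - chart z y) <= (1 + eta) * dist G y y' /\ dist G y y' <= (1 + eta) * E (chart z y' - chart z y).
  move=> dy Ey dy' Ey'; split.
    exact: en_le_dist I eta0 dy Ey dy' Ey'.
  have [l J le] := ich_upper I Ey Ey'; apply: le_trans le; apply: dist_le; by rewrite !chartK in J.
pose Z0 := chart z (zz 0); pose px := chart z (zz L) - Z0; pose qx := chart z (zz (- L)) - Z0.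
have [c [s [cs dir]]] := en_direction a1 a2 b2 px.
pose om v := c * (v.1 * a1 + v.2 * a2) + s * (v.2 * b2).
pose nu v := - s * (v.1 * a1 + v.2 * a2) + c * (v.2 * b2).
have E2 v : E v ^+ 2 = om v ^+ 2 + nu v ^+ 2.
  rewrite sqr_en; have -> : om v ^+ 2 + nu v ^+ 2 = (c ^+ 2 + s ^+ 2) * en2 a1 a2 b2 v.
    by rewrite /om /nu /en2; ring.
  by rewrite cs mul1r.
have En v : E v = n2 (om v) (nu v).
  by rewrite /n2 -E2 sqrtr_sqr ger0_norm// en_ge0.
have omB v v' : om (v - v') = om v - om v' by rewrite /om /=; ring.
have nuB v v' : nu (v - v') = nu v - nu v' by rewrite /nu /=; ring.
have nup : nu px = 0.
  have := E2 px; rewrite -[om px]/(c * (px.1 * a1 + px.2 * a2) + s * (px.2 * b2)) dir -/E => /eqP. by rewrite -subr_eq0 opprD addrA subrr sub0r oppr_eq0 sqrf_eq0 => /eqP.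
have [dz0 ez0] := zgood 0 (ltac:(lra)) (ltac:(lra)).
have [dzL ezL] := zgood L (ltac:(lra)) (lexx _).
have [dzm ezm] := zgood (- L) (lexx _) (ltac:(lra)).
pose Kp := [set x | `|om (x - Z0)| <= w /\ `|nu (x - Z0)| <= w].
have KpE x : Kp x -> E (x - Z0) <= 2 * w.
  by move=> [h1 h2]; rewrite En; apply: le_trans (n2_le_sum _ _) _; lra.
have Z0x : E (Z0 - x0) < r / 2.
  have [|_ //] := @near_z (zz 0); rewrite distyy; lra.
have KpB x : Kp x -> E (x - x0) < r.
  move=> /KpE h; have := ED (x - Z0) (Z0 - x0); rewrite addrA addrNK; lra.
have Kcod : Kp `<=` cod z by move=> x /KpB; exact: (ich_cod I).
have omA x : om (x - Z0) = x.1 * (c * a1) + x.2 * (c * a2 + s * b2) + - om Z0.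
  by rewrite omB /om; ring.
have nuA x : nu (x - Z0) = x.1 * (- s * a1) + x.2 * (- s * a2 + c * b2) + - nu Z0.
  by rewrite nuB /nu; ring.
have cl A B D : closed [set x : R * R | `|x.1 * A + x.2 * B + D| <= w].
  have cf : continuous (fun x : R * R => `|x.1 * A + x.2 * B + D| : R).
    have cA := @Ck_affine R 0%N setT A B D (@openT _). by move=> x; apply: cvg_norm; exact: cA.
  by apply: (@closed_comp _ _ (fun x : R * R => `|x.1 * A + x.2 * B + D| : R) [set t | t <= w]); [move=> x _; exact: cf|exact: closed_le].
have clK : closed Kp.
  have -> : Kp = [set x : R * R | `|x.1 * (c * a1) + x.2 * (c * a2 + s * b2) + - om Z0| <= w] `&`
      [set x : R * R | `|x.1 * (- s * a1) + x.2 * (- s * a2 + c * b2) + - nu Z0| <= w].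
    by apply/seteqP; split => x [h1 h2]; split; move: h1 h2; rewrite /= ?omA ?nuA.
  exact: closedI.
have cK : compact Kp.
  have c2 := @compact_en R a1 a2 b2 a0 b0 Z0 (2 * w) (ltac:(lra)). by apply: (subclosed_compact clK c2) => x /KpE.
have th11 : th <= 1 by lra.
have [g [sg g01 g0 g1]] := @box_bump (c * a1) (c * a2 + s * b2) (- om Z0) (- s * a1) (- s * a2 + c * b2) (- nu Z0) w th w0 th0 th11.
have oz := @open_cod R M z.
have gK x : cod z x -> ~ Kp x -> g x = 0.
  move=> _ nK; apply: g0; rewrite -omA -nuA. have [h1|h1] := leP w `|om (x - Z0)|; first by left. right; rewrite leNgt; apply/negP => h2; apply: nK; split; exact: ltW.
pose h := (1 - th) * w; have h0 : 0 < h by rewrite mulr_gt0//; lra.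
pose Pb := parallelogram (c * a1) (c * a2 + s * b2) (- s * a1) (- s * a2 + c * b2) (om Z0) (nu Z0) h.
have PbE x : Pb x -> `|om (x - Z0)| < h /\ `|nu (x - Z0)| < h.
  move=> [p1 p2]; rewrite omA nuA; split.
    by move: p1; rewrite (mulrC (c * a1)) (mulrC (_ + s * b2)).
  by move: p2; rewrite (mulrC (- s * a1)) (mulrC (_ + c * b2)).
have hw : h <= w by have := mulr_gt0 th0 w0; rewrite /h; lra.
have PbK : Pb `<=` Kp by move=> x /PbE[q1 q2]; split; apply: ltW; [exact: lt_le_trans hw|exact: lt_le_trans hw].
have eta11 : eta <= 1 by lra.
have [bQ aQ] := box_area I eta11 cs h0 (fun x Px => KpB x (PbK x Px) : [set x | en a1 a2 b2 (x - chart z z) < r] x).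
exists (chart_ext z g), (dom z `&` chart z @^-1` Kp), (chart_inv z @` Pb); split.
- split.
  + exact: msmooth_chart_ext cK Kcod (sg _ oz) gK.
  + by move=> y; rewrite /chart_ext; case: asboolP => _; rewrite ?lexx ?ler01.
  + exact: compact_chart_closed.
  + move=> y nK; have [dy|ndy] := pselect (dom z y); last by rewrite chart_ext_notin. by rewrite chart_extE// gK//; [exact: cod_chart|move=> Ky; apply: nK].
- exact: bQ.
- move=> _ [x Px <-]; have cx := Kcod x (PbK x Px). by split; [exact: dom_chart_inv|rewrite /= chart_invK//; exact: PbK].
- split; last exact: aQ. move=> _ [x Px <-]; have cx := Kcod x (PbK x Px); have [q1 q2] := PbE x Px. rewrite chart_extE ?chart_invK//; last exact: dom_chart_inv.
  by rewrite g1// -?omA -?nuA ltW.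
- move=> y [dy Ky]. pose O y := om (chart z y - Z0); pose V y := nu (chart z y - Z0). pose good y := dom z y /\ E (chart z y - x0) < r.
  have dE' y1 y2 : good y1 -> good y2 -> n2 (O y2 - O y1) (V y2 - V y1) <= (1 + eta) * dist G y1 y2 /\
      dist G y1 y2 <= (1 + eta) * n2 (O y2 - O y1) (V y2 - V y1).
    move=> [g1' g2'] [g3 g4]; have := dE _ _ g1' g2' g3 g4. rewrite En (_ : chart z y2 - chart z y1 = (chart z y2 - Z0) - (chart z y1 - Z0)).
      by rewrite omB nuB.
    by rewrite opprB addrA addrNK.
  have om0 : om 0 = 0 by rewrite -(subrr (0 : R * R)) omB subrr. have nu0 : nu 0 = 0 by rewrite -(subrr (0 : R * R)) nuB subrr. have O0 : O (zz 0) = 0 by rewrite /O subrr.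
  have V0 : V (zz 0) = 0 by rewrite /V subrr. have OL : 0 <= O (zz L).
    have -> : O (zz L) = E px by exact: dir. exact: en_ge0.
  have gy : good y by split=> //; exact: KpB. have [B1 B2] := box_coordinates dE' zgood O0 V0 nup OL gy Ky.1 Ky.2. by exists (O y); split=> //; exact: Ky.1.
Qed.

End Box.
End Chain.
End GeodesicBox.



(** * The profile functions and the arithmetic of the area bound *)

Section Tents.
Variable R : realType.

Lemma continuous_step : continuous (@step R).
Proof.
move=> t; have c1 : {for t, continuous (@flat R 0)} by exact: flat_cont.
have c2 : {for t, continuous (fun t : R => @flat R 0 (1 - t))}.
  have c0 : {for t, continuous (fun t : R => 1 - t : R)} by apply: cvgB; [exact: cvg_cst|exact: cvg_id].
  exact: (@cont_comp _ _ _ (fun t : R => 1 - t) (@flat R 0) t c0 (@flat_cont R 0 _)).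
have d0 : flat 0 t + flat 0 (1 - t) != 0 by rewrite gt_eqF// step_den_gt0.
exact: (cvgM c1 (cvgV d0 (cvgD c1 c2))).
Qed.

Lemma calibrating_function (r r' B : R) : 0 < r -> r < r' -> r' < B -> exists h Phi : R -> R, [/\
  forall t, h t = 1 - step ((t - r) / (r' - r)), forall t, 0 <= t < B -> is_derive t (1 : R) Phi (h t), forall t, 0 <= h t <= 1, forall t, r' <= t -> h t = 0 &
  forall p q, 0 <= p -> p <= r -> r <= q -> q < B -> r - p <= Phi q - Phi p].
Proof.
move=> r0 rr rB; pose h t := 1 - step ((t - r) / (r' - r)).
have d0 : 0 < r' - r by lra.
have ch : continuous h.
  move=> t; have c0 : {for t, continuous (fun t : R => (t - r) / (r' - r) : R)}.
    by apply: cvgM; [apply: cvgB; [exact: cvg_id|exact: cvg_cst]|exact: cvg_cst].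
  have c1 := @cont_comp _ _ _ (fun t : R => (t - r) / (r' - r)) (@step R) t c0 (@continuous_step _). have c2 : {for t, continuous (fun _ : R => 1 : R)} by exact: cvg_cst.
  exact: (cvgB c2 c1).
have mB : -1 < B by lra.
have [Phi dPhi] := primitive mB ch.
have h01 t : 0 <= h t <= 1.
  by have /andP[s0 s1] := step_itv ((t - r) / (r' - r)); rewrite /h; apply/andP; split; lra.
have h1 t : t <= r -> h t = 1.
  by move=> tr; rewrite /h step_eq0 ?subr0// pmulr_lle0 ?invr_gt0// subr_le0.
have dP t : 0 <= t < B -> is_derive t (1 : R) Phi (h t).
  by move=> /andP[t0 tB]; apply: dPhi; apply/andP; split; lra.
exists h, Phi; split=> //.
  by move=> t tr; rewrite /h step_eq1 ?subrr// ler_pdivlMr// mul1r lerD2r.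
move=> p q p0 pr rq qB.
have k1 : Phi r <= Phi q.
  apply: (@derive_ge0_le R Phi h r q rq) => t /andP[t1 t2].
    by apply: dP; apply/andP; split; lra.
  by have /andP[] := h01 t.
have k2 : Phi p - p <= Phi r - r.
  apply: (@derive_ge0_le R (fun t => Phi t - t) (fun t => h t - 1) p r pr) => t /andP[t1 t2].
    have dt : is_derive t (1 : R) Phi (h t) by apply: dP; apply/andP; split; lra. exact: is_deriveB.
  by rewrite h1// subrr.
lra.
Qed.

(** The discrete form of the area of a triangle with base 2 n and height n. *)
Lemma tent_sum (n : nat) : \sum_(j < n.*2.+1) (n%:R - `|j%:R - n%:R|) = (n%:R : R) ^+ 2.
Proof.
have half m : \sum_(j < m) (j%:R : R) = m%:R * (m%:R - 1) / 2.
  elim: m => [|m IH]; first by rewrite big_ord0 !mul0r. by rewrite big_ord_recr /= IH -(natr1 m); field.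
rewrite -addnn -addnS big_split_ord /=.
have -> : \sum_(i < n) (n%:R - `|i%:R - n%:R|) = \sum_(i < n) (i%:R : R).
  apply: eq_bigr => i _; have : (i%:R : R) <= n%:R by rewrite ler_nat ltnW. by move=> h; rewrite ler0_norm ?subr_le0// opprB subKr.
have -> : \sum_(i < n.+1) (n%:R - `|(n + i)%:R - n%:R|) = n.+1%:R * n%:R - \sum_(i < n.+1) (i%:R : R).
  rewrite -[X in _ = X - _]/(n.+1%:R * n%:R) [X in _ = X - _](_ : _ = \sum_(i < n.+1) (n%:R : R)); last first.
    by rewrite sumr_const card_ord mulr_natl.
  rewrite -sumrB; apply: eq_bigr => i _. have -> : (n + i)%:R - n%:R = i%:R :> R by rewrite natrD addrC addKr. by rewrite ger0_norm.
by rewrite !half -(natr1 n); field.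
Qed.

Lemma closed_finite_union (T : topologicalType) (K : nat -> set T) (n : nat) : (forall j, closed (K j)) ->
  closed [set y | exists2 j, (j < n)%N & K j y].
Proof.
move=> cK; elim: n => [|n IH].
  have -> : [set y | exists2 j, (j < 0)%N & K j y] = set0 by apply/seteqP; split => y // []. exact: closed0.
have -> : [set y | exists2 j, (j < n.+1)%N & K j y] = [set y | exists2 j, (j < n)%N & K j y] `|` K n.
  apply/seteqP; split => [y [j]|y [[j jn Kj]|Kn]].
  - by rewrite ltnS leq_eqVlt => /orP[/eqP ->|jn] Kj; [right|left; exists j].
  - by exists j => //; exact: ltnW.
  - by exists n.
exact: closedU.
Qed.

Lemma small_error_le (A B : R) : 0 <= A -> 0 <= B ->
  (forall th : R, 0 < th -> th <= 1 / 8 -> B * (1 - 6 * th) <= A * (1 + 24 * th)) -> B <= A.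
Proof.
move=> A0 B0 H; rewrite leNgt; apply/negP => AB.
pose th := Num.min (1 / 8) ((B - A) / (2 * (6 * B + 24 * A))).
have D0 : 0 < 2 * (6 * B + 24 * A) by lra.
have t0 : 0 < th by rewrite lt_min !divr_gt0// subr_gt0.
have t1 : th <= 1 / 8 by rewrite ge_min lexx.
have t2 : th * (2 * (6 * B + 24 * A)) <= B - A by rewrite -ler_pdivlMr// ge_min lexx orbT.
have := H th t0 t1; lra.
Qed.

(** To leading order in th: the weights add up to h n^2 = b0^2 / (2 w), the squares have area 4 w^2,
    so half of the weighted area is w b0^2, against 2 w A on the other side. *)
Lemma variation_arith (w th n h b0 eta e1 om A S : R) : 0 < w -> 0 < th -> th <= 1 / 8 -> 0 <= A -> 0 < b0 ->
  h = 2 * w * (1 + 2 * th) -> b0 = n * h -> 0 <= eta -> eta <= th -> 0 <= e1 -> e1 <= th -> om <= w * (1 + 3 * th) -> h * n ^+ 2 * ((1 - eta) * (4 * ((1 - th) * w) ^+ 2)) <= S ->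
  (2 - (1 + e1) ^+ 2) / 2 * S <= 2 * om * (1 + e1) * A -> b0 ^+ 2 / 2 * (1 - 6 * th) <= A * (1 + 24 * th).
Proof.
move=> w0 th0 th1 A0 b00 hE bE eta0 eta1 e10 e11 omE HS H.
have k1 : 1 - 3 * th <= 2 - (1 + e1) ^+ 2.
  have : e1 ^+ 2 <= th by rewrite expr2; have := ler_pM e10 e10 e11 e11; have := ler_wpM2l (ltW th0) th1; lra. by rewrite sqrrD expr1n mul1r mulr2n; lra.
have k0 : 0 <= 1 - 3 * th by lra.
pose T := h * n ^+ 2 * ((1 - th) * (4 * ((1 - th) * w) ^+ 2)).
have h0 : 0 < h by rewrite hE !mulr_gt0//; lra.
have hn0 := mulr_ge0 (ltW h0) (sqr_ge0 n).
have w40 := mulr_ge0 (ler0n R 4) (sqr_ge0 ((1 - th) * w)).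
have th2 : 0 <= 1 - th by lra.
have T0 : 0 <= T := mulr_ge0 hn0 (mulr_ge0 th2 w40).
have TS : T <= S.
  by apply: le_trans HS; apply: (ler_wpM2l hn0); apply: (ler_wpM2r w40); lra.
have H1 : (1 - 3 * th) / 2 * T <= 2 * om * (1 + e1) * A.
  apply: le_trans H; apply: ler_pM => //; first by rewrite divr_ge0. by rewrite ler_pM2r ?invr_gt0.
have H2 : 2 * om * (1 + e1) * A <= 2 * (w * (1 + 3 * th)) * (1 + th) * A.
  rewrite ler_wpM2r//; apply: (@le_trans _ _ (2 * (w * (1 + 3 * th)) * (1 + e1))).
    by rewrite ler_wpM2r//; [lra|rewrite ler_pM2l].
  by rewrite ler_wpM2l// ?mulr_ge0 ?(ltW w0)//; lra.
have Tb : T * (1 + 2 * th) = 2 * w * b0 ^+ 2 * (1 - th) ^+ 3.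
  by rewrite /T bE hE; ring.
clearbody T.
have H3 : (1 - 3 * th) / 2 * (2 * w * b0 ^+ 2 * (1 - th) ^+ 3) <= 2 * (w * (1 + 3 * th)) * (1 + th) * A * (1 + 2 * th).
  have th3 : 0 <= 1 + 2 * th by lra. by rewrite -Tb [leLHS]mulrA; apply: ler_wpM2r => //; exact: le_trans H1 H2.
have H4 : b0 ^+ 2 / 2 * ((1 - 3 * th) * (1 - th) ^+ 3) <= A * ((1 + 3 * th) * (1 + th) * (1 + 2 * th)).
  have W : 0 < 2 * w by rewrite mulr_gt0. rewrite -(ler_pM2l W); move: H3; congr (_ <= _); by field.
have bb : 0 <= b0 ^+ 2 / 2 by rewrite divr_ge0 ?sqr_ge0.
apply: le_trans (_ : b0 ^+ 2 / 2 * ((1 - 3 * th) * (1 - th) ^+ 3) <= _).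
  rewrite ler_wpM2l//. have -> : (1 - 3 * th) * (1 - th) ^+ 3 = 1 - 6 * th + th ^+ 2 * (12 - 10 * th + 3 * th ^+ 2) by ring. have : 0 <= th ^+ 2 * (12 - 10 * th + 3 * th ^+ 2).
    by rewrite mulr_ge0 ?sqr_ge0//; have := sqr_ge0 th; lra.
  lra.
apply: le_trans H4 _; rewrite ler_wpM2l//.
have t2 : th ^+ 2 <= th / 8 by rewrite expr2; have := ler_wpM2l (ltW th0) th1; lra.
have t3 : th ^+ 3 <= th / 8.
  rewrite exprS; have := ler_wpM2l (ltW th0) t2; have := ler_wpM2l (ltW th0) th1; rewrite expr2 in t2 *; lra.
have -> : (1 + 3 * th) * (1 + th) * (1 + 2 * th) = 1 + 6 * th + 11 * th ^+ 2 + 6 * th ^+ 3 by ring.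
lra.
Qed.

End Tents.

(** * Finite lists and sums *)

Section Sequences.
Variable R : realType.

Lemma uniq_sub_sum (T : eqType) (Z L : seq T) (F : T -> R) : (forall x, 0 <= F x) ->
  uniq Z -> {subset Z <= L} -> \sum_(x <- Z) F x <= \sum_(x <- L) F x.
Proof.
move=> F0; elim: Z L => [|z Z IH] L; first by rewrite big_nil sumr_ge0.
move=> /andP[zZ uZ] sub; have zL : z \in L by apply: sub; rewrite mem_head.
rewrite (perm_big _ (perm_to_rem zL)) !big_cons lerD2l; apply: IH => // y yZ.
have := sub y; rewrite !inE yZ orbT => /(_ isT); rewrite (perm_mem (perm_to_rem zL)) inE.
by case: eqP => // yz; rewrite -yz yZ in zZ.
Qed.

(** If no list exhausted Q, lists of every length could be built one element at a time. *)
Lemma bounded_enumeration (T : eqType) (Q : T -> Prop) n :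
  (forall S : seq T, uniq S -> (forall x, x \in S -> Q x) -> (size S <= n)%N) -> exists S : seq T, [/\ uniq S, forall x, x \in S -> Q x & forall x, Q x -> x \in S].
Proof.
move=> H; apply: contrapT => nS.
have ex k : exists S : seq T, [/\ uniq S, forall x, x \in S -> Q x & size S = k].
  elim: k => [|k [S [uS QS sS]]]; first by exists [::]. have [x /not_implyP[Qx xS]] : exists x, ~ (Q x -> x \in S).
    by apply/existsNP => h; apply: nS; exists S.
  exists (x :: S); split=> /=; [by rewrite uS andbT; exact/negP| |by rewrite sS]. by move=> y; rewrite inE => /orP[/eqP ->|/QS].
have [S [uS QS sS]] := ex n.+1; by have := H S uS QS; rewrite sS ltnn.
Qed.

End Sequences.

(** * Lower bound for the area of balls *)

Section AreaOfBalls.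
Variables (R : realType) (M : surface R) (G : riemannian_metric M) (U : universal_cover G).
Hypotheses (cM : compact [set: M]) (nsc : ~ simply_connected M) (ext : extremal G).
Local Notation s := (sys G).
Local Notation a B := (fine (area G B)).

Lemma dist_bounded (x : M) : exists B : R, forall y, dist G x y <= B.
Proof.
have [l Hl] := finite_net G cM (@ltr01 R).
have [K K0 HK] := @seq_bound R M l (fun z K => dist G x z <= K)
  (fun z K K' h1 h2 => le_trans h1 h2) (fun z _ => ex_intro (fun K => dist G x z <= K) (dist G x z) (lexx (dist G x z))).
exists (K + 1) => y; have [z zl zy] := Hl y.
have := dist_triangle G x z y; have := HK z zl; lra.
Qed.

Lemma natr_large (x : R) : exists n : nat, (0 < n)%N /\ x <= n%:R.
Proof.
exists (Num.truncn x).+1; split=> //; apply: ltW.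
by have [x0|x0] := leP 0 x; [exact: truncnS_gt|apply: lt_le_trans x0 _].
Qed.

(** [geodesic_box] applied to the chain translated by (j - n) h, for j from 0 to 2 n. As u is nearly
    the distance from [zz (- r)] minus r, triangle inequalities through the chain give the two
    bounds on u which that lemma requires. *)
Lemma box_chain (th L w h rho kap eta e1 r b0 : R) (n : nat) (zz : R -> M) (u : M -> R) :
  0 < th -> th <= 1 / 8 -> 0 < L -> w = th / 2 * L -> kap = th ^+ 3 / 800 -> eta = kap ^+ 2 -> L < rho ->
  h = 2 * w * (1 + 2 * th) -> b0 = n%:R * h -> b0 + L <= r -> 0 <= e1 -> 2 * e1 <= eta * L ->
  (forall y, exists z a1 a2 b2 r d, [/\ isometric_chart G z eta a1 a2 b2 r d, rho <= r / 4 &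
    forall y', dist G y y' < rho -> dom z y' /\ en a1 a2 b2 (chart z y' - chart z z) < r / 2]) ->
  (forall p q, - r <= p -> p <= q -> q <= r -> q - p - e1 <= dist G (zz p) (zz q) <= q - p) -> (forall y, `|u y - (dist G (zz (- r)) y - r)| <= e1) ->
  exists (chi : nat -> M -> R) (K Q : nat -> set M), forall j, (j < n.*2.+1)%N ->
    [/\ [/\ msmooth (chi j), forall y, 0 <= chi j y <= 1, closed (K j) & forall y, ~ K j y -> chi j y = 0], borel (Q j), Q j `<=` K j, (forall y, Q j y -> 1 <= chi j y) /\
      ((1 - eta) * (4 * ((1 - th) * w) ^+ 2) <= a (Q j)) &
    forall y, K j y -> exists mu, [/\ `|mu| <= w, `|u y - (j%:R - n%:R) * h - mu| <= th * w &
      dist G y (zz ((j%:R - n%:R) * h + mu)) <= w * (1 + th)]].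
Proof.
move=> th0 th1 L0 wE kapE etaE Lrho hE bE b0L e10 e11 uc chain uE.
have w0 : 0 < w by rewrite wE; have := mulr_gt0 th0 L0; lra.
have h0 : 0 < h by rewrite hE; have := mulr_gt0 th0 w0; lra.
pose C chij Kj Qj j := [/\ [/\ msmooth chij, forall y : M, 0 <= (chij y : R) <= 1, closed (Kj : set M) & forall y, ~ Kj y -> chij y = 0],
    borel (Qj : set M), Qj `<=` Kj, (forall y, Qj y -> 1 <= chij y) /\
      ((1 - eta) * (4 * ((1 - th) * w) ^+ 2) <= a Qj) &
    forall y, Kj y -> exists mu, [/\ `|mu| <= w, `|u y - (j%:R - n%:R) * h - mu| <= th * w &
      dist G y (zz ((j%:R - n%:R) * h + mu)) <= w * (1 + th)]].
suff /choice[D HD] : forall j, exists D : (M -> R) * set M * set M, (j < n.*2.+1)%N -> C D.1.1 D.1.2 D.2 j.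
  by exists (fun j => (D j).1.1), (fun j => (D j).1.2), (fun j => (D j).2).
move=> j; have [jn|_] := boolP (j < n.*2.+1)%N; last by exists ((fun=> 0), set0, set0).
set lam := (j%:R - n%:R) * h.
have [lam1 lam2] : - b0 <= lam /\ lam <= b0.
  have j0 : 0 <= (j%:R : R) by exact: ler0n. have j2 : (j%:R : R) <= 2 * n%:R by rewrite -natrM ler_nat mul2n -ltnS.
  have k1 := ler_wpM2r (ltW h0) j0; have k2 := ler_wpM2r (ltW h0) j2. by rewrite /lam bE; split; lra.
have [z [a1 [a2 [b2 [rz [d [I rr nz]]]]]]] := uc (zz lam).
have eL : 0 <= eta * L by lra.
have chain' p q : - L <= p -> p <= q -> q <= L -> q - p - eta * L <= dist G (zz (lam + p)) (zz (lam + q)) <= q - p.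
  move=> p1 pq q1; have c1 : - r <= lam + p by lra. have c2 : lam + p <= lam + q by lra. have c3 : lam + q <= r by lra.
  by have /andP[k1 k2] := chain _ _ c1 c2 c3; apply/andP; split; lra.
have nz' y : dist G (zz (lam + 0)) y < rho -> dom z y /\ en a1 a2 b2 (chart z y - chart z z) < rz / 2.
  by rewrite addr0; exact: nz.
have b00 : 0 <= b0 by rewrite bE mulr_ge0// ltW.
have rr0 : - r <= - r := lexx _.
have up y : u y <= lam - L + dist G (zz (lam + - L)) y + eta * L.
  have := uE y; rewrite ler_norml => /andP[_ k1]. have c2 : - r <= lam + - L by lra. have c3 : lam + - L <= r by lra.
  have /andP[_ k2] := chain _ _ rr0 c2 c3; have := dist_triangle G (zz (- r)) (zz (lam + - L)) y.
  move: (dist _ _ y) (dist _ _ (zz (lam + - L))) (dist _ (zz (lam + - L)) y) k1 k2 => A B D k1 k2 k3; lra.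
have lo y : lam + L - dist G (zz (lam + L)) y - eta * L <= u y.
  have := uE y; rewrite ler_norml => /andP[k1 _]. have c2 : - r <= lam + L by lra. have c3 : lam + L <= r by lra.
  have /andP[k2 _] := chain _ _ rr0 c2 c3; have := dist_triangle G (zz (- r)) y (zz (lam + L)).
  rewrite (dist_sym G y); move: (dist _ (zz (- r)) y) (dist _ (zz (- r)) (zz (lam + L))) (dist _ (zz (lam + L)) y) k1 k2 => A B D k1 k2 k3; lra.
have th1' : th <= 1 / 4 by lra.
have [chi [K [Q [H1 H2 H3 [H4 H5] H6]]]] := @geodesic_box _ _ G th L w lam kap eta (fun p => zz (lam + p)) u th0 th1' L0 wE kapE etaE chain' up lo rho z a1 a2 b2 rz d I rr Lrho nz'.
exists (chi, K, Q) => _; split=> //.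
by split=> //; rewrite -lee_fin -(area_finE G cM).
Qed.

Section ChainedPoints.
Variables (zz : R -> M) (r b0 w th : R).
Hypothesis zzle : forall p q, - r <= p -> p <= q -> q <= r -> dist G (zz p) (zz q) <= q - p.
Hypotheses (b0w : b0 + w <= r) (w0 : 0 <= w) (T8 : th * w <= w / 8).

Lemma chain_le p q : `|p| <= r -> `|q| <= r -> dist G (zz p) (zz q) <= `|p - q|.
Proof.
rewrite !ler_norml => /andP[g1 g2] /andP[g3 g4]; have [pp|pn] := leP p q.
  by rewrite distrC ger0_norm ?subr_ge0//; exact: zzle.
by rewrite dist_sym ger0_norm ?subr_ge0 ?(ltW pn)//; apply: zzle => //; exact: ltW.
Qed.

Lemma chain_itv (l mu : R) : `|l| <= b0 -> `|mu| <= w -> `|l + mu| <= r.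
Proof. by move=> h1 h2; apply: le_trans (ler_normD _ _) _; have := b0w; lra. Qed.

Lemma chain_position (x y : M) (l mu d : R) : `|l| <= b0 -> `|mu| <= w -> dist G x (zz 0) <= d ->
  dist G y (zz (l + mu)) <= w * (1 + th) -> dist G x y <= `|l| + d + 3 * w.
Proof.
move=> h1 h2 h3 h4; have r0 : `|(0 : R)| <= r.
  by rewrite normr0; have := normr_ge0 l; have := b0w; have := w0; lra.
have := chain_le r0 (chain_itv h1 h2); rewrite sub0r normrN => c3.
have c2 := ler_normD l mu; have c4 := dist_triangle G x (zz 0) y; have c5 := dist_triangle G (zz 0) (zz (l + mu)) y.
rewrite (dist_sym G y) in h4; have := T8; have := w0.
by move: (dist G x _) (dist G (zz 0) (zz _)) (dist G (zz (l + mu)) y) (dist G (zz 0) y) (dist G x y) h3 h4 c3 c4 c5 => D1 D2 D3 D4 D5; lra.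
Qed.

Lemma chain_gap (y y' : M) (v v' l l' mu mu' : R) : `|l| <= b0 -> `|mu| <= w -> `|l'| <= b0 -> `|mu'| <= w ->
  `|v - l - mu| <= th * w -> `|v' - l' - mu'| <= th * w -> dist G y (zz (l + mu)) <= w * (1 + th) -> dist G y' (zz (l' + mu')) <= w * (1 + th) ->
  dist G y y' <= `|v - v'| + 2 * (w * (1 + 2 * th)).
Proof.
move=> l1 m1 l2 m2 e1 e2 d1 d2; have c3 := chain_le (chain_itv l1 m1) (chain_itv l2 m2).
have c4 := dist_triangle G y (zz (l + mu)) y'; have c5 := dist_triangle G (zz (l + mu)) (zz (l' + mu')) y'.
rewrite (dist_sym G y') in d2.
have c6 : `|(l + mu) - (l' + mu')| <= `|v - v'| + 2 * (th * w).
  have -> : (l + mu) - (l' + mu') = (v - v') - (v - l - mu) + (v' - l' - mu') by ring. by apply: le_trans (ler_normD _ _) _; have := ler_normB (v - v') (v - l - mu); lra.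
move: (dist G y y') (dist G y _) (dist G (zz (l + mu)) (zz _)) (dist G (zz (l + mu)) y') (dist G (zz (l' + mu')) y') d1 d2 c3 c4 c5 c6.
by move: (`|(l + mu) - (l' + mu')|) (`|v - v'|) => N1 N2 D1 D2 D3 D4 D5; lra.
Qed.

End ChainedPoints.

(** Within one box u varies from the central parameter by at most w + th w, and the spacing h = 2 w
    (1 + 2 th) is larger than twice this; so boxes are disjoint. *)
Lemma steps_apart (j i n : nat) (h w th v mu nu : R) : 0 < w -> 0 < th -> h = 2 * w * (1 + 2 * th) ->
  `|mu| <= w -> `|nu| <= w -> `|v - (j%:R - n%:R) * h - mu| <= th * w -> `|v - (i%:R - n%:R) * h - nu| <= th * w -> j = i.
Proof.
move=> w0 th0 hE m1 n1 m2 n2; apply/eqP; apply: contraT => nji; have thw := mulr_gt0 th0 w0.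
have h0 : 0 <= h by rewrite hE; lra.
have c1 : `|(j%:R - i%:R) * h| <= 2 * w + 2 * (th * w).
  have -> : (j%:R - i%:R) * h = (v - (i%:R - n%:R) * h - nu) - (v - (j%:R - n%:R) * h - mu) + (nu - mu) by ring.
  apply: le_trans (ler_normD _ _) _; have := ler_normB (v - (i%:R - n%:R) * h - nu) (v - (j%:R - n%:R) * h - mu). by have := ler_normB nu mu; lra.
have c2 : 1 <= `|(j%:R : R) - i%:R|.
  case: (ltngtP j i) nji => // ji _.
    by rewrite distrC ger0_norm ?subr_ge0 ?ler_nat ?(ltnW ji)// lerBrDr addrC natr1 ler_nat.
  by rewrite ger0_norm ?subr_ge0 ?ler_nat ?(ltnW ji)// lerBrDr addrC natr1 ler_nat.
have c4 := ler_wpM2r h0 c2; rewrite normrM (ger0_norm h0) in c1; have := le_trans c4 c1.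
rewrite mul1r hE; lra.
Qed.

(** [first_variation] for the sum of the weighted bumps as shrinking term and a radial profile of F
    as enlarging term. Loops of length at least s + eps are covered by [long_length], all others by
    [strip_length]. *)
Lemma tents_area (x : M) (r r' b0 eps wp e1 om : R) (u F : M -> R) (m : nat)
  (chi : nat -> M -> R) (K Q : nat -> set M) (kp : nat -> R) : 0 < r -> r < r' -> 0 < b0 -> 0 < eps -> 4 * r + eps < s -> eps <= s -> 0 <= e1 -> e1 <= 1 / 8 ->
  msmooth u -> msmooth F -> lip G u (1 + e1) -> lip G F (1 + e1) -> (forall y, dist G x y <= F y) -> (forall y, F y <= dist G x y + 2 * e1) ->
  0 <= om -> wp + eps / 2 + e1 * s <= om -> (forall j, (j < m)%N -> [/\ [/\ msmooth (chi j), forall y, 0 <= chi j y <= 1, closed (K j) & forall y, ~ K j y -> chi j y = 0],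
    borel (Q j), Q j `<=` K j & forall y, Q j y -> 1 <= chi j y]) ->
  (forall j, (j < m)%N -> 0 <= kp j <= b0) -> (forall j y, (j < m)%N -> K j y -> dist G x y < r /\ kp j <= r - F y) ->
  (forall j i y y', (j < m)%N -> (i < m)%N -> K j y -> K i y' -> dist G y y' <= `|u y - u y'| + 2 * wp) -> (forall j i y, (j < m)%N -> (i < m)%N -> K j y -> K i y -> j = i) ->
  (2 - (1 + e1) ^+ 2) / 2 * (\sum_(i < m) kp i * a (Q i)) <= 2 * om * (1 + e1) * a [set y | dist G x y < r'].
Proof.
move=> rp rr' b00 eps0 rse eps3 e10 e18 su sF lu lF FD FU om0 omE HB kpb KF gap disj.
have [_ s0] := systole_fin U cM nsc.
have e15 : e1 <= 1 by lra.
have e1k0 : 0 <= 1 + e1 by lra.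
have e1k2 : (1 + e1) ^+ 2 <= 2.
  have := ler_pM e10 e10 e18 e18; rewrite sqrrD expr1n mul1r mulr2n expr2; lra.
have lip2 : 1 + e1 <= 2 by lra.
have kp0 j : (j < m)%N -> 0 <= kp j by move=> /kpb/andP[].
have KP' j y : (j < m)%N -> K j y -> dist G x y < r by move=> jm /(KF j y jm)[].
have kpF j y : (j < m)%N -> K j y -> kp j <= r - F y by move=> jm /(KF j y jm)[].
(* The profile falls to 0 at r2 < r', so psi vanishes off the ball of radius r', F being at least
   the distance from x. *)
pose r2 := (r + r') / 2; have [r2r r2r'] : r < r2 /\ r2 < r' by rewrite /r2; split; lra.
have [B HBd] := dist_bounded x.
(* A strict upper bound for F, beyond r2, as [calibrating_function] requires. *)
pose B2 := Num.max (B + 2 * e1 + 1) (r2 + 1).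
have B21 : B + 2 * e1 + 1 <= B2 by rewrite le_max lexx.
have B22 : r2 + 1 <= B2 by rewrite le_max lexx orbT.
clearbody r2 B2; have r2B : r2 < B2 by lra.
have [hh [Phi [hhE dPhi hh01 hh0 PhiF]]] := calibrating_function rp r2r r2B.
have F0 y : 0 <= F y by apply: le_trans (FD y); exact: dist_ge0.
have FB y : F y < B2 by have := FU y; have := HBd y; lra.
have Y0 : 0 <= 2 * om * (1 + e1) by rewrite !mulr_ge0.
pose KK := [set y | exists2 j, (j < m)%N & K j y].
pose K' j := if (j < m)%N then K j else set0.
have clKK : closed KK.
  have -> : KK = [set y | exists2 j, (j < m)%N & K' j y].
    by apply/seteqP; split => y [j jm Kj]; exists j => //; move: Kj; rewrite /K' jm.
  apply: closed_finite_union => j; rewrite /K'; case: ifP => [jm|_]; last exact: closed0. by have [[_ _ cK _] _ _ _] := HB j jm.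
pose X y := \sum_(j <- iota 0 m) kp j * chi j y.
have sX : msmooth X.
  apply: msmooth_sum => j; rewrite mem_iota add0n => /andP[_ jm]. by apply: msmoothM; [exact: msmooth_cst|have [[]] := HB j jm].
have XK j y : (j < m)%N -> K j y -> X y = kp j * chi j y.
  move=> jm Ky; rewrite /X (bigD1_seq j) ?iota_uniq ?mem_iota ?add0n// big1_seq; first by rewrite [LHS]addr0. move=> i /andP[nij].
  rewrite mem_iota add0n => /andP[_ im]; have [[_ _ _ c0] _ _ _] := HB i im. by rewrite c0 ?mulr0// => Ki; move/eqP: nij; apply; exact: disj Ki Ky.
have X0 y : ~ KK y -> X y = 0.
  move=> nK; rewrite /X big1_seq// => i; rewrite mem_iota add0n => /andP[_ /andP[_ im]]. by have [[_ _ _ c0] _ _ _] := HB i im; rewrite c0 ?mulr0// => Ki; apply: nK; exists i.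
have Xb y : 0 <= X y <= b0.
  have [[j jm Kj]|nK] := pselect (KK y); last by rewrite X0// lexx ltW. rewrite (XK j y jm Kj); have [[_ c01 _ _] _ _ _] := HB j jm; have /andP[c0 c1] := c01 y.
  have /andP[kj0 kb] := kpb j jm; by rewrite mulr_ge0//= (le_trans _ kb)// ler_piMr.
pose psi y := 2 * om * (1 + e1) * hh (F y).
have spsi : msmooth psi.
  have -> : psi = (fun y => 2 * om * (1 + e1) * (1 + (-1) * step ((F y + - r) * (r2 - r)^-1))).
    by apply/funext => y; rewrite /psi hhE mulN1r.
  apply: msmoothM; first exact: msmooth_cst. apply: msmoothD; first exact: msmooth_cst. apply: msmoothM; first exact: msmooth_cst.
  apply: (msmooth_step (F := fun y => (F y + - r) * (r2 - r)^-1)). apply: msmoothM; last exact: msmooth_cst. by apply: msmoothD => //; exact: msmooth_cst.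
have psib y : 0 <= psi y <= 2 * om * (1 + e1).
  by have /andP[g0 g1] := hh01 (F y); rewrite /psi mulr_ge0//= ler_piMr.
have psi0 y : ~ [set y | dist G x y < r'] y -> psi y = 0.
  move=> /negP; rewrite /= -leNgt => d; rewrite /psi hh0 ?mulr0//. by apply: le_trans (FD y); apply: le_trans d; exact: ltW.
pose Y := 2 * om * (1 + e1); pose C := (Y + 3 * b0) ^+ 2 / 2.
have C0 : 0 <= C by rewrite divr_ge0 ?sqr_ge0.
have YZ : 0 < Y + 3 * b0 by rewrite ltr_wpDl// mulr_gt0.
(* The first bound is the range of [varied_nrm], the second that of [long_length]. *)
pose t0 := Num.min (1 / (Y + 3 * b0)) (eps / (2 * (b0 * (s + eps)))).
have se0 : 0 < s + eps by rewrite addr_gt0.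
have t00 : 0 < t0 by rewrite lt_min !divr_gt0// !mulr_gt0.
pose Qn j := if (j < m)%N then Q j else set0.
pose kn j := if (j < m)%N then kp j else 0.
have bQ j : borel (Qn j).
  by rewrite /Qn; case: ifP => [jm|_]; [have [] := HB j jm|apply: borel_open; exact: open0].
have QK j y : Qn j y -> (j < m)%N /\ K j y.
  by rewrite /Qn; case: ifP => // jm Qy; split=> //; have [_ _ QK _] := HB j jm; exact: QK.
have tQ : trivIset setT Qn.
  by move=> i j _ _ [y [/QK[im Ki] /QK[jm Kj]]]; exact: disj Ki Kj.
have QP j : Qn j `<=` [set y | dist G x y < r'].
  by move=> y /QK[jm Kj] /=; apply: lt_trans (KP' j y jm Kj) _.
have kQ j y : Qn j y -> kn j <= X y.
  move=> Qy; have [jm Kj] := QK j y Qy; rewrite (XK j y jm Kj) /kn jm. rewrite /Qn jm in Qy; have [_ _ _ q1] := HB j jm; rewrite ler_peMr ?kp0//; exact: q1.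
have kn0 j : 0 <= kn j by rewrite /kn; case: ifP => // jm; exact: kp0.
have bP : borel [set y | dist G x y < r'] by apply: borel_open; exact: open_ball.
have := @first_variation _ _ G U cM nsc ext psi X u (1 + e1) Y b0 C t0 [set y | dist G x y < r'] Qn kn m
   spsi sX su e1k0 e1k2 lu Y0 psib Xb psi0 bP bQ tQ QP kQ kn0 t00 C0.
move=> FV; have {}FV : (2 - (1 + e1) ^+ 2) / 2 * (\sum_(i < m) kn i * a (Qn i)) <= Y * a [set y | dist G x y < r'].
  apply: FV => t G' k l l' t1 t2 HG ek hl hl'. have tt1 : t * (Y + 3 * b0) <= 1.
    by apply: ltW; rewrite -ltr_pdivlMr//; apply: lt_le_trans t2 _; rewrite ge_min lexx.
  have tt2 : 2 * (t * b0 * (s + eps)) <= eps.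
    have : t <= eps / (2 * (b0 * (s + eps))) by apply: ltW; apply: lt_le_trans t2 _; rewrite ge_min lexx orbT. by rewrite ler_pdivlMr ?mulr_gt0//; congr (_ <= _); ring.
  have lu2 : lip G u 2 by move=> p v v' cv; apply: le_trans (lu p v v' cv) _; rewrite ler_wpM2r ?nrm_ge0. have [sl|ls] := leP (s + eps) l.
    exact: (long_length s0 eps0 lu2 Xb psib t1 tt1 tt2 HG hl sl hl').
  apply: (strip_length (x := x) (r := r) (eps := eps) (wp := wp) (e := e1) (om := om) (psi := psi) (chi := X) (u := u) (F := F) (h := hh) (Phi := Phi) (K := KK)
     cM nsc eps0 rse eps3 e10 e15 su sF sX lu lF clKK _ X0 Xb psib FD _ _ _ _ omE (fun y => erefl) om0 t1 tt1 HG ek hl ls hl').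
  - move=> y [j jm Kj]; split; first exact: KP' Kj. rewrite (XK j y jm Kj); apply: le_trans (kpF j y jm Kj). have [[_ c01 _ _] _ _ _] := HB j jm; have /andP[c0 c1] := c01 y.
    by rewrite ler_piMr// kp0.
  - by move=> y y' [j jm Kj] [i im Ki]; exact: gap Kj Ki.
  - by move=> y; apply: dPhi; rewrite F0 FB.
  - by move=> y; have /andP[] := hh01 (F y).
  - by move=> y y' g1 g2; exact: PhiF (F0 y) g1 g2 (FB y').
move: FV; congr (_ * _ <= _); apply: eq_bigr => i _; by rewrite /kn /Qn ltn_ord.
Qed.

Lemma near_bounds (p q e : R) : `|p - q| <= e -> q <= p + e /\ p + e <= q + 2 * e.
Proof. by rewrite ler_norml => /andP[h1 h2]; split; lra. Qed.

Lemma centered_index (j n : nat) : (j < n.*2.+1)%N -> `|(j%:R : R) - n%:R| <= n%:R.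
Proof.
move=> jn; have j2 : (j%:R : R) <= 2 * n%:R by rewrite -natrM ler_nat mul2n -ltnS.
by have := ler0n R j; rewrite ler_norml => j0; apply/andP; split; lra.
Qed.

Lemma tent_slack (d l b0 r w e v : R) : w <= (r - b0) / 32 -> e <= (r - b0) / 16 -> b0 < r -> l <= b0 ->
  d <= l + (r - b0) / 16 + 3 * w -> v <= d + 2 * e -> d < r /\ b0 - l <= r - v.
Proof. by move=> h1 h2 h3 h4 h5 h6; split; lra. Qed.

Lemma area_bound_step (th r r' b0 : R) (x : M) : 0 < th -> th <= 1 / 8 -> 0 < b0 -> b0 < r -> r < r' -> 4 * r < s ->
  b0 ^+ 2 / 2 * (1 - 6 * th) <= a [set y | dist G x y < r'] * (1 + 24 * th).
Proof.
move=> th0 th1 b00 b0r rr' rs; have [_ s0] := systole_fin U cM nsc.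
pose kap := th ^+ 3 / 800; have kapE : kap = th ^+ 3 / 800 by [].
pose eta := kap ^+ 2; have etaE : eta = kap ^+ 2 by [].
have p3 := exprn_gt0 3 th0.
have t3 : th ^+ 3 <= th / 8.
  have t2 : th ^+ 2 <= th / 8 by rewrite expr2; have := ler_wpM2l (ltW th0) th1; lra.
  by rewrite exprS; have := ler_wpM2l (ltW th0) t2; have := ler_wpM2l (ltW th0) th1; rewrite expr2 in t2 *; lra.
have kap0 : 0 < kap by rewrite /kap; lra.
have kap1 : kap <= 1 / 100 by rewrite /kap; lra.
have [eta0 eta1 eta2] := eta_bounds kap0 kap1 (erefl eta).
have etath : eta <= th by move: eta1; rewrite /kap; lra.
have eta11 : eta <= 1 by lra.
clearbody eta kap.
have [rho rho0 uc] := uniform_chart G cM eta0 eta11.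
(* An upper bound for L, ensured by taking n large: boxes lie in the uniform charts, and chords
   around parameters up to b0 stay within parameter r. *)
pose m0 := Num.min (rho / 2) ((r - b0) / 2).
have m00 : 0 < m0 by rewrite lt_min !divr_gt0// subr_gt0.
have m01 : m0 <= rho / 2 by rewrite ge_min lexx.
have m02 : m0 <= (r - b0) / 2 by rewrite ge_min lexx orbT.
have [n [n0 nb]] := natr_large (b0 / (th * m0)).
have nR : 0 < (n%:R : R) by rewrite ltr0n.
pose h := b0 / n%:R; have h0 : 0 < h by rewrite divr_gt0.
have hn : b0 = n%:R * h by rewrite /h mulrC divfK// gt_eqF.
pose w := h / (2 * (1 + 2 * th)).
have q0 : 0 < 2 * (1 + 2 * th) by lra.
have w0 : 0 < w by rewrite divr_gt0.
have hE : h = 2 * w * (1 + 2 * th) by rewrite /w; field; rewrite gt_eqF//; lra.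
pose L := 2 * w / th.
have L0 : 0 < L by rewrite divr_gt0// mulr_gt0.
have wE : w = th / 2 * L by rewrite /L; field; rewrite gt_eqF.
have Lm : L <= m0.
  have k1 : h <= th * m0.
    rewrite -(ler_pM2l nR) -hn; have := nb; rewrite ler_pdivrMr ?mulr_gt0//.
  have k2 : 2 * w <= h by rewrite hE; have := mulr_gt0 w0 th0; lra. by rewrite /L ler_pdivrMr//; lra.
have Lrho : L < rho by lra.
have wL : w <= L / 16 by rewrite wE; have := ler_wpM2r (ltW L0) th1; lra.
clearbody w L h.
pose d0 := r - b0; have d00 : 0 < d0 by rewrite subr_gt0.
have etaL : 0 < eta * L by rewrite mulr_gt0.
have thw : 0 < th * w by rewrite mulr_gt0.
(* The smoothing error must be within the tolerance of the boxes, at most th, negligible in om after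
   multiplication by s, and small against the gap r - b0. *)
pose e1 := Num.min (eta * L / 2) (Num.min th (Num.min (th * w / (2 * s)) (d0 / 16))).
have e10 : 0 < e1 by rewrite !lt_min !divr_gt0// ?th0 ?mulr_gt0.
have e11 : e1 <= eta * L / 2 by rewrite ge_min lexx.
have e12 : e1 <= th by rewrite !ge_min lexx !orbT.
have e13 : e1 * s <= th * w / 2.
  have : e1 * (2 * s) <= th * w by rewrite -ler_pdivlMr ?mulr_gt0// !ge_min lexx !orbT. lra.
have e14 : e1 <= d0 / 16 by rewrite !ge_min lexx !orbT.
(* In turn: negligible in om, 4 r + eps < s, and eps <= s. *)
pose eps := Num.min (th * w) (Num.min ((s - 4 * r) / 2) s).
have eps0 : 0 < eps by rewrite !lt_min thw s0 divr_gt0// subr_gt0.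
have eps1 : eps <= th * w by rewrite ge_min lexx.
have eps2 : eps <= (s - 4 * r) / 2 by rewrite !ge_min lexx !orbT.
have eps3 : eps <= s by rewrite !ge_min lexx !orbT.
pose om := w * (1 + 2 * th) + eps / 2 + e1 * s.
have e1s : 0 < e1 * s by rewrite mulr_gt0.
have om0 : 0 <= om by rewrite /om; lra.
have omw : om <= w * (1 + 3 * th) by rewrite /om; lra.
have rse : 4 * r + eps < s by lra.
have e18 : e1 <= 1 / 8 by lra.
have tw1 : th * w <= w / 8 by have := ler_wpM2r (ltW w0) th1; lra.
have b0w : b0 + w <= r by lra.
have b0L : b0 + L <= r by lra.
have e11' : 2 * e1 <= eta * L by lra.
have w32 : w <= d0 / 32 by rewrite /d0; lra.
clearbody e1 eps; have rp : 0 < r by lra.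
have rs' : 4 * r <= s by exact: ltW.
have d016 : 0 < d0 / 16 by rewrite divr_gt0.
have [zz [dxz chain]] := geodesic_chain U cM nsc ext x d016 e10 rp rs'.
have [F1 [sF1 F1E lF1]] := smooth_approximation cM (fun y y' => dist_lip G (zz (- r)) y y') e10.
have [F2 [sF2 F2E lF2]] := smooth_approximation cM (fun y y' => dist_lip G x y y') e10.
have lipc (H : M -> R) (c k : R) : msmooth H -> lip G H k -> lip G (fun y => H y + c) k.
  move=> sH lH p v v' cv; have d1 := @diff_derivable _ _ _ _ _ v' (msmooth_diff sH cv). have -> : dM (fun y => H y + c) p v v' = dM H p v v'.
    have d2 : derivable (fun _ : R * R => c) v v' by exact: derivable_cst.
    rewrite /dM; have -> : (fun y => H y + c) \o chart_inv p = (H \o chart_inv p) + (fun _ : R * R => c) by apply/funext. by rewrite (deriveD d1 d2) derive_cst addr0.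
  exact: lH.
(* u is about p at [zz p], being measured from the end [zz (- r)]; the shift of F by e1 makes it at
   least the distance from x. *)
pose u y := F1 y + - r; pose F y := F2 y + e1.
have su : msmooth u by apply: msmoothD => //; exact: msmooth_cst.
have sF : msmooth F by apply: msmoothD => //; exact: msmooth_cst.
have lu : lip G u (1 + e1) := lipc F1 (- r) _ sF1 lF1.
have lF : lip G F (1 + e1) := lipc F2 e1 _ sF2 lF2.
have uE y : `|u y - (dist G (zz (- r)) y - r)| <= e1.
  by have := F1E y; congr (`| _ | <= _); rewrite /u; ring.
have FD y : dist G x y <= F y by exact: (near_bounds (F2E y)).1.
have FU y : F y <= dist G x y + 2 * e1 by exact: (near_bounds (F2E y)).2.
have [chi [K [Q HB]]] := box_chain th0 th1 L0 wE kapE etaE Lrho hE hn b0L (ltW e10) e11' uc chain uE.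
pose lam (j : nat) : R := (j%:R - n%:R) * h.
pose kp (j : nat) : R := b0 - `|lam j|.
pose m := n.*2.+1.
have lamb j : (j < m)%N -> `|lam j| <= b0.
  by move=> jm; rewrite /lam normrM (gtr0_norm h0) {1}hn ler_pM2r//; exact: centered_index.
have kp0 j : (j < m)%N -> 0 <= kp j by move=> /lamb; rewrite /kp subr_ge0.
have zzle p q : - r <= p -> p <= q -> q <= r -> dist G (zz p) (zz q) <= q - p.
  by move=> h1 h2 h3; have /andP[] := chain p q h1 h2 h3.
have KP j y : (j < m)%N -> K j y -> dist G x y <= `|lam j| + d0 / 16 + 3 * w.
  move=> jm Ky; have [_ _ _ _ /(_ y Ky)[mu [mu1 mu2 mu3]]] := HB j jm.
  exact: (@chain_position zz r b0 w th zzle b0w (ltW w0) tw1 x y (lam j) mu (d0 / 16) (lamb j jm) mu1 (ltW dxz) mu3).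
have KF j y : (j < m)%N -> K j y -> dist G x y < r /\ kp j <= r - F y.
  by move=> jm Ky; exact: tent_slack w32 e14 b0r (lamb j jm) (KP j y jm Ky) (FU y).
have gap j i y y' : (j < m)%N -> (i < m)%N -> K j y -> K i y' -> dist G y y' <= `|u y - u y'| + 2 * (w * (1 + 2 * th)).
  move=> jm im Ky Ky'; have [_ _ _ _ /(_ y Ky)[mu [mu1 mu2 mu3]]] := HB j jm. have [_ _ _ _ /(_ y' Ky')[nu [nu1 nu2 nu3]]] := HB i im.
  exact: (chain_gap zzle b0w (lamb j jm) mu1 (lamb i im) nu1 mu2 nu2 mu3 nu3).
have disj j i y : (j < m)%N -> (i < m)%N -> K j y -> K i y -> j = i.
  move=> jm im Ky Ky'; have [_ _ _ _ /(_ y Ky)[mu [mu1 mu2 _]]] := HB j jm. have [_ _ _ _ /(_ y Ky')[nu [nu1 nu2 _]]] := HB i im. exact: steps_apart w0 th0 hE mu1 nu1 mu2 nu2.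
have kpb j : (j < m)%N -> 0 <= kp j <= b0.
  by move=> jm; rewrite kp0//= /kp lerBlDr lerDl.
have HB' j : (j < m)%N -> [/\ [/\ msmooth (chi j), forall y, 0 <= chi j y <= 1, closed (K j) & forall y, ~ K j y -> chi j y = 0],
    borel (Q j), Q j `<=` K j & forall y, Q j y -> 1 <= chi j y].
  by move=> /HB[h1 h2 h3 [h4 _] _].
have FV := @tents_area x r r' b0 eps (w * (1 + 2 * th)) e1 om u F m chi K Q kp rp rr' b00 eps0 rse eps3 (ltW e10) e18 su sF lu lF FD FU
  om0 (lexx om) HB' kpb KF gap disj.
have A0 : 0 <= a [set y | dist G x y < r'] by exact: fine_area_ge0.
apply: (variation_arith w0 th0 th1 A0 b00 hE hn (ltW eta0) etath (ltW e10) e12 omw _ FV).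
have <- : \sum_(i < m) kp i * ((1 - eta) * (4 * ((1 - th) * w) ^+ 2)) = h * n%:R ^+ 2 * ((1 - eta) * (4 * ((1 - th) * w) ^+ 2)).
  rewrite -mulr_suml; congr (_ * _); rewrite -tent_sum mulr_sumr; apply: eq_bigr => j _. rewrite /kp /lam normrM (gtr0_norm h0) {1}hn; ring.
apply: ler_sum => j _; rewrite ler_wpM2l ?kp0//.
by have [_ _ _ [_ h5] _] := HB j (ltn_ord j).
Qed.

(** The limits th to 0 and b0 to r in [area_bound_step]. If the area were smaller, the bound would
    fail for b0 halfway between r and the square root of twice the area. *)
Lemma area_ball (x : M) (r : R) : 0 < r -> 4 * r <= s -> r ^+ 2 / 2 <= a [set y | dist G x y < r].
Proof.
move=> r0 rs; have A0 : 0 <= a [set y | dist G x y < r] by exact: fine_area_ge0.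
have H b0 : 0 < b0 -> b0 < r -> b0 ^+ 2 / 2 <= a [set y | dist G x y < r].
  move=> b00 b0r; apply: small_error_le => //; first by rewrite divr_ge0 ?sqr_ge0. move=> th th0 th1; pose r1 := (b0 + r) / 2.
  by apply: (@area_bound_step th r1 r b0) => //; rewrite /r1; lra.
rewrite leNgt; apply/negP => lt.
pose q := Num.sqrt (2 * a [set y | dist G x y < r]).
have q2 : q ^+ 2 = 2 * a [set y | dist G x y < r] by rewrite sqr_sqrtr// mulr_ge0.
have qr : q < r by rewrite -ltr_sqr ?nnegrE ?sqrtr_ge0 ?(ltW r0)// q2; lra.
have qb : q < (q + r) / 2 by lra.
have q0 : 0 <= q by exact: sqrtr_ge0.
have := H ((q + r) / 2) (ltac:(lra)) (ltac:(lra)).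
have : q ^+ 2 < ((q + r) / 2) ^+ 2 by rewrite ltr_sqr ?nnegrE//; lra.
rewrite q2; lra.
Qed.

(** Each point of M is assigned to the first net point within tau; m is the area of the resulting
    Borel cell. The cells that meet the ball of radius r have centres within r + tau. *)
Lemma mass_net (r tau : R) : 0 < r -> 4 * r <= s -> 0 < tau -> exists (zs : seq M) (m : M -> R),
  [/\ uniq zs, forall y, exists2 z, z \in zs & dist G z y < tau, forall z, 0 <= m z,
    \sum_(z <- zs) m z <= a [set: M] & forall y, r ^+ 2 / 2 <= \sum_(z <- zs | dist G y z < r + tau) m z].
Proof.
move=> r0 rs tau0; have [zs0 net0] := finite_net G cM tau0.
pose zs := undup zs0; have net y : exists2 z, z \in zs & dist G z y < tau.
  by have [z zz zy] := net0 y; exists z; rewrite // mem_undup.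
have uz : uniq zs by exact: undup_uniq.
have [u0 _] := nonclosed_lift_ex U nsc; pose z i := nth (cover_proj u0) zs i.
pose O i := [set y | dist G (z i) y < tau].
pose C i := O i `\` \bigcup_(j in [set j | (j < i)%N]) O j.
have bC i : borel (C i).
  apply: borelD; apply: borel_open; first exact: open_ball. by apply: bigcup_open => j _; exact: open_ball.
have tC : trivIset setT C.
  move=> i j _ _ [y [[Oi ni] [Oj nj]]]; apply/eqP; apply: contraT => nij; case: (ltngtP i j) nij => // ij _.
    by case: nj; exists i.
  by case: ni; exists j.
have cC y : exists2 i, (i < size zs)%N & C i y.
  have [z1 z1z z1y] := net y; have ex : exists i, asbool (O i y).
    by exists (index z1 zs); apply/asboolP; rewrite /O /z /= nth_index.
  have Om : O (ex_minn ex) y by case: ex_minnP => i /asboolP. have mn j : O j y -> (ex_minn ex <= j)%N by move=> Oj; case: ex_minnP => i _; apply; exact/asboolP.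
  exists (ex_minn ex).
    by apply: leq_ltn_trans (mn (index z1 zs) _) _; rewrite ?index_mem// /O /z /= nth_index.
  by split=> // -[j /= ji Oj]; have := mn j Oj; rewrite leqNgt ji.
pose m y := a (C (index y zs)).
have mE i : (i < size zs)%N -> m (z i) = a (C i) by move=> iz; rewrite /m /z index_uniq.
exists zs, m; split=> //; first by move=> y; exact: fine_area_ge0.
  rewrite (big_nth (cover_proj u0)) big_mkord -lee_fin -sumEFin -(area_finE G cM). have := area_packing G [set: M] (size zs) bC tC; congr (_ <= _)%E.
  by apply: eq_bigr => i _; rewrite setTI (area_finE G cM); congr (_%:E); rewrite -mE.
move=> y; apply: le_trans (area_ball y r0 rs) _.
rewrite (big_nth (cover_proj u0)) big_mkord big_mkcond -lee_fin -sumEFin -(area_finE G cM).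
apply: le_trans (area_cover G bC (fun w _ => cC w)) _.
apply: lee_sum => i _; rewrite -/(z i); case: ifP => [_|/negbT yz].
  by rewrite mE// -(area_finE G cM); apply: le_area; exact: subIsetr.
have -> : [set w | dist G y w < r] `&` C i = set0.
  apply/seteqP; split=> // w [/= yw [/= zw _]]; move/negP: yz; apply. by have : dist G (z i) w < tau := zw; have := dist_triangle G y w (z i); rewrite (dist_sym G w); lra.
have := @area_superadd _ _ G set0 set0 set0 (setI0 _); rewrite setU0 => /(_ (@subset_refl _ _)).
by rewrite (area_finE G cM) -EFinD !lee_fin; lra.
Qed.

(** * Growth of the mass of lifted net points *)

Local Notation GU := (cover_metric U).
Local Notation f := (@cover_proj R M G U).
Variables (r tau q : R) (zs : seq M) (m : M -> R) (x0 : U).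
Hypotheses (r0 : 0 < r) (rs : 4 * r <= s) (tau0 : 0 < tau) (q0 : 0 < q) (qs : 2 * (q + 2 * r + 2 * tau) <= s).
Hypotheses (uz : uniq zs) (net : forall y, exists2 z, z \in zs & dist G z y < tau) (m0 : forall z, 0 <= m z).
Hypotheses (mT : \sum_(z <- zs) m z <= a [set: M])
  (mB : forall y, r ^+ 2 / 2 <= \sum_(z <- zs | dist G y z < r + tau) m z).
Local Notation c := (r ^+ 2 / 2).

(** Bounds the mass in a ball of the cover through its finite subsets, as finiteness of the set of
    lifted net points is only a consequence. *)
Definition mass_le (Rr B : R) := forall S : seq U, uniq S ->
  (forall p, p \in S -> f p \in zs /\ dist GU x0 p < Rr) -> \sum_(p <- S) m (f p) <= B.

Lemma proj_uniq (S : seq U) p' (d : R) : uniq S -> 2 * d <= s ->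
  (forall p, p \in S -> dist GU p' p < d) -> uniq (map f S).
Proof.
move=> uS ds Sd; rewrite map_inj_in_uniq// => p1 p2 S1 S2 f12; apply/eqP; apply: contraT => p12.
have := fiber_dist cM nsc f12 p12; have := Sd _ S1; have := Sd _ S2.
have := dist_triangle GU p1 p' p2; rewrite (dist_sym GU p1 p'); have := ds; lra.
Qed.

(** Points of one fibre are at least sys apart, so the projection is injective on S and the total
    mass on M is an upper bound. *)
Lemma near_mass (S : seq U) p' (d : R) : uniq S -> 2 * d <= s ->
  (forall p, p \in S -> f p \in zs /\ dist GU p' p < d) -> \sum_(p <- S) m (f p) <= a [set: M].
Proof.
move=> uS ds Sd; rewrite -(big_map f xpredT m); apply: le_trans mT.
apply: uniq_sub_sum => //; first by apply: proj_uniq uS ds (fun p pS => (Sd p pS).2).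
by move=> y /mapP[p /Sd[fz _] ->].
Qed.

Lemma lift_net u : exists L : seq U, [/\ uniq L, forall p, p \in L -> f p \in zs /\ dist GU u p < r + tau &
  c <= \sum_(p <- L) m (f p)].
Proof.
have /choice[h Hh] : forall z, exists p, dist G (f u) z < r + tau -> f p = z /\ dist GU u p < r + tau.
  move=> z; have [d|nd] := pselect (dist G (f u) z < r + tau); last by exists u. by have [p fp up] := lift_dist d; exists p.
pose Z := [seq z <- zs | dist G (f u) z < r + tau].
have hZ z : z \in Z -> z \in zs /\ (f (h z) = z /\ dist GU u (h z) < r + tau).
  by rewrite mem_filter => /andP[d zz]; split=> //; exact: Hh.
exists (map h Z); split.
- rewrite map_inj_in_uniq ?filter_uniq// => z1 z2 /hZ[_ [f1 _]] /hZ[_ [f2 _]] h12. by rewrite -f1 -f2 h12.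
- by move=> p /mapP[z /hZ[zz [fz d]] ->]; rewrite fz.
have E : \sum_(z <- Z) m (f (h z)) = \sum_(z <- zs | dist G (f u) z < r + tau) m z.
  by rewrite -[RHS]big_filter; apply: eq_big_seq => z /hZ[_ [-> _]].
by rewrite big_map E.
Qed.

(** Double counting of the pairs p, p' with p' near [y p]: every p sees mass at least c around
    [y p], and every p' is charged weight at most K. *)
Lemma mass_count (S : seq U) (om : U -> R) (y : U -> U) (K B Rr : R) :
  (forall p, 0 <= om p) -> (forall p, p \in S -> dist GU x0 (y p) < Rr - r - tau) -> 0 <= K -> (forall p', \sum_(p <- S | dist GU (y p) p' < r + tau) om p <= K) -> mass_le Rr B ->
  c * \sum_(p <- S) om p <= K * B.
Proof.
move=> om0 yS K0 HK HB; have [L HL] := choice (fun p => lift_net (y p)).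
pose S' := undup (flatten (map L S)).
have SS' p : p \in S -> {subset L p <= [seq p' <- S' | dist GU (y p) p' < r + tau]}.
  move=> pS p' pL; have [_ /(_ _ pL)[_ d] _] := HL p. rewrite mem_filter d mem_undup; apply/flattenP; exists (L p) => //; exact: map_f.
have HS' : \sum_(p' <- S') m (f p') <= B.
  apply: HB; first exact: undup_uniq. move=> p'; rewrite mem_undup => /flattenP[_ /mapP[p pS ->] pL]; have [_ /(_ _ pL)[fz d] _] := HL p.
  by split=> //; have := yS p pS; have := dist_triangle GU x0 (y p) p'; lra.
apply: le_trans (ler_wpM2l K0 HS'); rewrite !mulr_sumr.
apply: (@le_trans _ _ (\sum_(p <- S) \sum_(p' <- S' | dist GU (y p) p' < r + tau) om p * m (f p'))).
  rewrite big_seq [leRHS]big_seq; apply: ler_sum => p pS; rewrite -mulr_sumr mulrC; apply: ler_wpM2l => //.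
  have [uL _ cL] := HL p; apply: le_trans cL _; rewrite -[leRHS]big_filter. by apply: uniq_sub_sum => // p'; exact: SS'.
under eq_bigr => p _ do rewrite big_mkcond.
rewrite exchange_big /=; apply: ler_sum => p' _; rewrite -big_mkcond -mulr_suml.
exact: ler_wpM2r.
Qed.

Let c0 : 0 < c. Proof. by rewrite divr_gt0// exprn_gt0. Qed.

Lemma mass_step (Rr B : R) : r + tau < Rr -> mass_le Rr B -> mass_le (Rr + q) (a [set: M] / c * B).
Proof.
move=> rR HB S uS HS; have hr := r0; have ht := tau0; have hq := q0; pose b := q + r + tau.
(* The point of a path from x0 to p that lies b before its end, or x0 if the path is shorter than b.
   With b = q + r + tau it lies in the ball of radius Rr - r - tau. *)
have /choice[y Hy] : forall p, exists y, dist GU x0 p < Rr + q ->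
    dist GU x0 y < Rr - r - tau /\ dist GU y p <= b.
  move=> p; have [d|nd] := pselect (dist GU x0 p < Rr + q); last by exists p. have [l [k [ak k0 k1]] ll] := dist_lt d; have l0 := arc_ge0 ak. have hl : 0 <= Num.max 0 (l - b) <= l.
    by rewrite le_max lexx/= ge_max l0 /b; lra.
  have [t [t01 w1 w2]] := arc_cut ak hl; exists (k t) => _. have := warc_dist w1; have := warc_dist w2; rewrite k0 k1 => d2 d1; split.
    by apply: le_lt_trans d1 _; rewrite gt_max /b; apply/andP; split; lra.
  by apply: le_trans d2 _; rewrite lerBlDr -lerBlDl le_max lexx orbT.
have A0 : 0 <= a [set: M] by exact: fine_area_ge0.
rewrite mulrAC ler_pdivlMr// mulrC; apply: (@mass_count S (m \o f) y _ _ Rr) => //.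
- by move=> p /=.
- by move=> p /HS[_ /Hy[]].
move=> p'; rewrite -big_filter; apply: (@near_mass _ p' (q + 2 * r + 2 * tau)) => //.
  by rewrite filter_uniq.
move=> p; rewrite mem_filter => /andP[d pS]; have [fz /Hy[_ d2]] := HS p pS; split=> //.
by have := dist_triangle GU p' (y p) p; rewrite (dist_sym GU p' (y p)); rewrite /b in d2; lra.
Qed.

(** It starts with radius s/2, where the projection is injective on lifted net points, so that the
    total mass bounds the sum. *)
Lemma mass_iter n : mass_le (s / 2 + n%:R * q) (a [set: M] * (a [set: M] / c) ^+ n).
Proof.
have hr := r0; have ht := tau0; have hq := q0; have hs := qs.
elim: n => [|n IH].
  rewrite mul0r addr0 expr0 mulr1 => S uS HS; apply: (@near_mass S x0 (s / 2)) => //. by rewrite mulrC divfK.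
have -> : s / 2 + n.+1%:R * q = s / 2 + n%:R * q + q by rewrite -(natr1 n); ring.
have -> : a [set: M] * (a [set: M] / c) ^+ n.+1 = a [set: M] / c * (a [set: M] * (a [set: M] / c) ^+ n).
  by rewrite exprS mulrCA.
apply: mass_step => //; have := mulr_ge0 (ler0n R n) (ltW q0); lra.
Qed.

(** The same double counting with weight 1: near a given point there is at most one lift of each net
    point. This is needed because some net points may have mass 0. *)
Lemma count_le (S : seq U) (Rr B : R) : uniq S -> (forall p, p \in S -> f p \in zs /\ dist GU x0 p < Rr) ->
  mass_le (Rr + r + tau) B -> c * (size S)%:R <= (size zs)%:R * B.
Proof.
move=> uS HS HB; have hr := r0; have ht := tau0; have hq := q0.
have -> : (size S)%:R = \sum_(p <- S) (1 : R) by rewrite big_const_seq count_predT iter_addr addr0.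
apply: (@mass_count S (fun=> 1) id _ _ (Rr + r + tau)) => //.
  by move=> p /HS[_]; lra.
move=> p'; rewrite -big_filter big_const_seq count_predT iter_addr addr0 ler_nat.
rewrite -(size_map f); apply: uniq_leq_size.
  apply: (@proj_uniq _ p' (r + tau)); [by rewrite filter_uniq|have := qs; lra|]. by move=> p; rewrite mem_filter dist_sym => /andP[].
by move=> z /mapP[p]; rewrite mem_filter => /andP[_ /HS[fz _]] ->.
Qed.

(** The ball is covered by tau-balls around the lifted net points close to it, whose number is
    controlled by [count_le] and [mass_iter]. *)
Lemma ball_area_le (C Rr : R) n : 0 <= C -> (forall u, (area GU [set u' | (dist GU u u' < tau)%R] <= C%:E)%E) ->
  Rr + 2 * tau + r <= s / 2 + n%:R * q -> (area GU [set u | (dist GU x0 u < Rr)%R] <= ((size zs)%:R / c * C * a [set: M] * (a [set: M] / c) ^+ n)%:E)%E.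
Proof.
move=> C0 HC Rn; pose B := a [set: M] * (a [set: M] / c) ^+ n.
have HB : mass_le (Rr + tau + r + tau) B.
  by move=> S uS HS; apply: (@mass_iter n S uS) => p /HS[fz d]; split=> //; lra.
pose Q p := f p \in zs /\ dist GU x0 p < Rr + tau.
have szb (S : seq U) : uniq S -> (forall p, p \in S -> Q p) -> (size S)%:R <= (size zs)%:R / c * B.
  move=> uS HS; rewrite mulrAC ler_pdivlMr// mulrC; exact: count_le uS HS HB.
have [N [_ HN]] := natr_large ((size zs)%:R / c * B).
have [S [uS QS SQ]] : exists S : seq U, [/\ uniq S, forall p, p \in S -> Q p & forall p, Q p -> p \in S].
  apply: (@bounded_enumeration U Q N) => S uS HS; rewrite -(ler_nat R); exact: le_trans (szb S uS HS) HN.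
pose O i := [set u' | dist GU (nth x0 S i) u' < tau].
have bO i : borel (O i) by apply: borel_open; exact: open_ball.
have cv u : [set u | dist GU x0 u < Rr] u -> exists2 i, (i < size S)%N & O i u.
  move=> /= d; have [z zz zu] := net (f u); rewrite dist_sym in zu. have [p fp up] := lift_dist zu. have pS : p \in S.
    by apply: SQ; split; [rewrite fp|have := dist_triangle GU x0 u p; lra].
  by exists (index p S); rewrite ?index_mem// /O /= nth_index// dist_sym.
apply: le_trans (area_cover GU bO cv) _.
apply: (@le_trans _ _ (\sum_(i < size S) C%:E)%E).
  by apply: lee_sum => i _; apply: le_trans (HC (nth x0 S i)); apply: le_area; exact: subIsetr.
rewrite sumEFin lee_fin sumr_const card_ord -mulr_natl.
have := ler_wpM2r C0 (szb S uS QS); congr (_ <= _); rewrite /B; ring.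
Qed.

End AreaOfBalls.





(** * Uniform area bound for small balls of the cover *)

Section LiftedBalls.
Variables (R : realType) (M : surface R) (G : riemannian_metric M) (U : universal_cover G).
Hypothesis cM : compact [set: M].
Local Notation GU := (cover_metric U).
Local Notation f := (@cover_proj R M G U).

(** A small ball lies in one sheet over a compact chart piece, and [lifted_area_bound] does not
    depend on the sheet; finitely many pieces suffice downstairs. *)
Lemma uniform_ball_area : exists2 e : R, 0 < e & exists2 C : R, 0 < C &
  forall u, (area GU [set u' | (dist GU u u' < e)%R] <= C%:E)%E.
Proof.
pose Q z (r : R) := exists C : R, forall u e, 0 < e -> dist G z (f u) + e < r ->
  (area GU [set u' | (dist GU u u' < e)%R] <= C%:E)%E.
have HQ z : exists2 r, 0 < r & Q z r.
  have [V [oV Vz HV]] := evenly_covered U z. have [r r0 [K [cK Kz BK KV]]] := compact_chart_in G (open_nbhs_nbhs (conj oV Vz)).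
  have [C HC] := lifted_area_bound G cK Kz; exists r => //; exists C => u e e0 due. have BV y : dist G z y < r -> V y by move=> d; exact: KV (BK y d).
  have Vu : V (f u) by apply: BV; lra. have [W [s [sec Wu]]] := HV u Vu. have [_ oW cs s1 s2] := sec.
  apply: le_trans (HC _ GU f W V s (cover_proj_smooth U) (@cover_proj_isometric _ _ _ U) oW oV cs s1 (fun w Ww => (s2 w Ww).2) KV).
  apply: le_area => u' /= d; have [l J le] := dist_lt d; exists (f u').
    apply: BK => /=; have := dist_triangle G z (f u) (f u'); have := dist_proj u u'; lra.
  apply: (section_end sec Wu J) => y dy; apply: BV. by have := dist_triangle G z (f u) y; lra.
have [e e0 He] := lebesgue_number G cM HQ.
have e2 : 0 < e / 2 by rewrite divr_gt0.
have [zs net] := finite_net G cM e2.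
pose P (z : M) (C : R) := forall u, dist G z (f u) < e / 2 -> (area GU [set u' | (dist GU u u' < e / 2)%R] <= C%:E)%E.
have [C C0 HC] : exists2 C : R, 0 < C & forall z, z \in zs -> P z C.
  apply: seq_bound => [z C C' h CC u d|z _]; first by apply: le_trans (h u d) _; rewrite lee_fin. have [z' [r' [[C HC] zr]]] := He z; exists C => u d; apply: HC => //.
  by have := dist_triangle G z' z (f u); lra.
exists (e / 2) => //; exists C => // u; have [z zz zu] := net (f u); exact: HC z zz u zu.
Qed.

End LiftedBalls.

(** * From exponential growth to the limit defining entropy *)

Section Entropy.
Variable R : realType.

Lemma lim_le_real (F : R -> \bar R) (B : R) : 0 <= B ->
  (forall e : R, 0 < e -> \forall r \near +oo%R, (F r <= (B + e)%:E)%E) -> (lim (F r @[r --> +oo%R]) <= B%:E)%E.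
Proof.
move=> B0 HF; have [cF|nF] := pselect (cvg (F r @[r --> +oo%R])); last first.
  (* A divergent [lim] takes the default value 0, whence the hypothesis [0 <= B]. *)
  by rewrite (dvgP nF) lee_fin.
apply/lee_addgt0Pr => e e0; rewrite -EFinD; apply: lime_le => //; exact: HF.
Qed.

Lemma lne_le (x : \bar R) (B : R) : 0 < B -> (x <= B%:E)%E -> (lne x <= (ln B)%:E)%E.
Proof.
move=> B0 xB; have [x0|x0] := leP x 0%E; first by rewrite le0_lneNy ?leNye.
by rewrite -lne_EFin// lee_lne// in_itv/= ?leey ?andbT ?lee_fin ltW.
Qed.

Lemma growth_rate (V : R -> \bar R) (D Gam q k : R) : 0 < D -> 1 <= Gam -> 0 < q ->
  (forall Rr n, Rr <= k + n%:R * q -> (V Rr <= (D * Gam ^+ n)%:E)%E) -> (lim ((lne (V r) * r^-1%:E)%E @[r --> +oo%R]) <= (ln Gam / q)%:E)%E.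
Proof.
move=> D0 G1 q0 HV; have g0 : 0 <= ln Gam by exact: ln_ge0.
apply: lim_le_real; first by rewrite divr_ge0// ltW.
move=> e e0; pose K := ln D + (1 + `|k| / q) * ln Gam.
near=> r; have r0 : 0 < r by near: r; exact: nbhs_pinfty_gt.
have Ker : K <= e * r by rewrite mulrC -ler_pdivrMr//; near: r; apply: nbhs_pinfty_ge; exact: num_real.
(* The number of steps of length q that reach radius r, up to one; the constants D and k disappear
   after division by r. *)
pose n := (Num.truncn ((r + `|k|) / q)).+1.
have x0 : 0 <= (r + `|k|) / q by rewrite divr_ge0 ?(ltW q0)// addr_ge0// ltW.
have n1 : (r + `|k|) / q <= n%:R by apply: ltW; exact: truncnS_gt.
have n2 : n%:R <= (r + `|k|) / q + 1 by rewrite /n -natr1 lerD2r truncn_le.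
have rn : r <= k + n%:R * q.
  by move: n1; rewrite ler_pdivrMr//; have := ler_norm (- k); rewrite normrN; lra.
have Dn : 0 < D * Gam ^+ n by rewrite mulr_gt0// exprn_gt0//; lra.
have h1 := lne_le Dn (HV _ _ rn).
have h2 : ln (D * Gam ^+ n) <= (ln Gam / q + e) * r.
  rewrite lnM ?posrE ?exprn_gt0//; last by lra. rewrite lnXn; last by lra. rewrite -mulr_natl; have := ler_wpM2r g0 n2.
  have -> : ((r + `|k|) / q + 1) * ln Gam = ln Gam / q * r + (1 + `|k| / q) * ln Gam by ring. by rewrite /K in Ker; lra.
apply: (@le_trans _ _ ((ln (D * Gam ^+ n))%:E * r^-1%:E)%E).
  by apply: lee_wpmul2r => //; rewrite lee_fin invr_ge0 ltW.
by rewrite -EFinM lee_fin ler_pdivrMr.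
Unshelve. all: by end_near.
Qed.

End Entropy.

Unset Implicit Arguments.
Theorem proposition2p1 (R : realType) (M : surface R)
    (M_closed : closed_surface M) (M_nsc : ~ simply_connected M)
    (G : riemannian_metric M) (G_extremal : extremal G)
    (U : universal_cover G) (x0 : U)
    (alpha beta : R) (alpha_gt0 : 0 < alpha) (beta_gt0 : 0 < beta)
    (alpha_beta : 4 * alpha + beta < 1 / 2) :
  (volume_entropy x0 <=
    (- (1 / (beta * fine (systole G))) *
       ln (2 * alpha ^+ 2 * fine (optimal_systolic_ratio M)))%:E)%E.
Proof.
have [_ s0] := systole_fin U M_closed M_nsc; rewrite -[fine (systole G)]/(sys G).
have A0 : 0 < fine (area G [set: M]) by exact: area_M_gt0 U M_closed M_nsc G.
pose r := 2 * alpha * sys G; pose q := beta * sys G.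
(* The hypothesis on alpha and beta says exactly that q + 2 r < sys / 2; the gap leaves room for the
   mesh tau of the net. *)
pose gap := sys G * (1 / 2 - 4 * alpha - beta).
have r0 : 0 < r by rewrite !mulr_gt0.
have q0 : 0 < q by rewrite mulr_gt0.
have gap0 : 0 < gap by rewrite mulr_gt0//; lra.
have gapE : q + 2 * r + gap = sys G / 2 by rewrite /q /r /gap; field.
have rs : 4 * r <= sys G by lra.
have [e e0 [C C0 HC]] := uniform_ball_area U M_closed.
pose tau := Num.min (gap / 2) e.
have tau0 : 0 < tau by rewrite lt_min e0 divr_gt0.
have tau1 : tau <= gap / 2 by rewrite ge_min lexx.
have taue : tau <= e by rewrite ge_min lexx orbT.
have qs : 2 * (q + 2 * r + 2 * tau) <= sys G by lra.
have [zs [m [uz net m0 mT mB]]] := mass_net U M_closed M_nsc G_extremal r0 rs tau0.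
pose c := r ^+ 2 / 2; have c0 : 0 < c by rewrite divr_gt0// exprn_gt0.
have cA : c <= fine (area G [set: M]).
  by apply: le_trans (area_ball U M_closed M_nsc G_extremal (cover_proj x0) r0 rs) _; exact: fine_le_area.
pose Gam := fine (area G [set: M]) / c.
have G1 : 1 <= Gam by rewrite ler_pdivlMr// mul1r.
have Gam0 : 0 < Gam by exact: lt_le_trans ltr01 G1.
pose D := (size zs)%:R / c * C * fine (area G [set: M]).
have D0 : 0 <= D by rewrite !mulr_ge0 ?invr_ge0 ?ler0n// ltW.
(* Only D >= 0 is known here, whereas [growth_rate] takes the logarithm of the constant. *)
have D1 : 0 < D + 1 by lra.
have -> : - (1 / (beta * sys G)) * ln (2 * alpha ^+ 2 * fine (optimal_systolic_ratio M)) = ln Gam / q.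
  rewrite -G_extremal /=.
  (* With r = 2 alpha sys, c = r^2 / 2 equals 2 alpha^2 sys^2, so the argument of the logarithm is c
     divided by the area of M. *)
  have -> : 2 * alpha ^+ 2 * systolic_ratio G = Gam^-1.
    rewrite /systolic_ratio -[fine (systole G)]/(sys G) /Gam /c /r; field.
    by rewrite !gt_eqF.
  by rewrite lnV ?posrE// mulrNN mul1r mulrC.
have HV Rr n : Rr <= sys G / 2 - 2 * tau - r + n%:R * q ->
    (area (cover_metric U) (riem_ball (cover_metric U) x0 Rr) <= ((D + 1) * Gam ^+ n)%:E)%E.
  move=> Rn; rewrite riem_ballE.
  have Ct u : (area (cover_metric U) [set u' | (dist (cover_metric U) u u' < tau)%R] <= C%:E)%E.
    by apply: le_trans (HC u); apply: le_area => u' /= d; exact: lt_le_trans d taue.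
  have Rn' : Rr + 2 * tau + r <= sys G / 2 + n%:R * q by lra.
  apply: le_trans (ball_area_le M_closed M_nsc x0 r0 tau0 q0 qs uz net m0 mT mB (ltW C0) Ct Rn') _.
  rewrite -/c -/Gam -/D lee_fin; apply: ler_wpM2r; first exact: exprn_ge0 (ltW Gam0).
  by rewrite lerDl.
exact: growth_rate D1 G1 q0 HV.
Qed.
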